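(* Let $\phi$ be a Drinfeld $\mathbf{A}$-module of rank $r\geq1$ defined over $A$, $\phi_t=\theta+a_1\tau+\dots+a_r\tau^r$ ($a_i\in A$, $a_r\ne0$), and let $n$ be a non-negative integer. (i) The Taelman $L$-value $L(\phi\otimes C^{\otimes n}/A)$ is transcendental over $\overline{K}$. (ii) If $r\geq 2$, the Taelman $L$-value $L((\wedge^{r-1}\phi)\otimes C^{\otimes n}/A)$ is transcendental over $\overline{K}$.
   Context: Notation: $\mathbb{F}_q$ finite field, $A=\mathbb{F}_q[\theta]$, $K=\mathbb{F}_q(\theta)$, $K_\infty=\mathbb{F}_q((1/\theta))$, $\mathbb{C}_\infty$ the completion of an algebraic closure of $K_\infty$, $\overline{K}$ the algebraic closure of $K$ in $\mathbb{C}_\infty$, $\mathbf{A}=\mathbb{F}_q[t]$. $\mathrm{Mat}_s(R)[\tau]$ denotes polynomials $\sum B_i\tau^i$ with $\tau B=B^{(1)}\tau$ ($B^{(1)}$: entrywise $q$-th power). A $t$-module of dimension $s$ is $G=(\mathbb{G}_a^s,\varphi)$ with $\varphi:\mathbf{A}\to\mathrm{Mat}_s(\mathbb{C}_\infty)[\tau]$ an $\mathbb{F}_q$-linear ring homomorphism, $\varphi(t)=A_0+A_1\tau+\dots$, $\partial\varphi(t):=A_0=\theta I_s+N$ with $N$ nilpotent; it is defined over $A$ if all $A_i$ have entries in $A$. Taelman $L$-value: for $G$ defined over $A$ and a monic irreducible $\beta\in A$, reduce the coefficients mod $\beta$; then $(A/\beta A)^s$ becomes a finite $\mathbf{A}$-module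 $\mathrm{Lie}(\overline{G})(A/\beta A)$ via $t\cdot x=\overline{A_0}x$ and a finite $\mathbf{A}$-module $\overline{G}(A/\beta A)$ via $t\cdot x=\sum_i\overline{A_i}x^{(i)}$. For a finite $\mathbf{A}$-module $\mathrm{N}\cong\oplus_i\mathbf{A}/f_i\mathbf{A}$ let $|\mathrm{N}|_A$ be the monic generator of $(\prod_if_i)$ with $t$ replaced by $\theta$. Then $L(G/A)=\prod_\beta\frac{|\mathrm{Lie}(\overline{G})(A/\beta A)|_A}{|\overline{G}(A/\beta A)|_A}\in1+\theta^{-1}\mathbb{F}_q[[1/\theta]]$. The $t$-modules: $\phi\otimes C^{\otimes 0}=\phi$. For $n\ge1$, $\phi\otimes C^{\otimes n}=(\mathbb{G}_a^{rn+1},\phi_n)$ (the $t$-module attached to the tensor product of the abelian $t$-motive of $\phi$ with that of the $n$-th tensor power of the Carlitz module) with $\phi_n(t)=\theta I_{rn+1}+N+E\tau$, where $N\in\mathrm{Mat}_{rn+1}(\mathbb{F}_q)$ has $N_{i,i+r}=1$ for $1\le i\le rn+1-r$ and all other entries $0$, and $E\in\mathrm{Mat}_{rn+1}(A)$ has $E_{rn+1-r+j,\,j}=1$ for $1\le j\le r-1$, last row $(a_1,\dots,a_r,0,\dots,0)$, and all other entries $0$. For $r\ge2$: $(\wedge^{r-1}\phi)\otimes C^{\otimes 0}=\wedge^{r-1}\phi=(\mathbb{G}_a^{r-1},\varphi_0)$ with $\varphi_0(t)=\theta I_{r-1}+E_1'\tau+E_2'\tau^2$, where $(E_1')_{i,1}=(-1)^{r}a_{r-i}$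 for $1\le i\le r-1$, $(E_1')_{i,i+1}=(-1)^{r-1}a_r$ for $1\le i\le r-2$, other entries $0$, and $E_2'$ has single nonzero entry $(E_2')_{r-1,1}=a_r$. For $n\ge1$, $(\wedge^{r-1}\phi)\otimes C^{\otimes n}=(\mathbb{G}_a^{rn+r-1},\varphi_n)$ with $\varphi_n(t)=\theta I+N'+E'\tau$, where $N'_{i,i+r}=1$ for $1\le i\le rn-1$ (others $0$) and $E'=(-1)^{r-1}F$ with $F_{rn,1}=1$, $F_{rn+j,1}=-a_{r-j}$ and $F_{rn+j,j+1}=a_r$ for $1\le j\le r-1$, other entries $0$. (These are the $t$-modules attached to $\wedge^{r-1}$ of the abelian $t$-motive of $\phi$, tensored with that of $C^{\otimes n}$.) *)

(* Defs.v *)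
From HB Require Import structures.
From mathcomp Require Import all_boot all_order all_algebra.
From mathcomp Require Import fraction qpoly.
From mathcomp Require Import boolp classical_sets reals.

Set Implicit Arguments.
Unset Strict Implicit.
Unset Printing Implicit Defensive.

Import Order.TTheory GRing.Theory Num.Theory.
Local Open Scope ring_scope.

(* The ring F[[u]] of formal power series; u will play the role of 1/theta. *)

Record powser (F : fieldType) := PowSer { pcoef :> nat -> F }.

Section PowserRing.
Variable F : fieldType.
Implicit Types s t v : powser F.

HB.instance Definition _ := gen_eqMixin (powser F).
HB.instance Definition _ := gen_choiceMixin (powser F).

Lemma powserP s t : (forall n, s n = t n) -> s = t.
Proof. by case: s t => [s] [t] /= st; congr PowSer; apply/funext. Qed.

Definition powser0 : powser F := PowSer (fun=> 0).
Definition powserN s : powser F := PowSer (fun n => - s n).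
Definition powserD s t : powser F := PowSer (fun n => s n + t n).
Definition powserC (c : F) : powser F := PowSer (fun n => c *+ (n == 0)%N).
Definition powserX : powser F := PowSer (fun n => (n == 1)%N%:R).
Definition powserM s t : powser F :=
  PowSer (fun n => \sum_(i < n.+1) s i * t (n - i)%N).

Fact powserDA : associative powserD.
Proof. by move=> s t v; apply: powserP => n /=; rewrite addrA. Qed.
Fact powserDC : commutative powserD.
Proof. by move=> s t; apply: powserP => n /=; rewrite addrC. Qed.
Fact powser0D : left_id powser0 powserD.
Proof. by move=> s; apply: powserP => n /=; rewrite add0r. Qed.
Fact powserND : left_inverse powser0 powserN powserD.
Proof. by move=> s; apply: powserP => n /=; rewrite addNr. Qed.

HB.instance Definition _ :=
  GRing.isZmodule.Build (powser F) powserDA powserDC powser0D powserND.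

Let trunc m s : {poly F} := \poly_(i < m.+1) s i.

Let truncE m s i : (i <= m)%N -> (trunc m s)`_i = s i.
Proof. by move=> im; rewrite coef_poly ltnS im. Qed.

Let powserME s t m n (p q : {poly F}) : (n <= m)%N ->
  (forall i, (i <= m)%N -> p`_i = s i) ->
  (forall i, (i <= m)%N -> q`_i = t i) -> powserM s t n = (p * q)`_n.
Proof.
move=> nm ps qt; rewrite coefM; apply: eq_bigr => i _.
rewrite ps ?qt //; first exact: leq_trans (leq_subr _ _) nm.
by rewrite (leq_trans _ nm) // -ltnS.
Qed.

Fact powserMA : associative powserM.
Proof.
move=> s t v; apply: powserP => n.
have tM w x i : (i <= n)%N -> (trunc n w * trunc n x)`_i = powserM w x i.
  by move=> im; rewrite (@powserME w x n i (trunc n w) (trunc n x)) //;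
     exact: truncE.
rewrite (@powserME _ _ n n (trunc n s) (trunc n t * trunc n v)) //;
  [|exact: truncE|exact: tM].
by rewrite mulrA; symmetry; apply: (@powserME _ _ n) => //;
   [exact: tM|exact: truncE].
Qed.

Fact powserMC : commutative powserM.
Proof.
move=> s t; apply: powserP => n.
rewrite (@powserME _ _ n n (trunc n s) (trunc n t)) // 1?mulrC;
  try exact: truncE.
by symmetry; apply: (@powserME _ _ n) => //; exact: truncE.
Qed.

Fact powser1M : left_id (powserC 1) powserM.
Proof.
move=> s; apply: powserP => n /=.
rewrite big_ord_recl /= subn0 mulr1n mul1r big1 ?addr0 // => i _.
by rewrite /= mulr0n mul0r.
Qed.

Fact powserMDl : left_distributive powserM powserD.
Proof.
move=> s t v; apply: powserP => n /=.
by rewrite -big_split; apply: eq_bigr => i _; rewrite mulrDl.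
Qed.

Fact powser1_neq0 : powserC 1 != 0.
Proof.
apply/eqP => /(congr1 (fun s : powser F => s 0%N)) /= /eqP.
by rewrite mulr1n oner_eq0.
Qed.

HB.instance Definition _ := GRing.Zmodule_isComNzRing.Build (powser F)
  powserMA powserMC powser1M powserMDl powser1_neq0.

Definition powser_unit : pred (powser F) :=
  fun s => `[< exists t, t * s = 1 >].
Definition powser_inv s : powser F :=
  if pselect (exists t, t * s = 1) is left ex then projT1 (cid ex) else s.

Fact powser_mulV : {in powser_unit, left_inverse 1 powser_inv *%R}.
Proof.
move=> s /asboolP us; rewrite /powser_inv.
by case: pselect => // ex; case: (cid ex).
Qed.
Fact powser_unitP s t : t * s = 1 -> powser_unit s.
Proof. by move=> ts; apply/asboolP; exists t. Qed.
Fact powser_inv_out : {in [predC powser_unit], powser_inv =1 id}.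
Proof.
move=> s /negP; rewrite /powser_inv; case: pselect => // ex ns.
by case: ns; apply/asboolP.
Qed.

HB.instance Definition _ := GRing.ComNzRing_hasMulInverse.Build (powser F)
  powser_mulV powser_unitP powser_inv_out.

Let ordP s : s != 0 -> exists2 k, s k != 0 & forall i, (i < k)%N -> s i = 0.
Proof.
move=> s0; have ex : exists k, s k != 0.
  apply: contrapT => /forallNP ns; move/eqP: s0; apply.
  by apply: powserP => n; have /negP := ns n; rewrite negbK => /eqP.
have [k sk mink] := ex_minnP ex; exists k => // i; apply: contraTeq => si.
by rewrite -leqNgt; apply: mink.
Qed.

Fact powser_integral s t : s * t = 0 -> (s == 0) || (t == 0).
Proof.
move=> st0; apply/orP; case: (eqVneq s 0) => [|s0]; [by left|right].
apply: contraTT isT => t0.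
have [k sk ltk] := ordP s0; have [l tl ltl] := ordP t0.
have /eqP : (s * t) (k + l)%N = 0 by rewrite st0.
rewrite /GRing.mul /= (bigD1 (inord k)) //= inordK ?ltnS ?leq_addr //.
rewrite addKn big1 ?addr0 ?mulf_eq0 ?(negPf sk) ?(negPf tl) // => i ik.
have {}ik : (i != k :> nat) 
  by apply: contra_neq ik => ik; apply: val_inj; rewrite /= inordK //
     ltnS leq_addr.
case: (ltngtP i k) ik => // ik _; first by rewrite ltk // mul0r.
by rewrite (ltl (_ - _)%N) ?mulr0 // ltn_subLR ?ltn_add2r // -ltnS.
Qed.

HB.instance Definition _ :=
  GRing.ComUnitRing_isIntegral.Build (powser F) powser_integral.

End PowserRing.

(* K_infty = F((1/theta)), as the fraction field of F[[u]] with u = 1/theta. *)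

Notation Kinf F := {fraction (powser F)}.

Definition theta_inf (F : fieldType) : Kinf F := (tofrac (powserX F))^-1.

(* Both A = F[theta] and F[t] are {poly F}; replacing t by theta is then
   the identity. *)
Definition A_to_Kinf (F : fieldType) (p : {poly F}) : Kinf F :=
  (map_poly (fun c => tofrac (powserC c)) p).[theta_inf F].

(* x - y lies in theta^-N F[[1/theta]] *)
Definition Kinf_close (F : fieldType) (N : nat) (x y : Kinf F) : Prop :=
  exists s : powser F, x - y = tofrac (powserX F) ^+ N * tofrac s.

Record is_nonarch_abs (R : realType) (E : fieldType) (abs : E -> R) : Prop := {
  abs_ge0 : forall x, 0 <= abs x;
  abs_eq0 : forall x, abs x = 0 <-> x = 0;
  absM : forall x y, abs (x * y) = abs x * abs y;
  abs_ultra : forall x y, abs (x + y) <= Num.max (abs x) (abs y) }.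

(* Since K_infty is the fraction field of F[[u]], multiplicativity leaves only
   the values on power series to be prescribed. *)
Definition extends_abs_inf (F : finFieldType) (R : realType) (E : fieldType)
    (iota : Kinf F -> E) (abs : E -> R) : Prop :=
  forall (s : powser F) (k : nat),
    (forall i, (i < k)%N -> s i = 0) -> s k != 0 ->
    abs (iota (tofrac s)) = #|F|%:R ^- k.

Definition abs_complete (R : realType) (E : fieldType) (abs : E -> R) : Prop :=
  forall x : nat -> E,
    (forall e : R, 0 < e -> exists n0, forall m n,
       (n0 <= m)%N -> (n0 <= n)%N -> abs (x m - x n) < e) ->
    exists l, forall e : R, 0 < e -> exists n0, forall n,
       (n0 <= n)%N -> abs (x n - l) < e.

(* A completion of an algebraic closure of K_infty; these data are unique up
   to isometric K_infty-isomorphism. *)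
Record Cinfty (F : finFieldType) (R : realType) := CInfty {
  Kinf_alg : fieldType;
  Kinf_to_alg : {rmorphism Kinf F -> Kinf_alg};
  Kinf_alg_closed : GRing.closed_field_axiom Kinf_alg;
  Kinf_alg_algebraic : forall x, algebraicOver Kinf_to_alg x;
  abs_alg : Kinf_alg -> R;
  abs_algP : is_nonarch_abs abs_alg;
  abs_alg_ext : extends_abs_inf Kinf_to_alg abs_alg;
  Cinf :> fieldType;
  alg_to_Cinf : {rmorphism Kinf_alg -> Cinf};
  abs_Cinf : Cinf -> R;
  abs_CinfP : is_nonarch_abs abs_Cinf;
  abs_Cinf_ext : forall x, abs_Cinf (alg_to_Cinf x) = abs_alg x;
  alg_dense : forall (x : Cinf) (e : R), 0 < e ->
    exists y, abs_Cinf (x - alg_to_Cinf y) < e;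
  Cinf_complete : abs_complete abs_Cinf }.

Definition Kinf_to_Cinf (F : finFieldType) (R : realType) (C : Cinfty F R)
    (x : Kinf F) : C := alg_to_Cinf C (Kinf_to_alg C x).
Arguments Kinf_to_Cinf {F R} C x.

Local Open Scope classical_set_scope.

Definition algebraic_over (E : fieldType) (S : set E) (x : E) : Prop :=
  exists p : {poly E}, [/\ p != 0, forall i, S p`_i & root p x].

Definition transcendental_over (E : fieldType) (S : set E) (x : E) : Prop :=
  ~ algebraic_over S x.

Definition K_in_Cinf (F : finFieldType) (R : realType) (C : Cinfty F R) :
    set C :=
  [set x | exists a b : {poly F},
     b != 0 /\ x = Kinf_to_Cinf C (A_to_Kinf a / A_to_Kinf b)].
Arguments K_in_Cinf {F R} C _.

Definition Kbar (F : finFieldType) (R : realType) (C : Cinfty F R) : set C :=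
  [set x | algebraic_over (K_in_Cinf C) x].
Arguments Kbar {F R} C _.

(* A t-module defined over A, given by the coefficients A_0, A_1, ... of
   phi(t); they determine the F-linear ring homomorphism phi. *)
Record tmodule (F : finFieldType) := TModule {
  tdim : nat;
  tcoef : seq 'M[{poly F}]_tdim;
  tcoef_nilp : exists k, (tcoef`_0 - 'X%:M) ^+ k = 0 }.

(* The F[t]-module (V, T), with t acting by the F-linear map T, is isomorphic
   to the direct sum of the F[t]/(f_i), and f is the product of the f_i.
   The f_i are taken monic and nonconstant: {poly %/ g} is the quotient by g
   only for such g. *)
Definition has_module_size (F : finFieldType) (V : lmodType F) (T : V -> V)
    (f : {poly F}) : Prop :=
  exists (k : nat) (fs : 'I_k -> {poly F})
         (h : V -> forall i : 'I_k, {poly %/ fs i}),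
  [/\ forall i, fs i \is monic /\ (1 < size (fs i))%N,
      bijective h,
      forall (c : F) x y i, h (c *: x + y) i = c *: h x i + h y i,
      forall x i, h (T x) i = in_qpoly (fs i) 'X * h x i
    & f = \prod_i fs i].

Definition module_size (F : finFieldType) (V : lmodType F) (T : V -> V) :
  {poly F} := xget 0 [set f | has_module_size T f].

Section TaelmanL.
Variables (F : finFieldType) (G : tmodule F).

(* (A/beta)^s *)
Definition redpts (beta : {poly F}) := {ffun 'I_(tdim G) -> {poly %/ beta}}.

Definition Lie_act (beta : {poly F}) (x : redpts beta) : redpts beta :=
  [ffun i => \sum_j in_qpoly beta ((tcoef G)`_0 i j) * x j].

Definition pts_act (beta : {poly F}) (x : redpts beta) : redpts beta :=
  [ffun i => \sum_(k < size (tcoef G)) \sum_j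
     in_qpoly beta ((tcoef G)`_k i j) * x j ^+ (#|F| ^ k)].

Definition euler_factor (beta : {poly F}) : Kinf F :=
  A_to_Kinf (module_size (@Lie_act beta)) /
  A_to_Kinf (module_size (@pts_act beta)).

Definition monic_irreducible (beta : {poly F}) : Prop :=
  beta \is monic /\ irreducible_poly beta.

(* Unconditional convergence of the Euler product to l: for every N, the
   product over any finite set of primes containing all those of sufficiently
   small degree agrees with l modulo theta^-N. *)
Definition is_Lvalue (l : Kinf F) : Prop :=
  forall N : nat, exists d : nat, forall S : seq {poly F},
    uniq S ->
    (forall beta, beta \in S -> monic_irreducible beta) ->
    (forall beta, monic_irreducible beta -> (size beta <= d)%N ->
       beta \in S) ->
    Kinf_close N (\prod_(beta <- S) euler_factor beta) l.

(* The default value 0 is algebraic, so that transcendence of Lvalue entails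
   convergence of the product. *)
Definition Lvalue : Kinf F := xget 0 [set l | is_Lvalue l].

End TaelmanL.

(* Square matrix with entries given as a function of 1-based indices. *)
Definition mx1 (T : Type) (m : nat) (f : nat -> nat -> T) : 'M[T]_m :=
  \matrix_(i < m, j < m) f i.+1 j.+1.

Lemma shift_nilp (F : fieldType) m s : (0 < s)%N ->
  exists k, mx1 m (fun i j => (j == i + s)%N%:R : {poly F}) ^+ k = 0.
Proof.
move=> s0; exists m; set M := mx1 _ _.
suff H k (i j : 'I_m) : (M ^+ k) i j != 0 -> (i + k <= j)%N.
  apply/matrixP => i j; rewrite mxE; apply/eqP.
  apply: contraTT isT => /H; rewrite leqNgt.
  by rewrite (leq_trans (ltn_ord j)) // leq_addl.
elim: k i j => [|k IH] i j.
  by rewrite expr0 mxE addn0; case: (i =P j) => [-> //|_]; rewrite eqxx.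
rewrite exprS [M * _]/(M *m _) mxE => nz.
have [l] : exists l, M i l * (M ^+ k) l j != 0.
  apply: contrapT => /forallNP h; move/eqP: nz; apply.
  by apply: big1 => l _; have /negP := h l; rewrite negbK => /eqP.
rewrite mulf_eq0 negb_or => /andP[+ /IH lk].
rewrite mxE; case: (_ =P (i.+1 + s)%N) => [il _|_]; last by rewrite eqxx.
apply: leq_trans lk; rewrite addnS -addSn leq_add2r.
by rewrite -ltnS il addSn ltnS -addn1 leq_add2l.
Qed.

Lemma shift_tmodule (F : fieldType) m s (e : seq 'M[{poly F}]_m) :
  (0 < s)%N ->
  exists k, (('X%:M + mx1 m (fun i j => (j == i + s)%N%:R) :: e)`_0
             - 'X%:M) ^+ k = 0.
Proof. by move=> s0; rewrite /= addrAC subrr add0r; apply: shift_nilp. Qed.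

Lemma scalar_tmodule (F : fieldType) m (e : seq 'M[{poly F}]_m) :
  exists k, (('X%:M :: e)`_0 - 'X%:M) ^+ k = 0.
Proof. by exists 1%N; rewrite /= subrr expr1. Qed.

(* phi_t = theta + a_1 tau + ... + a_r tau^r with a_i = dcoef i; the values of
   dcoef outside 1..r are irrelevant. *)
Record Drinfeld_module (F : finFieldType) (r : nat) := DrinfeldModule {
  dcoef :> nat -> {poly F};
  rank_gt0 : (0 < r)%N;
  dcoef_lead : dcoef r != 0 }.

Section TheTModules.
Variables (F : finFieldType) (r : nat) (a : Drinfeld_module F r).

Definition phi_E (n : nat) : 'M[{poly F}]_(r * n + 1) :=
  mx1 _ (fun i j =>
    if i == (r * n + 1)%N then (if (j <= r)%N then a j else 0)
    else ((j <= r - 1)%N && (i == r * n + 1 - r + j)%N)%:R).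

(* phi (x) C^n; since the matrix has size r n + 1, the support condition
   1 <= i <= r n + 1 - r of the shift matrix N is automatic. *)
Definition phi_tensor (n : nat) : tmodule F :=
  if n is 0 then
    @TModule F 1 ('X%:M :: [seq (a k)%:M | k <- iota 1 r]) (scalar_tmodule _)
  else
    @TModule F (r * n + 1)
      [:: 'X%:M + mx1 _ (fun i j => (j == i + r)%N%:R); phi_E n]
      (shift_tmodule _ (rank_gt0 a)).

Definition wedge_E1 : 'M[{poly F}]_(r - 1) :=
  mx1 _ (fun i j =>
    if j == 1%N then (-1) ^+ r * a (r - i)%N
    else if j == i.+1 then (-1) ^+ (r - 1) * a r else 0).

Definition wedge_E2 : 'M[{poly F}]_(r - 1) :=
  mx1 _ (fun i j => if (i == r - 1)%N && (j == 1)%N then a r else 0).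

Definition wedge_F (n : nat) : 'M[{poly F}]_(r * n + r - 1) :=
  mx1 _ (fun i j =>
    if (i < r * n)%N then 0
    else if i == (r * n)%N then (j == 1%N)%:R
    else if j == 1%N then - a (r - (i - r * n))%N
    else if j == (i - r * n).+1 then a r else 0).

(* (wedge^(r-1) phi) (x) C^n, meaningful for r >= 2 *)
Definition wedge_tensor (n : nat) : tmodule F :=
  if n is 0 then
    @TModule F (r - 1) [:: 'X%:M; wedge_E1; wedge_E2] (scalar_tmodule _)
  else
    @TModule F (r * n + r - 1)
      [:: 'X%:M + mx1 _ (fun i j => (j == i + r)%N%:R);
          (-1) ^+ (r - 1) *: wedge_F n]
      (shift_tmodule _ (rank_gt0 a)).

End TheTModules.

(* Main.v *)
Require Import Defs.
From HB Require Import structures.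
From mathcomp Require Import all_boot all_order all_fingroup all_algebra all_solvable.
From mathcomp Require Import fraction qpoly finfield.
From mathcomp Require Import boolp classical_sets reals.
From mathcomp Require Import zify ring.

Set Implicit Arguments.
Unset Strict Implicit.
Unset Printing Implicit Defensive.

Import Order.TTheory GRing.Theory Num.Theory.
Local Open Scope ring_scope.

(** Taelman's Euler product is the Fredholm determinant of the Frobenius-linear
operator (t - A_0)^{-1} (A_1 tau + A_2 tau^2 + ...) on polynomials.  Sylvester's
identity turns the n-fold pole of the twisted modules into a simple pole along
theta = t^e, with e a power of q, and a simple pole makes the determinant, up to
a rational factor, equal to det Psi(t, t) for a matrix Psi of power series in
1/theta over F[t] that solves a Frobenius difference equation.  If L is algebraic,
then the products L^c (minors of Psi) satisfy such an equation too, and an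
auxiliary-polynomial argument lifts the linear relation between L and det Psi at
theta = t to a relation R over F[t][1/theta] between the functions themselves.
Taking the residue of this relation along t = theta^(q^m) for all large m leaves a
relation between the minors of a product of m Frobenius twists of the companion
matrix.  For n > 0 that product is invertible and the relation specializes at
theta = t to a contradiction.  For n = 0 its columns are given by the coefficients
of the exponential of phi, which are independent because they are nonzero for
infinitely many m and multiplication by theta^(q^m) acts on them through phi_t. *)

(** * Determinants indexed by finite types *)

(** Two variables are kept apart until the end. In the operators the polynomial variable is theta
    and w is 1/t; from the recursions on, [{poly F}] is F[t], the series variable u is 1/theta, and
    L becomes a function f(u) that is constant in t. The obstacle is convergence: the solutions need
    values at theta = t and at all Frobenius twists. This holds because a recursion step only sees
    terms of about half the index, so that degrees in t grow at most half as fast as exponents of u.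
    The exponent e is a power of q because then (t - theta)^e = t^e - theta^e, and cyclicity of
    determinants can replace theta^e by theta. Algebraicity of L enters through an equation of
    minimal degree d: as L^q is f(u^q), the powers of L below d solve a difference equation, and
    their independence over F(theta) separates them again after the residue. For n = 0 the exterior
    power r - 1 is within reach because minors of that size are combinations of entries of an
    adjugate, hence linear in a vector that is governed again by the exponential of phi. *)

Lemma inj_surj_bij (T T' : finType) (f : T -> T') :
  injective f -> (forall y, exists x, f x == y) -> bijective f.
Proof.
move=> fI fS; exists (fun y => xchoose (fS y)) => [x|y].
  by apply: fI; apply/eqP; apply: (xchooseP (fS (f x))).
by apply/eqP; apply: (xchooseP (fS y)).
Qed.

Section Fdet.
Variable R : comNzRingType.

(** The block matrix with rows (1, A) and (B, 1) is factored in two ways. A and B may be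
    rectangular, and this is the cyclicity that later moves factors around an operator. *)
Lemma det_sylvester m n (A : 'M[R]_(m, n)) (B : 'M[R]_(n, m)) :
  \det (1%:M - A *m B) = \det (1%:M - B *m A).
Proof.
have E1 : block_mx 1%:M A B 1%:M
    = block_mx (1%:M - A *m B) A 0 1%:M *m block_mx 1%:M 0 B 1%:M.
  by rewrite mulmx_block ?(mulmx1, mulmx0, mul0mx, mul1mx, add0r, addr0) subrK.
have E2 : block_mx 1%:M A B 1%:M
    = block_mx 1%:M 0 B 1%:M *m block_mx 1%:M A 0 (1%:M - B *m A).
  by rewrite mulmx_block ?(mulmx1, mulmx0, mul0mx, mul1mx, add0r, addr0) addrC subrK.
have := congr1 determinant E1; rewrite E2 !det_mulmx !det_ublock !det_lblock.
by rewrite !det1 !mul1r !mulr1.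
Qed.

(** Sylvester's identity for (1 - A) Q and Q'. The sizes m and n are not identified, so index sets
    can be exchanged without transporting matrix types. *)
Lemma det_intertwine m n (A : 'M[R]_m) (A' : 'M[R]_n) (Q : 'M[R]_(m, n))
    (Q' : 'M[R]_(n, m)) :
  Q *m Q' = 1%:M -> Q' *m Q = 1%:M -> A *m Q = Q *m A' -> \det A = \det A'.
Proof.
move=> QQ' Q'Q AQ.
have -> : A = 1%:M - ((1%:M - A) *m Q) *m Q'.
  by rewrite -mulmxA QQ' mulmx1 opprB addrC subrK.
rewrite det_sylvester mulmxBl AQ mul1mx mulmxBr Q'Q mulmxA Q'Q mul1mx.
by rewrite opprB addrC subrK.
Qed.

(** Truncated operators are indexed by products and sums of finite types; with an arbitrary index
    type, reindexing and block decompositions are bijections of types. *)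
Definition fdet (T : finType) (M : T -> T -> R) : R :=
  \det (\matrix_(i < #|T|, j < #|T|) M (enum_val i) (enum_val j)).

Definition fmx (T T' : finType) (M : T -> T' -> R) : 'M[R]_(#|T|, #|T'|) :=
  \matrix_(i, j) M (enum_val i) (enum_val j).

Lemma sum_enum_val (T : finType) (F : T -> R) :
  \sum_k F k = \sum_(i < #|T|) F (enum_val i).
Proof. by rewrite -big_enum_val; apply: eq_bigl => k; rewrite inE. Qed.

Lemma fmx_mul (T T' T'' : finType) (A : T -> T' -> R) (B : T' -> T'' -> R) :
  fmx A *m fmx B = fmx (fun i j => \sum_k A i k * B k j).
Proof.
apply/matrixP => i j; rewrite !mxE [RHS]sum_enum_val.
by apply: eq_bigr => k _; rewrite !mxE.
Qed.

Lemma fmx1 (T : finType) : fmx (fun i j : T => (i == j)%:R) = 1%:M.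
Proof. by apply/matrixP => i j; rewrite !mxE (inj_eq enum_val_inj). Qed.

Lemma fmxB (T T' : finType) (A B : T -> T' -> R) :
  fmx A - fmx B = fmx (fun i j => A i j - B i j).
Proof. by apply/matrixP => i j; rewrite !mxE. Qed.

Lemma eq_fmx (T T' : finType) (A B : T -> T' -> R) : A =2 B -> fmx A = fmx B.
Proof. by move=> AB; apply/matrixP => i j; rewrite !mxE AB. Qed.

Lemma fdetE (T : finType) (M : T -> T -> R) : fdet M = \det (fmx M).
Proof. by []. Qed.

Lemma eq_fdet (T : finType) (M M' : T -> T -> R) : M =2 M' -> fdet M = fdet M'.
Proof. by move=> MM; rewrite !fdetE (eq_fmx MM). Qed.

Lemma fdetM (T : finType) (A B : T -> T -> R) :
  fdet (fun i j => \sum_k A i k * B k j) = fdet A * fdet B.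
Proof. by rewrite !fdetE -fmx_mul det_mulmx. Qed.

Lemma fdet1 (T : finType) : fdet (fun i j : T => (i == j)%:R) = 1.
Proof. by rewrite fdetE fmx1 det1. Qed.

Lemma fdet_sylvester (T T' : finType) (A : T -> T' -> R) (B : T' -> T -> R) :
  fdet (fun i j => (i == j)%:R - \sum_k A i k * B k j)
  = fdet (fun i j => (i == j)%:R - \sum_k B i k * A k j).
Proof. by rewrite !fdetE -!fmxB -!fmx_mul !fmx1 det_sylvester. Qed.

Lemma fdet_intertwine (T T' : finType) (M : T -> T -> R) (M' : T' -> T' -> R)
    (Q : T -> T' -> R) (Q' : T' -> T -> R) :
  (forall i j, \sum_k Q i k * Q' k j = (i == j)%:R) ->
  (forall i j, \sum_k Q' i k * Q k j = (i == j)%:R) ->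
  (forall i j, \sum_k M i k * Q k j = \sum_k Q i k * M' k j) ->
  fdet M = fdet M'.
Proof.
move=> QQ' Q'Q MQ; rewrite !fdetE; apply: (@det_intertwine _ _ _ _ (fmx Q) (fmx Q')).
- by rewrite fmx_mul (eq_fmx QQ') fmx1.
- by rewrite fmx_mul (eq_fmx Q'Q) fmx1.
- by rewrite !fmx_mul (eq_fmx MQ).
Qed.

Lemma sum_delta (T : finType) (F : T -> R) i : \sum_k (i == k)%:R * F k = F i.
Proof.
rewrite (bigD1 i) //= eqxx mul1r big1 ?addr0 // => k ki.
by rewrite eq_sym (negPf ki) mul0r.
Qed.

Lemma sum_delta_r (T : finType) (F : T -> R) j : \sum_k F k * (k == j)%:R = F j.
Proof.
rewrite -[RHS](sum_delta F j); apply: eq_bigr => k _.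
by rewrite mulrC eq_sym.
Qed.

Lemma fdet_bij (T T' : finType) (h : T' -> T) (M : T -> T -> R) :
  bijective h -> fdet (fun i j => M (h i) (h j)) = fdet M.
Proof.
move=> [g hK gK].
apply: (@fdet_intertwine _ _ _ _ (fun i k => (h i == k)%:R)
                         (fun k i => (k == h i)%:R)).
- by move=> i j; rewrite sum_delta (inj_eq (can_inj hK)).
- move=> i j; rewrite (eq_bigr (fun k => (g i == k)%:R * (h k == j)%:R)).
    by rewrite sum_delta gK.
  by move=> k _; rewrite -{1}(gK i) (inj_eq (can_inj hK)).
- move=> i j; rewrite sum_delta.
  rewrite (eq_bigr (fun k => M (h i) (h k) * (k == g j)%:R)).
    by rewrite sum_delta_r gK.
  by move=> k _; rewrite -{1}(gK j) (inj_eq (can_inj hK)).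
Qed.

Lemma fdet_ord n (M : 'I_n -> 'I_n -> R) : fdet M = \det (\matrix_(i, j) M i j).
Proof.
rewrite fdetE; apply: (@det_intertwine _ _ _ _
  (\matrix_(i, j) (enum_val i == j)%:R) (\matrix_(i, j) (i == enum_val j)%:R)).
- apply/matrixP => i j; rewrite !mxE -(inj_eq enum_val_inj).
  rewrite -[RHS](@sum_delta _ (fun k => (k == enum_val j)%:R)).
  by apply: eq_bigr => k _; rewrite !mxE.
- apply/matrixP => i j; rewrite !mxE.
  rewrite -[RHS](@sum_delta _ (fun k => (k == j)%:R)) [RHS]sum_enum_val.
  by apply: eq_bigr => k _; rewrite !mxE.
- apply/matrixP => i j; rewrite !mxE.
  transitivity (M (enum_val i) j).
    rewrite -[RHS](@sum_delta_r _ (fun k => M (enum_val i) k)) [RHS]sum_enum_val.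
    by apply: eq_bigr => k _; rewrite !mxE.
  rewrite -[LHS](@sum_delta _ (fun k => M k j)).
  by apply: eq_bigr => k _; rewrite !mxE.
Qed.

Lemma fdet_repr (T : finType) n (h : 'I_n -> T) (M : T -> T -> R) :
  bijective h -> fdet M = \det (\matrix_(i, j) M (h i) (h j)).
Proof. by move=> hb; rewrite -(fdet_bij M hb) fdet_ord. Qed.

Lemma fdet_sum (T1 T2 : finType) (M : T1 + T2 -> T1 + T2 -> R) :
  (forall i j, M (inl i) (inr j) = 0) ->
  fdet M = fdet (fun i j => M (inl i) (inl j)) * fdet (fun i j => M (inr i) (inr j)).
Proof.
move=> M0.
pose h (i : 'I_(#|T1| + #|T2|)) : T1 + T2 :=
  match split i with inl a => inl (enum_val a) | inr b => inr (enum_val b) end.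
have hb : bijective h.
  exists (fun x => unsplit (match x with inl a => inl (enum_rank a)
                                    | inr b => inr (enum_rank b) end)) => [i|x].
    by rewrite /h -[RHS]splitK; case: (split i) => a; rewrite enum_valK.
  by case: x => a; rewrite /h unsplitK enum_rankK.
rewrite (fdet_repr _ hb) !fdetE -(det_lblock (fmx (fun i j => M (inl i) (inl j)))
  (\matrix_(i, j) M (inr (enum_val i)) (inl (enum_val j)))).
congr determinant; apply/matrixP => i j; rewrite -[i]splitK -[j]splitK.
case: (split i) (split j) => a [] b; rewrite mxE /h !unsplitK /=.
- by rewrite block_mxEul mxE.
- by rewrite block_mxEur mxE M0.
- by rewrite block_mxEdl mxE.
- by rewrite block_mxEdr mxE.
Qed.

(** A permutation s whose term survives satisfies rk (s i) < rk i at every moved i. Since s permutes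
    the ranks, their sum is preserved, so nothing moves. *)
Lemma fdet_unitri (T : finType) (rk : T -> nat) (M : T -> T -> R) :
  (forall i, M i i = 1) ->
  (forall i j, i != j -> (rk i <= rk j)%N -> M i j = 0) -> fdet M = 1.
Proof.
move=> M1 M0; rewrite fdetE /determinant (bigD1 1%g) //= odd_perm1 expr0 mul1r.
rewrite [X in X + _]big1 => [|i _]; last by rewrite mxE perm1 M1.
rewrite big1 ?addr0 // => s s1.
suff [i i1 i2] : exists2 i, s i != i &
    (rk (enum_val i) <= rk (enum_val (s i)))%N.
  rewrite (bigD1 i) //= mxE M0 ?mul0r ?mulr0 //.
  by rewrite (inj_eq enum_val_inj) eq_sym.
apply: contrapT => H; move/negP: s1; apply; apply/eqP/permP => i; rewrite perm1.
have le i' : (rk (enum_val (s i')) <= rk (enum_val i'))%N.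
  case: (eqVneq (s i') i') => [->//|si]; rewrite leqNgt; apply/negP => lt.
  by apply: H; exists i' => //; apply: ltnW.
have eqs : (\sum_(i < #|T|) rk (enum_val (s i)) = \sum_(i < #|T|) rk (enum_val i))%N.
  by rewrite [in RHS](reindex_inj (@perm_inj _ s)).
case: (eqVneq (s i) i) => // si; exfalso.
have lt : (rk (enum_val (s i)) < rk (enum_val i))%N.
  by rewrite ltnNge; apply/negP => lt; apply: H; exists i.
move: eqs; rewrite (bigD1 i) //= [RHS](bigD1 i) //=.
have : (\sum_(j | j != i) rk (enum_val (s j)) <= \sum_(j | j != i) rk (enum_val j))%N.
  by apply: leq_sum => j _.
move=> le' /eqP; rewrite eqn_leq => /andP[_]; apply/negP.
by rewrite -ltnNge -addSn; apply: leq_add.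
Qed.

Lemma fdet_tag k (T_ : 'I_k -> finType)
    (M : {i : 'I_k & T_ i} -> {i : 'I_k & T_ i} -> R) :
  (forall u v, tag u != tag v -> M u v = 0) ->
  fdet M = \prod_i fdet (fun a b : T_ i => M (Tagged T_ a) (Tagged T_ b)).
Proof.
elim: k => [|k IH] in T_ M * => M0.
  rewrite big_ord0; apply: (@fdet_unitri _ (fun=> 0%N)); first by case; case.
  by case; case.
pose T' (i : 'I_k) := T_ (lift ord0 i).
pose h (x : T_ ord0 + {i & T' i}) : {i & T_ i} :=
  match x with inl a => Tagged T_ a | inr u => Tagged T_ (tagged u : T_ (lift ord0 (tag u))) end.
have hb : bijective h.
  apply: inj_surj_bij.
    case=> [a|[i a]] [b|[j b]] //= eqh.
    - by congr inl; apply: eq_from_Tagged eqh.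
    - have ij := congr1 tag eqh; move/lift_inj: ij => /= ij.
      by case: _ / ij in b eqh *; rewrite (eq_from_Tagged eqh).
  case=> i a; case: (unliftP ord0 i) => [j|] ij; case: _ / (esym ij) in a *.
    by exists (inr (Tagged T' a)).
  by exists (inl a).
rewrite -(fdet_bij M hb) fdet_sum => [|a u]; last by rewrite M0.
rewrite big_ord_recl /= IH // => u v uv; apply: M0 => /=.
by rewrite (inj_eq lift_inj).
Qed.

End Fdet.

(** * Congruences modulo powers of an element *)

Section Congruence.
Variables (R : comNzRingType) (Z : R).

Definition cl (N : nat) (x y : R) := exists s, x - y = Z ^+ N * s.

Lemma cl_refl N x : cl N x x.
Proof. by exists 0; rewrite subrr mulr0. Qed.

Lemma cl_sym N x y : cl N x y -> cl N y x.
Proof. by case=> s xy; exists (- s); rewrite mulrN -xy opprB. Qed.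

Lemma cl_trans N y x z : cl N x y -> cl N y z -> cl N x z.
Proof.
by move=> [s xy] [t yz]; exists (s + t); rewrite mulrDr -xy -yz addrA subrK.
Qed.

Lemma clD N x y x' y' : cl N x y -> cl N x' y' -> cl N (x + x') (y + y').
Proof.
by move=> [s xy] [t xy']; exists (s + t); rewrite mulrDr -xy -xy' opprD addrACA.
Qed.

Lemma clN N x y : cl N x y -> cl N (- x) (- y).
Proof. by move=> [s xy]; exists (- s); rewrite mulrN -xy opprB opprK addrC. Qed.

Lemma clB N x y x' y' : cl N x y -> cl N x' y' -> cl N (x - x') (y - y').
Proof. by move=> xy /clN; apply: clD. Qed.

Lemma clM N x y x' y' : cl N x y -> cl N x' y' -> cl N (x * x') (y * y').
Proof.
move=> [s xy] [t xy']; exists (s * x' + y * t).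
rewrite mulrDr mulrA -xy [_ * (y * t)]mulrCA -xy'; ring.
Qed.

Lemma cl_sum N (I : Type) (r : seq I) (P : pred I) (f g : I -> R) :
  (forall i, P i -> cl N (f i) (g i)) ->
  cl N (\sum_(i <- r | P i) f i) (\sum_(i <- r | P i) g i).
Proof.
move=> fg; apply: (big_ind2 (cl N)) => //; first exact: cl_refl.
by move=> *; apply: clD.
Qed.

Lemma cl_prod N (I : Type) (r : seq I) (P : pred I) (f g : I -> R) :
  (forall i, P i -> cl N (f i) (g i)) ->
  cl N (\prod_(i <- r | P i) f i) (\prod_(i <- r | P i) g i).
Proof.
move=> fg; apply: (big_ind2 (cl N)) => //; first exact: cl_refl.
by move=> *; apply: clM.
Qed.

Lemma cl_fdet N (T : finType) (f g : T -> T -> R) :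
  (forall i j, cl N (f i j) (g i j)) -> cl N (fdet f) (fdet g).
Proof.
move=> fg; apply: cl_sum => s _; apply: clM; first exact: cl_refl.
by apply: cl_prod => i _; rewrite !mxE.
Qed.

Lemma cl_weak N M x y : (M <= N)%N -> cl N x y -> cl M x y.
Proof.
move=> MN [s xy]; exists (Z ^+ (N - M) * s).
by rewrite mulrA -exprD subnKC.
Qed.

(** Modulo Z^N the inverse of w is a finite geometric sum in 1 - w, so the cancellation works in any
    commutative ring. *)
Lemma cl_cancel N w x y : cl 1 w 1 -> cl N (x * w) (y * w) -> cl N x y.
Proof.
move=> [s ws] xy.
pose v := \sum_(i < N) (- (Z * s)) ^+ i.
have wv : cl N (w * v) 1.
  exists (- (- s) ^+ N).
  have -> : w = 1 + Z * s by rewrite -[Z]expr1 -ws addrC subrK.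
  have := subrX1 (- (Z * s)) N; rewrite -/v => E.
  have -> : (1 + Z * s) * v = 1 - (- (Z * s)) ^+ N.
    by rewrite -[RHS]opprB E; ring.
  by rewrite mulrN -exprMn mulrN; ring.
apply: (@cl_trans _ (x * (w * v))).
  by rewrite -{1}[x]mulr1; apply: clM; [exact: cl_refl|exact: cl_sym].
apply: (@cl_trans _ (y * (w * v))).
  by rewrite !mulrA; apply: clM => //; exact: cl_refl.
by rewrite -{2}[y]mulr1; apply: clM => //; exact: cl_refl.
Qed.

End Congruence.

(** * Traces of Cartier-linear operators *)

Section Kappa.
Variable R : comNzRingType.
Implicit Types f g : {poly R}.

(* The Cartier-type operator dual to f |-> f(X^Q) under the residue pairing. *)
Definition kap Q f : {poly R} := \poly_(i < size f) f`_(Q * i.+1 - 1).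

Lemma coef_kap Q f i : (0 < Q)%N -> (kap Q f)`_i = f`_(Q * i.+1 - 1).
Proof.
move=> Q0; rewrite coef_poly; case: ltnP => // le.
rewrite nth_default //; apply: leq_trans le _.
by rewrite -[i in (i <= _)%N](subn1 i.+1) // leq_sub2r // leq_pmull.
Qed.

Lemma kapD Q f g : (0 < Q)%N -> kap Q (f + g) = kap Q f + kap Q g.
Proof. by move=> Q0; apply/polyP => i; rewrite coefD !coef_kap // coefD. Qed.

Lemma kapZ Q c f : (0 < Q)%N -> kap Q (c *: f) = c *: kap Q f.
Proof. by move=> Q0; apply/polyP => i; rewrite coefZ !coef_kap // coefZ. Qed.

Lemma kap0 Q : kap Q 0 = 0.
Proof. by apply/polyP => i; rewrite coef_poly size_poly0 ltn0 coef0. Qed.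

Lemma kap_sum Q (I : Type) (r : seq I) (P : pred I) (f : I -> {poly R}) :
  (0 < Q)%N -> kap Q (\sum_(i <- r | P i) f i) = \sum_(i <- r | P i) kap Q (f i).
Proof.
move=> Q0; apply: (big_morph (kap Q)); last exact: kap0.
by move=> *; apply: kapD.
Qed.

Lemma kap_kap Q1 Q2 f : (0 < Q1)%N -> (0 < Q2)%N ->
  kap Q2 (kap Q1 f) = kap (Q1 * Q2) f.
Proof.
move=> Q1p Q2p; apply/polyP => i; rewrite !coef_kap ?muln_gt0 ?Q1p //.
by rewrite -mulnA; congr (_`_(Q1 * _ - 1)); rewrite subn1 prednK // muln_gt0 Q2p.
Qed.

(** Projection formula: a polynomial in X^Q passes through [kap Q] as a polynomial in X. It turns
    products of operators into compositions and identifies the action on multiples of a modulus. *)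
Lemma kap_mul_comp Q f g : (0 < Q)%N ->
  kap Q ((g \Po 'X^Q) * f) = g * kap Q f.
Proof.
move=> Q0; rewrite comp_polyE mulr_suml kap_sum //.
transitivity ((\poly_(i < size g) g`_i) * kap Q f); last by rewrite coefK.
rewrite poly_def mulr_suml; apply: eq_bigr => b _.
rewrite -!scalerAl kapZ //; congr (_ *: _); apply/polyP => i.
rewrite coef_kap // -exprM !coefXnM; case: (ltnP i b) => ib.
  rewrite ifT //; have : (Q * i.+1 <= Q * b)%N by rewrite leq_mul2l ib orbT.
  have : (0 < Q * i.+1)%N by rewrite muln_gt0 Q0.
  by lia.
rewrite coef_kap // ifF.
  by congr (_`_ _); rewrite -subSn // mulnBr; lia.
apply/negbTE; rewrite -leqNgt.
have : (Q * b.+1 <= Q * i.+1)%N by rewrite leq_mul2l ltnS ib orbT.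
by rewrite mulnS; lia.
Qed.

Lemma sum_kap Q (a : {poly R}) g i C : (0 < Q)%N -> (size a <= C)%N ->
  \sum_(l < C) a`_l * (kap Q ('X^l * g))`_i = (kap Q (a * g))`_i.
Proof.
move=> Q0 aC; rewrite {2}(_ : a = \sum_(l < C) a`_l *: 'X^l).
  rewrite mulr_suml kap_sum // coef_sum; apply: eq_bigr => l _.
  by rewrite -scalerAl kapZ // coefZ.
rewrite -poly_def; apply/polyP => j; rewrite coef_poly; case: ltnP => // Cj.
by rewrite nth_default // (leq_trans aC).
Qed.

End Kappa.

Section Ops.
Variables (R : comNzRingType) (Z : R) (q : nat).
Hypothesis q1 : (1 < q)%N.

Let qe0 j : (0 < q ^ j)%N. Proof. by rewrite expn_gt0 (ltnW q1). Qed.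

(* A pair (j, H) stands for H tau^j; it acts on row vectors of polynomials by
   g |-> kap (q ^ j) (g H), and Mop is the matrix of this action in the
   monomial basis. *)
Definition Mop s s' (o : seq (nat * 'M[{poly R}]_(s, s'))) (m i : nat)
    (p : 'I_s) (p' : 'I_s') : R :=
  \sum_(x <- o) (kap (q ^ x.1) ('X^m * x.2 p p'))`_i.

Definition hd s s' (o : seq (nat * 'M[{poly R}]_(s, s'))) : nat :=
  \max_(x <- o) \max_p \max_p' size (x.2 p p').

Definition posj s s' (o : seq (nat * 'M[{poly R}]_(s, s'))) : bool :=
  all (fun x => 0 < x.1)%N o.

(** Product in the twisted ring: tau^j moves past a polynomial by X -> X^(q^j) and fixes the
    coefficients in R. *)
Definition comp s s' s'' (o1 : seq (nat * 'M[{poly R}]_(s, s')))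
    (o2 : seq (nat * 'M[{poly R}]_(s', s''))) :=
  [seq ((x.1 + y.1)%N, x.2 *m map_mx (comp_poly 'X^(q ^ x.1)) y.2)
  | x <- o1, y <- o2].

Definition opN s s' (o : seq (nat * 'M[{poly R}]_(s, s'))) :=
  [seq (x.1, - x.2) | x <- o].

Lemma size_hd s s' (o : seq (nat * 'M[{poly R}]_(s, s'))) x p p' :
  x \in o -> (size (x.2 p p') <= hd o)%N.
Proof.
move=> xo; apply: leq_trans (leq_bigmax_seq _ xo isT).
by apply: leq_trans (leq_bigmax p); apply: leq_bigmax.
Qed.

(** For j > 0 an operator divides degrees by q^j >= 2 up to the constant [hd], so row m has no
    entries beyond about (m + hd) / 2. The same bound later yields the convergence of the
    solutions. *)
Lemma Mop_far s s' (o : seq (nat * 'M[{poly R}]_(s, s'))) m i p p' :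
  posj o -> (m.+1 + hd o <= i.+1.*2)%N -> Mop o m i p p' = 0.
Proof.
move=> /allP po far; rewrite /Mop big_seq big1 // => x xo.
rewrite coef_kap // coefXnM; case: ifP => // _; rewrite nth_default //.
apply: leq_trans (size_hd p p' xo) _.
have : (2 * i.+1 <= q ^ x.1 * i.+1)%N.
  rewrite leq_mul2r; apply/orP; right.
  by apply: leq_trans q1 _; rewrite -{1}(expn1 q) leq_exp2l // po.
by move: far; rewrite -mul2n; move: (q ^ x.1 * _)%N => n; lia.
Qed.

Lemma Mop_low s s' (o : seq (nat * 'M[{poly R}]_(s, s'))) m i p p' :
  posj o -> (hd o <= i)%N -> (m <= i)%N -> Mop o m i p p' = 0.
Proof. by move=> po hi mi; apply: Mop_far => //; rewrite -mul2n; lia. Qed.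

Lemma Mop_cat s s' (o1 o2 : seq (nat * 'M[{poly R}]_(s, s'))) m i p p' :
  Mop (o1 ++ o2) m i p p' = Mop o1 m i p p' + Mop o2 m i p p'.
Proof. by rewrite /Mop big_cat. Qed.

Lemma Mop_opN s s' (o : seq (nat * 'M[{poly R}]_(s, s'))) m i p p' :
  Mop (opN o) m i p p' = - Mop o m i p p'.
Proof.
rewrite /Mop big_map -sumrN; apply: eq_bigr => x _ /=.
by rewrite mxE mulrN -scaleN1r kapZ // coefZ mulN1r.
Qed.

Lemma size_kap_le (f : {poly R}) Q : (0 < Q)%N -> (size (kap Q f) <= size f)%N.
Proof. by move=> _; apply: size_poly. Qed.

Lemma Mop_comp s s' s'' (o1 : seq (nat * 'M[{poly R}]_(s, s')))
    (o2 : seq (nat * 'M[{poly R}]_(s', s''))) m i p p' C :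
  (m + hd o1 <= C)%N ->
  \sum_(l < C) \sum_k Mop o1 m l p k * Mop o2 l i k p'
  = Mop (comp o1 o2) m i p p'.
Proof.
move=> hC; rewrite [RHS]/Mop big_allpairs_dep /=.
transitivity (\sum_(x <- o1) \sum_(y <- o2) \sum_k \sum_(l < C)
   (kap (q ^ x.1) ('X^m * x.2 p k))`_l *
   (kap (q ^ y.1) ('X^l * y.2 k p'))`_i).
  rewrite exchange_big /=.
  under eq_bigr => k _.
    under eq_bigr => l _ do rewrite /Mop big_distrlr /=.
    rewrite exchange_big /=.
    under eq_bigr => x _ do rewrite exchange_big /=.
    over.
  rewrite exchange_big /=; apply: eq_bigr => x _.
  by rewrite exchange_big.
rewrite big_seq [RHS]big_seq; apply: eq_bigr => x xo; apply: eq_bigr => y _.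
rewrite mxE mulr_sumr kap_sum // coef_sum; apply: eq_bigr => k _.
rewrite sum_kap //; last first.
  apply: leq_trans (size_kap_le _ (qe0 _)) _.
  apply: leq_trans hC; rewrite mulrC; apply: leq_trans (size_polyMleq _ _) _.
  rewrite size_polyXn addnS /= addnC leq_add2l; exact: size_hd.
rewrite mxE expnD -kap_kap //; congr (_`_i); congr (kap _ _).
by rewrite mulrC -kap_mul_comp //; congr kap; ring.
Qed.

Lemma posj_comp s s' s'' (o1 : seq (nat * 'M[{poly R}]_(s, s')))
    (o2 : seq (nat * 'M[{poly R}]_(s', s''))) : posj o1 -> posj (comp o1 o2).
Proof.
move=> /allP po; apply/allP => z /allpairsP[[x y] /= [xo yo ->]] /=.
by rewrite addn_gt0 po.
Qed.

Lemma posj_opN s s' (o : seq (nat * 'M[{poly R}]_(s, s'))) :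
  posj (opN o) = posj o.
Proof. by rewrite /posj all_map. Qed.

Definition dt s c (E : nat -> nat -> 'I_s -> 'I_s -> R) : R :=
  fdet (fun a b : 'I_c * 'I_s => (a == b)%:R - E a.1 b.1 a.2 b.2).

Lemma eq_dt s c (E E' : nat -> nat -> 'I_s -> 'I_s -> R) :
  (forall m i p p', E m i p p' = E' m i p p') -> dt c E = dt c E'.
Proof. by move=> EE; apply: eq_fdet => a b; rewrite EE. Qed.

(** From h on the matrix is triangular with unit diagonal, so the infinite determinant is already
    attained at the cut-off h. This makes [detop] a Fredholm determinant without a limit process. *)
Lemma dt_stable s h c (E : nat -> nat -> 'I_s -> 'I_s -> R) :
  (forall m i p p', (h <= i)%N -> (m <= i)%N -> E m i p p' = 0) ->
  (h <= c)%N -> dt c E = dt h E.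
Proof.
move=> E0; elim: c => [|c IH]; first by rewrite leqn0 => /eqP->.
rewrite leq_eqVlt => /orP[/eqP->//|]; rewrite ltnS => hc; rewrite -IH //.
pose f (x : 'I_c * 'I_s + 'I_s) : 'I_c.+1 * 'I_s :=
  match x with inl a => (widen_ord (leqnSn c) a.1, a.2)
             | inr p => (ord_max, p) end.
have fb : bijective f.
  apply: inj_surj_bij.
    case=> [[i p]|p] [[j p']|p'] //= [].
    - by move=> ij ->; congr (inl (_, _)); apply: val_inj.
    - by move=> ij; have := ltn_ord i; rewrite ij ltnn.
    - by move=> ij; have := ltn_ord j; rewrite -ij ltnn.
    - by move=> ->.
  case=> i p; have [ic|ic] := ltnP i c.
    by exists (inl (Ordinal ic, p)); rewrite xpair_eqE eqxx -val_eqE /= eqxx.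
  exists (inr p); rewrite xpair_eqE eqxx andbT -val_eqE /= eqn_leq ic /=.
  by rewrite -ltnS ltn_ord.
rewrite /dt -(fdet_bij _ fb) fdet_sum => [|[i p] p'] /=; last first.
  rewrite E0 ?(ltnW (ltn_ord i)) // subr0 xpair_eqE -val_eqE /=.
  by rewrite (ltn_eqF (ltn_ord i)).
rewrite [X in _ * X](_ : _ = 1) ?mulr1; last first.
  rewrite -[RHS](fdet1 R 'I_s); apply: eq_fdet => p p'.
  by rewrite E0 // subr0 xpair_eqE eqxx.
apply: eq_fdet => -[i p] [j p'] /=; rewrite xpair_eqE -val_eqE /=.
by rewrite xpair_eqE -val_eqE.
Qed.

Definition detop s (o : seq (nat * 'M[{poly R}]_s)) := dt (hd o) (Mop o).

Lemma detopE s (o : seq (nat * 'M[{poly R}]_s)) c :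
  posj o -> (hd o <= c)%N -> detop o = dt c (Mop o).
Proof.
by move=> po hc; rewrite /detop (dt_stable _ hc) // => *; apply: Mop_low.
Qed.

Lemma cl_detop s (o o' : seq (nat * 'M[{poly R}]_s)) N :
  posj o -> posj o' ->
  (forall m i p p', cl Z N (Mop o m i p p') (Mop o' m i p p')) ->
  cl Z N (detop o) (detop o').
Proof.
move=> po po' E; rewrite (detopE po (leq_addr (hd o') _)).
rewrite (detopE po' (leq_addl (hd o) _)); apply: cl_fdet => a b.
by apply: clB; [exact: cl_refl|exact: E].
Qed.

Lemma detop_nil s : detop ([::] : seq (nat * 'M[{poly R}]_s)) = 1.
Proof.
rewrite /detop /dt -[RHS](fdet1 R ('I_(hd ([::] : seq (nat * 'M[{poly R}]_s))) * 'I_s)%type).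
by apply: eq_fdet => a b; rewrite /Mop big_nil subr0.
Qed.

Lemma sum_pair c s (F : 'I_c -> 'I_s -> R) :
  \sum_(k : 'I_c * 'I_s) F k.1 k.2 = \sum_l \sum_p F l p.
Proof. by rewrite pair_bigA. Qed.

Lemma Mop_comp_trunc s (o1 o2 : seq (nat * 'M[{poly R}]_s)) c m i p p' :
  posj o1 -> (hd o1 <= c)%N -> (m < c)%N ->
  \sum_(l < c) \sum_k Mop o1 m l p k * Mop o2 l i k p'
  = Mop (comp o1 o2) m i p p'.
Proof.
move=> po hc mc; rewrite -(@Mop_comp _ _ _ o1 o2 m i p p' (c + (m + hd o1))) ?leq_addl //.
rewrite [RHS]big_split_ord /= [X in _ = _ + X]big1 ?addr0 // => l _.
rewrite big1 // => k _; rewrite Mop_low ?mul0r //=.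
  by apply: leq_trans hc (leq_addr _ _).
by apply: leq_trans (ltnW mc) (leq_addr _ _).
Qed.

(** The list on the right encodes A + B - AB, as in (1 - A)(1 - B). Truncations multiply because
    beyond [hd o1] the first factor has no entry leading from a row below the cut-off to a column
    above it. *)
Lemma detopM s (o1 o2 : seq (nat * 'M[{poly R}]_s)) :
  posj o1 -> posj o2 ->
  detop o1 * detop o2 = detop (o1 ++ o2 ++ opN (comp o1 o2)).
Proof.
move=> po1 po2; set o3 := (_ ++ _).
have po3 : posj o3.
  by rewrite /o3 /posj !all_cat -!/(posj _) po1 po2 posj_opN posj_comp.
pose c := (hd o1 + hd o2 + hd o3)%N.
rewrite (@detopE _ o1 c) ?(@detopE _ o2 c) ?(@detopE _ o3 c) //; try by rewrite /c; lia.
rewrite /dt -fdetM; apply: eq_fdet => a b.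
rewrite /o3 !Mop_cat Mop_opN -(@Mop_comp_trunc _ o1 o2 c) //; last first.
- by rewrite /c; lia.
rewrite -(sum_pair (fun l p => Mop o1 a.1 l a.2 p * Mop o2 l b.1 p b.2)).
rewrite (eq_bigr (fun k => (a == k)%:R * ((k == b)%:R - Mop o2 k.1 b.1 k.2 b.2)
   - (Mop o1 a.1 k.1 a.2 k.2 * (k == b)%:R
   - Mop o1 a.1 k.1 a.2 k.2 * Mop o2 k.1 b.1 k.2 b.2))); last first.
  by move=> k _; ring.
rewrite sumrB sum_delta sumrB.
rewrite (sum_delta_r (fun k : 'I_c * 'I_s => Mop o1 a.1 k.1 a.2 k.2)); ring.
Qed.

(** H tau^j f equals f(X^(q^j)) H tau^j, so the two lists are the products of [o] and multiplication
    by f in both orders, and Sylvester's identity applies. Multiplication by f raises degrees,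
    whence the two cut-offs c + d and c. *)
Lemma detop_comm s (f : {poly R}) (o : seq (nat * 'M[{poly R}]_s)) :
  posj o ->
  detop [seq (x.1, (f \Po 'X^(q ^ x.1)) *: x.2) | x <- o]
  = detop [seq (x.1, f *: x.2) | x <- o].
Proof.
move=> po; set o1 := map _ o; set o2 := map _ o.
have po1 : posj o1 by rewrite /posj all_map.
have po2 : posj o2 by rewrite /posj all_map.
pose of1 : seq (nat * 'M[{poly R}]_s) := [:: (0%N, f%:M)].
pose d := (size f + hd of1)%N.
pose c := (hd o + hd o1 + hd o2 + d)%N.
rewrite (@detopE _ o1 (c + d)) //; last by rewrite /c; lia.
rewrite (@detopE _ o2 c) //; last by rewrite /c; lia.
rewrite /dt.
have E1 (a b : 'I_(c + d) * 'I_s) : Mop o1 a.1 b.1 a.2 b.2 =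
    \sum_(k : 'I_c * 'I_s) Mop o a.1 k.1 a.2 k.2 * Mop of1 k.1 b.1 k.2 b.2.
  rewrite (sum_pair (fun l p => Mop o a.1 l a.2 p * Mop of1 l b.1 p b.2)).
  transitivity (\sum_(l < c + (a.1 + hd o)) \sum_p Mop o a.1 l a.2 p * Mop of1 l b.1 p b.2).
    rewrite Mop_comp; last by rewrite leq_addl.
    rewrite /Mop big_map /comp big_allpairs_dep /=; apply: eq_bigr => x _.
    rewrite big_seq1 /= addn0 mxE mulrC; congr ((kap _ _)`_ _); rewrite mulrC.
    congr (_ * _); rewrite mxE (bigD1 b.2) //= big1 ?addr0 => [|j jb].
      by rewrite !mxE eqxx mulr1n mulrC.
    by rewrite !mxE (negPf jb) mulr0n comp_poly0 mulr0.
  rewrite big_split_ord /= [X in _ + X]big1 ?addr0 // => l _; rewrite big1 // => k _.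
  rewrite Mop_far ?mul0r //=; have := ltn_ord a.1; rewrite -mul2n /c; lia.
have E2 (a b : 'I_c * 'I_s) : Mop o2 a.1 b.1 a.2 b.2 =
    \sum_(k : 'I_(c + d) * 'I_s) Mop of1 a.1 k.1 a.2 k.2 * Mop o k.1 b.1 k.2 b.2.
  rewrite (sum_pair (fun l p => Mop of1 a.1 l a.2 p * Mop o l b.1 p b.2)) Mop_comp.
    rewrite /Mop big_map /comp big_allpairs_dep /= big_seq1; apply: eq_bigr => x _ /=.
    rewrite add0n mxE; congr ((kap _ _)`_ _); congr (_ * _).
    rewrite mul_scalar_mx mxE; congr (_ * _).
    by rewrite mxE expn0 expr1 comp_polyXr.
  by apply: leq_add; [exact: ltnW|rewrite /d leq_addl].
rewrite (eq_fdet (fun a b => congr1 (fun x => _ - x) (E1 a b))).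
by rewrite fdet_sylvester; apply: eq_fdet => a b; rewrite E2.
Qed.

(** Sylvester's identity again, now with a constant matrix, which commutes with tau; it trades an
    operator of size s for one of size r. *)
Lemma detop_rect s r (o : seq (nat * 'M[{poly R}]_(s, r))) (pi : 'M[R]_(r, s)) :
  posj o ->
  detop [seq (x.1, x.2 *m map_mx polyC pi) | x <- o]
  = detop [seq (x.1, map_mx polyC pi *m x.2) | x <- o].
Proof.
move=> po; set o1 := map _ o; set o2 := map _ o.
have po1 : posj o1 by rewrite /posj all_map.
have po2 : posj o2 by rewrite /posj all_map.
pose c := (hd o1 + hd o2)%N.
rewrite (@detopE _ o1 c) ?(@detopE _ o2 c) ?leq_addl ?leq_addr //.
pose A (a : 'I_c * 'I_s) (b : 'I_c * 'I_r) := Mop o a.1 b.1 a.2 b.2.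
pose B (a : 'I_c * 'I_r) (b : 'I_c * 'I_s) := (a.1 == b.1)%:R * pi a.2 b.2.
rewrite /dt (@eq_fdet _ _ _ (fun a b => (a == b)%:R - \sum_k A a k * B k b)).
  rewrite fdet_sylvester; apply: eq_fdet => a b; congr (_ - _).
  rewrite (sum_pair (fun l p => (a.1 == l)%:R * pi a.2 p * Mop o l b.1 p b.2)).
  rewrite (eq_bigr (fun l => (a.1 == l)%:R * \sum_p pi a.2 p * Mop o l b.1 p b.2)); last first.
    by move=> l _; rewrite mulr_sumr; apply: eq_bigr => p _; rewrite mulrA.
  rewrite sum_delta /Mop.
  under eq_bigr => p _ do rewrite mulr_sumr.
  rewrite exchange_big big_map /=; apply: eq_bigr => x _.
  rewrite mxE mulr_sumr kap_sum // coef_sum; apply: eq_bigr => p _.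
  by rewrite mxE mulrCA mul_polyC kapZ // coefZ.
move=> a b; congr (_ - _).
rewrite (sum_pair (fun (l : 'I_c) p => Mop o a.1 l a.2 p * ((l == b.1)%:R * pi p b.2))).
rewrite (eq_bigr (fun l : 'I_c => (\sum_p Mop o a.1 l a.2 p * pi p b.2) * (l == b.1)%:R)); last first.
  by move=> l _; rewrite mulr_suml; apply: eq_bigr => p _; rewrite mulrA mulrAC.
rewrite (sum_delta_r (fun l : 'I_c => \sum_p Mop o a.1 l a.2 p * pi p b.2)) /Mop.
under [RHS]eq_bigr => p _ do rewrite mulr_suml.
rewrite exchange_big big_map /=; apply: eq_bigr => x _.
rewrite mxE mulr_sumr kap_sum // coef_sum; apply: eq_bigr => p _.
by rewrite mxE mulrA [_ * _%:P]mulrC mul_polyC kapZ // coefZ mulrC.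
Qed.

Section Small.
Variables (s N J : nat) (P : {poly R}).
Hypothesis HP : forall j, (0 < j <= N * J)%N ->
  exists A, P = ('X^(q ^ j) - 'X) * A.

(** Z^v says how small an operator is, and K how many times it can still be written as a commutator
    with X. The bound j <= v J is stable under products and gives j <= N J as long as Z^v survives
    modulo Z^N, which is the range of [HP]. *)
Definition good (m K : nat) (o : seq (nat * 'M[{poly R}]_s)) :=
  forall x, x \in o -> exists v G,
    [/\ (m <= v)%N, (0 < x.1 <= v * J)%N & x.2 = (Z ^+ v *: P ^+ K) *: G].

Lemma good_posj m K o : good m K o -> posj o.
Proof. by move=> go; apply/allP => x /go[v [G [_ /andP[]]]]. Qed.

Lemma good_weak m m' K o : (m <= m')%N -> good m' K o -> good m K o.
Proof.
move=> mm go x /go[v [G [mv jv ->]]]; exists v, G; split=> //.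
exact: leq_trans mm mv.
Qed.

Lemma good_cat m K o1 o2 : good m K o1 -> good m K o2 -> good m K (o1 ++ o2).
Proof. by move=> g1 g2 x; rewrite mem_cat => /orP[/g1|/g2]. Qed.

Lemma good_opN m K o : good m K o -> good m K (opN o).
Proof.
move=> go x /mapP[y /go[v [G [mv jv Ey]]] ->]; exists v, (- G).
by split=> //=; rewrite Ey scalerN.
Qed.

Lemma good_comp m m' K K' o1 o2 : good m K o1 -> good m' K' o2 ->
  good (m + m') K (comp o1 o2).
Proof.
move=> g1 g2 z /allpairsP[[x y] /= [/g1[v [G [mv jv Ex]]] /g2[v' [G' [mv' jv' Ey]]] ->]].
exists (v + v')%N, (G *m map_mx (comp_poly 'X^(q ^ x.1)) (P ^+ K' *: G')).
split=> /=; first exact: leq_add.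
  case/andP: jv => j0 jv; case/andP: jv' => j0' jv'.
  by rewrite addn_gt0 j0 mulnDl leq_add.
rewrite Ex Ey; apply/matrixP => i j; rewrite !mxE mulr_sumr.
apply: eq_bigr => k _; rewrite !mxE !comp_polyM comp_polyZ exprD.
by rewrite -!scalerAl -!scalerAr !scalerA !mulrA.
Qed.

Lemma good_scale m K o (f : nat -> {poly R}) : good m K o ->
  good m K [seq (x.1, f x.1 *: x.2) | x <- o].
Proof.
move=> go z /mapP[x /go[v [G [mv jv Ex]]] ->]; exists v, (f x.1 *: G).
by split=> //=; rewrite Ex !scalerA mulrC.
Qed.

Lemma good_cl m K o m0 i p p' N' : good m K o -> (N' <= m)%N ->
  cl Z N' (Mop o m0 i p p') 0.
Proof.
move=> go Nm; rewrite /Mop big_seq.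
have E0 : \sum_(x <- o | x \in o) 0 = 0 :> R by rewrite big1.
rewrite -[X in cl _ _ _ X]E0.
apply: cl_sum => x /go[v [G [mv _ ->]]]; apply: (@cl_weak _ _ v).
  exact: leq_trans Nm mv.
exists (kap (q ^ x.1) ('X^m0 * (P ^+ K * G p p')))`_i.
by rewrite mxE subr0 -scalerAl -scalerAr kapZ // coefZ.
Qed.

(** One factor P is spent on producing X^(q^j) - X; terms with v >= N are dropped. *)
Lemma good_split m K o : good m K.+1 o -> exists2 g, good m K g &
  forall m0 i p p', cl Z N (Mop o m0 i p p')
    (Mop [seq (x.1, ('X^(q ^ x.1) - 'X) *: x.2) | x <- g] m0 i p p').
Proof.
elim: o => [|x o IH] go; first by exists [::] => // *; apply: cl_refl.
have [|g gg cg] := IH; first by move=> y yo; apply: go; rewrite inE yo orbT.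
have [v [G [mv jv Ex]]] := go x (mem_head _ _).
have Mc (y : nat * 'M[{poly R}]_s) o' m0 i p p' : Mop (y :: o') m0 i p p' =
    (kap (q ^ y.1) ('X^m0 * y.2 p p'))`_i + Mop o' m0 i p p'.
  by rewrite /Mop big_cons.
have [Nv|vN] := leqP N v.
  exists g => // m0 i p p'; rewrite Mc -[X in cl _ _ _ X]add0r.
  apply: clD => //; apply: (cl_weak Nv).
  exists (kap (q ^ x.1) ('X^m0 * (P ^+ K.+1 * G p p')))`_i.
  by rewrite Ex mxE subr0 -scalerAl -scalerAr kapZ // coefZ.
have [|A PA] := HP (j := x.1).
  case/andP: jv => -> /leq_trans-> //; by rewrite leq_mul2r (ltnW vN) orbT.
exists ((x.1, (Z ^+ v *: P ^+ K) *: (A *: G)) :: g).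
  move=> y; rewrite inE => /orP[/eqP-> /=|/gg//].
  by exists v, (A *: G); split.
move=> m0 i p p' /=; rewrite !Mc /=; apply: clD => //.
have PE : P ^+ K.+1 = ('X^(q ^ x.1) - 'X) * A * P ^+ K by rewrite -PA exprS.
suff -> : x.2 p p' = (('X^(q ^ x.1) - 'X) *: ((Z ^+ v *: P ^+ K) *: (A *: G))) p p'.
  exact: cl_refl.
by rewrite Ex !mxE PE -!mul_polyC; ring.
Qed.

(** A multiple of X^(q^j) - X is a commutator h = b - a with b = g X and a = X g, and [detop_comm]
    gives equal determinants to 1 - a and 1 - b. The correction o' with (1 - h)(1 - a) = (1 - b)(1 -
    o') modulo Z^N is quadratic, so it gains a power of Z in exchange for one power of P; this
    drives the induction on K. *)
Lemma detop_small m K o : (0 < m)%N -> (N <= m + K)%N -> good m K o ->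
  cl Z N (detop o) 1.
Proof.
elim: K m o => [|K IH] m o m0 NmK go.
  rewrite -(detop_nil s); apply: cl_detop; [exact: good_posj go|by []|].
  move=> m1 i p p'; rewrite {2}/Mop big_nil.
  by apply: good_cl go _; rewrite -(addn0 m).
have [g gg cg] := good_split go.
pose h := [seq (x.1, ('X^(q ^ x.1) - 'X) *: x.2) | x <- g].
pose b := [seq (x.1, ('X \Po 'X^(q ^ x.1)) *: x.2) | x <- g].
pose a := [seq (x.1, 'X *: x.2) | x <- g].
have gh : good m K h by exact: (@good_scale m K g (fun j => 'X^(q ^ j) - 'X) gg).
have gb : good m K b by exact: (@good_scale m K g (fun j => 'X \Po 'X^(q ^ j)) gg).
have ga : good m K a by exact: (@good_scale m K g (fun j => 'X) gg).
have Mh m1 i p p' : Mop h m1 i p p' = Mop b m1 i p p' - Mop a m1 i p p'.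
  rewrite /Mop !big_map -sumrB; apply: eq_bigr => x _ /=.
  rewrite !mxE comp_polyX mulrBl mulrBr -[X in _ + X]scaleN1r kapD // kapZ //.
  by rewrite coefD coefZ mulN1r.
(* [oi i] is b^i h a and [oS] collects the partial sums, so the o' below is the truncation of -(1 -
   b)^(-1) h a. *)
pose oi := fix oi i := if i is i'.+1 then comp b (oi i') else comp h a.
pose oS := fix oS i := if i is i'.+1 then oS i' ++ oi i' else [::].
have goi i : good (m * i.+2) K (oi i).
  elim: i => [|i IHi] /=; first by rewrite muln2 -addnn; apply: good_comp gh ga.
  by rewrite mulnS; apply: good_comp gb IHi.
have goS i : good m.+1 K (oS i).
  elim: i => [|i IHi] //=; apply: good_cat => //; apply: good_weak (goi i).
  by rewrite !mulnS; lia.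
have Mcat o1 o2 m1 i p p' : Mop (comp b (o1 ++ o2)) m1 i p p' =
   Mop (comp b o1) m1 i p p' + Mop (comp b o2) m1 i p p'.
  rewrite /Mop !big_allpairs_dep /= -big_split; apply: eq_bigr => x _ /=.
  by rewrite big_cat.
have MN o1 m1 i p p' : Mop (comp b (opN o1)) m1 i p p' = - Mop (comp b o1) m1 i p p'.
  rewrite /Mop !big_allpairs_dep /= -sumrN; apply: eq_bigr => x _ /=.
  rewrite big_map -sumrN; apply: eq_bigr => y _ /=.
  by rewrite map_mxN mulmxN mxE mulrN -scaleN1r kapZ // coefZ mulN1r.
have MS i m1 i1 p p' : Mop (comp b (oS i)) m1 i1 p p' =
   Mop (oS i) m1 i1 p p' + Mop (oi i) m1 i1 p p' - Mop (oi 0%N) m1 i1 p p'.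
  elim: i => [|i IHi] /=.
    by rewrite addrK /comp /Mop !big_allpairs_dep /= big1 ?big_nil // => x _; rewrite big_nil.
  by rewrite Mcat IHi Mop_cat /=; ring.
pose o' := opN (oS N).
have go' : good m.+1 K o' by apply: good_opN.
have pa := good_posj ga; have pb := good_posj gb; have ph := good_posj gh.
have po' := good_posj go'.
have ab : detop a = detop b by rewrite /b (detop_comm 'X (good_posj gg)).
have hh : cl Z N (detop o) (detop h).
  by apply: cl_detop => //; exact: good_posj go.
apply: (cl_trans hh); apply: (cl_trans _ (IH m.+1 o' _ _ go')) => //; last first.
  by rewrite addSn -addnS.
(* The common determinant of 1 - a and 1 - b is 1 modulo Z, hence can be cancelled. *)
apply: (@cl_cancel _ _ _ (detop a)).
  rewrite -(detop_nil s); apply: cl_detop => // m1 i p p'.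
  by rewrite {2}/Mop big_nil; apply: good_cl ga _.
rewrite detopM // ab mulrC detopM //.
apply: cl_detop.
- by rewrite /posj !all_cat -!/(posj _) ph pa posj_opN posj_comp.
- by rewrite /posj !all_cat -!/(posj _) pb po' posj_opN posj_comp.
move=> m1 i p p'; rewrite !Mop_cat !Mop_opN MN MS Mh.
have := @good_cl _ _ _ m1 i p p' N (goi N) _.
case; first by rewrite !mulnS; apply: leq_trans (leq_pmull N m0) _; lia.
move=> t Et; exists (- t); rewrite mulrN -Et /=; ring.
Qed.

End Small.
End Ops.

(** * Conjugation by a polynomial and the induced action on quotients *)

Section Quotients.
Variables (R : comNzRingType) (q : nat).
Hypothesis q1 : (1 < q)%N.
Implicit Types (b f g w D : {poly R}).
Import Pdiv.Ring Pdiv.RingMonic.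

Let qe0 j : (0 < q ^ j)%N. Proof. by rewrite expn_gt0 (ltnW q1). Qed.

(** Polynomials with coefficients in F_q have this property; the ring R itself carries no Frobenius
    here. *)
Definition frob b := forall j, b \Po 'X^(q ^ j) = b ^+ (q ^ j).

(** The conjugate D^(-1) o D: for D with [frob D] one has D^(-1) H tau^j D = D^(q^j - 1) H tau^j. *)
Definition opD D s s' (o : seq (nat * 'M[{poly R}]_(s, s'))) :=
  [seq (x.1, D ^+ (q ^ x.1 - 1) *: x.2) | x <- o].

Lemma posj_opD D s s' (o : seq (nat * 'M[{poly R}]_(s, s'))) :
  posj (opD D o) = posj o.
Proof. by rewrite /posj all_map. Qed.

(* The matrix of x |-> H x^(q ^ j) on (A / b)^s, for the basis X^i e_p. *)
Definition Nq b s s' (o : seq (nat * 'M[{poly R}]_(s, s'))) (m i : nat)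
    (p : 'I_s) (p' : 'I_s') : R :=
  \sum_(x <- o) (rmodp (x.2 p p' * 'X^(q ^ x.1 * i)) b)`_m.

Definition dq b s (o : seq (nat * 'M[{poly R}]_s)) : R :=
  fdet (fun a c : 'I_(size b).-1 * 'I_s => (a == c)%:R - Nq b o a.1 c.1 a.2 c.2).

Lemma poly_sum_le (a : {poly R}) C : (size a <= C)%N ->
  a = \sum_(l < C) a`_l *: 'X^l.
Proof.
move=> aC; rewrite -poly_def; apply/polyP => j; rewrite coef_poly.
by case: ltnP => // Cj; rewrite nth_default // (leq_trans aC).
Qed.

Lemma rmodp_addM b f g : b \is monic -> rmodp (f + g * b) b = rmodp f b.
Proof. by move=> bm; rewrite rmodpD // rmodp_mull // addr0. Qed.

Lemma size_rmodp_le b f : b \is monic -> (size (rmodp f b) <= (size b).-1)%N.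
Proof.
move=> bm; have b0 := monic_neq0 bm.
have := ltn_rmodp f b; rewrite b0; case: (size b) => // n; by rewrite ltnS.
Qed.

Lemma size_rdivp_le b f c : b \is monic -> (size f <= c + (size b).-1)%N ->
  (size (rdivp f b) <= c)%N.
Proof.
move=> bm sf; have b0 := monic_neq0 bm; rewrite leqNgt; apply/negP => lt.
have r0 : rdivp f b != 0 by rewrite -size_poly_gt0 (leq_ltn_trans _ lt).
have E : rdivp f b * b = f - rmodp f b by rewrite {2}(rdivp_eq bm f) addrK.
have := size_polyD f (- rmodp f b); rewrite size_polyN -E (size_Mmonic r0 bm).
rewrite leq_max; have := size_rmodp_le f bm; rewrite -size_poly_gt0 in b0.
move: sf lt b0; move: (size (rdivp f b)) (size b) (size (rmodp f b)) (size f).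
by move=> *; lia.
Qed.

Lemma rdivp_linD b f g : b \is monic -> rdivp (f + g) b = rdivp f b + rdivp g b.
Proof.
move=> bm; rewrite {1}(rdivp_eq bm f) {1}(rdivp_eq bm g) addrACA -mulrDl.
rewrite rdivp_addl_mul_small //.
apply: leq_ltn_trans (size_polyD _ _) _.
by rewrite gtn_max !ltn_rmodp monic_neq0.
Qed.

Lemma rdivp_linZ b (a : R) f : b \is monic -> rdivp (a *: f) b = a *: rdivp f b.
Proof.
move=> bm; rewrite {1}(rdivp_eq bm f) scalerDr scalerAl.
rewrite rdivp_addl_mul_small //.
apply: leq_ltn_trans (size_scale_leq _ _) _.
by rewrite ltn_rmodp monic_neq0.
Qed.

Lemma sum_rmodp b (a : {poly R}) f Q m C : b \is monic -> (size a <= C)%N ->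
  \sum_(l < C) (rmodp (f * 'X^(Q * l)) b)`_m * a`_l
  = (rmodp (f * (a \Po 'X^Q)) b)`_m.
Proof.
move=> bm aC; rewrite [in RHS](poly_sum_le aC) linear_sum mulr_sumr rmodp_sum //.
rewrite coef_sum; apply: eq_bigr => l _.
by rewrite linearZ /= comp_Xn_poly -exprM -scalerAr rmodpZ // coefZ mulrC.
Qed.

Lemma rmodp_mul_comp b f g Q : b \is monic -> (0 < Q)%N ->
  b \Po 'X^Q = b ^+ Q ->
  rmodp (f * (rmodp g b \Po 'X^Q)) b = rmodp (f * (g \Po 'X^Q)) b.
Proof.
move=> bm Q0 fb; rewrite [in RHS](rdivp_eq bm g) comp_polyD comp_polyM fb.
rewrite mulrDr addrC -[X in _ + X](_ : f * (rdivp g b \Po 'X^Q) * b ^+ Q.-1 * b = _).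
  by rewrite rmodp_addM.
by rewrite -mulrA -exprSr prednK // mulrA.
Qed.

Lemma Nq_comp b s s' s'' (o1 : seq (nat * 'M[{poly R}]_(s, s')))
    (o2 : seq (nat * 'M[{poly R}]_(s', s''))) m i p p' :
  b \is monic -> frob b ->
  \sum_(l < (size b).-1) \sum_k Nq b o1 m l p k * Nq b o2 l i k p'
  = Nq b (comp q o1 o2) m i p p'.
Proof.
move=> bm fb; rewrite [RHS]/Nq big_allpairs_dep /=.
transitivity (\sum_(x <- o1) \sum_(y <- o2) \sum_k \sum_(l < (size b).-1)
   (rmodp (x.2 p k * 'X^(q ^ x.1 * l)) b)`_m *
   (rmodp (y.2 k p' * 'X^(q ^ y.1 * i)) b)`_l).
  rewrite exchange_big /=.
  under eq_bigr => k _.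
    under eq_bigr => l _ do rewrite /Nq big_distrlr /=.
    rewrite exchange_big /=.
    under eq_bigr => x _ do rewrite exchange_big /=.
    over.
  rewrite exchange_big /=; apply: eq_bigr => x _.
  by rewrite exchange_big.
apply: eq_bigr => x _; apply: eq_bigr => y _.
rewrite mxE mulr_suml rmodp_sum // coef_sum; apply: eq_bigr => k _.
rewrite sum_rmodp //; last exact: size_rmodp_le.
rewrite rmodp_mul_comp // mxE comp_polyM comp_Xn_poly -exprM mulrA.
by rewrite mulnA -expnD.
Qed.

Lemma coef_mul_top f g m n : (size f <= m.+1)%N -> (size g <= n.+1)%N ->
  (f * g)`_(m + n) = f`_m * g`_n.
Proof.
move=> sf sg; have mlt : (m < (m + n).+1)%N by rewrite ltnS leq_addr.
rewrite coefM (bigD1 (Ordinal mlt)) //= addKn big1 ?addr0 // => i im.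
have {}im : (i != m :> nat) by rewrite -val_eqE in im.
have [lt|le] := ltnP i m.
  by rewrite [g`_ _]nth_default ?mulr0 //; apply: leq_trans sg _; lia.
rewrite [f`_ _]nth_default ?mul0r //; apply: leq_trans sf _.
by move: im le; lia.
Qed.

Section OneModulus.
Variable b : {poly R}.
Hypotheses (bm : b \is monic) (fb : frob b) (b1 : (1 < size b)%N).
Let d := (size b).-1.

Let sb : size b = d.+1. Proof. by rewrite /d prednK // ltnW. Qed.
Let d0 : (0 < d)%N. Proof. by rewrite -ltnS -sb. Qed.

(* The residue at infinity of f / b. *)
Definition ell f : R := (rmodp f b)`_d.-1.

Lemma ell_sum f n : \sum_(l < d) (rmodp f b)`_l * ell 'X^(l + n) = ell (f * 'X^n).
Proof.
have E : rmodp (f * 'X^n) b = rmodp ('X^n * (rmodp f b \Po 'X^1)) b.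
  by rewrite expr1 comp_polyXr rmodp_mulmr // mulrC.
rewrite /ell E -(@sum_rmodp _ _ _ _ _ d) //; last exact: size_rmodp_le.
by apply: eq_bigr => l _; rewrite mul1n -exprD addnC mulrC.
Qed.

(** Cartier operators preserve residues. The multiple of b in w stays a multiple of b; for the
    remainder, only its top coefficient times the leading coefficient 1 of b^(Q - 1) is seen. *)
Lemma ell_kap Q w : (0 < Q)%N -> b \Po 'X^Q = b ^+ Q ->
  ell (kap Q (b ^+ (Q - 1) * w)) = ell w.
Proof.
move=> Q0 fQ; rewrite {1}(rdivp_eq bm w) mulrDr.
have -> : b ^+ (Q - 1) * (rdivp w b * b) = (b \Po 'X^Q) * rdivp w b.
  by rewrite fQ mulrCA -exprSr subn1 prednK // mulrC.
rewrite kapD // kap_mul_comp // addrC [b * _]mulrC {1}/ell rmodp_addM //.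
have QE : (d * (Q - 1) + d = Q * d)%N.
  by rewrite subn1 addnC -mulnS prednK // mulnC.
set w0 := rmodp w b; have sw0 : (size w0 <= d)%N := size_rmodp_le w bm.
have sB : (size (b ^+ (Q - 1)) <= (d * (Q - 1)).+1)%N := size_poly_exp_leq b _.
have sk : (size (kap Q (b ^+ (Q - 1) * w0)) < size b)%N.
  rewrite sb ltnS; apply/leq_sizeP => j dj; rewrite coef_kap // nth_default //.
  apply: leq_trans (size_polyMleq _ _) _.
  have aux (n1 n2 x1 x2 x3 d' q' : nat) : (x1 + d' = x2 -> n1 <= x1.+1 ->
      n2 <= d' -> 0 < d' -> x2 <= x3 -> 0 < q' -> (n1 + n2).-1 <= q' + x3 - 1)%N by lia.
  by rewrite mulnS; exact: aux QE sB sw0 d0 (leq_mul (leqnn Q) dj) Q0.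
rewrite rmodp_small // coef_kap // prednK // /ell -/w0.
have -> : (Q * d - 1 = d * (Q - 1) + d.-1)%N.
  by move: QE d0; lia.
rewrite coef_mul_top // ?prednK //.
suff -> n : (b ^+ n)`_(d * n) = 1 by rewrite mul1r.
elim: n => [|n IH]; first by rewrite muln0 expr0 coefC.
rewrite exprS mulnS coef_mul_top ?sb ?IH ?mulr1 //.
  exact: (monicP bm).
exact: size_poly_exp_leq.
Qed.

Section Main.
Variables (s : nat) (o : seq (nat * 'M[{poly R}]_s)).
Hypothesis po : posj o.

Let ob := opD b o.
Let pob : posj ob. Proof. by rewrite posj_opD. Qed.
Let c := (hd o + hd ob)%N.
Let T : finType := ('I_c * 'I_s + 'I_d * 'I_s)%type.
(** A basis adapted to b: multiples b X^i, then the remainders X^i. Euclidean division supplies the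
    coordinates [crd]. *)
Let bas (x : T) : {poly R} :=
  match x with inl a => b * 'X^(a.1) | inr a => 'X^(a.1) end.
Let ix (x : T) : 'I_s := match x with inl a => a.2 | inr a => a.2 end.
Let crd (x : T) f : R :=
  match x with inl a => (rdivp f b)`_a.1 | inr a => (rmodp f b)`_a.1 end.
Let Q (x : T) (a : 'I_(c + d) * 'I_s) : R := (ix x == a.2)%:R * (bas x)`_a.1.
Let Q' (a : 'I_(c + d) * 'I_s) (x : T) : R := (a.2 == ix x)%:R * crd x 'X^(a.1).

Let size_bas x : (size (bas x) <= c + d)%N.
Proof.
case: x => -[i p] /=; last by rewrite size_polyXn (leq_trans (ltn_ord i)) ?leq_addl.
apply: leq_trans (size_polyMleq _ _) _; rewrite size_polyXn sb.
by have := ltn_ord i; lia.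
Qed.

Let crd_sum x f C : (size f <= C)%N -> \sum_(l < C) f`_l * crd x 'X^l = crd x f.
Proof.
move=> sf; rewrite [in RHS](poly_sum_le sf); case: x => a /=.
  rewrite (big_morph (fun f => rdivp f b) (id1 := 0) (op1 := +%R)) ?rdiv0p //; last first.
    by move=> *; apply: rdivp_linD.
  by rewrite coef_sum; apply: eq_bigr => l _; rewrite rdivp_linZ // coefZ.
rewrite rmodp_sum // coef_sum; apply: eq_bigr => l _.
by rewrite rmodpZ // coefZ.
Qed.

Let crd_bas x y : ix x = ix y -> crd y (bas x) = (x == y)%:R.
Proof.
case: x y => -[i p] [] [j p'] /= E; have {E}pp : p = p' := E.
- rewrite mulrC rdivp_mull // coefXn; congr (_%:R).
  by rewrite (inj_eq inl_inj) xpair_eqE pp eqxx andbT eq_sym.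
- by rewrite mulrC rmodp_mull // coef0.
- by rewrite rdivp_small ?coef0 // size_polyXn sb ltnS.
- rewrite rmodp_small ?coefXn; last by rewrite size_polyXn sb ltnS.
  by congr (_%:R); rewrite (inj_eq inr_inj) xpair_eqE pp eqxx andbT eq_sym.
Qed.

Let expand f p p' l : (size f <= c + d)%N ->
  \sum_(x : T) (p == ix x)%:R * crd x f * ((ix x == p')%:R * (bas x)`_l)
  = (p == p')%:R * f`_l.
Proof.
move=> sf; rewrite big_sumType /=.
have sD := size_rdivp_le bm sf; have sM := size_rmodp_le f bm.
rewrite [in RHS](rdivp_eq bm f) coefD mulrDr; congr (_ + _).
  rewrite (sum_pair (fun (i : 'I_c) k => (p == k)%:R * (rdivp f b)`_i *
     ((k == p')%:R * (b * 'X^i)`_l))).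
  rewrite {2}(poly_sum_le sD) mulr_suml coef_sum mulr_sumr.
  apply: eq_bigr => i _.
  rewrite (eq_bigr (fun k => (p == k)%:R * ((rdivp f b)`_i * ((k == p')%:R * (b * 'X^i)`_l)))).
    by rewrite sum_delta -scalerAl coefZ [_ * b]mulrC; ring.
  by move=> k _; rewrite mulrA.
rewrite (sum_pair (fun (i : 'I_d) k => (p == k)%:R * (rmodp f b)`_i *
     ((k == p')%:R * ('X^i : {poly R})`_l))).
rewrite {2}(poly_sum_le sM) coef_sum mulr_sumr.
apply: eq_bigr => i _.
rewrite (eq_bigr (fun k => (p == k)%:R * ((rmodp f b)`_i * ((k == p')%:R * ('X^i : {poly R})`_l)))).
  by rewrite sum_delta coefZ; ring.
by move=> k _; rewrite mulrA.
Qed.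

Let QQ' x y : \sum_a Q x a * Q' a y = (x == y)%:R.
Proof.
rewrite (sum_pair (fun (l : 'I_(c + d)) k => (ix x == k)%:R * (bas x)`_l *
   ((k == ix y)%:R * crd y 'X^l))).
rewrite (eq_bigr (fun l : 'I_(c + d) => (ix x == ix y)%:R * ((bas x)`_l * crd y 'X^l))); last first.
  move=> l _.
  rewrite (eq_bigr (fun k => (ix x == k)%:R * ((bas x)`_l * ((k == ix y)%:R * crd y 'X^l)))).
    by rewrite sum_delta; ring.
  by move=> k _; rewrite mulrA.
rewrite -mulr_sumr crd_sum //; case: (eqVneq (ix x) (ix y)) => [xy|xy].
  by rewrite mul1r crd_bas.
by rewrite mul0r; case: (eqVneq x y) xy => // ->; rewrite eqxx.
Qed.

Let Q'Q a e : \sum_x Q' a x * Q x e = (a == e)%:R.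
Proof.
rewrite expand ?size_polyXn ?ltn_ord // coefXn.
by case: a e => i p [j p'] /=; rewrite xpair_eqE mulrC -natrM mulnb eq_sym.
Qed.

Let rowf (x : T) (p' : 'I_s) : {poly R} :=
  \sum_(y <- o) kap (q ^ y.1) (bas x * (b ^+ (q ^ y.1 - 1) * y.2 (ix x) p')).

(** The conjugated operator in the adapted basis. On multiples of b the factor b^(q^j) passes
    through [kap] and leaves the original [o], whence the block triangular shape. *)
Let Mn (x y : T) : R :=
  match x, y with
  | inl a, inl e => Mop q o a.1 e.1 a.2 e.2
  | inl _, inr _ => 0
  | inr _, _ => crd y (rowf x (ix y))
  end.

Let QMop x (e : 'I_(c + d) * 'I_s) : \sum_a Q x a * Mop q ob a.1 e.1 a.2 e.2 = (rowf x e.2)`_e.1.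
Proof.
rewrite (sum_pair (fun (l : 'I_(c + d)) k => (ix x == k)%:R * (bas x)`_l *
   Mop q ob l e.1 k e.2)).
rewrite (eq_bigr (fun l : 'I_(c + d) => (bas x)`_l * Mop q ob l e.1 (ix x) e.2)); last first.
  move=> l _.
  rewrite (eq_bigr (fun k => (ix x == k)%:R * ((bas x)`_l * Mop q ob l e.1 k e.2))).
    by rewrite sum_delta.
  by move=> k _; rewrite mulrA.
rewrite /Mop /ob /opD.
under eq_bigr => l _ do rewrite big_map mulr_sumr.
rewrite exchange_big /= coef_sum; apply: eq_bigr => y _.
by rewrite mxE sum_kap.
Qed.

Let size_rowf a p' : (size (rowf (inr a) p') <= c + d)%N.
Proof.
apply/leq_sizeP => j cj.
have -> : (rowf (inr a) p')`_j = Mop q ob a.1 j a.2 p'.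
  rewrite /rowf coef_sum /Mop /ob /opD big_map; apply: eq_bigr => y _.
  by rewrite mxE.
apply: Mop_low => //; first by apply: leq_trans cj; rewrite /c; lia.
by apply: leq_trans (ltnW (ltn_ord a.1)) _; apply: leq_trans cj; rewrite leq_addl.
Qed.

Let MnQ x e : \sum_y Mn x y * Q y e = (rowf x e.2)`_e.1.
Proof.
case: x => a; last first.
  transitivity (\sum_y (e.2 == ix y)%:R * crd y (rowf (inr a) e.2) *
     ((ix y == e.2)%:R * (bas y)`_e.1)).
    apply: eq_bigr => y _; rewrite /Q /Mn.
    by case: (eqVneq (ix y) e.2) => [->|_]; rewrite ?eqxx ?mul1r // !mul0r !mulr0.
  by rewrite expand ?eqxx ?mul1r // size_rowf.
rewrite big_sumType /= [X in _ + X]big1 ?addr0 => [|y _]; last by rewrite mul0r.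
rewrite (sum_pair (fun (i : 'I_c) k => Mop q o a.1 i a.2 k *
     ((k == e.2)%:R * (b * 'X^i)`_e.1))).
rewrite (eq_bigr (fun i : 'I_c => Mop q o a.1 i a.2 e.2 * (b * 'X^i)`_e.1)); last first.
  move=> i _; rewrite -[RHS](sum_delta_r (fun k => Mop q o a.1 i a.2 k * (b * 'X^i)`_e.1)).
  by apply: eq_bigr => k _; ring.
pose k := \sum_(y <- o) kap (q ^ y.1) ('X^(a.1) * y.2 a.2 e.2).
have kE i : k`_i = Mop q o a.1 i a.2 e.2 by rewrite coef_sum.
have sk : (size k <= c)%N.
  apply/leq_sizeP => j cj; rewrite kE; apply: Mop_low => //.
    by apply: leq_trans cj; rewrite leq_addr.
  exact: leq_trans (ltnW (ltn_ord a.1)) cj.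
have -> : rowf (inl a) e.2 = b * k.
  rewrite /rowf mulr_sumr; apply: eq_bigr => y _.
  rewrite -kap_mul_comp // fb /=; congr kap.
  rewrite -[X in _ = b ^+ X * _](@prednK (q ^ y.1)) // exprS subn1; ring.
rewrite [in RHS](poly_sum_le sk) mulr_sumr coef_sum; apply: eq_bigr => i _.
by rewrite -scalerAr coefZ kE.
Qed.

(** The residue pairing on remainders. It makes the Cartier-linear action on the quotient adjoint to
    the Frobenius-linear [Nq]. *)
Let B (a e : 'I_d * 'I_s) : R := (a.2 == e.2)%:R * ell 'X^(a.1 + e.1).
Let Nrow (a e : 'I_d * 'I_s) : R := (rmodp (rowf (inr a) e.2) b)`_e.1.

Let NrowB a e : \sum_k Nrow a k * B k e = \sum_k B a k * Nq b o k.1 e.1 k.2 e.2.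
Proof.
transitivity (\sum_(y <- o) ell (y.2 a.2 e.2 * 'X^(q ^ y.1 * e.1) * 'X^(a.1))).
  rewrite (sum_pair (fun (l : 'I_d) k => (rmodp (rowf (inr a) k) b)`_l *
     ((k == e.2)%:R * ell 'X^(l + e.1)))).
  rewrite (eq_bigr (fun l : 'I_d => (rmodp (rowf (inr a) e.2) b)`_l * ell 'X^(l + e.1))); last first.
    move=> l _; rewrite -[RHS](sum_delta_r (fun k => (rmodp (rowf (inr a) k) b)`_l * ell 'X^(l + e.1))).
    by apply: eq_bigr => k _; ring.
  rewrite ell_sum /rowf mulr_suml /ell rmodp_sum // coef_sum.
  apply: eq_bigr => y _; rewrite -!/(ell _) mulrC -kap_mul_comp // comp_Xn_poly -exprM.
  rewrite -[RHS](@ell_kap (q ^ y.1)) //; congr (ell (kap _ _)) => /=; ring.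
rewrite (sum_pair (fun (l : 'I_d) k => (a.2 == k)%:R * ell 'X^(a.1 + l) * Nq b o l e.1 k e.2)).
rewrite (eq_bigr (fun l : 'I_d => ell 'X^(a.1 + l) * Nq b o l e.1 a.2 e.2)); last first.
  move=> l _; rewrite -[RHS](sum_delta (fun k => ell 'X^(a.1 + l) * Nq b o l e.1 k e.2)).
  by apply: eq_bigr => k _; rewrite mulrA.
rewrite /Nq.
under [RHS]eq_bigr => l _ do rewrite mulr_sumr.
rewrite exchange_big; apply: eq_bigr => y _; rewrite -ell_sum.
by apply: eq_bigr => l _; rewrite mulrC addnC.
Qed.

(** The pairing is perfect: with its rows reversed the matrix is unitriangular. *)
Let fdetB x y : x * fdet B = y * fdet B -> x = y.
Proof.
pose P (a e : 'I_d * 'I_s) : R := ((rev_ord a.1, a.2) == e)%:R.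
have PB : fdet P * fdet B = 1.
  rewrite -fdetM; apply: (@fdet_unitri _ _ (fun a : 'I_d * 'I_s => (d - a.1)%N)).
    case=> i p; rewrite sum_delta /B /= eqxx mul1r.
    have -> : (d - i.+1 + i = d.-1)%N by have := ltn_ord i; lia.
    by rewrite /ell rmodp_small ?coefXn ?eqxx // size_polyXn sb; move: d0; lia.
  case=> i p [j p'] ij /= le; rewrite sum_delta /B /=.
  case: (eqVneq p p') ij => [->|_ _]; last by rewrite mul0r.
  rewrite xpair_eqE eqxx andbT -val_eqE /= => ij; rewrite mul1r.
  have lt : (j < i)%N by move: ij le; have := ltn_ord i; have := ltn_ord j; lia.
  have lt2 : (d - i.+1 + j < d.-1)%N by have := ltn_ord i; lia.
  rewrite /ell rmodp_small ?coefXn ?(gtn_eqF lt2) // size_polyXn sb; lia.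
move=> E; rewrite -[x]mulr1 -[y]mulr1 -PB [fdet P * _]mulrC !mulrA E; ring.
Qed.

(** Multiplicativity along the submodule of multiples of b: this submodule contributes [detop q o],
    and the quotient is dual to (R[X]/b)^s under the residue pairing, which gives [dq b o]. *)
Lemma detop_quot : detop q (opD b o) = detop q o * dq b o.
Proof.
rewrite (@detopE _ q q1 _ (opD b o) (c + d)) //; last by rewrite /c /ob; lia.
rewrite (@detopE _ q q1 _ o c) //; last by rewrite /c; lia.
rewrite /dt -(@fdet_intertwine _ _ _ (fun x y => (x == y)%:R - Mn x y) _ Q Q' QQ' Q'Q); last first.
  move=> x e.
  under eq_bigr => k _ do rewrite mulrBl.
  under [RHS]eq_bigr => k _ do rewrite mulrBr.
  rewrite !sumrB sum_delta (sum_delta_r (Q x)) MnQ; congr (_ - _).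
  by rewrite -[LHS](QMop x e); apply: eq_bigr => i _.
rewrite fdet_sum; last by move=> a e; rewrite subr0.
congr (_ * _).
transitivity (fdet (fun a e => (a == e)%:R - Nrow a e)) => //.
apply: fdetB; rewrite [RHS]mulrC /dq -!fdetM; apply: eq_fdet => a e.
under eq_bigr => k _ do rewrite mulrBl.
under [RHS]eq_bigr => k _ do rewrite mulrBr.
by rewrite !sumrB (sum_delta (fun k => B k e)) (sum_delta_r (B a)) NrowB.
Qed.

End Main.

Definition cop D := exists U V, U * D + V * b = 1.

Lemma copM D E : cop D -> cop E -> cop (D * E).
Proof.
move=> [U [V UV]] [U' [V' UV']]; exists (U * U'), (U * D * V' + V * U' * E + V * b * V').
by rewrite -[RHS](mulr1 1) -{1}UV -UV'; ring.
Qed.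

Lemma Nq_scal s (f : {poly R}) m i (p p' : 'I_s) :
  Nq b [:: (0%N, f%:M)] m i p p' = (p == p')%:R * (rmodp (f * 'X^i) b)`_m.
Proof.
rewrite /Nq big_seq1 /= mxE expn0 mul1n; case: eqP => _.
  by rewrite mulr1n mul1r.
by rewrite mulr0n !mul0r rmod0p coef0.
Qed.

Lemma Nq_inv s (f g : {poly R}) (a e : 'I_d * 'I_s) : rmodp (f * g) b = 1 ->
  \sum_(k : 'I_d * 'I_s) Nq b [:: (0%N, f%:M)] a.1 k.1 a.2 k.2 * Nq b [:: (0%N, g%:M)] k.1 e.1 k.2 e.2
  = (a == e)%:R.
Proof.
move=> fg; rewrite (sum_pair (fun (l : 'I_d) k => Nq b [:: (0%N, f%:M)] a.1 l a.2 k *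
  Nq b [:: (0%N, g%:M)] l e.1 k e.2)) Nq_comp //.
rewrite /comp /= map_scalar_mx /= expn0 expr1 comp_polyXr -scalar_mxM Nq_scal.
have -> : rmodp (f * g * 'X^(e.1)) b = 'X^(e.1).
  rewrite mulrC -rmodp_mulmr // fg mulr1 rmodp_small // size_polyXn sb ltnS.
  exact: ltn_ord.
by rewrite coefXn -natrM mulnb; case: a e => i p [j p'] /=; rewrite xpair_eqE andbC.
Qed.

(** D is a unit modulo b, so the conjugation can be performed on the quotient itself. *)
Lemma dq_conj s D (o : seq (nat * 'M[{poly R}]_s)) :
  frob D -> cop D -> dq b (opD D o) = dq b o.
Proof.
move=> fD [U [V UV]].
have DU : rmodp (D * U) b = 1.
  have -> : D * U = 1 - V * b by rewrite -UV mulrC addrK.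
  rewrite rmodpB // rmodp_mull // subr0 rmodp_small // size_poly1.
  exact: b1.
have UD : rmodp (U * D) b = 1 by rewrite mulrC.
pose nD (a e : 'I_d * 'I_s) := Nq b [:: (0%N, D%:M)] a.1 e.1 a.2 e.2.
pose nU (a e : 'I_d * 'I_s) := Nq b [:: (0%N, U%:M)] a.1 e.1 a.2 e.2.
symmetry; apply: (@fdet_intertwine _ _ _ _ _ nD nU); try by move=> a e; apply: Nq_inv.
move=> a e.
under eq_bigr => k _ do rewrite mulrBl.
under [RHS]eq_bigr => k _ do rewrite mulrBr.
rewrite !sumrB (sum_delta (fun k => nD k e)) (sum_delta_r (nD a)); congr (_ - _).
rewrite (sum_pair (fun (l : 'I_d) k => Nq b o a.1 l a.2 k *
  Nq b [:: (0%N, D%:M)] l e.1 k e.2)) Nq_comp //.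
rewrite (sum_pair (fun (l : 'I_d) k => Nq b [:: (0%N, D%:M)] a.1 l a.2 k *
  Nq b (opD D o) l e.1 k e.2)) Nq_comp //.
rewrite /Nq /comp big_allpairs_dep big_allpairs_dep /= big_seq1 big_map.
apply: eq_bigr => x _; rewrite big_seq1 /= addn0 add0n; congr ((rmodp (_ * _) _)`_ _).
rewrite map_scalar_mx /= fD mul_mx_scalar mul_scalar_mx !mxE expn0 expr1 comp_polyXr.
by rewrite mulrA -exprS subn1 prednK.
Qed.

(** As q^j - 1 > 0, at least one factor D remains and the operator is zero modulo b. *)
Lemma dq_dvd s D (o : seq (nat * 'M[{poly R}]_s)) : posj o ->
  (exists A, D = A * b) -> dq b (opD D o) = 1.
Proof.
move=> /allP po [A ->]; rewrite -[RHS](fdet1 R ('I_d * 'I_s)%type).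
apply: eq_fdet => a e; rewrite /Nq /opD big_map big_seq big1 ?subr0 // => x xo /=.
have : (1 < q ^ x.1)%N.
  by apply: leq_trans q1 _; rewrite -{1}(expn1 q) leq_exp2l // po.
rewrite mxE; case E : (q ^ x.1 - 1)%N => [|k]; first by lia.
move=> _; set H := x.2 _ _; set m := (_ * _)%N.
have -> : (A * b) ^+ k.+1 * H * 'X^m = A * (A * b) ^+ k * H * 'X^m * b.
  by rewrite exprS; ring.
by rewrite rmodp_mull // coef0.
Qed.

End OneModulus.

Lemma opDM s D E (o : seq (nat * 'M[{poly R}]_s)) :
  opD (D * E) o = opD D (opD E o).
Proof. by rewrite /opD -map_comp; apply: eq_map => x /=; rewrite scalerA exprMn. Qed.

Lemma frob_prod (l : seq {poly R}) :
  (forall b, b \in l -> frob b) -> frob (\prod_(b <- l) b).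
Proof.
elim: l => [|b l IH] fl j; first by rewrite big_nil -[1]/(1%:P) comp_polyC expr1n.
rewrite big_cons comp_polyM exprMn fl ?mem_head // IH // => e el.
by apply: fl; rewrite inE el orbT.
Qed.

(** A repeated factor contributes 1 by [dq_dvd], so only distinct moduli count. This permits
    conjugation by a high power of a product of primes. *)
Lemma detop_prod s (o : seq (nat * 'M[{poly R}]_s)) (l : seq {poly R}) :
  posj o ->
  (forall b, b \in l -> [/\ b \is monic, (1 < size b)%N & frob b]) ->
  (forall b e, b \in l -> e \in l -> b != e -> cop b e) ->
  detop q (opD (\prod_(b <- l) b) o) = detop q o * \prod_(b <- undup l) dq b o.
Proof.
move=> po; elim: l => [|b l IH] bl cl.
  rewrite !big_nil mulr1; congr (detop q _); rewrite /opD.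
  by rewrite -[RHS]map_id; apply: eq_map => -[j H] /=; rewrite expr1n scale1r.
have [bm b1 fb] := bl b (mem_head _ _).
have bl' e : e \in l -> [/\ e \is monic, (1 < size e)%N & frob e].
  by move=> el; apply: bl; rewrite inE el orbT.
have fl : frob (\prod_(e <- l) e) by apply: frob_prod => e /bl'[].
rewrite big_cons opDM detop_quot ?posj_opD // IH //; last first.
  by move=> e e' el el'; apply: cl; rewrite inE ?el ?el' orbT.
rewrite /=; case: ifP => [inl|ninl].
  rewrite dq_dvd ?mulr1 //; exists (\prod_(e <- rem b l) e).
  by rewrite (big_rem b) //= mulrC.
rewrite big_cons dq_conj //; first by ring.
have : forall e, e \in l -> cop b e.
  move=> e el; apply: cl; rewrite ?inE ?eqxx ?el ?orbT //.
  by apply: contraFneq ninl => ->.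
elim: (l) => [|e l' IHl] ce.
  by rewrite big_nil; exists 1, 0; rewrite mul1r mul0r addr0.
rewrite big_cons; apply: copM; first by apply: ce; rewrite mem_head.
by apply: IHl => e' el'; apply: ce; rewrite inE el' orbT.
Qed.

(* Multiplicativity of characteristic determinants on the quotient, in the
   same form as detopM. *)
Lemma dqM b s (o1 o2 : seq (nat * 'M[{poly R}]_s)) : b \is monic -> frob b ->
  dq b o1 * dq b o2 = dq b (o1 ++ o2 ++ opN (comp q o1 o2)).
Proof.
move=> bm fb; rewrite /dq -fdetM; apply: eq_fdet => a e.
have NqN (o : seq (nat * 'M[{poly R}]_s)) m i p p' :
    Nq b (opN o) m i p p' = - Nq b o m i p p'.
  rewrite /Nq big_map -sumrN; apply: eq_bigr => x _ /=.
  by rewrite mxE mulNr rmodpN // coefN.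
have NqC (o o' : seq (nat * 'M[{poly R}]_s)) m i p p' :
    Nq b (o ++ o') m i p p' = Nq b o m i p p' + Nq b o' m i p p'.
  by rewrite /Nq big_cat.
rewrite !NqC NqN -Nq_comp //.
rewrite -(sum_pair (fun (l : 'I_(size b).-1) p => Nq b o1 a.1 l a.2 p * Nq b o2 l e.1 p e.2)).
rewrite (eq_bigr (fun k : 'I_(size b).-1 * 'I_s => (a == k)%:R * ((k == e)%:R - Nq b o2 k.1 e.1 k.2 e.2)
   - (Nq b o1 a.1 k.1 a.2 k.2 * (k == e)%:R
   - Nq b o1 a.1 k.1 a.2 k.2 * Nq b o2 k.1 e.1 k.2 e.2))); last first.
  by move=> k _; ring.
rewrite sumrB sum_delta sumrB.
rewrite (sum_delta_r (fun k : 'I_(size b).-1 * 'I_s => Nq b o1 a.1 k.1 a.2 k.2)); ring.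
Qed.

End Quotients.

(** * Laurent series in w = 1 / theta *)

Lemma frac_ex (R : idomainType) (x : {fraction R}) :
  exists p : R * R, p.2 != 0 /\ x = tofrac p.1 / tofrac p.2.
Proof.
elim/quotW: x => r; exists (frac r); split; first exact: denom_ratioP.
have d0 : tofrac (frac r).2 != 0 by rewrite tofrac_eq0 denom_ratioP.
apply: (mulIf d0); rewrite divfK //; unlock FracField.tofrac.
rewrite -[LHS]FracField.pi_mul; apply/eqmodP => /=; rewrite FracField.equivfE.
rewrite /FracField.mulf /= !numden_Ratio ?mulf_neq0 ?oner_eq0 ?denom_ratioP //.
by rewrite !mulr1 mulrC.
Qed.

Section FractionLift.
Variables (R : idomainType) (K : fieldType) (f : {rmorphism R -> K}).
Hypothesis finj : forall x, x != 0 -> f x != 0.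

(** The redex on [finj] makes the body depend on injectivity, so that after the section the morphism
    instances are found for [flift finj]. *)
Definition flift (x : {fraction R}) : K :=
  let p := projT1 (cid (frac_ex x)) in
  (fun _ : forall x, x != 0 -> f x != 0 => f p.1 / f p.2) finj.

Lemma fliftE a b : b != 0 -> flift (tofrac a / tofrac b) = f a / f b.
Proof.
move=> b0; rewrite /flift; case: cid => -[c d] /= [d0 E].
apply/eqP; rewrite eqr_div ?finj // -!rmorphM; apply/eqP; congr (f _).
apply/eqP; rewrite -tofrac_eq !tofracM -eqr_div ?tofrac_eq0 //.
by rewrite E.
Qed.

Lemma flift_tofrac a : flift (tofrac a) = f a.
Proof.
by rewrite -[tofrac a]divr1 -tofrac1 fliftE ?oner_eq0 // rmorph1 divr1.
Qed.

Lemma flift_is_zmod_morphism : zmod_morphism flift.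
Proof.
move=> x y; have [[a b] /= [b0 ->]] := frac_ex x.
have [[c d] /= [d0 ->]] := frac_ex y.
have bF : tofrac b != 0 by rewrite tofrac_eq0.
have dF : tofrac d != 0 by rewrite tofrac_eq0.
rewrite -mulNr addf_div // -!tofracN -!tofracM -tofracD !fliftE ?mulf_neq0 //.
by rewrite rmorphD !rmorphM rmorphN -mulNr addf_div ?finj.
Qed.

Lemma flift_is_monoid_morphism : monoid_morphism flift.
Proof.
split=> [|x y]; first by rewrite -tofrac1 flift_tofrac rmorph1.
have [[a b] /= [b0 ->]] := frac_ex x; have [[c d] /= [d0 ->]] := frac_ex y.
rewrite mulf_div -!tofracM !fliftE ?mulf_neq0 // !rmorphM.
by rewrite mulf_div.
Qed.

HB.instance Definition _ := GRing.isZmodMorphism.Build _ _ flift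
  flift_is_zmod_morphism.
HB.instance Definition _ := GRing.isMonoidMorphism.Build _ _ flift
  flift_is_monoid_morphism.

End FractionLift.

Section Powser.
Variable F : fieldType.
Local Notation W := (powser F).
Local Notation X := (powserX F).
Implicit Types s t : W.

Lemma powserDE s t n : (s + t) n = s n + t n. Proof. by []. Qed.
Lemma powserNE s n : (- s) n = - s n. Proof. by []. Qed.
Lemma powserBE s t n : (s - t) n = s n - t n. Proof. by []. Qed.
Lemma powser0E n : (0 : W) n = 0. Proof. by []. Qed.
Lemma powser1E n : (1 : W) n = (n == 0)%:R. Proof. by []. Qed.

Lemma powserME s t n : (s * t) n = \sum_(i < n.+1) s i * t (n - i)%N.
Proof. by []. Qed.

Lemma powser_sumE (I : Type) (r : seq I) (P : pred I) (f : I -> W) n :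
  (\sum_(i <- r | P i) f i) n = \sum_(i <- r | P i) f i n.
Proof. by elim/big_ind2: _ => // s a t b <- <-. Qed.

Lemma powserC_is_zmod_morphism : zmod_morphism (@powserC F).
Proof. by move=> a b; apply: powserP => n /=; rewrite mulrnBl. Qed.

Lemma powserCM_coef (a : F) s n : (powserC a * s) n = a * s n.
Proof.
rewrite powserME big_ord_recl /= subn0 mulr1n big1 ?addr0 // => i _.
by rewrite mulr0n mul0r.
Qed.

Lemma powserC_is_monoid_morphism : monoid_morphism (@powserC F).
Proof.
split=> // a b; apply: powserP => n; rewrite powserCM_coef /=.
by rewrite mulrnAr.
Qed.

HB.instance Definition _ := GRing.isZmodMorphism.Build F W (@powserC F)
  powserC_is_zmod_morphism.
HB.instance Definition _ := GRing.isMonoidMorphism.Build F W (@powserC F)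
  powserC_is_monoid_morphism.

Lemma powserXM s n : (X * s) n = if n is n'.+1 then s n' else 0.
Proof.
rewrite powserME; case: n => [|n]; first by rewrite big_ord1 mul0r.
rewrite big_ord_recl mul0r add0r big_ord_recl /= mul1r subn1 /= big1 ?addr0 //.
by move=> i _; rewrite mul0r.
Qed.

Lemma powserXnM k s n : (X ^+ k * s) n = if (k <= n)%N then s (n - k)%N else 0.
Proof.
elim: k => [|k IH] in n *; first by rewrite mul1r subn0.
by rewrite exprS -mulrA powserXM; case: n => // n; rewrite IH ltnS subSS.
Qed.

Lemma powserX_neq0 : X != 0.
Proof.
apply/eqP => /(congr1 (fun s : W => s 1%N)) /= /eqP.
by rewrite oner_eq0.
Qed.

Lemma powser_shift k s : (forall i, (i < k)%N -> s i = 0) ->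
  s = X ^+ k * PowSer (fun n => s (n + k)%N).
Proof.
move=> s0; apply: powserP => n; rewrite powserXnM /=; case: leqP => kn.
  by rewrite subnK.
by rewrite s0.
Qed.

Lemma powser_clP N s t : cl X N s t <-> (forall i, (i < N)%N -> s i = t i).
Proof.
split=> [[v E] i iN|E].
  apply/eqP; rewrite -subr_eq0 -powserBE E powserXnM ifF //.
  by apply/negbTE; rewrite -ltnNge.
exists (PowSer (fun n => (s - t) (n + N)%N)); apply: powser_shift => i iN.
by rewrite powserBE E // subrr.
Qed.

Lemma eq_powserM s t t' n : (forall i, (i <= n)%N -> t i = t' i) ->
  (s * t) n = (s * t') n.
Proof.
by move=> E; rewrite !powserME; apply: eq_bigr => i _; rewrite E // leq_subr.
Qed.

Lemma powser_inv1 r : exists t, (1 - X * r) * t = 1.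
Proof.
pose S m : W := \sum_(i < m) (X * r) ^+ i.
have S_eq j m m' : (j < m)%N -> (m <= m')%N -> S m j = S m' j.
  move=> jm mm'; rewrite /S !powser_sumE (big_ord_widen _ (fun i => ((X * r) ^+ i) j) mm').
  rewrite big_mkcond /=; apply: eq_bigr => i _; case: ifP => // /negbT.
  rewrite -leqNgt exprMn powserXnM => mi; rewrite ifF //.
  by apply/negbTE; rewrite -ltnNge (leq_trans jm mi).
exists (PowSer (fun n => S n.+1 n)); apply: powserP => n.
rewrite (@eq_powserM _ _ (S n.+1)) => [|i ini]; last first.
  by apply: S_eq; rewrite ?ltnSn.
have -> : (1 - X * r) * S n.+1 = 1 - (X * r) ^+ n.+1.
  have := subrX1 (X * r) n.+1; rewrite -/(S _) => E.
  by rewrite -[RHS]opprB E -[RHS]mulNr opprB.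
by rewrite powserBE exprMn powserXnM ltnn subr0.
Qed.

Lemma powser_inv_ex s : s 0%N != 0 -> exists t, s * t = 1.
Proof.
move=> s0; have [s' s'0 s'E] : exists2 s' : W, s' 0%N = 1 & s' = powserC (s 0%N)^-1 * s.
  by exists (powserC (s 0%N)^-1 * s) => //; rewrite powserCM_coef mulVf.
have [r E] : exists r, s' = 1 - X * r.
  exists (PowSer (fun n => - s' n.+1)); apply: powserP => n.
  rewrite powserBE powserXM powser1E; case: n => [|n] /=.
    by rewrite s'0 subr0.
  by rewrite sub0r opprK.
have [t rt] := powser_inv1 r; exists (powserC (s 0%N)^-1 * t).
by rewrite mulrCA mulrA -s'E E.
Qed.

Lemma powser_ord s : s != 0 ->
  exists k s', s = X ^+ k * s' /\ s' 0%N != 0.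
Proof.
move=> s0; have ex : exists k, s k != 0.
  apply: contrapT => /forallNP ns; move/eqP: s0; apply.
  by apply: powserP => n; have /negP := ns n; rewrite negbK => /eqP.
have [k sk mink] := ex_minnP ex; exists k, (PowSer (fun n => s (n + k)%N)).
split=> //; apply: powser_shift => i; apply: contraTeq => si.
by rewrite -leqNgt; apply: mink.
Qed.

Local Notation K := (Kinf F).
Definition wK : K := tofrac X.

Lemma wK_neq0 : wK != 0. Proof. by rewrite tofrac_eq0 powserX_neq0. Qed.

Implicit Types (x y : K) (N M : int).

(* x lies in w^N F[[w]] *)
Definition vge N x := exists s : W, x = wK ^ N * tofrac s.

Lemma vgeD N x y : vge N x -> vge N y -> vge N (x + y).
Proof. by move=> [s ->] [t ->]; exists (s + t); rewrite tofracD mulrDr. Qed.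

Lemma vgeN N x : vge N x -> vge N (- x).
Proof. by move=> [s ->]; exists (- s); rewrite tofracN mulrN. Qed.

Lemma vgeB N x y : vge N x -> vge N y -> vge N (x - y).
Proof. by move=> vx /vgeN; apply: vgeD. Qed.

Lemma vgeM N M x y : vge N x -> vge M y -> vge (N + M) (x * y).
Proof.
move=> [s ->] [t ->]; exists (s * t).
by rewrite tofracM expfzDr ?wK_neq0 // mulrACA.
Qed.

Lemma vge00 N : vge N 0.
Proof. by exists 0; rewrite tofrac0 mulr0. Qed.

Lemma vge_sum N (I : Type) (r : seq I) (P : pred I) (f : I -> K) :
  (forall i, P i -> vge N (f i)) -> vge N (\sum_(i <- r | P i) f i).
Proof.
by move=> vf; apply: (big_ind (vge N)) => //; [exact: vge00|exact: vgeD].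
Qed.

Lemma vge_weak N M x : (M <= N)%R -> vge N x -> vge M x.
Proof.
move=> MN [s ->]; exists (X ^+ `|N - M|%N * s).
rewrite tofracM tofracXn mulrA -/wK; congr (_ * _).
rewrite -[wK ^+ _]/(wK ^ `|N - M|%N%:Z) -expfzDr ?wK_neq0 //.
by have -> : M + `|N - M|%N%:Z = N by lia.
Qed.

Lemma vge_w N : vge N (wK ^ N).
Proof. by exists 1; rewrite tofrac1 mulr1. Qed.

Lemma vge_wn (n : nat) : vge n (wK ^+ n).
Proof. exact: vge_w n. Qed.

Lemma vge_tofrac s : vge 0 (tofrac s).
Proof. by exists s; rewrite expr0z mul1r. Qed.

Lemma vge0P x : vge 0 x -> exists s, x = tofrac s.
Proof. by move=> [s ->]; exists s; rewrite expr0z mul1r. Qed.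

Lemma vge_inv_tofrac s : s 0%N != 0 -> exists t, (tofrac s : K)^-1 = tofrac t.
Proof.
move=> /powser_inv_ex[t st]; exists t; apply: (@mulfI _ (tofrac s)).
  rewrite tofrac_eq0; apply/eqP => s0; move/eqP: st.
  by rewrite s0 mul0r eq_sym oner_eq0.
rewrite -tofracM st tofrac1 divff // tofrac_eq0; apply/eqP => s0; move/eqP: st.
by rewrite s0 mul0r eq_sym oner_eq0.
Qed.

Lemma vge_ex x : exists N, vge N x.
Proof.
have [[a b] /= [b0 ->]] := frac_ex x.
have [k [b' [-> b'0]]] := powser_ord b0; have [t tE] := vge_inv_tofrac b'0.
exists (- k%:Z), (a * t); rewrite tofracM tofracXn invfM tE tofracM -/wK.
by rewrite exprnN mulrCA.
Qed.

Lemma vge_tofracP (n : nat) s : vge n (tofrac s) -> forall i, (i < n)%N -> s i = 0.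
Proof.
move=> [t E] i lin.
have : tofrac s = tofrac (X ^+ n * t) by rewrite tofracM tofracXn E.
by move=> /eqP; rewrite tofrac_eq => /eqP ->; rewrite powserXnM ifF // leqNgt lin.
Qed.

Lemma vge_coef (n : nat) s : (forall i, (i < n)%N -> s i = 0) -> vge n (tofrac s).
Proof.
by move=> /powser_shift ->; rewrite tofracM tofracXn; eexists.
Qed.

Lemma vge_all x : (forall n : nat, vge n x) -> x = 0.
Proof.
move=> vx; apply/eqP; apply: contraT => x0.
have [M vM] := vge_ex x^-1.
have := vgeM (vx `|1 - M|%N) vM; rewrite divff // => v1.
have : vge 1%N (tofrac (1 : W)).
  rewrite tofrac1; apply: vge_weak v1; rewrite abszE.
  have := ler_norm (1 - M); lia.
by move/vge_tofracP/(_ 0%N isT)/eqP; rewrite oner_eq0.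
Qed.

Lemma Kinf_closeE (n : nat) x y : Kinf_close n x y <-> vge n (x - y).
Proof. by split=> -[s E]; exists s. Qed.

Lemma cl_vge (n : nat) s t : cl X n s t -> vge n (tofrac s - tofrac t).
Proof. by move=> [v E]; exists v; rewrite -tofracB E tofracM tofracXn. Qed.

Definition cvgK (u : nat -> K) x :=
  forall n : nat, exists M0 : nat, forall m, (M0 <= m)%N -> vge n (u m - x).

Lemma cvgK_uniq u x y : cvgK u x -> cvgK u y -> x = y.
Proof.
move=> ux uy; apply/eqP; rewrite -subr_eq0; apply/eqP; apply: vge_all => n.
have [M1 v1] := ux n; have [M2 v2] := uy n.
have := vgeB (v2 _ (leq_addl M1 M2)) (v1 _ (leq_addr M2 M1)).
set a := u _; by have -> : a - y - (a - x) = x - y by ring.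
Qed.

Lemma cvgKD u v x y : cvgK u x -> cvgK v y -> cvgK (fun m => u m + v m) (x + y).
Proof.
move=> ux vy n; have [M1 v1] := ux n; have [M2 v2] := vy n.
exists (M1 + M2)%N => m le; rewrite opprD addrACA; apply: vgeD.
  exact/v1/(leq_trans (leq_addr _ _) le).
exact/v2/(leq_trans (leq_addl _ _) le).
Qed.

Lemma cvgK_cst x : cvgK (fun=> x) x.
Proof. by move=> n; exists 0%N => m _; rewrite subrr; apply: vge00. Qed.

Lemma cvgK_bd u x : cvgK u x -> exists B (M0 : nat), forall m, (M0 <= m)%N -> vge B (u m).
Proof.
move=> ux; have [M0 v0] := ux 0%N; have [N vx] := vge_ex x.
exists (Order.min 0 N), M0 => m /v0 v; rewrite -(subrK x (u m)).
by apply: vgeD; [apply: vge_weak v|apply: vge_weak vx]; rewrite ge_min lexx ?orbT.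
Qed.

Lemma cvgKM u v x y : cvgK u x -> cvgK v y -> cvgK (fun m => u m * v m) (x * y).
Proof.
move=> ux vy n; have [B [M1 bu]] := cvgK_bd ux; have [N vx] := vge_ex y.
have [M2 v2] := ux `|n%:Z - N|%N; have [M3 v3] := vy `|n%:Z - B|%N.
exists (M1 + M2 + M3)%N => m le.
have -> : u m * v m - x * y = u m * (v m - y) + (u m - x) * y by ring.
apply: vgeD.
  by apply: vge_weak (vgeM (bu m _) (v3 m _)); lia.
by apply: vge_weak (vgeM (v2 m _) vx); lia.
Qed.

Lemma cvgK_sum (I : Type) (r : seq I) (P : pred I) (f : I -> nat -> K) (g : I -> K) :
  (forall i, P i -> cvgK (f i) (g i)) ->
  cvgK (fun m => \sum_(i <- r | P i) f i m) (\sum_(i <- r | P i) g i).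
Proof.
move=> fg; elim: r => [|i r IH].
  by rewrite big_nil; under eq_fun do rewrite big_nil; apply: cvgK_cst.
rewrite big_cons; under eq_fun do rewrite big_cons.
by case: ifP => // Pi; apply: cvgKD => //; apply: fg.
Qed.

Lemma cvgK_prod (I : Type) (r : seq I) (P : pred I) (f : I -> nat -> K) (g : I -> K) :
  (forall i, P i -> cvgK (f i) (g i)) ->
  cvgK (fun m => \prod_(i <- r | P i) f i m) (\prod_(i <- r | P i) g i).
Proof.
move=> fg; elim: r => [|i r IH].
  by rewrite big_nil; under eq_fun do rewrite big_nil; apply: cvgK_cst.
rewrite big_cons; under eq_fun do rewrite big_cons.
by case: ifP => // Pi; apply: cvgKM => //; apply: fg.
Qed.

Lemma cvgK_det n (f : nat -> 'M[K]_n) (g : 'M[K]_n) :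
  (forall i j, cvgK (fun m => f m i j) (g i j)) ->
  cvgK (fun m => \det (f m)) (\det g).
Proof.
move=> fg; rewrite /determinant; apply: cvgK_sum => s _; apply: cvgKM.
  exact: cvgK_cst.
by apply: cvgK_prod => i _; apply: fg.
Qed.

Lemma cvgK_shift u x k : cvgK u x -> cvgK (fun m => u (m + k)%N) x.
Proof.
move=> ux n; have [M0 v] := ux n; exists M0 => m le; apply: v.
exact: leq_trans le (leq_addr _ _).
Qed.

Lemma cvgK_complete u :
  (forall n : nat, exists M0 : nat, forall m, (M0 <= m)%N -> vge n (u m.+1 - u m)) ->
  exists x, cvgK u x.
Proof.
move=> cu.
have cu' (n : nat) : exists M0 : nat, forall m m', (M0 <= m)%N -> (M0 <= m')%N -> vge n (u m - u m').
  have [M0 v] := cu n; exists M0.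
  suff H m k : (M0 <= m)%N -> vge n (u (m + k)%N - u m).
    move=> m m' le le'; have [mm|mm] := leqP m m'.
      by rewrite -(subnKC mm) -opprB; apply/vgeN/H.
    by rewrite -(subnKC (ltnW mm)); apply: H.
  move=> le; elim: k => [|k IH]; first by rewrite addn0 subrr; apply: vge00.
  rewrite addnS -(subrK (u (m + k)%N) (u _.+1)) -addrA; apply: vgeD => //.
  by apply: v; apply: leq_trans le (leq_addr _ _).
have [M0 v0] := cu' 0%N.
have sx m : exists s : W, (M0 <= m)%N -> u m - u M0 = tofrac s.
  case: (leqP M0 m) => [le|_]; last by exists 0.
  by have [s E] := vge0P (v0 _ _ le (leqnn M0)); exists s.
have [s sE] := choice sx; have [Mf MfP] := choice cu'.
(* From index M n on the sequence is constant modulo w^(n+1), so coefficient n of the limit is read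
   there. *)
pose M n := (M0 + Mf n.+1)%N.
exists (u M0 + tofrac (PowSer (fun n => s (M n) n))) => n.
exists (M0 + \sum_(i < n) M i)%N => m le.
have le0 : (M0 <= m)%N by apply: leq_trans le; rewrite leq_addr.
rewrite opprD addrA sE // -tofracB; apply: vge_coef => i lin.
rewrite powserBE /=.
have leM : (M i <= m)%N.
  apply: leq_trans le; rewrite (bigD1 (Ordinal lin)) //=; lia.
have : vge i.+1 (tofrac (s m - s (M i))).
  rewrite tofracB -!sE ?leq_addr //.
  rewrite opprB addrA subrK; apply: MfP => //; last by rewrite leq_addl.
  by apply: leq_trans leM; rewrite leq_addl.
by move/vge_tofracP/(_ i (ltnSn i)); rewrite powserBE.
Qed.

Definition CK (c : F) : K := tofrac (powserC c).

Lemma CK_is_zmod_morphism : zmod_morphism CK.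
Proof. by move=> a b; rewrite /CK rmorphB tofracB. Qed.
Lemma CK_is_monoid_morphism : monoid_morphism CK.
Proof. by split=> [|a b]; rewrite /CK ?rmorph1 ?tofrac1 // rmorphM tofracM. Qed.
HB.instance Definition _ := GRing.isZmodMorphism.Build F K CK CK_is_zmod_morphism.
HB.instance Definition _ := GRing.isMonoidMorphism.Build F K CK CK_is_monoid_morphism.

(* substitution t := w^(-a) *)
Definition evt (a : nat) (p : {poly F}) : K := (map_poly CK p).[wK ^- a].

Lemma evt_is_zmod_morphism a : zmod_morphism (evt a).
Proof. by move=> p p'; rewrite /evt rmorphB hornerD hornerN. Qed.
Lemma evt_is_monoid_morphism a : monoid_morphism (evt a).
Proof. by split=> [|p p']; rewrite /evt ?rmorph1 ?hornerC // rmorphM hornerM. Qed.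
HB.instance Definition _ a := GRing.isZmodMorphism.Build {poly F} K (evt a)
  (evt_is_zmod_morphism a).
HB.instance Definition _ a := GRing.isMonoidMorphism.Build {poly F} K (evt a)
  (evt_is_monoid_morphism a).

Lemma A_to_KinfE p : A_to_Kinf p = evt 1 p.
Proof. by []. Qed.

Lemma evtC a c : evt a c%:P = CK c.
Proof. by rewrite /evt map_polyC hornerC. Qed.

Lemma evtX a : evt a 'X = wK ^- a.
Proof. by rewrite /evt map_polyX hornerX. Qed.

(** w^(a n) p(w^(-a)): the reversed polynomial, an element of F[[w]] as soon as n bounds the
    degree. *)
Definition rv (a n : nat) (p : {poly F}) : W :=
  \sum_(i < n.+1) powserC p`_i * X ^+ (a * (n - i)).

Lemma evt_rv a n (p : {poly F}) : (size p <= n.+1)%N -> evt a p = wK ^- (a * n) * tofrac (rv a n p).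
Proof.
move=> sp; rewrite /evt (@horner_coef_wide _ n.+1); last first.
  by apply: leq_trans sp; rewrite size_map_poly.
rewrite /rv rmorph_sum mulr_sumr; apply: eq_bigr => i _ /=.
rewrite coef_map tofracM tofracXn -/wK mulrCA; congr (_ * _).
have ia : (a * n = a * i + a * (n - i))%N.
  by rewrite -mulnDr subnKC // -ltnS.
rewrite ia exprD invfM -mulrA mulVf ?mulr1 ?expf_neq0 ?wK_neq0 //.
by rewrite exprVn -exprM.
Qed.

Lemma vge_evt a n (p : {poly F}) : (size p <= n.+1)%N -> vge (- (a * n)%:Z) (evt a p).
Proof. by move=> /(evt_rv a) ->; exists (rv a n p); rewrite exprnN. Qed.

Lemma evt_eq0 a (p : {poly F}) : (0 < a)%N -> p != 0 -> evt a p != 0.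
Proof.
move=> a0 p0; have sp : (size p <= (size p).-1.+1)%N by rewrite prednK // size_poly_gt0.
rewrite (evt_rv a sp) mulf_neq0 ?invr_eq0 ?expf_neq0 ?wK_neq0 // tofrac_eq0.
apply/eqP => /(congr1 (fun s : W => s 0%N)); rewrite /rv powser_sumE.
rewrite (bigD1 ord_max) // powserCM_coef [nat_of_ord _]/= subnn muln0 expr0 big1 ?addr0 => [|i im].
  move/eqP; rewrite [X in X == _]addr0 powser1E mulr1 powser0E.
  by rewrite -[_`_ _]/(lead_coef p) lead_coef_eq0 (negPf p0).
rewrite powserCM_coef -[X ^+ _]mulr1 powserXnM ifF ?mulr0 //.
apply/negbTE; rewrite -ltnNge muln_gt0 a0 subn_gt0.
by rewrite ltn_neqAle -val_eqE /= in im *; rewrite im -ltnS ltn_ord.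
Qed.

End Powser.

Arguments evt {F} a p.
Arguments wK {F}.

(** * Sizes of finite F[t]-modules are characteristic polynomials *)

Section CharPoly.
Variable F : fieldType.

Definition fcp (T : finType) (M : T -> T -> F) : {poly F} :=
  fdet (fun a b => (a == b)%:R * 'X - (M a b)%:P).

Definition coords (V : lmodType F) (T : V -> V) (I : finType)
    (co : V -> I -> F) (M : I -> I -> F) :=
  [/\ forall c x y i, co (c *: x + y) i = c * co x i + co y i,
      forall x y, co x =1 co y -> x = y,
      forall f, exists x, co x =1 f
    & forall x i, co (T x) i = \sum_j M i j * co x j].

Lemma coords_sum (V : lmodType F) (T : V -> V) (I : finType)
    (co : V -> I -> F) (M : I -> I -> F) (J : finType) (c : J -> F) (x : J -> V) i :
  coords T co M ->
  co (\sum_j c j *: x j) i = \sum_j c j * co (x j) i.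
Proof.
move=> [lin _ _ _].
have co0 j : co 0 j = 0.
  have := lin 1 0 0 j; rewrite scaler0 addr0 mul1r => /eqP.
  by rewrite -{1}[co 0 j]addr0 (inj_eq (addrI _)) eq_sym => /eqP.
elim: (index_enum J) => [|j r IH]; first by rewrite !big_nil co0.
by rewrite !big_cons lin IH.
Qed.

Lemma coords_expand (V : lmodType F) (T : V -> V) (I I' : finType)
  (co : V -> I -> F) (M : I -> I -> F) (co' : V -> I' -> F) (M' : I' -> I' -> F) :
  coords T co M -> coords T co' M' -> exists Q : I -> I' -> F,
  forall x i, co x i = \sum_j Q i j * co' x j.
Proof.
move=> C C'; have [_ inj' surj' _] := C'.
have [e eE] := choice (fun j => surj' (fun i => (i == j)%:R)).
exists (fun i j => co (e j) i) => x i.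
have {1}-> : x = \sum_j co' x j *: e j.
  apply: inj' => j; rewrite (coords_sum _ _ _ C') -[LHS](sum_delta (co' x)).
  by apply: eq_bigr => k _; rewrite eE mulrC.
by rewrite (coords_sum _ _ _ C); apply: eq_bigr => k _; rewrite mulrC.
Qed.

Lemma coords_fcp (V : lmodType F) (T : V -> V) (I I' : finType)
  (co : V -> I -> F) (M : I -> I -> F) (co' : V -> I' -> F) (M' : I' -> I' -> F) :
  coords T co M -> coords T co' M' -> fcp M = fcp M'.
Proof.
move=> C C'; have [Q QE] := coords_expand C C'; have [Q' Q'E] := coords_expand C' C.
have [_ _ surj coT] := C; have [_ _ surj' coT'] := C'.
have QQ' i j : \sum_k Q i k * Q' k j = (i == j)%:R.
  have [x xE] := surj (fun i => (i == j)%:R); rewrite -xE QE.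
  apply: eq_bigr => k _; rewrite Q'E; congr (_ * _).
  by rewrite -[LHS](sum_delta_r (Q' k)); apply: eq_bigr => l _; rewrite xE.
have Q'Q i j : \sum_k Q' i k * Q k j = (i == j)%:R.
  have [x xE] := surj' (fun i => (i == j)%:R); rewrite -xE Q'E.
  apply: eq_bigr => k _; rewrite QE; congr (_ * _).
  by rewrite -[LHS](sum_delta_r (Q k)); apply: eq_bigr => l _; rewrite xE.
have MQ i j : \sum_k M i k * Q k j = \sum_k Q i k * M' k j.
  have [x xE] := surj' (fun i => (i == j)%:R).
  transitivity (co (T x) i).
    rewrite coT; apply: eq_bigr => k _; rewrite QE; congr (_ * _).
    by rewrite -[LHS](sum_delta_r (Q k)); apply: eq_bigr => l _; rewrite xE.
  rewrite QE; apply: eq_bigr => k _; rewrite coT'; congr (_ * _).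
  by rewrite -[RHS](sum_delta_r (M' k)); apply: eq_bigr => l _; rewrite xE.
apply: (@fdet_intertwine _ _ _ _ _ (fun i j => (Q i j)%:P) (fun i j => (Q' i j)%:P)).
- move=> i j; under eq_bigr => k _ do rewrite -polyCM.
  by rewrite -rmorph_sum QQ' rmorph_nat.
- move=> i j; under eq_bigr => k _ do rewrite -polyCM.
  by rewrite -rmorph_sum Q'Q rmorph_nat.
move=> i j.
under eq_bigr => k _ do rewrite mulrBl -polyCM -mulrA.
under [RHS]eq_bigr => k _ do rewrite mulrBr -polyCM mulrCA.
rewrite !sumrB -!rmorph_sum /= MQ; congr (_ - _).
rewrite (sum_delta (fun k => 'X * (Q k j)%:P)) mulrC.
rewrite -[LHS](sum_delta_r (fun k => (Q i k)%:P * 'X)).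
by apply: eq_bigr => k _; ring.
Qed.

End CharPoly.

(** * Diagonalization of matrices over F[t] *)

Section Diagonalize.
Variable F : fieldType.
Local Notation A := {poly F}.

Definition mxequiv m n (B C : 'M[A]_(m, n)) :=
  exists U W, [/\ U \in unitmx, W \in unitmx & C = U *m B *m W].

Lemma mxequiv_refl m n (B : 'M[A]_(m, n)) : mxequiv B B.
Proof. by exists 1%:M, 1%:M; rewrite !unitmx1 mul1mx mulmx1. Qed.

Lemma mxequiv_trans m n (C B D : 'M[A]_(m, n)) :
  mxequiv B C -> mxequiv C D -> mxequiv B D.
Proof.
move=> [U [W [uU uW ->]]] [U' [W' [uU' uW' ->]]]; exists (U' *m U), (W *m W').
by rewrite !unitmx_mul uU uW uU' uW' !mulmxA.
Qed.

Lemma mxequiv_tr m n (B C : 'M[A]_(m, n)) : mxequiv B C -> mxequiv B^T C^T.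
Proof.
move=> [U [W [uU uW ->]]]; exists W^T, U^T.
by rewrite !unitmx_tr uU uW !trmx_mul mulmxA.
Qed.

(** One step of Euclid's algorithm: a column operation followed by a swap puts the remainder in the
    pivot position. *)
Lemma mxequiv_step n (B : 'M[A]_n.+1) j : B 0 0 != 0 -> ~~ (B 0 0 %| B 0 j) ->
  exists C, [/\ mxequiv B C, C 0 0 != 0 & (size (C 0 0)%R < size (B 0 0)%R)%N].
Proof.
move=> B0 nd; have j0 : 0 != j by apply: contraNneq nd => <-; rewrite dvdpp.
pose c := B 0 j %/ B 0 0.
pose E : 'M[A]_n.+1 := c *: delta_mx 0 j.
have E2 : E *m E = 0.
  rewrite /E -scalemxAl -scalemxAr mul_delta_mx_0 ?scaler0 //.
  by rewrite eq_sym.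
have uE : 1%:M - E \in unitmx.
  have /mulmx1_unit[] // : (1%:M - E) *m (1%:M + E) = 1%:M.
  by rewrite mulmxDr mulmx1 mulmxBl mul1mx E2 subr0 subrK.
exists (xcol 0 j (B *m (1%:M - E))).
have CE : xcol 0 j (B *m (1%:M - E)) 0 0 = B 0 j %% B 0 0.
  rewrite mxE tpermL mulmxBr mulmx1 mxE [X in _ + X]mxE.
  have -> : (B *m E) 0 j = c * B 0 0.
    rewrite /E -scalemxAr mxE mxE (bigD1 0) //= mxE !eqxx mulr1 big1 ?addr0 //.
    by move=> i i0; rewrite mxE (negPf i0) mulr0.
  by rewrite {1}(divp_eq (B 0 j) (B 0 0)) addrC addKr.
rewrite CE ltn_modp B0; split=> //.
exists 1%:M, ((1%:M - E) *m tperm_mx 0 j); split; rewrite ?unitmx1 //.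
  by rewrite unitmx_mul uE unitmx_perm.
by rewrite xcolE mul1mx mulmxA.
Qed.

(** A pivot of least size among all equivalent matrices divides its row and its column by
    [mxequiv_step], so both can be cleared. The f_i in [has_module_size] are arbitrary, so a
    diagonal form suffices. *)
Lemma mxequiv_diag n (B : 'M[A]_n) : exists D : 'rV[A]_n, mxequiv B (diag_mx D).
Proof.
elim: n => [|n IH] in B *.
  by exists 0; rewrite (flatmx0 B) (flatmx0 (diag_mx _)); apply: mxequiv_refl.
case: (eqVneq B 0) => [->|B0].
  exists 0; rewrite (_ : diag_mx 0 = 0); first exact: mxequiv_refl.
  by apply/matrixP => a b; rewrite !mxE mul0rn.
have [i [j Bij]] : exists i j, B i j != 0.
  apply: contrapT => H; move/eqP: B0; apply; apply/matrixP => i j; rewrite mxE.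
  by apply/eqP; apply: contraT => Bij; case: H; exists i, j.
pose P m := `[< exists C, [/\ mxequiv B C, C 0 0 != 0 & size (C 0 0) = m] >].
have exP : exists m, P m.
  pose C := xrow i 0 (xcol j 0 B).
  have C0 : C 0 0 = B i j by rewrite !mxE !tpermR.
  exists (size (C 0 0)); apply/asboolP; exists C; rewrite C0; split=> //.
  exists (tperm_mx i 0), (tperm_mx j 0); rewrite !unitmx_perm; split=> //.
  by rewrite /C xrowE xcolE mulmxA.
have [m /asboolP[C [BC C0 sC]] minm] := ex_minnP exP.
have dvr k : C 0 0 %| C 0 k.
  apply: contraT => nd; have [C' [CC' C'0 lt]] := mxequiv_step C0 nd.
  have : (m <= size (C' 0 0)%R)%N.
    by apply: minm; apply/asboolP; exists C'; split=> //; apply: mxequiv_trans CC'.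
  by rewrite leqNgt -sC lt.
have dvc k : C 0 0 %| C k 0.
  apply: contraT => nd; have := @mxequiv_step _ C^T k; rewrite !mxE.
  move=> /(_ C0 nd)[C' [CC' C'0 lt]].
  have : (m <= size (C'^T 0 0)%R)%N.
    apply: minm; apply/asboolP; exists C'^T; rewrite mxE; split=> //.
    by apply: mxequiv_trans BC _; rewrite -[C]trmxK; apply: mxequiv_tr.
  by rewrite mxE leqNgt -sC lt.
pose b := C 0 0; move: (C : 'M[A]_(1 + n)) BC dvr dvc => C1 BC dvr dvc.
have ulE : ulsubmx C1 = (C1 0 0)%:M by rewrite [LHS]mx11_scalar !mxE !lshift0.
pose u : 'rV[A]_n := \row_k (C1 0 (rshift 1 k) %/ C1 0 0).
pose v : 'cV[A]_n := \col_k (C1 (rshift 1 k) 0 %/ C1 0 0).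
have urE : ursubmx C1 = C1 0 0 *: u.
  apply/matrixP => i1 k; rewrite ord1 !mxE lshift0 mulrC divpK //; exact: dvr.
have dlE : dlsubmx C1 = C1 0 0 *: v.
  apply/matrixP => k i1; rewrite ord1 !mxE lshift0 mulrC divpK //; exact: dvc.
have [D [U [W [uU uW DE]]]] := IH (drsubmx C1 - C1 0 0 *: (v *m u)).
have /diag_mxP[D' D'E] :
    is_diag_mx (block_mx ((C1 0 0)%:M : 'M_1) 0 0 (diag_mx D) : 'M_(1 + n)).
  by rewrite is_diag_block_mx // !eqxx scalar_mx_is_diag diag_mx_is_diag.
exists D'; apply: mxequiv_trans BC _.
have u1 : (block_mx 1%:M 0 0 U : 'M_(1 + n)) \in unitmx.
  by rewrite unitmxE det_lblock det1 mul1r -unitmxE.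
have u2 : (block_mx 1%:M 0 (- v) 1%:M : 'M_(1 + n)) \in unitmx.
  by rewrite unitmxE det_lblock !det1 mul1r unitr1.
have u3 : (block_mx 1%:M (- u) 0 1%:M : 'M_(1 + n)) \in unitmx.
  by rewrite unitmxE det_ublock !det1 mul1r unitr1.
have u4 : (block_mx 1%:M 0 0 W : 'M_(1 + n)) \in unitmx.
  by rewrite unitmxE det_lblock det1 mul1r -unitmxE.
exists (block_mx 1%:M 0 0 U *m block_mx 1%:M 0 (- v) 1%:M),
  (block_mx 1%:M (- u) 0 1%:M *m block_mx 1%:M 0 0 W); split.
- by rewrite (@unitmx_mul _ (1 + n)) u1 u2.
- by rewrite (@unitmx_mul _ (1 + n)) u3 u4.
rewrite -D'E.
rewrite DE -[C1 in RHS]submxK ulE urE dlE.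
move: (C1 0 0) (drsubmx C1) => p E.
have P1 : block_mx 1%:M 0 (- v) 1%:M *m block_mx p%:M (p *: u) (p *: v) E
    = block_mx p%:M (p *: u) 0 (E - p *: (v *m u)).
  rewrite mulmx_block ?(mul1mx, mul0mx, addr0) mulNmx mul_mx_scalar addNr.
  by rewrite mulNmx -scalemxAr addrC.
have P2 : block_mx p%:M (p *: u) 0 (E - p *: (v *m u)) *m block_mx 1%:M (- u) 0 1%:M
    = block_mx p%:M 0 0 (E - p *: (v *m u)).
  rewrite mulmx_block ?(mulmx1, mulmx0, mul0mx, addr0, add0r) mulmxN.
  by rewrite mul_scalar_mx addNr.
rewrite -!mulmxA [X in _ = _ *m X]mulmxA P1 [X in _ = _ *m X]mulmxA P2.
have P3 Y : block_mx 1%:M 0 0 U *m (block_mx p%:M 0 0 Y *m block_mx 1%:M 0 0 W)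
    = block_mx p%:M 0 0 (U *m (Y *m W)) :> 'M_(1 + n).
  by rewrite !mulmx_block ?(mul1mx, mulmx1, mulmx0, mul0mx, addr0, add0r).
by rewrite P3.
Qed.

End Diagonalize.

Section ModuleSize.
Variables (F : finFieldType) (V : lmodType F) (T : V -> V).
Variables (I : finType) (co : V -> I -> F) (M : I -> I -> F).
Hypothesis C : coords T co M.
Import Pdiv.Ring Pdiv.RingMonic.

Lemma mk_monicE (f : {poly F}) : f \is monic -> (1 < size f)%N -> mk_monic f = f.
Proof. by move=> fm f1; rewrite /mk_monic f1 fm. Qed.

(** On a sum of cyclic modules the matrix of T is block diagonal with companion blocks. Together
    with [coords_fcp] this shows that the product of the f_i does not depend on the
    decomposition. *)
Lemma has_module_size_fcp f : has_module_size T f -> f = fcp M.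
Proof.
move=> [k [fs [h [fsP hb hlin hT ->]]]].
have mkE i : mk_monic (fs i) = fs i by have [fm f1] := fsP i; apply: mk_monicE.
pose T_ (i : 'I_k) : finType := 'I_(size (fs i)).-1.
pose co' x (u : {i : 'I_k & T_ i}) : F := (h x (tag u))`_(tagged u).
pose M' (u v : {i : 'I_k & T_ i}) : F := (tag u == tag v)%:R *
  (rmodp ('X * 'X^(tagged v)) (fs (tag u)))`_(tagged u).
have C' : coords T co' M'.
  split.
  - by move=> c x y u; rewrite /co' hlin coefD coefZ.
  - move=> x y E; case: hb => g hK gK; rewrite -[x]hK -[y]hK; congr g.
    apply: functional_extensionality_dep => i; apply/npolyP => j.
    have [lt|le] := ltnP j (size (fs i)).-1.
      exact: (E (Tagged T_ (Ordinal lt : T_ i))).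
    by rewrite !big_coef_npoly // mkE.
  - move=> f0; case: hb => g hK gK.
    exists (g (fun i => npolyp _ (\poly_(j < (size (fs i)).-1)
       (if insub j is Some j' then f0 (Tagged T_ (j' : T_ i)) else 0)))) => -[i j].
    rewrite /co' gK /= coef_npolyp mkE ltn_ord coef_poly ltn_ord.
    by rewrite valK.
  - move=> x [i a]; rewrite /co' /= hT.
    have qE (p : {poly F}) : Pdiv.CommonRing.rmodp p (mk_monic (fs i)) = rmodp p (fs i).
      by rewrite mkE.
    rewrite poly_of_qpolyM qE; have [fm f1] := fsP i.
    have -> : (in_qpoly (fs i) 'X : {poly F}) = rmodp 'X (fs i) by exact: qE.
    rewrite mulrC rmodp_mulmr // mulrC.
    rewrite [X in rmodp ('X * X)](@poly_sum_le _ _ (size (fs i)).-1); last first.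
      by apply: leq_trans (size_npoly _) _; rewrite mkE.
    rewrite mulr_sumr rmodp_sum // coef_sum.
    transitivity (\sum_i' \sum_(b : T_ i')
        M' (existT _ i a) (Tagged T_ b) * (h x i')`_b); last first.
      by rewrite sig_big_dep; apply: eq_big => [u|[i' b] _].
    rewrite (bigD1 i) //= [X in _ = _ + X]big1 ?addr0 => [|i' ii'].
      apply: eq_bigr => b _; rewrite /M' /= eqxx mul1r -scalerAr rmodpZ //.
      by rewrite coefZ mulrC.
    by rewrite big1 // => b _; rewrite /M' /= eq_sym (negPf ii') mul0r mul0r.
rewrite (coords_fcp C C') /fcp fdet_tag; last first.
  move=> u v uv; rewrite /M' (negPf uv) mul0r subr0.
  have /negPf-> : u != v by apply: contraNneq uv => ->.
  by rewrite mul0r.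
apply: eq_bigr => i _; have [fm f1] := fsP i; rewrite fdet_ord.
rewrite -[LHS](companionmxK fm) /char_poly -det_tr; congr determinant.
apply/matrixP => a b; rewrite !mxE /M' /= eqxx mul1r; congr (_ - _).
  by rewrite eq_Tagged /= eq_sym mulr_natl.
congr (_%:P); rewrite -exprS.
have [bd|bd] := eqVneq (b : nat) (size (fs i)).-2; last first.
  rewrite rmodp_small ?coefXn ?size_polyXn; first by rewrite eq_sym.
  have aux (x m : nat) : (x < m.-1 -> x != m.-2 -> 1 < m -> x.+2 < m)%N by lia.
  exact: aux (ltn_ord b) bd f1.
move: (nat_of_ord b) bd => bn bd.
have sE : size (fs i) = bn.+2 by rewrite bd; case: (size (fs i)) f1 => // -[].
have alt : (a < bn.+1)%N by apply: leq_trans (ltn_ord a) _; rewrite sE.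
move: (nat_of_ord a) alt => an alt.
have -> : rmodp 'X^(bn.+1) (fs i) = 'X^(bn.+1) - fs i.
  have E : 'X^(bn.+1) = ('X^(bn.+1) - fs i) + 1 * fs i by rewrite mul1r subrK.
  rewrite [in LHS]E rmodp_addM // rmodp_small //.
  rewrite sE ltnS; apply/leq_sizeP => j; rewrite leq_eqVlt => /orP[/eqP<-|lt].
    by rewrite coefB coefXn eqxx -(monicP fm) /lead_coef sE subrr.
  by rewrite coefB coefXn (gtn_eqF lt) sub0r nth_default ?oppr0 // sE.
by rewrite coefB coefXn (ltn_eqF alt) sub0r.
Qed.

(** Division with remainder by X - Mx. Together with [const_zero] it identifies the cokernel of X -
    Mx with F^n, on which X acts as Mx. *)
Lemma const_decomp n (Mx : 'M[F]_n) (z : 'cV[{poly F}]_n) :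
  exists c y, z = map_mx polyC c + ('X%:M - map_mx polyC Mx) *m y.
Proof.
have [m sz] : exists m, forall i, (size (z i 0%R) <= m)%N.
  exists (\max_i size (z i 0%R)) => i; exact: (leq_bigmax i).
elim: m z sz => [|m IH] z sz.
  exists 0, 0; apply/matrixP => i j; rewrite ord1 mulmx0 !mxE addr0.
  by apply/eqP; rewrite -size_poly_leq0.
pose z1 := map_mx (drop_poly 1) z.
pose z0 : 'cV[F]_n := map_mx (fun p : {poly F} => p`_0) z.
have zE : z = map_mx polyC z0 + 'X *: z1.
  apply/matrixP => i j; rewrite !mxE mulrC -{1}(poly_take_drop 1 (z i j)) expr1.
  congr (_ + _); apply/polyP => -[|k]; by rewrite coef_take_poly coefC.
have [|c1 [y1 z1E]] := IH z1.
  by move=> i; rewrite mxE size_drop_poly leq_subLR add1n.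
exists (z0 + Mx *m c1), (map_mx polyC c1 + 'X *: y1).
have E1 : map_mx polyC (z0 + Mx *m c1)
    = map_mx polyC z0 + map_mx polyC Mx *m map_mx polyC c1.
  by rewrite map_mxD map_mxM.
rewrite zE [in LHS]z1E E1.
move: (map_mx polyC z0) (map_mx polyC Mx) (map_mx polyC c1) => Z0 MM cc.
rewrite mulmxDr !mulmxBl !mul_scalar_mx -!scalemxAr scalerDr scalerBr.
by rewrite -!addrA; congr (_ + _); rewrite [RHS]addrCA addNKr.
Qed.

Lemma const_zero n (Mx : 'M[F]_n) (c : 'cV[F]_n) (y : 'cV[{poly F}]_n) :
  map_mx polyC c = ('X%:M - map_mx polyC Mx) *m y -> c = 0.
Proof.
move=> E; suff y0 : y = 0.
  by move: E; rewrite y0 mulmx0 => /matrixP E; apply/matrixP => i j;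
    have := E i j; rewrite !mxE => /eqP; rewrite polyC_eq0 => /eqP.
apply/eqP; apply: contraT => yn0.
have [i0 yi0] : exists i, y i 0 != 0.
  apply: contrapT => H; move/eqP: yn0; apply; apply/matrixP => i j; rewrite ord1 mxE.
  by apply/eqP; apply: contraT => yi; case: H; exists i.
case: (@arg_maxnP _ i0 xpredT (fun i => size (y i 0%R))) => // i _ imax.
have /matrixP/(_ i 0) := E; rewrite mulmxBl mul_scalar_mx !mxE => Ei.
have yi : (0 < size (y i 0%R))%N.
  by apply: leq_trans (imax i0 isT); rewrite size_poly_gt0.
have : (size ('X * y i 0)%R <= size (y i 0%R))%N.
  have -> : 'X * y i 0 = (c i 0)%:P + \sum_j map_mx polyC Mx i j * y j 0.
    by rewrite Ei subrK.
  apply: leq_trans (size_polyD _ _) _; rewrite geq_max; apply/andP; split.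
    exact: leq_trans (size_polyC_leq1 _) yi.
  apply: leq_trans (size_sum _ _ _) _; apply/bigmax_leqP => j _; rewrite mxE mul_polyC.
  exact: leq_trans (size_scale_leq _ _) (imax j isT).
by rewrite mulrC size_mulX -?size_poly_gt0 // ltnn.
Qed.

(** V is the cokernel of X - Mx, and diagonalizing this matrix splits the cokernel into cyclic
    summands. *)
Lemma has_module_size_ex : exists f, has_module_size T f.
Proof.
have [clin cinj csurj cT] := C.
pose n := #|I|; pose Mx : 'M[F]_n := fmx M.
pose cv x : 'cV[F]_n := \col_i co x (enum_val i).
have cvT x : cv (T x) = Mx *m cv x.
  apply/matrixP => i j; rewrite !mxE cT sum_enum_val.
  by apply: eq_bigr => k _; rewrite !mxE.
have cvlin c x y : cv (c *: x + y) = c *: cv x + cv y.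
  by apply/matrixP => i j; rewrite !mxE clin.
have cvinj x y : cv x = cv y -> x = y.
  move=> /matrixP E; apply: cinj => i; have := E (enum_rank i) 0.
  by rewrite !mxE enum_rankK.
have cvsurj c : exists x, cv x = c.
  have [x xE] := csurj (fun i => c (enum_rank i) 0); exists x.
  by apply/matrixP => i j; rewrite ord1 mxE xE enum_valK.
pose A0 : 'M[{poly F}]_n := 'X%:M - map_mx polyC Mx.
have [D [U [W [uU uW DE]]]] := mxequiv_diag A0.
have D0 i : D 0 i != 0.
  have : \det (diag_mx D) != 0.
    have uD (Q : 'M[{poly F}]_n) : Q \in unitmx -> \det Q != 0.
      by rewrite unitmxE; apply: contraTneq => ->; rewrite unitr0.
    rewrite DE !det_mulmx; apply: mulf_neq0; last exact: uD.
    apply: mulf_neq0; first exact: uD.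
    exact: (monic_neq0 (char_poly_monic Mx)).
  by rewrite det_diag => /prodf_neq0/(_ i isT).
have subD (x y : 'cV[{poly F}]_n) i :
    (x - diag_mx D *m y) i 0 = x i 0 - D 0 i * y i 0.
  by rewrite mul_diag_mx !mxE.
(* Constant diagonal entries give zero summands and are left out, because the f_i have to be
   nonconstant. *)
pose S := [set i | (1 < size (D 0%R i))%N].
pose e (j : 'I_#|S|) : 'I_n := enum_val j.
have eS j : (1 < size (D 0%R (e j)))%N by have := enum_valP j; rewrite inE.
pose fs j := (lead_coef (D 0 (e j)))^-1 *: D 0 (e j).
have lc0 j : lead_coef (D 0 (e j)) != 0 by rewrite lead_coef_eq0.
have fsm j : fs j \is monic by rewrite monicE lead_coefZ mulVf.
have fs1 j : (1 < size (fs j))%N by rewrite size_scale ?invr_eq0.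
have mkE j : mk_monic (fs j) = fs j by apply: mk_monicE.
have inqD j p : in_qpoly (fs j) (D 0 (e j) * p) = 0.
  apply: val_inj => /=; rewrite mkE.
  have -> : D 0 (e j) * p = (lead_coef (D 0 (e j)) *: p) * fs j.
    by rewrite /fs -scalerAl -scalerAr scalerA divff // scale1r mulrC.
  by rewrite rmodp_mull.
have inqE j p p' : in_qpoly (fs j) p = in_qpoly (fs j) p' ->
    exists c, p - p' = D 0 (e j) * c.
  move=> /(congr1 val) /=; rewrite mkE => E.
  have := rdivp_eq (fsm j) (p - p'); rewrite rmodpB // E subrr addr0 => ->.
  by exists ((lead_coef (D 0 (e j)))^-1 *: rdivp (p - p') (fs j));
    rewrite /fs -scalerAr -scalerAr mulrC.
pose h x j := in_qpoly (fs j) ((U *m map_mx polyC (cv x)) (e j) 0).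
have hT x j : h (T x) j = in_qpoly (fs j) 'X * h x j.
  rewrite /h -in_qpolyM.
  have -> : U *m map_mx polyC (cv (T x)) =
     'X *: (U *m map_mx polyC (cv x)) - diag_mx D *m (invmx W *m map_mx polyC (cv x)).
    have DW : diag_mx D *m invmx W = U *m A0 by rewrite DE mulmxK.
    rewrite [X in _ - X]mulmxA DW cvT map_mxM -mulmxA /A0 mulmxBl mul_scalar_mx mulmxBr -scalemxAr opprB addrCA subrr addr0.
    by [].
  rewrite subD -mulrN in_qpolyD inqD addr0.
  by congr in_qpoly; rewrite mxE.
exists (\prod_j fs j), #|S|, fs, h; split=> //.
  have hi : injective h.
    move=> x y hxy; apply: cvinj; apply/eqP; rewrite -subr_eq0; apply/eqP.
    have dv i : exists c, (U *m map_mx polyC (cv x - cv y)) i 0 = D 0 i * c.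
      case: (boolP (i \in S)) => iS.
        have ei : e (enum_rank_in iS i) = i by rewrite /e enum_rankK_in.
        have := congr1 (fun g => g (enum_rank_in iS i)) hxy; rewrite /h.
        by move/inqE; rewrite ei map_mxB mulmxBr => -[c Ec]; exists c; rewrite mxE [X in _ + X]mxE.
      have sD : size (D 0 i) == 1%N.
        by move: iS; rewrite inE -leqNgt eqn_leq size_poly_gt0 D0 andbT.
      have /size_poly1P[c c0 ->] := sD.
      by exists (c^-1 *: (U *m map_mx polyC (cv x - cv y)) i 0);
        rewrite -scalerAr mul_polyC scalerA mulVf // scale1r.
    have [z zE] := choice dv.
    have E : U *m map_mx polyC (cv x - cv y) = U *m (A0 *m (W *m \col_i z i)).
      rewrite !mulmxA -DE; apply/matrixP => i j; rewrite ord1 zE mul_diag_mx !mxE.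
      by [].
    by have := can_inj (mulKmx uU) E; apply: const_zero.
  have hs y : exists x, h x = y.
    pose v : 'cV[{poly F}]_n := \col_i (if [pick j | e j == i] is Some j then (y j : {poly F}) else 0).
    have [c [y' zE]] := const_decomp Mx (invmx U *m v).
    have [x xE] := cvsurj c; exists x; apply: functional_extensionality_dep => j.
    have -> : y j = in_qpoly (fs j) (v (e j) 0).
      rewrite mxE; case: pickP => [j'|/(_ j)]; last by rewrite eqxx.
      move=> /eqP/enum_val_inj ->; apply: val_inj => /=.
      by rewrite rmodp_small // size_mk_monic.
    rewrite /h xE.
    have -> : map_mx polyC c = invmx U *m v - A0 *m y' by rewrite zE addrK.
    have DW : U *m A0 = diag_mx D *m invmx W by rewrite DE mulmxK.
    rewrite mulmxBr mulmxA mulmxV // mul1mx mulmxA DW -mulmxA.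
    by rewrite subD -mulrN in_qpolyD inqD addr0.
  have [g gE] := choice hs; exists g => [x|y] //; apply: hi; exact: gE.
move=> c x y j; rewrite /h cvlin map_mxD map_mxZ mulmxDr -scalemxAr.
by rewrite mxE [X in X + _]mxE mul_polyC in_qpolyD in_qpolyZ.
Qed.

(** Existence comes first: without it [module_size] would be the default 0. *)
Lemma module_sizeE : module_size T = fcp M.
Proof.
apply: has_module_size_fcp.
exact: (@xgetPex _ 0 [set f | has_module_size T f] has_module_size_ex).
Qed.

End ModuleSize.

(** * The Euler product as a Fredholm determinant *)

Section Frobenius.
Variable F : finFieldType.
Local Notation q := #|F|.

Lemma q_gt1 : (1 < q)%N. Proof. exact: finNzRing_gt1. Qed.

Section General.
Variables (R : comNzRingType) (f : {rmorphism F -> R}).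

Lemma frobD j (x y : R) : (x + y) ^+ (q ^ j) = x ^+ (q ^ j) + y ^+ (q ^ j).
Proof.
have [p pr pF] := finPcharP F.
have pR : p \in [pchar R] := rmorph_pchar f pF.
apply: exprDn_pchar; rewrite (eq_pnat _ (pcharf_eq pR)) pnatX.
by have := abelem_pgroup (fin_ring_pchar_abelem pF); rewrite /pgroup cardsT => ->.
Qed.

Lemma q_exp_gt0 j : (0 < q ^ j)%N.
Proof. by rewrite expn_gt0 (ltnW q_gt1). Qed.

Lemma frob_sum j (I : Type) (r : seq I) (P : pred I) (x : I -> R) :
  (\sum_(i <- r | P i) x i) ^+ (q ^ j) = \sum_(i <- r | P i) x i ^+ (q ^ j).
Proof.
apply: (big_morph (fun x => x ^+ (q ^ j))); first by move=> *; apply: frobD.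
by rewrite expr0n -[_ == _]negbK -lt0n q_exp_gt0.
Qed.

Lemma frobN j (x : R) : (- x) ^+ (q ^ j) = - x ^+ (q ^ j).
Proof.
apply/eqP; rewrite -addr_eq0 -frobD addNr expr0n.
by rewrite (gtn_eqF (q_exp_gt0 j)).
Qed.

End General.

Lemma expf_cardX (c : F) j : c ^+ (q ^ j) = c.
Proof. by elim: j => [|j IH]; rewrite ?expr1 // expnSr exprM IH expf_card. Qed.

Lemma comp_polyXq (p : {poly F}) j : p \Po 'X^(q ^ j) = p ^+ (q ^ j).
Proof.
rewrite [in RHS](poly_sum_le (leqnn (size p))) (frob_sum polyC) comp_polyE.
by apply: eq_bigr => i _; rewrite exprZn expf_cardX -!exprM mulnC.
Qed.

Lemma frob_map (R : comNzRingType) (f : {rmorphism F -> R}) (p : {poly F}) :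
  frob q (map_poly f p).
Proof. by move=> j; rewrite -[X in _ \Po X](map_polyXn f) -map_comp_poly comp_polyXq rmorphXn. Qed.

End Frobenius.

Section FdetMap.
Variables (R S : comNzRingType) (f : {rmorphism R -> S}).

Lemma fdet_map (T : finType) (M : T -> T -> R) :
  f (fdet M) = fdet (fun a b => f (M a b)).
Proof. by rewrite /fdet -det_map_mx; congr determinant; apply/matrixP => i j; rewrite !mxE. Qed.

Lemma fdetZ (T : finType) (c : R) (M : T -> T -> R) :
  fdet (fun a b => c * M a b) = c ^+ #|T| * fdet M.
Proof. by rewrite /fdet -detZ; congr determinant; apply/matrixP => i j; rewrite !mxE. Qed.

End FdetMap.

Lemma div_scale (K : fieldType) (c x y u v : K) :
  u = c * x -> v = c * y -> c != 0 -> u / v = x / y.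
Proof. by move=> -> -> c0; rewrite -mulf_div divff // mul1r. Qed.

Section QuotientAction.
Variables (F : finFieldType) (b : {poly F}).
Local Notation q := #|F|.
Local Notation W := (powser F).
Local Notation X := (powserX F).
Hypotheses (bm : b \is monic) (b1 : (1 < size b)%N).
Import Pdiv.Ring Pdiv.RingMonic.
Let d := (size b).-1.
Let mkb : mk_monic b = b. Proof. exact: mk_monicE. Qed.

Let qE (p : {poly F}) : Pdiv.CommonRing.rmodp p (mk_monic b) = rmodp p b.
Proof. by rewrite mkb. Qed.

Section Act.
Variables (s : nat) (o : seq (nat * 'M[{poly F}]_s)).

Definition qact (x : {ffun 'I_s -> {poly %/ b}}) : {ffun 'I_s -> {poly %/ b}} :=
  [ffun p => \sum_(y <- o) \sum_j in_qpoly b (y.2 p j) * x j ^+ (q ^ y.1)].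

Definition qco (x : {ffun 'I_s -> {poly %/ b}}) (a : 'I_d * 'I_s) : F :=
  (x a.2)`_a.1.

Lemma coords_qact :
  coords qact qco (fun a c => Nq q b o a.1 c.1 a.2 c.2).
Proof.
split.
- by move=> c x y a; rewrite /qco !ffunE coefD coefZ.
- move=> x y E; apply/ffunP => p; apply/npolyP => j.
  have [lt|le] := ltnP j d; first exact: (E (Ordinal lt, p)).
  by rewrite !big_coef_npoly // mkb.
- move=> f; exists [ffun p => npolyp _ (\poly_(j < d)
     (if insub j is Some j' then f (j', p) else 0))] => -[j p].
  by rewrite /qco ffunE /= coef_npolyp mkb ltn_ord coef_poly ltn_ord valK.
move=> x a; rewrite /qco ffunE poly_of_qpoly_sum coef_sum.
rewrite (sum_pair (fun (l : 'I_d) k => Nq q b o a.1 l a.2 k * (x k)`_l)) /Nq.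
under [RHS]eq_bigr => l _ do under eq_bigr => k _ do rewrite mulr_suml.
rewrite exchange_big /=.
under [RHS]eq_bigr => k _ do rewrite exchange_big /=.
rewrite exchange_big /=; apply: eq_bigr => y _.
rewrite poly_of_qpoly_sum coef_sum; apply: eq_bigr => k _.
rewrite sum_rmodp //; last by apply: leq_trans (size_npoly _) _; rewrite mkb.
rewrite poly_of_qpolyM qE poly_of_qpolyX qE.
have -> : (in_qpoly b (y.2 a.2 k) : {poly F}) = rmodp (y.2 a.2 k) b by exact: qE.
by rewrite rmodp_mulmr // mulrC rmodp_mulmr // mulrC comp_polyXq.
Qed.

End Act.

Local Notation iW := (map_poly (@powserC F)).

(** With w = 1/t one has det(t - M) = t^dim det(1 - w M); the power of t depends only on the
    dimension and cancels in [fcp_div]. *)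
Definition zop s (o : seq (nat * 'M[{poly F}]_s)) : seq (nat * 'M[{poly W}]_s) :=
  [seq (x.1, X%:P *: map_mx iW x.2) | x <- o].

Lemma map_rmodp (p : {poly F}) : iW (rmodp p b) = rmodp (iW p) (iW b).
Proof.
have mb : iW b \is monic by rewrite monic_map.
rewrite [in RHS](rdivp_eq bm p) rmorphD rmorphM rmodp_addl_mul_small //.
by rewrite !size_map_poly ltn_rmodp monic_neq0.
Qed.

Lemma fcp_dq s (o : seq (nat * 'M[{poly F}]_s)) :
  evt 1 (fcp (fun a c : 'I_d * 'I_s => Nq q b o a.1 c.1 a.2 c.2)) =
  wK ^- #|{: 'I_d * 'I_s}| * tofrac (dq q (iW b) (zop o)).
Proof.
rewrite /fcp /dq size_map_poly !fdet_map -exprVn -fdetZ; apply: eq_fdet => a c.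
rewrite rmorphB rmorphM rmorph_nat /= evtX evtC.
rewrite rmorphB rmorph_nat mulrBr expr1 mulrC; congr (_ - _).
suff -> : Nq q (iW b) (zop o) a.1 c.1 a.2 c.2 = X * powserC (Nq q b o a.1 c.1 a.2 c.2).
  by rewrite /= tofracM mulrA -/wK mulVf ?mul1r // wK_neq0.
have mb : iW b \is monic by rewrite monic_map.
rewrite /Nq /zop big_map rmorph_sum mulr_sumr; apply: eq_bigr => y _ /=.
rewrite !mxE -mulrA mul_polyC rmodpZ // coefZ; congr (_ * _).
by rewrite -(map_polyXn (@powserC F)) -rmorphM -map_rmodp coef_map.
Qed.

Lemma fcp_div s (o o' : seq (nat * 'M[{poly F}]_s)) :
  evt 1 (fcp (fun a c : 'I_d * 'I_s => Nq q b o a.1 c.1 a.2 c.2)) /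
  evt 1 (fcp (fun a c : 'I_d * 'I_s => Nq q b o' a.1 c.1 a.2 c.2)) =
  tofrac (dq q (iW b) (zop o)) / tofrac (dq q (iW b) (zop o')).
Proof.
apply: (div_scale (fcp_dq o) (fcp_dq o')).
by rewrite invr_eq0 expf_neq0 // wK_neq0.
Qed.

End QuotientAction.

Section Lvalue.
Variables (F : finFieldType) (G : tmodule F).
Local Notation q := #|F|.
Local Notation W := (powser F).
Local Notation X := (powserX F).
Local Notation iW := (map_poly (@powserC F)).
Local Notation s := (tdim G).
Import Pdiv.Ring Pdiv.RingMonic.
Let A k : 'M[{poly W}]_s := map_mx iW (tcoef G)`_k.

(** (t - A_0)^(-1) (A_1 tau + A_2 tau^2 + ...) with w = 1/t. The geometric series is cut after N
    terms so that the coefficients remain polynomials in theta. *)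
Definition LopN (N : nat) : seq (nat * 'M[{poly W}]_s) :=
  [seq (k, \sum_(i < N) (X ^+ i.+1)%:P *: (A 0 ^+ i *m A k))
  | k <- iota 1 (size (tcoef G)).-1].

Lemma posj_LopN N : posj (LopN N).
Proof. by apply/allP => x /mapP[k]; rewrite mem_iota => /andP[k0 _] ->. Qed.

Let oL : seq (nat * 'M[{poly W}]_s) := [:: (0%N, X%:P *: A 0)].
Let oP : seq (nat * 'M[{poly W}]_s) :=
  oL ++ [seq (k, X%:P *: A k) | k <- iota 1 (size (tcoef G)).-1].

(** (1 - w A_0)(1 - [LopN]) telescopes to 1 - w A_0 - w (A_1 tau + ...). The first factor is the
    determinant of the Lie module and the right-hand side that of the points, so 1 - [LopN] inverts
    the Euler factor modulo w^N. *)
Lemma dq_LopN b N : b \is monic ->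
  cl X N (dq q (iW b) oL * dq q (iW b) (LopN N)) (dq q (iW b) oP).
Proof.
move=> bm; have mb : iW b \is monic by rewrite monic_map.
rewrite (dqM (q_gt1 F)) //; last exact: frob_map.
have -> : opN (comp q oL (LopN N)) =
    [seq (x.1, - (X%:P *: A 0 *m map_mx (comp_poly 'X) x.2)) | x <- LopN N].
  rewrite /opN /comp /= cats0 -map_comp; apply: eq_map => x /=.
  by rewrite expn0 expr1.
apply: cl_fdet => a c; apply: clB; first exact: cl_refl.
have NqC (o o' : seq (nat * 'M[{poly W}]_s)) m i p p' :
    Nq q (iW b) (o ++ o') m i p p' = Nq q (iW b) o m i p p' + Nq q (iW b) o' m i p p'.
  by rewrite /Nq big_cat.
rewrite /oP !NqC; apply: clD; first exact: cl_refl.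
rewrite /Nq /LopN -map_comp !big_map -big_split /=; apply: cl_sum => k _.
have := A 0 ^+ N *m A k.
have E : (\sum_(i < N) (X ^+ i.+1)%:P *: (A 0 ^+ i *m A k))
   - X%:P *: A 0 *m map_mx (comp_poly 'X) (\sum_(i < N) (X ^+ i.+1)%:P *: (A 0 ^+ i *m A k))
   = X%:P *: A k - (X ^+ N.+1)%:P *: (A 0 ^+ N *m A k).
  have -> (H : 'M[{poly W}]_s) : map_mx (comp_poly 'X) H = H.
    by apply/matrixP => i j; rewrite mxE comp_polyXr.
  elim: N => [|n IH].
    by rewrite big_ord0 mulmx0 subrr expr0 mul1mx subrr.
  rewrite big_ord_recr /= mulmxDr opprD addrACA IH.
  rewrite -scalemxAl -scalemxAr scalerA mulmxA -[A 0 *m _]exprS -polyCM -exprS.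
  by rewrite addrA subrK.
move: E; set S := \sum_(i < N) _; set Tm := _ *m map_mx _ _; move: (A 0 ^+ N *m _) => B0 E _.
have Ep : S a.2 c.2 + (- Tm) a.2 c.2 =
    (X%:P *: A k) a.2 c.2 - (X ^+ N)%:P * (X%:P * B0 a.2 c.2).
  have := congr1 (fun H : 'M_s => H a.2 c.2) E; rewrite [LHS]mxE => ->.
  by rewrite mxE; congr (_ + _); rewrite !mxE exprSr polyCM mulrA.
move: Ep; move: (X%:P * B0 _ _) => Y Ep.
rewrite -coefD -rmodpD // -mulrDl Ep mulrBl rmodpB // coefB -mulrA mul_polyC rmodpZ // coefZ.
by eexists; rewrite addrC addKr -mulrN.
Qed.

Let unit_dq (o : seq (nat * 'M[{poly W}]_s)) b : b \is monic ->
  (forall x, x \in o -> exists H, x.2 = X%:P *: H) ->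
  cl X 1 (dq q (iW b) o) 1.
Proof.
move=> bm oX; have mb : iW b \is monic by rewrite monic_map.
rewrite -(fdet1 _ ('I_(size (iW b)).-1 * 'I_s)%type); apply: cl_fdet => a c.
rewrite -[X in cl _ _ _ X]subr0; apply: clB; first exact: cl_refl.
have E0 : \sum_(x <- o | x \in o) 0 = 0 :> W by rewrite big1.
rewrite /Nq big_seq -[X in cl _ _ _ X]E0; apply: cl_sum => x /oX[H ->].
by rewrite mxE -mulrA mul_polyC rmodpZ // coefZ; eexists; rewrite subr0 expr1.
Qed.

Lemma LopN_X N x : x \in LopN N -> exists H, x.2 = X%:P *: H.
Proof.
move=> /mapP[k _ ->] /=; exists (\sum_(i < N) (X ^+ i)%:P *: (A 0 ^+ i *m A k)).
rewrite scaler_sumr; apply: eq_bigr => i _.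
by rewrite scalerA -polyCM -exprS.
Qed.

Lemma cl1_neq0 (x : W) : cl X 1 x 1 -> x 0%N != 0.
Proof. by move/powser_clP/(_ 0%N isT) => ->; rewrite oner_eq0. Qed.

Lemma euler_factorE b : monic_irreducible b ->
  euler_factor G b = tofrac (dq q (iW b) oL) / tofrac (dq q (iW b) oP).
Proof.
move=> [bm birr]; have b1 : (1 < size b)%N by case: birr.
pose oT := [seq (k, (tcoef G)`_k) | k <- iota 0 (size (tcoef G))].
have LE : @Lie_act F G b = @qact F b s [:: (0%N, (tcoef G)`_0)].
  apply/funext => x; apply/ffunP => p; rewrite !ffunE big_seq1.
  by apply: eq_bigr => j _; rewrite expn0 expr1.
have PE : @pts_act F G b = @qact F b s oT.
  apply/funext => x; apply/ffunP => p; rewrite !ffunE big_map.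
  rewrite -(big_mkord xpredT (fun k => \sum_j in_qpoly b ((tcoef G)`_k p j) * x j ^+ (q ^ k))).
  by rewrite /index_iota subn0.
rewrite /euler_factor !A_to_KinfE LE PE.
rewrite (module_sizeE (coords_qact bm b1 [:: (0%N, (tcoef G)`_0)])).
rewrite (module_sizeE (coords_qact bm b1 oT)).
rewrite (fcp_div bm [:: (0%N, (tcoef G)`_0)] oT).
suff E2 : dq q (iW b) (zop oT) = dq q (iW b) oP by rewrite E2.
apply: eq_fdet => a c; congr (_ - _); rewrite /zop /oT /oP /oL -map_comp.
have [E|nz] := eqVneq (size (tcoef G)) 0%N.
  have A00 : A 0 = 0.
    by apply/matrixP => i j; rewrite /A nth_default ?E // !mxE rmorph0.
  by rewrite E /= /Nq big_nil big_seq1 /= A00 scaler0 mxE mul0r rmod0p coef0.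
have -> : iota 0 (size (tcoef G)) = 0%N :: iota 1 (size (tcoef G)).-1.
  by case: (size _) nz.
by [].
Qed.

Lemma vge0_of (n : nat) (x : Kinf F) : vge n (x - 1) -> vge 0 x.
Proof.
move=> v; rewrite -(subrK 1 x); apply: vgeD; first by apply: vge_weak v.
by rewrite -tofrac1; apply: vge_tofrac.
Qed.

Lemma vge1M (n : nat) (x y : Kinf F) :
  vge n (x - 1) -> vge n (y - 1) -> vge n (x * y - 1).
Proof.
move=> vx vy; have -> : x * y - 1 = x * (y - 1) + (x - 1) by ring.
by apply: vgeD => //; rewrite -[n%:Z]add0r; apply: vgeM => //; apply: vge0_of vx.
Qed.

Lemma vge_div_close (N : nat) (l p d : W) : p 0%N != 0 -> cl X N (l * d) p ->
  vge 0 (tofrac l / tofrac p) /\ vge N (tofrac l / tofrac p * tofrac d - 1).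
Proof.
move=> P1 E; have [t tE] := vge_inv_tofrac P1.
split; first by rewrite tE -tofracM; apply: vge_tofrac.
have P0 : tofrac p != 0.
  by rewrite tofrac_eq0; apply: contraNneq P1 => ->; rewrite powser0E.
have -> : tofrac l / tofrac p * tofrac d - 1 = (tofrac l * tofrac d - tofrac p) / tofrac p.
  by rewrite mulrBl divff // mulrAC.
rewrite -tofracM tE -[N%:Z]addr0.
by apply: vgeM; [exact: cl_vge|exact: vge_tofrac].
Qed.

Lemma euler_dq b (N : nat) : monic_irreducible b ->
  vge 0 (euler_factor G b) /\
  vge N (euler_factor G b * tofrac (dq q (iW b) (LopN N)) - 1).
Proof.
move=> bi; rewrite euler_factorE //; have [bm _] := bi.
have P1 : (dq q (iW b) oP) 0%N != 0.
  apply: cl1_neq0; apply: unit_dq => // x; rewrite mem_cat inE.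
  case/orP=> [/eqP->|/mapP[k _ ->]] /=; by eexists.
apply: vge_div_close P1 _; exact: dq_LopN.
Qed.

Lemma irr_factor (f : {poly F}) : (1 < size f)%N ->
  exists2 b, monic_irreducible b & b %| f.
Proof.
move=> f1; have f0 : f != 0 by rewrite -size_poly_gt0 ltnW.
pose P m := `[< exists2 b : {poly F}, b %| f & size b = m /\ (1 < m)%N >].
have exP : exists m, P m by exists (size f); apply/asboolP; exists f.
have [m /asboolP[b bf [sb m1]] minm] := ex_minnP exP.
have b0 : b != 0 by rewrite -size_poly_gt0 sb ltnW.
have l0 : lead_coef b != 0 by rewrite lead_coef_eq0.
have eqb : (lead_coef b)^-1 *: b %= b by rewrite eqp_scale // invr_eq0.
exists ((lead_coef b)^-1 *: b); last by rewrite (eqp_dvdl _ eqb).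
split; first by rewrite monicE lead_coefZ mulVf.
split; first by rewrite size_scale ?invr_eq0 // sb.
move=> g sg gb; have gb' : g %| b by rewrite -(eqp_dvdr _ eqb).
have g0 : g != 0 by apply: contraTneq gb' => ->; rewrite dvd0p.
have g1 : (1 < size g)%N by rewrite ltn_neqAle eq_sym sg size_poly_gt0.
apply: (@eqp_trans _ b); last by rewrite eqp_sym.
rewrite -(dvdp_size_eqp gb') eqn_leq dvdp_leq //= sb; apply: minm.
by apply/asboolP; exists g => //; apply: dvdp_trans gb' bf.
Qed.

(** One irreducible factor is removed at a time; the number of factors is below size f, which serves
    as exponent. *)
Lemma dvd_rad (S : seq {poly F}) (f : {poly F}) : f != 0 ->
  (forall b, monic_irreducible b -> b %| f -> b \in S) ->
  f %| (\prod_(b <- S) b) ^+ (size f).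
Proof.
have [n] := ubnP (size f); elim: n f => // n IH f; rewrite ltnS => fn f0 fS.
have [f1|f1] := leqP (size f) 1.
  have /eqP : size f = 1%N by apply/eqP; rewrite eqn_leq f1 size_poly_gt0.
  by rewrite size_poly_eq1 => /eqp_dvdl ->; rewrite dvd1p.
have [b bi bf] := irr_factor f1; have [bm [b1 _]] := bi.
have fE := divpK bf; set g := f %/ b in fE.
have g0 : g != 0 by apply: contraNneq f0 => g0; rewrite -fE g0 mul0r.
have sg : (size f = size g + (size b).-1)%N.
  by rewrite -fE size_Mmonic //; case: (size b) b1 => // m _; rewrite addnS.
have lgf : (size g < size f)%N.
  by rewrite sg; case: (size b) b1 => // -[] // m _; rewrite addnS ltnS leq_addr.
have gf : g %| f by rewrite -fE dvdp_mulr.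
have h2 : g %| (\prod_(b <- S) b) ^+ (size g).
  apply: IH => //; first exact: leq_trans lgf fn.
  by move=> e ei eg; apply: fS => //; apply: dvdp_trans eg gf.
have hb : b %| \prod_(b <- S) b by rewrite (big_rem b) ?fS //= dvdp_mulr.
apply: (@dvdp_trans _ ((\prod_(b0 <- S) b0) ^+ (size g).+1)).
  by rewrite -fE exprSr dvdp_mul.
exact: dvdp_exp2l.
Qed.

Lemma irr_cop (b e : {poly F}) : monic_irreducible b -> monic_irreducible e ->
  b != e -> cop (iW b) (iW e).
Proof.
move=> [bm [_ birr]] [em [_ eirr]] be.
have /Bezout_eq1_coprimepP[[u v] /= uv] : coprimep e b.
  rewrite coprimep_def; apply: contraNT be => sg.
  have gb := birr _ sg (dvdp_gcdr e b); have ge := eirr _ sg (dvdp_gcdl e b).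
  rewrite -eqp_monic //; apply: eqp_trans ge.
  by rewrite eqp_sym.
by exists (iW u), (iW v); rewrite -!rmorphM -rmorphD /= uv rmorph1.
Qed.

(** After conjugation by a polynomial D made of the primes in S and divisible enough, [detop_small]
    gives determinant 1 modulo w^N. By [detop_prod] this determinant is that of 1 - [LopN] times the
    local ones, and the latter invert the Euler factors by [euler_dq]. *)
Lemma Lprod (N : nat) : exists d, forall S : seq {poly F}, uniq S ->
  (forall b, b \in S -> monic_irreducible b) ->
  (forall b, monic_irreducible b -> (size b <= d)%N -> b \in S) ->
  vge N (\prod_(b <- S) euler_factor G b - tofrac (detop q (LopN N))).
Proof.
pose J := size (tcoef G).
(* J exceeds every power of tau, and P0 contains X^(q^j) - X for all 0 < j <= N J. Taking d to be
   the size of P0^N puts all prime divisors of P0^N into S. *)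
pose P0 : {poly F} := \prod_(1 <= j < (N * J).+1) ('X^(q ^ j) - 'X).
have P00 : P0 != 0.
  rewrite /P0 big_nat_cond prodf_seq_neq0; apply/allP => j _; apply/implyP.
  rewrite andbT => /andP[j0 _]; rewrite subr_eq0; apply/eqP => E.
  have := congr1 (fun p : {poly F} => size p) E; rewrite size_polyXn size_polyX => -[] E1.
  by have := ltn_expl j (q_gt1 F); rewrite E1 ltnNge j0.
pose f := P0 ^+ N; have f0 : f != 0 by rewrite expf_neq0.
exists (size f) => S uS Sirr Sd.
have fS : f %| (\prod_(b <- S) b) ^+ (size f).
  apply: dvd_rad => // b bi bf; apply: Sd => //; exact: dvdp_leq.
pose l := flatten (nseq (size f) S).
have lS b : b \in l = (b \in S).
  rewrite /l; have : (0 < size f)%N by rewrite size_poly_gt0.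
  case: (size f) => // n _ /=; rewrite mem_cat; case: (boolP (b \in S)) => //= bS.
  by elim: n => //= n IH; rewrite mem_cat (negPf bS).
have prl : \prod_(b <- l) b = (\prod_(b <- S) b) ^+ (size f).
  rewrite /l; elim: (size f) => [|n IH] /=; first by rewrite big_nil.
  by rewrite big_cat IH exprS.
pose D : {poly W} := \prod_(b <- map iW l) b.
have DE : D = iW ((\prod_(b <- S) b) ^+ (size f)).
  by rewrite /D big_map -prl rmorph_prod.
have iWI : injective iW.
  apply: map_inj_poly; last exact: rmorph0.
  by move=> a c /(congr1 (fun x : W => x 0%N)) E; exact: E.
have C2 : detop q (opD q D (LopN N)) =
    detop q (LopN N) * \prod_(b <- S) dq q (iW b) (LopN N).
  rewrite /D detop_prod; first last.
  - move=> _ _ /mapP[b bl ->] /mapP[e el ->] be; apply: irr_cop.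
    + by apply: Sirr; rewrite -lS.
    + by apply: Sirr; rewrite -lS.
    + by apply: contraNneq be => ->.
  - move=> _ /mapP[b bl ->]; have [bm [b1 _]] : monic_irreducible b by apply: Sirr; rewrite -lS.
    by split; [rewrite monic_map|rewrite size_map_poly|exact: frob_map].
  - exact: posj_LopN.
  - exact: q_gt1.
  congr (_ * _); rewrite undup_map_inj // big_map; apply: perm_big.
  by apply: uniq_perm; rewrite ?undup_uniq // => b; rewrite mem_undup lS.
have C1 : cl X N (detop q (opD q D (LopN N))) 1.
  (* Parameters m = 1 and K = N: the factor w in front of [LopN] gives v = 1, and one factor D of
     D^(q^j - 1) supplies P0^N. *)
  apply: (@detop_small _ _ _ (q_gt1 F) _ N J (iW P0) _ 1 N) => //.
    move=> j /andP[j0 jN].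
    exists (iW (\prod_(1 <= i < (N * J).+1 | i != j) ('X^(q ^ i) - 'X))).
    rewrite /P0 (bigD1_seq j) ?iota_uniq ?mem_index_iota ?j0 //= rmorphM rmorphB /=.
    by rewrite map_polyXn map_polyX.
  move=> x /mapP[y yo ->] /=; have [H HE] := LopN_X yo.
  have /mapP[k] := yo; rewrite mem_iota => /andP[k0 kJ] yE.
  have y1 : y.1 = k by rewrite yE.
  have [c cE] : exists c, D = c * iW P0 ^+ N.
    by rewrite DE -(divpK fS) rmorphM /= [iW f]rmorphXn; eexists.
  exists 1%N, (c *: (D ^+ (q ^ y.1 - 2) *: H)); split=> //.
    by rewrite y1 k0 mul1n; move: kJ; rewrite /J; lia.
  have q2 : (q ^ y.1 - 1 = (q ^ y.1 - 2).+1)%N.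
    have : (1 < q ^ y.1)%N.
      by apply: leq_trans (q_gt1 F) _; rewrite -{1}(expn1 q) leq_exp2l ?q_gt1 // y1.
    by lia.
  rewrite HE q2 exprS {1}cE expr1 -mul_polyC !scalerA; congr (_ *: _); ring.
have EQ : vge N (\prod_(b <- S) euler_factor G b
    * tofrac (\prod_(b <- S) dq q (iW b) (LopN N)) - 1) /\
    vge 0 (\prod_(b <- S) euler_factor G b).
  rewrite rmorph_prod -big_split /= big_seq [X in _ /\ vge _ X]big_seq.
  split.
    apply: (big_ind (fun x : Kinf F => vge N (x - 1))); first by rewrite subrr; apply: vge00.
      by move=> x y; apply: vge1M.
    by move=> b /Sirr bi; case: (euler_dq N bi).
  apply: (big_ind (vge 0)); first by rewrite -tofrac1; apply: vge_tofrac.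
    by move=> x y vx vy; rewrite -[0%R]addr0; apply: vgeM.
  by move=> b /Sirr bi; case: (euler_dq N bi).
have TQ : vge N (tofrac (detop q (LopN N)) *
    tofrac (\prod_(b <- S) dq q (iW b) (LopN N)) - 1).
  by rewrite -tofracM -C2 -tofrac1; apply: cl_vge.
case: EQ => EQ E0.
move: (tofrac (\prod_(b <- S) _)) EQ TQ => Q EQ TQ.
move: (\prod_(b <- S) euler_factor G b) EQ E0 => E EQ E0.
move: (vge_tofrac (detop q (LopN N))) TQ; move: (tofrac _) => T T0 TQ.
have -> : E - T = T * (E * Q - 1) - E * (T * Q - 1) by ring.
by apply: vgeB; rewrite -[N%:Z]add0r; apply: vgeM.
Qed.

Lemma cl_LopN N M : (N <= M)%N ->
  cl X N (detop q (LopN M)) (detop q (LopN N)).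
Proof.
move=> NM; apply: cl_detop; try exact: posj_LopN; first exact: q_gt1.
move=> m i p p'; rewrite /Mop /LopN !big_map; apply: cl_sum => k _ /=.
rewrite -(big_mkord xpredT (fun i => (X ^+ i.+1)%:P *: (A 0 ^+ i *m A k))).
rewrite (@big_cat_nat _ _ _ N) //= big_mkord mxE mulrDr kapD ?q_exp_gt0 // coefD.
rewrite -[X in cl _ _ _ X]addr0; apply: clD; first exact: cl_refl.
have [H ->] : exists H, \sum_(N <= i < M) (X ^+ i.+1)%:P *: (A 0 ^+ i *m A k)
    = (X ^+ N)%:P *: H.
  exists (\sum_(N <= i < M) (X ^+ (i.+1 - N))%:P *: (A 0 ^+ i *m A k)).
  rewrite scaler_sumr big_nat [RHS]big_nat; apply: eq_bigr => j /andP[Nj _].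
  by rewrite scalerA -polyCM -exprD subnKC // leqW.
rewrite mxE mul_polyC -scalerAr kapZ ?q_exp_gt0 // coefZ.
by eexists; rewrite subr0.
Qed.

Lemma irr_list d : exists S : seq {poly F}, [/\ uniq S,
  forall b, b \in S -> monic_irreducible b &
  forall b, monic_irreducible b -> (size b <= d)%N -> b \in S].
Proof.
exists [seq p <- [seq val x | x : {poly_d F}] | `[< monic_irreducible p >]]; split.
- by rewrite filter_uniq // map_inj_uniq ?enum_uniq //; exact: val_inj.
- by move=> b; rewrite mem_filter => /andP[/asboolP].
- move=> b bi sb; rewrite mem_filter; apply/andP; split; first exact/asboolP.
  by apply/mapP; exists (NPoly sb) => //; rewrite mem_enum.
Qed.

(** The truncations agree modulo growing powers of w, so coefficient n is taken from the truncation
    n + 1. Any two limits are compared on a finite list of all primes of bounded degree, which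
    identifies the value chosen by [xget]. *)
Theorem Lvalue_detop : exists l : W, [/\ Lvalue G = tofrac l, l 0%N = 1 &
  forall N, cl X N l (detop q (LopN N))].
Proof.
pose l : W := PowSer (fun n => detop q (LopN n.+1) n).
have lN N : cl X N l (detop q (LopN N)).
  apply/powser_clP => i iN; rewrite /l /=.
  by have /powser_clP/(_ i (ltnSn i)) := cl_LopN iN.
exists l; split=> //; last first.
  have /powser_clP/(_ 0%N isT) -> := lN 1%N.
  have /powser_clP/(_ 0%N isT) -> // : cl X 1 (detop q (LopN 1)) 1.
  rewrite -(detop_nil _ q s); apply: cl_detop => //; [exact: q_gt1|exact: posj_LopN|].
  move=> m i p p'; have E0 : \sum_(x <- LopN 1 | x \in LopN 1) 0 = 0 :> W by rewrite big1.
  rewrite {2}/Mop big_nil /Mop big_seq -[X in cl _ _ _ X]E0; apply: cl_sum => x /LopN_X[H ->].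
  rewrite mxE mul_polyC -scalerAr kapZ ?q_exp_gt0 // coefZ.
  by eexists; rewrite subr0 expr1.
have lL : is_Lvalue G (tofrac l).
  move=> N; have [d dP] := Lprod N; exists d => S uS Sirr Sd.
  apply/Kinf_closeE; rewrite -(subrK (tofrac (detop q (LopN N))) (\prod_(b <- S) _)) -addrA.
  apply: vgeD; first exact: dP.
  by apply: cl_vge; apply: cl_sym.
have := @xgetPex _ 0 [set l | is_Lvalue G l] (ex_intro _ _ lL); rewrite -/(Lvalue G) => LL.
apply/eqP; rewrite -subr_eq0; apply/eqP; apply: vge_all => N.
have [d1 P1] := LL N; have [d2 P2] := lL N.
have [S [uS Sirr Sd]] := irr_list (d1 + d2).
have /Kinf_closeE v1 : Kinf_close N (\prod_(b <- S) euler_factor G b) (Lvalue G).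
  by apply: P1 => // b bi sb; apply: Sd => //; apply: leq_trans sb (leq_addr _ _).
have /Kinf_closeE v2 : Kinf_close N (\prod_(b <- S) euler_factor G b) (tofrac l).
  by apply: P2 => // b bi sb; apply: Sd => //; apply: leq_trans sb (leq_addl _ _).
have := vgeB v2 v1; set x := \prod_(b <- S) _.
by have -> : x - tofrac l - (x - Lvalue G) = Lvalue G - tofrac l by ring.
Qed.

End Lvalue.

(** * Algebraicity over K *)

Lemma common_den (R : idomainType) (I : finType) (f : I -> {fraction R}) :
  exists2 d : R, d != 0 & forall i, exists a, tofrac d * f i = tofrac a.
Proof.
have [g gE] := choice (fun i => frac_ex (f i)).
exists (\prod_i (g i).2) => [|i].
  by rewrite prodf_seq_neq0; apply/allP => i _; apply/implyP => _; case: (gE i).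
have [d0 ->] := gE i.
exists ((\prod_(j | j != i) (g j).2) * (g i).1).
rewrite (bigD1 i) //= !tofracM mulrA mulrC !mulrA mulVf ?tofrac_eq0 // mul1r.
by rewrite mulrC.
Qed.

Section AlgebraicReduction.
Variables (F : finFieldType) (R : realType) (C : Cinfty F R).
Local Notation k := {fraction {poly F}}.

(** Algebraicity is transitive and descends along the embedding of K_infty into C; clearing
    denominators gives polynomial coefficients. From here on everything takes place in K_infty. *)
Lemma algebraic_Kinf (x : Kinf F) :
  algebraic_over (Kbar C) (Kinf_to_Cinf C x) ->
  exists P : {poly {poly F}}, P != 0 /\ root (map_poly (evt 1) P) x.
Proof.
have fin (p : {poly F}) : p != 0 -> evt 1 p != 0 by exact: evt_eq0.
pose kK : {rmorphism k -> Kinf F} := flift fin.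
pose i : {rmorphism Kinf F -> C} := alg_to_Cinf C \o Kinf_to_alg C.
pose kc : {rmorphism k -> C} := i \o kK.
have KE z : K_in_Cinf C z -> exists y, z = kc y.
  move=> [a [b [b0 ->]]]; exists (tofrac a / tofrac b).
  by rewrite /kc /kK /= fliftE // !A_to_KinfE.
have lift_poly (p : {poly C}) : (forall j, K_in_Cinf C p`_j) -> exists p0, p = map_poly kc p0.
  move=> h; have [f fE] := choice (fun j => KE _ (h j)).
  exists (\poly_(j < size p) f j); apply/polyP => j; rewrite coef_map coef_poly.
  case: ltnP => [_|le]; first exact: fE.
  by rewrite nth_default //; symmetry; exact: (rmorph0 kc).
have KbE z : Kbar C z -> algebraicOver kc z.
  move=> [p [p0 pK rp]]; have [p1 E] := lift_poly p pK.
  exists p1; last by rewrite -E.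
  by apply: contraNneq p0 => p10; rewrite E p10 rmorph0.
move=> [p [p0 pK rp]].
have /integral_algebraic [p1 p10 rp1] : integralOver kc (i x).
  apply: (integral_root p0 rp) => z /(nthP 0)[j jp <-].
  exact/integral_algebraic/KbE/pK.
have rK : root (map_poly kK p1) x.
  by rewrite -(fmorph_root i) -map_poly_comp.
have [d d0 /choice[a aE]] := common_den (fun j : 'I_(size p1) => p1`_j).
pose P : {poly {poly F}} := \poly_(j < size p1) (if insub j is Some j' then a j' else 0).
have PE : map_poly (evt 1) P = evt 1 d *: map_poly kK p1.
  apply/polyP => j; rewrite coefZ !coef_map coef_poly; case: ltnP => [lt|le].
    by rewrite insubT /= -(flift_tofrac fin d) -(flift_tofrac fin (a _)) -aE rmorphM.
  have E0 : kK p1`_j = 0 by rewrite (_ : p1`_j = 0) ?nth_default //; exact: (rmorph0 kK).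
  symmetry; transitivity (evt 1 d * 0); first by congr (_ * _); exact: E0.
  by rewrite mulr0; symmetry; exact: (rmorph0 (@evt F 1)).
exists P; split; last by rewrite PE rootZ // fin.
apply: contraNneq p10 => P0; rewrite -(map_poly_eq0 kK).
have /eqP : map_poly (evt 1) P = 0 by rewrite P0 rmorph0.
by rewrite PE scaler_eq0 (negPf (fin _ d0)).
Qed.

End AlgebraicReduction.

(** * Evaluation of power series over F(t) *)

Section Series.
Variable F : fieldType.
Local Notation K := (Kinf F).
Implicit Types (u v : nat -> K) (x y : K).

Definition serK u x := cvgK (fun M => \sum_(m < M) u m) x.

Lemma cvgK_close u v x : cvgK u x ->
  (forall n : nat, exists M0 : nat, forall m, (M0 <= m)%N -> vge n (v m - u m)) ->
  cvgK v x.
Proof.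
move=> ux vu n; have [M1 h1] := ux n; have [M2 h2] := vu n.
exists (M1 + M2)%N => m le; rewrite -(subrK (u m) (v m)) -addrA; apply: vgeD.
  by apply: h2; apply: leq_trans le; rewrite leq_addl.
by apply: h1; apply: leq_trans le; rewrite leq_addr.
Qed.

Lemma cvgK_comp u x (c : nat -> nat) : cvgK u x ->
  (forall A, exists B, forall m, (B <= m)%N -> (A <= c m)%N) -> cvgK (u \o c) x.
Proof.
move=> ux cc n; have [M h] := ux n; have [B hB] := cc M.
by exists B => m /hB; apply: h.
Qed.

Lemma cvgKX u x n : cvgK u x -> cvgK (fun m => u m ^+ n) (x ^+ n).
Proof.
move=> ux; elim: n => [|n IH].
  by under eq_fun do rewrite expr0; apply: cvgK_cst.
by rewrite exprS; under eq_fun do rewrite exprS; apply: cvgKM.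
Qed.

Lemma serK_term u x : serK u x ->
  forall n : nat, exists M0 : nat, forall m, (M0 <= m)%N -> vge n (u m).
Proof.
move=> ux n; have [M h] := ux n; exists M => m le.
have := vgeB (h _ (leqW le)) (h _ le); rewrite big_ord_recr /=.
set a := \sum_(_ < _) _; by have -> : a + u m - x - (a - x) = u m by ring.
Qed.

Lemma serK_ex u :
  (forall n : nat, exists M0 : nat, forall m, (M0 <= m)%N -> vge n (u m)) ->
  exists x, serK u x.
Proof.
move=> u0; apply: cvgK_complete => n; have [M h] := u0 n; exists M => m le.
by rewrite big_ord_recr /= addrAC subrr add0r; apply: h.
Qed.

Lemma serK_bd u x : serK u x -> exists B : nat, forall m, vge (- B%:Z) (u m).
Proof.
move=> /serK_term/(_ 0%N)[M h].
suff [B hB] : exists B : nat, forall m, (m < M)%N -> vge (- B%:Z) (u m).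
  exists B => m; have [|le] := ltnP m M; first exact: hB.
  by apply: vge_weak (h m le); lia.
move: {h}(M) => n; elim: n => [|n [B hB]]; first by exists 0%N.
have [b vb] := vge_ex (u n); exists (B + `|b|)%N => m; rewrite ltnS leq_eqVlt.
case/orP=> [/eqP->|/hB v]; last by apply: vge_weak v; lia.
by apply: vge_weak vb; lia.
Qed.

Lemma sum_triangle u v M :
  \sum_(n < M) \sum_(i < n.+1) u i * v (n - i)%N =
  \sum_(i < M) \sum_(j < M - i) u i * v j.
Proof.
elim: M => [|M IH]; first by rewrite !big_ord0.
rewrite big_ord_recr /= IH [RHS]big_ord_recr /= subSnn big_ord1 /=.
rewrite [X in _ + X]big_ord_recr /= subnn addrA; congr (_ + _).
rewrite -big_split /=; apply: eq_bigr => i _.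
by rewrite subSn ?(ltnW (ltn_ord i)) // big_ord_recr.
Qed.

(** Terms are bounded and tend to 0; each product outside the triangle has a large index in one of
    the two factors. *)
Lemma serKM u v x y : serK u x -> serK v y ->
  serK (fun n => \sum_(i < n.+1) u i * v (n - i)%N) (x * y).
Proof.
move=> ux vy; apply: cvgK_close (cvgKM ux vy) _ => n.
have [Bu bu] := serK_bd ux; have [Bv bv] := serK_bd vy.
have [Mu hu] := serK_term ux (n + Bv); have [Mv hv] := serK_term vy (n + Bu).
exists (Mu + Mv)%N => M le; rewrite sum_triangle -opprB; apply: vgeN.
rewrite big_distrlr /= -sumrB; apply: vge_sum => i _.
have E : \sum_(j < M) u i * v j = \sum_(j < M - i) u i * v j + \sum_(M - i <= j < M) u i * v j.
  rewrite -(big_mkord xpredT (fun j => u i * v j)) (@big_cat_nat _ _ _ (M - i)) ?leq_subr //=.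
  by rewrite big_mkord.
rewrite E addrC addKr big_nat; apply: vge_sum => j /andP[jl jM].
have [le1|lt1] := leqP Mu i.
  by apply: vge_weak (vgeM (hu _ le1) (bv j)); lia.
by apply: vge_weak (vgeM (bu i) (hv j _)); lia.
Qed.

End Series.

Section PowserExtra.
Variable k : fieldType.
Local Notation S := (powser k).

Lemma powserM_poly (f g : S) n (p p' : {poly k}) :
  (forall i, (i <= n)%N -> f i = p`_i) -> (forall i, (i <= n)%N -> g i = p'`_i) ->
  (f * g) n = (p * p')`_n.
Proof.
move=> fp gp; rewrite powserME coefM; apply: eq_bigr => i _.
by rewrite fp ?gp ?leq_subr // -ltnS.
Qed.

(* f(u^b), with the convention b = 1 when b = 0 *)
Definition fpow (b : nat) (f : S) : S :=
  PowSer (fun n => if (b.-1.+1 %| n)%N then f (n %/ b.-1.+1)%N else 0).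

Lemma fpowE b f n : (0 < b)%N ->
  fpow b f n = if (b %| n)%N then f (n %/ b)%N else 0.
Proof. by case: b. Qed.

Lemma fpow_is_zmod_morphism b : zmod_morphism (fpow b).
Proof.
by move=> f g; apply: powserP => n; rewrite powserBE /=; case: ifP => _; rewrite ?subr0.
Qed.

Lemma fpow_is_monoid_morphism b : monoid_morphism (fpow b).
Proof.
split.
  apply: powserP => n; rewrite [LHS]/= !powser1E; case: ifP => [/dvdnP[m ->]|].
    by rewrite mulnK // muln_eq0 orbF.
  by case: n => [|n] //; rewrite dvdn0.
move=> f g; apply: powserP => n; pose t (h : S) := \poly_(i < n.+1) h i.
have tE (h : S) i : (i <= n)%N -> (fpow b h) i = (t h \Po 'X^(b.-1.+1))`_i.
  move=> lin; rewrite coef_comp_poly_Xn //= coef_poly; case: ifP => // _.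
  by rewrite ltnS (leq_trans (leq_div _ _) lin).
rewrite (@powserM_poly _ _ n (t f \Po 'X^(b.-1.+1)) (t g \Po 'X^(b.-1.+1))); try exact: tE.
rewrite -comp_polyM coef_comp_poly_Xn // [LHS]/=; case: ifP => // _.
by apply: powserM_poly => i le; rewrite coef_poly ltnS (leq_trans le) ?leq_div.
Qed.

HB.instance Definition _ b := GRing.isZmodMorphism.Build S S (fpow b) (fpow_is_zmod_morphism b).
HB.instance Definition _ b := GRing.isMonoidMorphism.Build S S (fpow b) (fpow_is_monoid_morphism b).

Lemma fpow1 f : fpow 1 f = f.
Proof. by apply: powserP => n; rewrite fpowE // dvd1n divn1. Qed.

Lemma fpow_comp a b f : (0 < a)%N -> (0 < b)%N -> fpow a (fpow b f) = fpow (a * b) f.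
Proof.
move=> a0 b0; apply: powserP => n; rewrite !fpowE ?muln_gt0 ?a0 //.
have [/dvdnP[m ->]|na] := boolP (a %| n)%N.
  by rewrite mulnK // [(m * a)%N]mulnC dvdn_pmul2l // divnMl.
by case: ifP => // /(dvdn_trans (dvdn_mulr b (dvdnn a))); rewrite (negPf na).
Qed.

Lemma fpow_coefM b f n : (0 < b)%N -> fpow b f (n * b)%N = f n.
Proof. by move=> b0; rewrite fpowE // dvdn_mull // mulnK. Qed.

Lemma fpow_eq0 b f : fpow b f = 0 -> f = 0.
Proof.
move=> E; apply: powserP => n; have := congr1 (fun h : S => h (n * b.-1.+1)%N) E.
by rewrite [X in X = _ -> _]/= dvdn_mull // mulnK.
Qed.

Lemma powserXnE n m : (powserX k ^+ n) m = (m == n)%:R.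
Proof.
rewrite -[powserX k ^+ n]mulr1 powserXnM powser1E subn_eq0 eqn_leq.
by case: leqP; rewrite ?andbT ?andbF.
Qed.

Lemma fpowXn b n : fpow b (powserX k ^+ n) = powserX k ^+ (n * b.-1.+1).
Proof.
have E1 : fpow b (powserX k) = powserX k ^+ b.-1.+1.
  apply: powserP => m; rewrite powserXnE [LHS]/=.
  have [->|ne] := eqVneq m b.-1.+1; first by rewrite dvdnn divnn.
  case: ifP => // /dvdnP[j E]; rewrite E mulnK //; case: (j =P 1%N) => // j1.
  by move: ne; rewrite E j1 mul1n eqxx.
by rewrite rmorphXn /= E1 -exprM mulnC.
Qed.

(** Exponents are written in base Q, so the residue classes carry independent series. It separates
    the unknowns of the auxiliary function, and the w^i over q-th powers. *)
Lemma coef_digits (Q n : nat) (G : nat -> S) : (0 < Q)%N ->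
  (\sum_(c < Q) powserX k ^+ c * fpow Q (G c)) n = G (n %% Q)%N (n %/ Q)%N.
Proof.
move=> Q0; have nQ := ltn_pmod n Q0.
have tE (c : 'I_Q) : (powserX k ^+ c * fpow Q (G c)) n =
    if c == Ordinal nQ then G c (n %/ Q)%N else 0.
  rewrite powserXnM; case: eqP => [->|cn].
    rewrite leq_mod; have -> : (n - n %% Q = n %/ Q * Q)%N by rewrite {1}(divn_eq n Q) addnK.
    by rewrite fpow_coefM.
  case: leqP => // cle; rewrite fpowE // -eqn_mod_dvd //.
  case: eqP => // E; case: cn; apply: val_inj => /=.
  by rewrite E modn_small.
rewrite powser_sumE (eq_bigr _ (fun c _ => tE c)) -big_mkcond.
by rewrite (big_pred1 (Ordinal nQ)).
Qed.

End PowserExtra.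

Section Evaluation.
Variable F : finFieldType.
Local Notation q := #|F|.
Local Notation k := {fraction {poly F}}.
Local Notation S := (powser k).
Local Notation K := (Kinf F).
Implicit Types (f g : S) (x y : K) (a b : nat).

(* f(t,u) has coefficients in F[t] and converges to x at t = w^-a, u = w *)
Definition evr a f x := exists2 p : nat -> {poly F},
  forall m, f m = tofrac (p m) & serK (fun m => evt a (p m) * wK ^+ m) x.

Lemma tofrac_inj (R : idomainType) : injective (@tofrac R).
Proof. by move=> a b /eqP; rewrite tofrac_eq => /eqP. Qed.

Lemma evr_uniq a f x y : evr a f x -> evr a f y -> x = y.
Proof.
move=> [p pE px] [p' pE' px']; apply: cvgK_uniq px _.
suff -> : p = p' by [].
by apply/funext => m; apply: tofrac_inj; rewrite -pE.
Qed.

Lemma evrD a f g x y : evr a f x -> evr a g y -> evr a (f + g) (x + y).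
Proof.
move=> [p pE px] [p' pE' py]; exists (fun m => p m + p' m) => [m|].
  by rewrite powserDE pE pE' tofracD.
apply: cvgK_close (cvgKD px py) _ => n; exists 0%N => m _.
rewrite -big_split /= -sumrB big1 => [|i _]; first exact: vge00.
by rewrite rmorphD mulrDl subrr.
Qed.

Lemma evrM a f g x y : evr a f x -> evr a g y -> evr a (f * g) (x * y).
Proof.
move=> [p pE px] [p' pE' py]; exists (fun m => \sum_(i < m.+1) p i * p' (m - i)%N) => [m|].
  rewrite powserME rmorph_sum; apply: eq_bigr => i _.
  by rewrite rmorphM /= pE pE'.
apply: cvgK_close (serKM px py) _ => n; exists 0%N => m _.
rewrite -sumrB big1 => [|i _]; first exact: vge00.
rewrite rmorph_sum mulr_suml -sumrB big1 // => j _.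
rewrite rmorphM mulrACA -exprD subnKC ?subrr //.
by rewrite -ltnS.
Qed.

Definition pu (P : {poly {poly F}}) : S := PowSer (fun m => tofrac P`_m).

Lemma pu_is_zmod_morphism : zmod_morphism pu.
Proof. by move=> P Q; apply: powserP => n; rewrite powserBE /= coefB tofracB. Qed.

Lemma pu_is_monoid_morphism : monoid_morphism pu.
Proof.
split; first by apply: powserP => n; rewrite powser1E /= coef1 rmorph_nat.
move=> P Q; apply: powserP => n; rewrite powserME /= coefM rmorph_sum.
by apply: eq_bigr => i _; rewrite rmorphM.
Qed.

HB.instance Definition _ := GRing.isZmodMorphism.Build _ _ pu pu_is_zmod_morphism.
HB.instance Definition _ := GRing.isMonoidMorphism.Build _ _ pu pu_is_monoid_morphism.

Lemma puE P n : pu P n = tofrac P`_n. Proof. by []. Qed.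

Lemma puX : pu 'X = powserX k.
Proof. by apply: powserP => n; rewrite puE coefX rmorph_nat. Qed.

Lemma pu_eq0 P : pu P = 0 -> P = 0.
Proof.
move=> E; apply/polyP => n; have := congr1 (fun h : S => h n) E.
by rewrite puE coef0 powser0E -[RHS]tofrac0 => /tofrac_inj.
Qed.

Lemma fpow_pu b P : (0 < b)%N -> fpow b (pu P) = pu (P \Po 'X^b).
Proof.
move=> b0; apply: powserP => n; rewrite fpowE // !puE coef_comp_poly_Xn //.
by case: ifP; rewrite ?tofrac0.
Qed.

Lemma evr_pu a P : evr a (pu P) (map_poly (evt a) P).[wK].
Proof.
exists (fun m => P`_m) => // n; exists (size P) => m le.
rewrite (@horner_coef_wide _ m) ?(leq_trans (size_poly _ _)) //.
rewrite -sumrB big1 => [|i _]; first exact: vge00.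
by rewrite coef_map subrr.
Qed.

Lemma evr0 a : evr a 0 0.
Proof. by have := evr_pu a 0; rewrite !rmorph0 horner0. Qed.

Lemma evr1 a : evr a 1 1.
Proof. by have := evr_pu a 1; rewrite !rmorph1 hornerC. Qed.

Lemma evr_sum a (I : Type) (r : seq I) (P : pred I) (f : I -> S) (x : I -> K) :
  (forall i, P i -> evr a (f i) (x i)) ->
  evr a (\sum_(i <- r | P i) f i) (\sum_(i <- r | P i) x i).
Proof. by move=> fx; apply: (big_ind2 (evr a)) => //; [exact: evr0|move=> *; exact: evrD]. Qed.

Lemma evr_prod a (I : Type) (r : seq I) (P : pred I) (f : I -> S) (x : I -> K) :
  (forall i, P i -> evr a (f i) (x i)) ->
  evr a (\prod_(i <- r | P i) f i) (\prod_(i <- r | P i) x i).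
Proof. by move=> fx; apply: (big_ind2 (evr a)) => //; [exact: evr1|move=> *; exact: evrM]. Qed.

Lemma evrN a f x : evr a f x -> evr a (- f) (- x).
Proof.
move=> fx; rewrite -mulN1r -(mulN1r x); apply: evrM => //.
by have := evr_pu a (-1); rewrite !rmorphN !rmorph1 hornerN hornerC.
Qed.

Lemma evr_det a n (f : 'M[S]_n) (x : 'M[K]_n) :
  (forall i j, evr a (f i j) (x i j)) -> evr a (\det f) (\det x).
Proof.
move=> fx; apply: evr_sum => s _; apply: evrM; last by apply: evr_prod => i _.
by case: (s : bool); rewrite ?expr0 ?expr1; [apply/evrN/evr1|apply: evr1].
Qed.

Lemma evt_frob a j (p : {poly F}) : evt (a * q ^ j) p = evt a p ^+ (q ^ j).
Proof.
rewrite /evt !horner_coef !size_map_poly (frob_sum (@CK F)); apply: eq_bigr => i _.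
rewrite exprMn !coef_map /= -[CK _ ^+ _]rmorphXn expf_cardX; congr (_ * _).
by rewrite !exprVn -!exprM -mulnA [(q ^ j * i)%N]mulnC ?mulnA.
Qed.

Lemma sum_dvd b (G : nat -> K) M : (0 < b)%N ->
  \sum_(n < M) (if (b %| n)%N then G (n %/ b)%N else 0) = \sum_(m < (M + b.-1) %/ b) G m.
Proof.
move=> b0; elim: M => [|M IH].
  by rewrite add0n divn_small ?prednK // !big_ord0.
have -> : ((M.+1 + b.-1) %/ b = (M %/ b).+1)%N.
  by rewrite addSnnS prednK // -{1}(mul1n b) addnC divnMDl.
rewrite big_ord_recr /= IH.
case: ifP => [/dvdnP[m ->]|nd].
  by rewrite mulnK // divnMDl // (@divn_small b.-1) ?prednK // addn0 big_ord_recr.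
rewrite addr0; suff -> : ((M + b.-1) %/ b = (M %/ b).+1)%N by [].
have r0 : (0 < M %% b)%N by rewrite lt0n; apply: contraFneq nd => /eqP.
rewrite {1}(divn_eq M b) -addnA divnMDl // -addn1; congr (_ + _)%N.
have rb : (M %% b < b)%N by rewrite ltn_mod.
have -> : (M %% b + b.-1 = b + (M %% b).-1)%N.
  by move: (M %% b)%N r0 rb => r; case: b b0 {IH nd} => //; lia.
rewrite divnDl // divnn b0 divn_small //.
exact: leq_ltn_trans (leq_pred _) rb.
Qed.

(** The coefficients lie in F_q[t], so raising a value to the power q^j is the same as replacing t =
    w^(-a) by w^(-a q^j) and u by u^(q^j). *)
Lemma evr_frob a j f x : evr a f x -> evr (a * q ^ j) (fpow (q ^ j) f) (x ^+ (q ^ j)).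
Proof.
move=> [p pE px]; have b0 := q_exp_gt0 F j.
exists (fun n => if (q ^ j %| n)%N then p (n %/ q ^ j)%N else 0) => [m|].
  by rewrite fpowE // pE; case: ifP; rewrite ?tofrac0.
pose c M := ((M + (q ^ j).-1) %/ q ^ j)%N.
have cc A : exists B, forall m, (B <= m)%N -> (A <= c m)%N.
  exists (A * q ^ j)%N => m le; rewrite /c leq_divRL //.
  by apply: leq_trans le (leq_addr _ _).
apply: cvgK_close (cvgKX (q ^ j) (cvgK_comp px cc)) _ => n; exists 0%N => m _.
suff -> : \sum_(m0 < m) evt (a * q ^ j)
     (if (q ^ j %| m0)%N then p (m0 %/ q ^ j)%N else 0) * wK ^+ m0 =
   (\sum_(m0 < c m) evt a (p m0) * wK ^+ m0) ^+ (q ^ j) by rewrite subrr; apply: vge00.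
rewrite (frob_sum (@CK F)) -(sum_dvd (fun m0 => (evt a (p m0) * wK ^+ m0) ^+ (q ^ j))) //.
apply: eq_bigr => i _; case: ifP => [d|_]; last by rewrite rmorph0 mul0r.
by rewrite exprMn evt_frob -exprM divnK.
Qed.

(* coefficients in F[t], with deg f_m <= m / 2 *)
Definition gr f := forall m, exists2 p : {poly F}, f m = tofrac p & ((size p).*2 <= m.+2)%N.

Lemma gr_fun f : gr f -> exists p : nat -> {poly F},
  forall m, f m = tofrac (p m) /\ ((size (p m)).*2 <= m.+2)%N.
Proof. move=> gf.
have [p pE] := @choice nat {poly F} (fun m p => f m = tofrac p /\ ((size p).*2 <= m.+2)%N)
  (fun m => match gf m with ex_intro2 p e s => ex_intro _ p (conj e s) end).
by exists p.
Qed.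

Lemma gr0 : gr 0.
Proof. by move=> m; exists 0; rewrite ?tofrac0 // size_poly0. Qed.

Lemma gr1 : gr 1.
Proof.
move=> m; exists (m == 0)%:R; first by rewrite rmorph_nat.
by case: m => [|m]; rewrite ?size_poly1 ?size_poly0.
Qed.

Lemma grD f g : gr f -> gr g -> gr (f + g).
Proof.
move=> gf gg m; have [p pE sp] := gf m; have [p' pE' sp'] := gg m.
exists (p + p'); first by rewrite powserDE pE pE' tofracD.
have := size_polyD p p'; rewrite leq_max => /orP[] le.
  by apply: leq_trans sp; rewrite leq_double.
by apply: leq_trans sp'; rewrite leq_double.
Qed.

Lemma grM f g : gr f -> gr g -> gr (f * g).
Proof.
move=> gf gg m; have [p pE] := gr_fun gf; have [p' pE'] := gr_fun gg.
exists (\sum_(i < m.+1) p i * p' (m - i)%N).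
  rewrite powserME rmorph_sum; apply: eq_bigr => i _ /=.
  by rewrite tofracM; case: (pE i) => -> _; case: (pE' (m - i)%N) => ->.
suff H i : (i <= m)%N -> ((size (p i * p' (m - i)%N)%R).*2 <= m.+2)%N.
  have aux (x1 x2 : nat) : (x1.*2 <= x2.+2)%N = (x1 <= x2./2.+1)%N by lia.
  rewrite aux; apply: leq_trans (size_sum _ _ _) _; apply/bigmax_leqP => i _.
  by rewrite -aux; apply: H; rewrite -ltnS.
move=> im; have [_ s1] := pE i; have [_ s2] := pE' (m - i)%N.
have [->|n1] := eqVneq (p i) 0; first by rewrite mul0r size_poly0.
have [->|n2] := eqVneq (p' (m - i)%N) 0; first by rewrite mulr0 size_poly0.
rewrite size_mul //; move: s1 s2; rewrite -size_poly_gt0 in n1.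
have aux (x1 x2 x3 x4 : nat) : (x3 <= x4)%N -> (0 < x1)%N -> (x1.*2 <= x3.+2)%N ->
   (x2.*2 <= (x4 - x3).+2)%N -> ((x1 + x2).-1.*2 <= x4.+2)%N by lia.
exact: aux.
Qed.

Lemma gr_sum (I : Type) (r : seq I) (P : pred I) (f : I -> S) :
  (forall i, P i -> gr (f i)) -> gr (\sum_(i <- r | P i) f i).
Proof. by move=> h; apply: (big_ind gr) => //; [exact: gr0|exact: grD]. Qed.

Lemma gr_prod (I : Type) (r : seq I) (P : pred I) (f : I -> S) :
  (forall i, P i -> gr (f i)) -> gr (\prod_(i <- r | P i) f i).
Proof. by move=> h; apply: (big_ind gr) => //; [exact: gr1|exact: grM]. Qed.

Lemma gr_pu_le (P : {poly {poly F}}) : (forall m, ((size (P`_m)%R).*2 <= m.+2)%N) -> gr (pu P).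
Proof. by move=> h m; exists P`_m. Qed.

Lemma gr_Xn n : gr (powserX k ^+ n).
Proof.
rewrite -puX -rmorphXn; apply: gr_pu_le => m; rewrite coefXn.
by case: eqP => _; rewrite ?size_poly1 ?size_poly0.
Qed.

Lemma grN f : gr f -> gr (- f).
Proof. by move=> gf m; have [p pE sp] := gf m; exists (- p); rewrite ?size_polyN // powserNE pE tofracN. Qed.

Lemma gr_det n (f : 'M[S]_n) : (forall i j, gr (f i j)) -> gr (\det f).
Proof.
move=> fx; apply: gr_sum => s _; apply: grM; last by apply: gr_prod => i _.
by case: (s : bool); rewrite ?expr0 ?expr1; [apply/grN/gr1|apply: gr1].
Qed.

(** Slope 1/2 in [gr] gives order at least b m - a m / 2 to the term m, which tends to infinity for
    a < 2 b. With a = 1 and b = q^m this covers theta = t and all its twists. *)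
Lemma evr_gr f a b : gr f -> (0 < b)%N -> (a < b.*2)%N -> exists x, evr a (fpow b f) x.
Proof.
move=> gf b0 ab; have [p pE] := gr_fun gf.
pose p' n : {poly F} := if (b %| n)%N then p (n %/ b)%N else 0.
have [|x xE] := @serK_ex _ (fun m => evt a (p' m) * wK ^+ m).
  move=> n; exists (n.*2 * b)%N => m le; rewrite /p'.
  case: ifP => [/dvdnP[j E]|_]; last by rewrite rmorph0 mul0r; apply: vge00.
  move: le; rewrite E mulnK // leq_pmul2r // => le.
  have [_ sp] := pE j.
  have sp' : (size (p j) <= (j./2).+1)%N.
    have aux (x1 x2 : nat) : (x1.*2 <= x2.+2)%N -> (x1 <= x2./2.+1)%N by lia.
    exact: aux.
  apply: vge_weak (vgeM (vge_evt a sp') (vge_wn _ _)).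
  have h2 : (j./2.*2 <= j)%N by lia.
  nia.
exists x; exists p' => // m; rewrite fpowE // /p'.
by case: ifP; rewrite ?tofrac0 //; case: (pE (m %/ b)%N).
Qed.

End Evaluation.

(** * Independence of values *)

Section LinearAlgebra.
Variable K : fieldType.

Lemma ker_ex (T1 T2 : finType) (A : T1 -> T2 -> K) : (#|T2| < #|T1|)%N ->
  exists2 v : T1 -> K, (exists i, v i != 0) & forall j, \sum_i v i * A i j = 0.
Proof.
move=> lt; pose M := \matrix_(i < #|T1|, j < #|T2|) A (enum_val i) (enum_val j).
have : kermx M != 0.
  by rewrite -mxrank_eq0 mxrank_ker -lt0n subn_gt0 (leq_ltn_trans (rank_leq_col _)).
move/rowV0Pn => [v /sub_kermxP vM v0]; exists (fun i => v 0 (enum_rank i)).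
  have /rV0Pn[i vi] := v0; exists (enum_val i).
  by rewrite enum_valK.
move=> j; have /matrixP/(_ 0 (enum_rank j)) := vM; rewrite !mxE => E.
rewrite -[RHS]E [LHS]sum_enum_val; apply: eq_bigr => i _.
by rewrite mxE enum_valK enum_rankK.
Qed.

(** The kernels of the first C columns decrease with C; once the rank is maximal they equal the
    kernel of all columns. *)
Lemma kernel_stable (T : finType) (A : T -> nat -> K) :
  (forall v, (forall n, \sum_i v i * A i n = 0) -> forall i, v i = 0) ->
  exists C, forall v, (forall n, (n < C)%N -> \sum_i v i * A i n = 0) ->
    forall i, v i = 0.
Proof.
move=> inj; pose M C := \matrix_(i < #|T|, n < C) A (enum_val i) n.
pose P r := `[< exists C, \rank (M C) = r >].
have exP : exists r, P r by exists (\rank (M 0)); apply/asboolP; exists 0%N.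
have bdP r : P r -> (r <= #|T|)%N by move=> /asboolP[C <-]; apply: rank_leq_row.
have [r /asboolP[C rC] maxr] := ex_maxnP exP bdP; exists C => v vC; apply: inj => n.
pose C' := (C + n.+1)%N.
have kerE (D : nat) (x : 'rV[K]_#|T|) : x *m M D = 0 <->
    forall m, (m < D)%N -> \sum_(i < #|T|) x 0 i * A (enum_val i) m = 0.
  split=> [E m mD|E].
    have /matrixP/(_ 0 (Ordinal mD)) := E; rewrite !mxE => E1; rewrite -[RHS]E1.
    by apply: eq_bigr => i _; rewrite mxE.
  apply/matrixP => i m; rewrite !mxE ord1 -[RHS](E m) //.
  by apply: eq_bigr => j _; rewrite mxE.
have sub : (kermx (M C') <= kermx (M C))%MS.
  apply/rV_subP => x /sub_kermxP/kerE E; apply/sub_kermxP/kerE => m mC.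
  by apply: E; rewrite /C' (leq_trans mC) ?leq_addr.
have sup : (kermx (M C) <= kermx (M C'))%MS.
  rewrite -(mxrank_leqif_sup sub) eqn_leq mxrankS //= !mxrank_ker rC leq_sub2l //.
  by apply: maxr; apply/asboolP; exists C'.
pose x := \row_(i < #|T|) v (enum_val i).
have xE m : \sum_(i < #|T|) x 0 i * A (enum_val i) m = \sum_i v i * A i m.
  by rewrite [RHS]sum_enum_val; apply: eq_bigr => i _; rewrite mxE.
have /sub_kermxP/kerE xC : (x <= kermx (M C))%MS.
  by apply/sub_kermxP/kerE => m mC; rewrite xE vC.
have /sub_kermxP/kerE : (x <= kermx (M C'))%MS.
  by apply: submx_trans sup; apply/sub_kermxP/kerE.
by move=> /(_ n); rewrite xE; apply; rewrite /C' addnS ltnS leq_addl.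
Qed.

End LinearAlgebra.

Section Schwarz.
Variable F : finFieldType.
Local Notation q := #|F|.
Local Notation W := (powser F).
Local Notation X := (powserX F).
Local Notation K := (Kinf F).

Lemma vge_prod (n B : nat) (x : 'I_n -> K) :
  (forall i, vge (- B%:Z) (x i)) -> vge (- (n * B)%:Z) (\prod_i x i).
Proof.
elim: n x => [|n IH] x h.
  by rewrite big_ord0 mul0n oppr0 -tofrac1; apply: vge_tofrac.
rewrite big_ord_recr /= mulSn; have v1 := IH (fun i => x (widen_ord (leqnSn n) i)) (fun i => h _).
by apply: vge_weak (vgeM v1 (h _)); lia.
Qed.

(** The Vandermonde matrix in the points w^(q^i) is inverted through its adjugate. Each difference
    of points has order at most q^Z, and at most Z Z of them are divided out. *)
Lemma vandermonde_vge (Z : nat) (c : 'I_Z -> K) (m : int) :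
  (forall i : 'I_Z, vge m (\sum_b c b * wK ^+ (q ^ i * b))) ->
  forall b, vge (m - (Z * (Z * q ^ Z))%:Z) (c b).
Proof.
move=> h b; pose V0 : 'M[W]_Z := Vandermonde Z (\row_i X ^+ (q ^ i)).
pose V := map_mx (@tofrac W) V0; pose cv := \row_b c b.
have rE i : (cv *m V) 0 i = \sum_b c b * wK ^+ (q ^ i * b).
  by rewrite !mxE; apply: eq_bigr => b' _; rewrite !mxE rmorphXn rmorphXn -exprM.
have dE : \det V * c b = \sum_i (cv *m V) 0 i * tofrac ((\adj V0) i b).
  have /matrixP/(_ 0 b) : cv *m V *m \adj V = \det V *: cv.
    by rewrite -mulmxA mul_mx_adj mul_mx_scalar.
  rewrite [X in _ = X]mxE [cv 0 b]mxE => <-; rewrite [LHS]mxE; apply: eq_bigr => i _.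
  by congr (_ * _); rewrite /V -map_mx_adj mxE.
have v1 : vge m (\det V * c b).
  rewrite dE; apply: vge_sum => i _; rewrite rE -[m]addr0.
  by apply: vgeM; [exact: h|exact: vge_tofrac].
have dV : \det V = \prod_(i < Z) \prod_(j < Z | (i < j)%N) (wK ^+ (q ^ j) - wK ^+ (q ^ i)).
  rewrite /V det_map_mx det_Vandermonde rmorph_prod; apply: eq_bigr => i _.
  rewrite rmorph_prod; apply: eq_bigr => j _.
  by rewrite !mxE rmorphB !rmorphXn.
have uE (i j : 'I_Z) : (i < j)%N -> wK ^+ (q ^ j) - wK ^+ (q ^ i) != 0 :> K /\
    vge (- (q ^ Z)%:Z) (wK ^+ (q ^ j) - wK ^+ (q ^ i) : K)^-1.
  move=> ij; have lt : (q ^ i < q ^ j)%N by rewrite ltn_exp2l // q_gt1.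
  pose s : W := X ^+ (q ^ j - q ^ i) - 1.
  have s0 : s 0%N != 0.
    rewrite /s powserBE powserXnE powser1E ltn_eqF ?sub0r ?oppr_eq0 ?oner_eq0 //.
    by rewrite subn_gt0.
  have sE : wK ^+ (q ^ j) - wK ^+ (q ^ i) = wK ^+ (q ^ i) * tofrac s :> K.
    by rewrite rmorphB rmorph1 rmorphXn /= mulrBr mulr1 -exprD subnKC // ltnW.
  have [t tE] := vge_inv_tofrac s0; rewrite sE; split.
    rewrite mulf_neq0 ?expf_neq0 ?wK_neq0 // tofrac_eq0.
    by apply: contraNneq s0 => ->; rewrite powser0E.
  rewrite ?sE invfM tE exprnN -[- _]addr0; apply: vgeM; last exact: vge_tofrac.
  apply: vge_weak (vge_w _ _); rewrite lerN2 lez_nat leq_exp2l ?q_gt1 //.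
  exact: ltnW.
have d0 : \det V != 0.
  rewrite dV prodf_seq_neq0; apply/allP => i _; apply/implyP => _.
  rewrite prodf_seq_neq0; apply/allP => j _; apply/implyP => ij.
  by have [] := uE i j ij.
have v2 : vge (- (Z * (Z * q ^ Z))%:Z) (\det V)^-1.
  rewrite dV -prodfV; apply: vge_prod => i; rewrite -prodfV big_mkcond.
  apply: vge_prod => j; case: ifP => [ij|_]; first by have [] := uE i j ij.
  by apply: (@vge_weak _ 0); [lia|rewrite -tofrac1; apply: vge_tofrac].
by have := vgeM v1 v2; rewrite mulrAC divff // mul1r.
Qed.

Lemma evt_sum a (p : {poly F}) B : (size p <= B)%N ->
  evt a p = \sum_(b < B) CK p`_b * wK ^ (- (a * b)%:Z).
Proof.
move=> sp; rewrite /evt (@horner_coef_wide _ B) ?(leq_trans (size_poly _ _)) //.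
by apply: eq_bigr => i _; rewrite coef_map exprVn -exprM exprnN.
Qed.

Lemma vge_CK c : vge 0 (CK c : K).
Proof. exact: vge_tofrac. Qed.

(** A Schwarz lemma. Coefficients of t^b with b >= Z occur only for n so large that they are
    invisible modulo w^(2 Q g). The Z zeros then become a Vandermonde system for the series [c b]
    with b < Z, and solving it loses an order of at most Q. *)
Lemma schwarz (phi : nat -> {poly F}) (N g Q : nat) :
  let Z := (N + g)%N in
  (0 < N)%N -> (0 < g)%N -> (Z * (Z * q ^ Z) <= Q)%N ->
  (forall n, (size (phi n) <= N + n %/ (2 * Q))%N) ->
  (forall i, (i < Z)%N -> serK (fun n => evt (q ^ i) (phi n) * wK ^+ n) 0) ->
  forall n, (n < Q * g)%N -> phi n = 0.
Proof.
move=> Z N0 g0 QZ sphi van n nlt.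
have Z0 : (0 < Z)%N by rewrite /Z addn_gt0 N0.
have qZ := q_exp_gt0 F Z.
have Q0 : (0 < Q)%N by apply: leq_trans QZ; rewrite !muln_gt0 Z0.
pose c (b : nat) : W := PowSer (fun n => (phi n)`_b).
have key (i : 'I_Z) : vge (2 * Q * g)%N
    (\sum_(b < Z) tofrac (c b) * wK ^ (- (q ^ i * b)%:Z) : K).
  have iZ : (q ^ i <= q ^ Z)%N by rewrite leq_exp2l ?q_gt1 // ltnW.
  have [M0 h0] := van i (ltn_ord i) (2 * Q * g)%N.
  pose M := (M0 + 2 * Q * g + Z * q ^ Z)%N.
  have {h0} := h0 M; rewrite subr0 => h0.
  pose B := (Z + N + M)%N.
  have sB m : (m < M)%N -> (size (phi m) <= B)%N.
    move=> mM; apply: leq_trans (sphi m) _; have := leq_div m (2 * Q); rewrite /B; lia.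
  have E1 : \sum_(m < M) evt (q ^ i) (phi m) * wK ^+ m =
     \sum_(m < M) \sum_(b < B) (CK (phi m)`_b * wK ^ (- (q ^ i * b)%:Z)) * wK ^+ m.
    by apply: eq_bigr => m _; rewrite (evt_sum _ (sB m (ltn_ord m))) mulr_suml.
  have v1 : vge (2 * Q * g)%N (\sum_(m < M) \sum_(b < Z) (CK (phi m)`_b * wK ^ (- (q ^ i * b)%:Z)) * wK ^+ m : K).
    have -> : \sum_(m < M) \sum_(b < Z) (CK (phi m)`_b * wK ^ (- (q ^ i * b)%:Z)) * wK ^+ m =
      \sum_(m < M) evt (q ^ i) (phi m) * wK ^+ m -
      \sum_(m < M) \sum_(Z <= b < B) (CK (phi m)`_b * wK ^ (- (q ^ i * b)%:Z)) * wK ^+ m.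
      rewrite E1 -sumrB; apply: eq_bigr => m _.
      rewrite -(big_mkord xpredT (fun b => (CK (phi m)`_b * wK ^ (- (q ^ i * b)%:Z)) * wK ^+ m)).
      rewrite -[X in _ = X - _](big_mkord xpredT (fun b => (CK (phi m)`_b * wK ^ (- (q ^ i * b)%:Z)) * wK ^+ m)).
      rewrite [X in _ = X - _](@big_cat_nat _ _ _ Z) //=; last by rewrite /B; lia.
      by rewrite addrK.
    apply: vgeB; first by apply: h0; rewrite /M; lia.
    apply: vge_sum => m _; rewrite big_nat; apply: vge_sum => b /andP[Zb _].
    have [lt|ge] := ltnP b (size (phi m)); last first.
      by rewrite nth_default // rmorph0 !mul0r; apply: vge00.
    have : (b < N + m %/ (2 * Q))%N by apply: leq_trans lt (sphi m).
    rewrite -ltn_subLR ?(leq_trans _ Zb) ?leq_addr // => lt2.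
    have lt3 : ((b - N).+1 * (2 * Q) <= m)%N by rewrite -leq_divRL // muln_gt0.
    rewrite -mulrA -[(2 * Q * g)%N%:Z]add0r; apply: vgeM; first exact: vge_CK.
    apply: vge_weak (vgeM (vge_w _ _) (vge_wn _ _)).
    have h1 : (q ^ i * b <= q ^ Z * b)%N by rewrite leq_mul2r iZ orbT.
    have h2 : (q ^ Z * Z <= Q)%N.
      by rewrite mulnC; apply: leq_trans QZ; rewrite leq_pmull.
    have h3 : (q ^ Z <= Q)%N by apply: leq_trans h2; rewrite leq_pmulr.
    have [b' bE] : exists b', b = (Z + b')%N by exists (b - Z)%N; rewrite subnKC.
    move: h1 lt3; rewrite bE /Z.
    have -> : (N + g + b' - N = g + b')%N by lia.
    rewrite -/Z => h1 lt3.
    have h4 : (q ^ Z * b' <= Q * b')%N by rewrite leq_mul2r h3 orbT.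
    nia.
  have E2 : \sum_(b < Z) tofrac (c b) * wK ^ (- (q ^ i * b)%:Z) =
    \sum_(m < M) \sum_(b < Z) (CK (phi m)`_b * wK ^ (- (q ^ i * b)%:Z)) * wK ^+ m
    + \sum_(b < Z) (tofrac (c b) - \sum_(m < M) CK (phi m)`_b * wK ^+ m) * wK ^ (- (q ^ i * b)%:Z) :> K.
    rewrite exchange_big -big_split /=; apply: eq_bigr => b _.
    rewrite mulrBl mulr_suml addrC.
    under [X in _ = _ + X]eq_bigr => m _ do rewrite mulrAC.
    by rewrite subrK.
  rewrite E2; apply: vgeD => //; apply: vge_sum => b _.
  have tr : \sum_(m < M) CK (phi m)`_b * wK ^+ m = tofrac (\sum_(m < M) powserC (phi m)`_b * X ^+ m) :> K.
    by rewrite rmorph_sum; apply: eq_bigr => m _; rewrite rmorphM rmorphXn.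
  rewrite tr -tofracB; apply: (@vge_weak _ (M%:Z - (q ^ i * b)%:Z)).
    have : (q ^ i * b <= q ^ Z * Z)%N by apply: leq_mul => //; apply: ltnW.
    rewrite /M; lia.
  apply: vgeM; last exact: vge_w.
  apply: vge_coef => m mM; rewrite powserBE powser_sumE.
  under eq_bigr => j _ do rewrite powserCM_coef powserXnE.
  rewrite (bigD1 (Ordinal mM)) //= eqxx mulr1 big1 ?addr0 ?subrr // => j jm.
  rewrite eq_sym (_ : (j == m :> nat) = false) ?mulr0 //.
  by apply: contraNF jm => /eqP jm; apply/eqP/val_inj.
(* Multiplying by w^(q^i (Z - 1)) and reversing b makes all exponents nonnegative, as
   [vandermonde_vge] requires. *)
have key2 : forall b : 'I_Z, vge (Q * g)%N (tofrac (c (Z - b.+1)%N) : K).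
  move=> b; pose c' (b : 'I_Z) : K := tofrac (c (Z - b.+1)%N).
  have h (i : 'I_Z) : vge (2 * Q * g)%N (\sum_b c' b * wK ^+ (q ^ i * b)).
    have -> : \sum_b c' b * wK ^+ (q ^ i * b) = wK ^+ (q ^ i * Z.-1) *
        \sum_(b < Z) tofrac (c b) * wK ^ (- (q ^ i * b)%:Z).
      rewrite mulr_sumr (reindex_inj rev_ord_inj) /=; apply: eq_bigr => j _.
      rewrite /c' /= subnSK // subKn 1?ltnW // mulrCA; congr (_ * _).
      rewrite -exprnN -expfB_cond ?(negPf (wK_neq0 F)) //=; last first.
        by rewrite leq_mul2l -ltnS prednK // ltn_ord orbT.
      rewrite -mulnBr; congr (_ ^+ (_ * _)%N).
      by rewrite -subn1 -subnDA add1n.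
    rewrite -[(2 * Q * g)%N%:Z]add0r; apply: vgeM => //.
    by apply: vge_weak (vge_wn _ _).
  have := vandermonde_vge h b; apply: vge_weak.
  move: QZ; move: (Z * (Z * q ^ Z))%N => D QD.
  have : (Q <= Q * g)%N by rewrite leq_pmulr.
  lia.
(* For n < Q g the degree bound N + n / (2 Q) stays below Z, so coefficients with b >= Z vanish by
   size. *)
apply/polyP => b; rewrite coef0; have [bZ|Zb] := ltnP b Z; last first.
  rewrite nth_default //; apply: leq_trans (sphi n) _; apply: leq_trans Zb.
  rewrite /Z leq_add2l; apply: (@leq_trans (Q * g %/ (2 * Q))).
    by apply: leq_div2r; apply: ltnW.
  by rewrite mulnC divnMr //; apply: leq_div.
have bE : b = (Z - (rev_ord (Ordinal bZ)).+1)%N by rewrite /= subnSK // subKn // ltnW.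
have := key2 (rev_ord (Ordinal bZ)); rewrite -bE => /vge_tofracP/(_ n nlt).
by [].
Qed.

End Schwarz.

Section Independence.
Variable F : finFieldType.
Local Notation q := #|F|.
Local Notation k := {fraction {poly F}}.
Local Notation S := (powser k).
Local Notation X := (powserX k).
Local Notation K := (Kinf F).

Lemma pu_C (c : {poly F}) : pu c%:P = powserC (tofrac c).
Proof. by apply: powserP => n; rewrite puE coefC /=; case: n => [|n] /=; rewrite ?tofrac0 ?mulr1n. Qed.

Lemma pu_CXn (c : {poly F}) n : pu (c%:P * 'X^n) = powserC (tofrac c) * X ^+ n.
Proof. by rewrite rmorphM rmorphXn /= pu_C puX. Qed.

Lemma evr_Xn a n : evr a (X ^+ n) (wK ^+ n).
Proof.
have E : pu 'X^n = X ^+ n :> S by rewrite -puX; exact: (rmorphXn (@pu F)).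
by have := @evr_pu F a 'X^n; rewrite E map_polyXn hornerXn.
Qed.

Lemma evr_CXn a (c : {poly F}) n b :
  evr a (pu ((c%:P * 'X^n) \Po 'X^b)) (evt a c * wK ^+ (b * n)).
Proof.
rewrite comp_polyM comp_polyC comp_Xn_poly -exprM pu_CXn.
apply: evrM; last exact: evr_Xn.
by rewrite -pu_C; have := evr_pu a c%:P; rewrite map_polyC hornerC.
Qed.

Lemma evt_comp n (p : {poly F}) : evt 1 (p \Po 'X^n) = evt n p.
Proof.
by rewrite /evt map_comp_poly map_polyXn horner_comp hornerXn exprVn -exprM mul1n.
Qed.

Lemma evtZXn a (c : F) n : evt a (c *: 'X^n) = CK c * wK ^- (a * n).
Proof. by rewrite -mul_polyC rmorphM rmorphXn /= evtC evtX exprVn -exprM. Qed.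

Variables (l : nat) (psi : 'I_l -> S) (C0 k0 : nat) (sg : nat -> 'I_l -> {poly F})
  (x : nat -> 'I_l -> K).
Hypothesis gpsi : forall j, gr (psi j).
Hypothesis ipsi : forall E : 'I_l -> {poly {poly F}},
  \sum_j pu (E j) * psi j = 0 -> forall j, E j = 0.
Hypothesis xE : forall m j, evr 1 (fpow (q ^ m) (psi j)) (x m j).
Hypothesis sg0 : forall m, (k0 <= m)%N -> exists j, sg m j != 0.
Hypothesis ssg : forall m j, (size (sg m j) <= C0 * q ^ m)%N.
Hypothesis rel : forall m, (k0 <= m)%N -> \sum_j evt 1 (sg m j) * x m j = 0.

(** A multiplier of size (l + 1) Q times a twisted relation of size C0 Q has to fit into (H + 1)
    Q. *)
Let H := (C0 + l + 1)%N.

(** Independence over F(t) of the finitely many u^a psi_j, a < H, is detected by finitely many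
    coefficients; their number decides how many zeros the auxiliary function must have. *)
Lemma independent_index : exists C, forall v : 'I_l * 'I_H -> k,
  (forall n, (n < C)%N -> \sum_ja v ja * (X ^+ ja.2 * psi ja.1) n = 0) ->
  forall i, v i = 0.
Proof.
apply: kernel_stable => v v0.
have [d d0 /choice[a aE]] := common_den v.
pose E j : {poly {poly F}} := \sum_(i < H) (a (j, i))%:P * 'X^i.
have E0 : \sum_j pu (E j) * psi j = 0.
  apply: powserP => n; rewrite powser0E -(mulr0 (tofrac d)) -(v0 n).
  have -> : \sum_i v i * (X ^+ i.2 * psi i.1) n =
      \sum_j \sum_(i < H) v (j, i) * (X ^+ i * psi j) n.
    by rewrite [RHS]pair_bigA; apply: eq_bigr => -[].
  rewrite powser_sumE.
  rewrite mulr_sumr; apply: eq_bigr => j _.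
  rewrite rmorph_sum mulr_suml powser_sumE mulr_sumr; apply: eq_bigr => i _.
  transitivity ((pu ((a (j, i))%:P * 'X^i) * psi j) n) => //.
  by rewrite pu_CXn -mulrA powserCM_coef -aE mulrA.
move=> [j i]; have /polyP/(_ i) := ipsi E0 j.
rewrite coef0 coef_sum (bigD1 i) //= coefCM coefXn eqxx mulr1 big1 ?addr0 => [a0|i' ii'].
  have := aE (j, i); rewrite a0 tofrac0 => /eqP; rewrite mulf_eq0 tofrac_eq0.
  by rewrite (negPf d0) => /eqP.
rewrite coefCM coefXn (_ : (_ == _) = false) ?mulr0 //.
by apply: contraNF ii' => /eqP ii'; apply/eqP/val_inj.
Qed.

(** Auxiliary function f: a combination of u^(a Q + c) psi_j(u^Q) with unknown coefficients
    E_(j,a,c)(t). At t = w^(-q^i) the functions psi_j(u^Q) take the values x (M - i) j to the power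
    q^i; requiring the coefficient vector there to be a multiple of the twisted relation
    [sg (M - i)] forces f to vanish. These are linear conditions over F. By [schwarz] f starts with
    Q g zeros, and [independent_index] then kills all unknowns. *)
Theorem values_independent : False.
Proof.
have [pp ppE] := choice (fun j => gr_fun (gpsi j)).
have [CH CHP] := independent_index.
have H0 : (0 < H)%N by rewrite /H addn1.
(* N > g l (H + 1) makes the unknowns outnumber the equations. M is large enough for Q = q^M to
   dominate the other constants and for M - i >= k0. *)
pose g := CH.+1; pose N := (g * l * (H + 1)).+1; pose Z := (N + g)%N.
pose D := (Z * (Z * q ^ Z))%N; pose M := (k0 + Z + D + N * q ^ Z)%N.
have := ltn_expl M (q_gt1 F); set Q := (q ^ M)%N => QM.
have Q0 : (0 < Q)%N by apply: leq_ltn_trans QM.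
(* Unknowns: the coefficients of the E_(j,a,c), of degree below N, and of the Z multipliers.
   Equations: the coefficients of Z l polynomials of size at most (H + 1) Q. *)
pose T1 := (('I_l * 'I_H) * ('I_Q * 'I_N) + 'I_Z * 'I_((l + 1) * Q))%type.
pose T2 := ('I_Z * 'I_l * 'I_((H + 1) * Q))%type.
(* Multiplication by w^(-(Q H - 1)) clears all positive powers of w, so each condition becomes an
   identity of polynomials in 1/w. *)
pose ex (i : 'I_Z) (y : ('I_l * 'I_H) * ('I_Q * 'I_N)) :=
  (Q * H - 1 - (y.1.2 * Q + y.2.1) + y.2.2 * q ^ i)%N.
pose Bs (i : 'I_Z) (j : 'I_l) (u : T1) : {poly F} := match u with
  | inl y => if y.1.1 == j then 'X^(ex i y) else 0
  | inr z => if z.1 == i then - ('X^(z.2) * (sg (M - i) j \Po 'X^(q ^ i))) else 0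
  end.
have card : (#|{: T2}| < #|{: T1}|)%N.
  rewrite card_sum !card_prod !card_ord.
  have : (Z * l * (H + 1) < l * H * N + Z * (l + 1))%N by rewrite /Z /N; nia.
  move: (Z) (N) => z n h; have : (Z * l * (H + 1) + 1 <= l * H * N + Z * (l + 1))%N by rewrite /Z /N; nia.
  move: h; nia.
have [v [u0 vu0] vA] := ker_ex (fun (u : T1) (y : T2) => (Bs y.1.1 y.1.2 u)`_y.2) card.
have qi (i : 'I_Z) : (q ^ i <= q ^ Z)%N by rewrite leq_exp2l ?q_gt1 // ltnW.
have acH (a : 'I_H) (c : 'I_Q) : (a * Q + c <= Q * H - 1)%N.
  have : (a.+1 * Q <= H * Q)%N by rewrite leq_mul2r ltn_ord orbT.
  have := ltn_ord c; rewrite mulSn [(Q * H)%N]mulnC; lia.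
have sBs i j u : (size (Bs i j u) <= (H + 1) * Q)%N.
  case: u => [y|z] /=; case: ifP => _; rewrite ?size_poly0 //.
    rewrite size_polyXn /ex.
    have : (y.2.2 * q ^ i <= N * q ^ Z)%N by apply: leq_mul; [apply: ltnW|].
    move: QM; rewrite /M; have := acH y.1.2 y.2.1.
    move: (y.2.2 * _)%N (_ * Q + _)%N => c1 c2; nia.
  rewrite size_polyN; apply: leq_trans (size_polyMleq _ _) _.
  rewrite size_polyXn /=; have := size_comp_poly_leq (sg (M - i) j) 'X^(q ^ i).
  rewrite size_polyXn /= => sc.
  have iM : (i <= M)%N by have := ltn_ord i; rewrite /M; lia.
  have s2 : ((size (sg (M - i) j)).-1 * q ^ i <= C0 * Q)%N.
    apply: (@leq_trans (C0 * q ^ (M - i) * q ^ i)).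
      by rewrite leq_mul2r (leq_trans (leq_pred _) (ssg _ _)) orbT.
    by rewrite -mulnA -expnD subnK.
  have := ltn_ord z.2; move: sc s2; rewrite /H.
  move: (size _) (_.-1 * _)%N (nat_of_ord z.2) => c1 c2 c3; nia.
have P0 i j : \sum_u v u *: Bs i j u = 0.
  apply/polyP => d; rewrite coef_sum coef0; have [lt|ge] := ltnP d ((H + 1) * Q).
    by have := vA (i, j, Ordinal lt) => /= E; rewrite -[RHS]E; apply: eq_bigr => u _; rewrite coefZ.
  by rewrite big1 // => u _; rewrite coefZ nth_default ?mulr0 // (leq_trans (sBs i j u)).
pose Ec (j : 'I_l) (a : 'I_H) (c : 'I_Q) : {poly F} := \sum_(b < N) v (inl ((j, a), (c, b))) *: 'X^b.
pose la (i : 'I_Z) : {poly F} := \sum_(a < (l + 1) * Q) v (inr (i, a)) *: 'X^a.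
have P1 i j : \sum_(a < H) \sum_(c < Q) \sum_(b < N)
    v (inl ((j, a), (c, b))) *: 'X^(ex i ((j, a), (c, b))) = la i * (sg (M - i) j \Po 'X^(q ^ i)).
  have := P0 i j; rewrite big_sumType.
  have -> : \sum_(y : ('I_l * 'I_H) * ('I_Q * 'I_N)) v (inl y) *: Bs i j (inl y) =
      \sum_(a < H) \sum_(c < Q) \sum_(b < N)
        v (inl ((j, a), (c, b))) *: 'X^(ex i ((j, a), (c, b))).
    transitivity (\sum_(ja : 'I_l * 'I_H) \sum_(cb : 'I_Q * 'I_N)
        v (inl (ja, cb)) *: Bs i j (inl (ja, cb))).
      by rewrite [RHS]pair_bigA; apply: eq_bigr => -[].
    transitivity (\sum_(j' < l) \sum_(a < H) \sum_(cb : 'I_Q * 'I_N)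
        v (inl ((j', a), cb)) *: Bs i j (inl ((j', a), cb))).
      by rewrite [RHS]pair_bigA; apply: eq_bigr => -[].
    rewrite (bigD1 j) //= [X in _ + X]big1 ?addr0 => [|j' jj']; last first.
      by rewrite big1 // => a _; rewrite big1 // => cb _; rewrite (negPf jj') scaler0.
    apply: eq_bigr => a _; rewrite pair_bigA; apply: eq_bigr => -[c b] _ /=.
    by rewrite eqxx.
  have -> : \sum_(z : 'I_Z * 'I_((l + 1) * Q)) v (inr z) *: Bs i j (inr z) =
      - (la i * (sg (M - i) j \Po 'X^(q ^ i))).
    transitivity (\sum_(i' < Z) \sum_(a < (l + 1) * Q) v (inr (i', a)) *: Bs i j (inr (i', a))).
      by rewrite [RHS]pair_bigA; apply: eq_bigr => -[].
    rewrite (bigD1 i) //= [X in _ + X]big1 ?addr0 => [|i' ii']; last first.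
      by rewrite big1 // => a _; rewrite (negPf ii') scaler0.
    rewrite eqxx /la mulr_suml -sumrN; apply: eq_bigr => a _.
    by rewrite scalerN -scalerAl.
  by move/eqP; rewrite subr_eq0 => /eqP.
have val (i : 'I_Z) (j : 'I_l) : \sum_(a < H) \sum_(c < Q) \sum_(b < N) CK (v (inl ((j, a), (c, b)))) *
    (wK ^+ (a * Q + c) * wK ^- (q ^ i * b)) =
    wK ^+ (Q * H - 1) * (evt 1 (la i) * evt 1 (sg (M - i) j) ^+ (q ^ i)) :> K.
  have -> : evt 1 (la i) * evt 1 (sg (M - i) j) ^+ (q ^ i) =
      evt 1 (la i * (sg (M - i) j \Po 'X^(q ^ i))).
    by rewrite rmorphM /= evt_comp -evt_frob mul1n.
  rewrite -P1 rmorph_sum mulr_sumr; apply: eq_bigr => a _.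
  rewrite rmorph_sum mulr_sumr; apply: eq_bigr => c _.
  rewrite rmorph_sum mulr_sumr; apply: eq_bigr => b _ /=.
  rewrite evtZXn [RHS]mulrCA; congr (_ * _); rewrite /ex /= mul1n [in RHS]exprD invfM mulrA [(b * _)%N]mulnC.
  congr (_ * _); have := acH a c; move: (a * Q + c)%N (Q * H - 1)%N => c1 c2 le.
  by rewrite -expfB_cond ?(negPf (wK_neq0 F)) ?leq_subr // subKn.
pose G (c : nat) : S := \sum_j \sum_(a < H)
  pu ((if insub c is Some c' then Ec j a c' else 0)%:P * 'X^a) * psi j.
pose f : S := \sum_(c < Q) X ^+ c * fpow Q (G c).
have sEc j a c : (size (Ec j a c) <= N)%N.
  apply: leq_trans (size_sum _ _ _) _; apply/bigmax_leqP => b _.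
  by apply: leq_trans (size_scale_leq _ _) _; rewrite size_polyXn.
have GE (c : 'I_Q) n : G c n = \sum_(ja : 'I_l * 'I_H) tofrac (Ec ja.1 ja.2 c) * (X ^+ ja.2 * psi ja.1) n.
  rewrite (sum_pair (fun j (a : 'I_H) => tofrac (Ec j a c) * (X ^+ a * psi j) n)) /G powser_sumE.
  apply: eq_bigr => j _; rewrite powser_sumE; apply: eq_bigr => a _.
  by rewrite valK pu_CXn -mulrA powserCM_coef.
have van (i : 'I_Z) : evr (q ^ i) f 0.
  have iM : (i <= M)%N by have := ltn_ord i; rewrite /M; lia.
  pose y j := x (M - i) j ^+ (q ^ i).
  have yE j : evr (q ^ i) (fpow Q (psi j)) (y j).
    have := evr_frob i (xE (M - i) j); rewrite mul1n fpow_comp ?q_exp_gt0 //.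
    by rewrite -expnD subnKC.
  have E : evr (q ^ i) f (\sum_(c < Q) wK ^+ c * \sum_j \sum_(a < H)
      (evt (q ^ i) (Ec j a c) * wK ^+ (Q * a)) * y j).
    apply: evr_sum => c _; apply: evrM.
      exact: evr_Xn.
    rewrite /G rmorph_sum; apply: evr_sum => j _; rewrite rmorph_sum; apply: evr_sum => a _.
    rewrite rmorphM; apply: evrM; last exact: yE.
    by rewrite /= fpow_pu // valK; apply: evr_CXn.
  suff E0 : \sum_(c < Q) wK ^+ c * \sum_j \sum_(a < H)
      (evt (q ^ i) (Ec j a c) * wK ^+ (Q * a)) * y j = 0 by rewrite E0 in E.
  transitivity (\sum_j (\sum_(a < H) \sum_(c < Q) \sum_(b < N) CK (v (inl ((j, a), (c, b)))) *
    (wK ^+ (a * Q + c) * wK ^- (q ^ i * b))) * y j).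
    under eq_bigr => c _ do rewrite mulr_sumr.
    rewrite exchange_big; apply: eq_bigr => j _ /=.
    under eq_bigr => c _ do rewrite mulr_sumr.
    rewrite exchange_big mulr_suml; apply: eq_bigr => a _ /=.
    rewrite mulr_suml; apply: eq_bigr => c _.
    rewrite mulrA; congr (_ * _); rewrite rmorph_sum mulr_suml mulr_sumr.
    apply: eq_bigr => b _ /=; rewrite evtZXn [(a * Q)%N]mulnC exprD; ring.
  under eq_bigr => j _ do rewrite val.
  transitivity (wK ^+ (Q * H - 1) * (evt 1 (la i) *
    (\sum_j evt 1 (sg (M - i) j) * x (M - i) j) ^+ (q ^ i))).
    rewrite (frob_sum (@CK F)) !mulr_sumr; apply: eq_bigr => j _.
    by rewrite /y exprMn; ring.
  rewrite rel; last by rewrite /M; have := ltn_ord i; lia.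
  by rewrite expr0n gtn_eqF ?q_exp_gt0 // !mulr0.
have gro n : exists p : {poly F}, f n = tofrac p /\ (size p <= N + n %/ (2 * Q))%N.
  rewrite /f coef_digits // mulnC divnMA; set m := (n %/ Q)%N.
  rewrite (GE (Ordinal (ltn_pmod n Q0))); set c := Ordinal _.
  exists (\sum_(ja : 'I_l * 'I_H) if (ja.2 <= m)%N then Ec ja.1 ja.2 c * pp ja.1 (m - ja.2)%N else 0).
  split.
    rewrite rmorph_sum; apply: eq_bigr => ja _; rewrite powserXnM.
    case: ifP => _ /=; last by rewrite mulr0 tofrac0.
    by rewrite tofracM; have [-> _] := ppE ja.1 (m - ja.2)%N.
  apply: leq_trans (size_sum _ _ _) _; apply/bigmax_leqP => ja _.
  case: ifP => am; last by rewrite size_poly0.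
  apply: leq_trans (size_polyMleq _ _) _.
  have [_ sp] := ppE ja.1 (m - ja.2)%N; have se := sEc ja.1 ja.2 c.
  have aux (x1 x2 x3 x4 x5 : nat) : (x1 <= x2)%N -> (x3.*2 <= (x4 - x5).+2)%N ->
    (0 < x2)%N -> ((x1 + x3).-1 <= x2 + x4 %/ 2)%N by lia.
  exact: aux se sp _.
have [ph phE] := choice gro.
have ph0 n : (n < Q * g)%N -> ph n = 0.
  apply: (@schwarz F ph N g Q) => //.
  - by move: QM; rewrite -/Z -/D /M; lia.
  - by move=> n'; case: (phE n').
  - move=> i iZ; have [p pE pv] := van (Ordinal iZ).
    suff -> : ph = p by [].
    by apply/funext => n'; apply: tofrac_inj; rewrite -pE; case: (phE n').
have f0 n : (n < Q * g)%N -> f n = 0.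
  by move=> /ph0 E; case: (phE n) => -> _; rewrite E tofrac0.
(* If all E vanished, a nonzero multiplier times a nonzero relation would be zero. *)
have [y0 vy0] : exists y, v (inl y) != 0.
  case: u0 vu0 => [y vy|z vz]; first by exists y.
  apply: contrapT => /forallNP v0.
  have {}v0 y : v (inl y) = 0 by apply/eqP; have /negP := v0 y; rewrite negbK.
  have kM : (k0 <= M - z.1)%N by rewrite /M; have := ltn_ord z.1; lia.
  have [j sj] := sg0 kM.
  have := P1 z.1 j; rewrite big1 => [|a _]; last first.
    by rewrite big1 // => c _; rewrite big1 // => b _; rewrite v0 scale0r.
  move/eqP; rewrite eq_sym mulf_eq0 => /orP[/eqP l0|/eqP s0].
    have := congr1 (fun p : {poly F} => p`_z.2) l0; rewrite /la coef0 coef_sum.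
    rewrite (bigD1 z.2) //= coefZ coefXn eqxx mulr1 big1 ?addr0 => [E|i' ii'].
      by move: vz; case: (z) E => z1 z2 /= ->; rewrite eqxx.
    rewrite coefZ coefXn (_ : (_ == _) = false) ?mulr0 //.
    by apply: contraNF ii' => /eqP ii'; apply/eqP/val_inj.
  have := congr1 (@evt F 1) s0; rewrite evt_comp rmorph0 => /eqP.
  by rewrite (negPf (evt_eq0 (q_exp_gt0 F z.1) sj)).
case: y0 vy0 => [[j0 a0] [c0 b0]] vy0.
(* Since g = CH + 1, the vanishing range covers all exponents n Q + c0 with n < CH, that is, the
   first CH coefficients of the series of digit c0. *)
have E : tofrac (Ec j0 a0 c0) = 0 :> k.
  apply: (CHP (fun ja => tofrac (Ec ja.1 ja.2 c0)) _ (j0, a0)) => n nC; rewrite -GE.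
  have : f (n * Q + c0)%N = 0.
    apply: f0; rewrite /g mulnS addnC mulnC.
    have := ltn_ord c0; have : (Q * n.+1 <= Q * CH)%N by rewrite leq_mul2l nC orbT.
    rewrite mulnS; lia.
  by rewrite /f coef_digits // modnMDl modn_small // divnMDl // divn_small // addn0.
move/eqP: E; rewrite tofrac_eq0 => E.
move/eqP: E => /polyP/(_ b0); rewrite coef0 coef_sum (bigD1 b0) //= coefZ coefXn eqxx mulr1.
rewrite big1 ?addr0 => [E|i' ii']; first by rewrite E eqxx in vy0.
rewrite coefZ coefXn (_ : (_ == _) = false) ?mulr0 //.
by apply: contraNF ii' => /eqP ii'; apply/eqP/val_inj.
Qed.

End Independence.

(** * Lifting relations between values *)

Section Lift.
Variable F : finFieldType.
Local Notation q := #|F|.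
Local Notation k := {fraction {poly F}}.
Local Notation S := (powser k).
Local Notation X := (powserX k).
Local Notation K := (Kinf F).
Local Notation P2 := {poly {poly F}}.

(* value at t = 1/w, u = w^(q^m) *)
Definition spm (m : nat) (P : P2) : K := (map_poly (evt 1) P).[wK ^+ (q ^ m)].

Lemma spm_is_zmod_morphism m : zmod_morphism (spm m).
Proof. by move=> p p'; rewrite /spm rmorphB hornerD hornerN. Qed.
Lemma spm_is_monoid_morphism m : monoid_morphism (spm m).
Proof. by split=> [|p p']; rewrite /spm ?rmorph1 ?hornerC // rmorphM hornerM. Qed.
HB.instance Definition _ m := GRing.isZmodMorphism.Build P2 K (spm m) (spm_is_zmod_morphism m).
HB.instance Definition _ m := GRing.isMonoidMorphism.Build P2 K (spm m) (spm_is_monoid_morphism m).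

Lemma spmC m c : spm m c%:P = evt 1 c.
Proof. by rewrite /spm map_polyC hornerC. Qed.

Lemma spm_comp m P : spm 0 (P \Po 'X^(q ^ m)) = spm m P.
Proof. by rewrite /spm map_comp_poly map_polyXn horner_comp hornerXn expn0 expr1. Qed.

Lemma evr_spm m P : evr 1 (fpow (q ^ m) (pu P)) (spm m P).
Proof.
rewrite fpow_pu ?q_exp_gt0 // -spm_comp /spm expn0 expr1; exact: evr_pu.
Qed.

Lemma spm_sum m h (P : P2) : (size P <= h.+1)%N ->
  spm m P = \sum_(i < h.+1) evt 1 P`_i * wK ^+ (i * q ^ m).
Proof.
move=> sP; rewrite /spm (@horner_coef_wide _ h.+1) ?(leq_trans (size_poly _ _)) //.
by apply: eq_bigr => i _; rewrite coef_map -exprM mulnC.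
Qed.

(** Once q^m exceeds the degrees in t, the lowest power of u dominates. *)
Lemma spm_neq0 (P : P2) : P != 0 -> exists k0, forall m, (k0 <= m)%N -> spm m P != 0.
Proof.
move=> P0; have ex : exists i, P`_i != 0.
  by exists (size P).-1; rewrite -[_`_ _]/(lead_coef P) lead_coef_eq0.
have [i0 Pi0 mini] := ex_minnP ex.
apply: contrapT => /forallNP nk; have := evt_eq0 (isT : (0 < 1)%N) Pi0; apply/negP/negPn/eqP.
have [B hB] : exists B : nat, forall i, vge (- B%:Z) (evt 1 P`_i).
  exists (\max_(i < size P) size (P`_i)%R)%N => i.
  have [lt|ge] := ltnP i (size P); last by rewrite nth_default // rmorph0; apply: vge00.
  have := @vge_evt F 1 _ _ (leqnSn (size P`_i)); rewrite mul1n; apply: vge_weak.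
  by rewrite lerN2 lez_nat (leq_bigmax (Ordinal lt)).
apply: vge_all => n; have := nk (n + B)%N; move/existsNP => [m].
rewrite not_implyE => -[nm /negP]; rewrite negbK => /eqP E.
have qm : (n + B <= q ^ m)%N by apply: leq_trans nm _; apply/ltnW/ltn_expl/q_gt1.
have i0s : (i0 < size P)%N by rewrite ltnNge; apply: contra Pi0 => le; rewrite nth_default.
move: E; rewrite (@spm_sum m (size P)) // (bigD1 (inord i0)) //= inordK; last by rewrite ltnW.
move/eqP; rewrite addr_eq0 => /eqP E.
have -> : evt 1 P`_i0 = wK ^- (i0 * q ^ m) * (evt 1 P`_i0 * wK ^+ (i0 * q ^ m)).
  by rewrite mulrC mulfK // expf_neq0 // wK_neq0.
rewrite E mulrN mulr_sumr; apply: vgeN; apply: vge_sum => i ii0.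
have [lt|ge] := ltnP i i0.
  have -> : P`_i = 0 by apply/eqP; apply: contraTT lt => Pi; rewrite -leqNgt mini.
  by rewrite rmorph0 mul0r mulr0; apply: vge00.
have gt : (i0 < i)%N.
  rewrite ltn_neqAle ge andbT; apply: contra_neq ii0 => ->.
  by apply: val_inj; rewrite /= inordK.
rewrite mulrCA exprnN; apply: vge_weak (vgeM (hB i) (vgeM (vge_w _ _) (vge_wn _ _))).
have : (i0 * q ^ m + q ^ m <= i * q ^ m)%N by rewrite -mulSnr leq_mul2r gt orbT.
move: (i0 * q ^ m)%N (i * q ^ m)%N (q ^ m)%N qm => c1 c2 c3; lia.
Qed.

(* t^(h q^m) P(t, t^(-q^m)) *)
Definition sp (m h : nat) (P : P2) : {poly F} :=
  \sum_(i < h.+1) P`_i * 'X^((h - i) * q ^ m).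

Lemma evt_sp m h (P : P2) : (size P <= h.+1)%N -> evt 1 (sp m h P) = wK ^- (h * q ^ m) * spm m P.
Proof.
move=> sP; rewrite (spm_sum _ sP) rmorph_sum mulr_sumr; apply: eq_bigr => i _ /=.
rewrite rmorphM rmorphXn /= evtX mulrCA; congr (_ * _).
have E : (h * q ^ m = i * q ^ m + (h - i) * q ^ m)%N by rewrite -mulnDl subnKC // -ltnS.
by rewrite E expr1 exprD invfM mulrAC mulVf ?mul1r ?exprVn // expf_neq0 // wK_neq0.
Qed.

Lemma size_sp m h b (P : P2) : (forall i, (size (P`_i)%R <= b)%N) -> (size (sp m h P) <= b + h * q ^ m)%N.
Proof.
move=> sP; apply: leq_trans (size_sum _ _ _) _; apply/bigmax_leqP => i _.
apply: leq_trans (size_polyMleq _ _) _; rewrite size_polyXn addnS /=.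
by apply: leq_add => //; rewrite leq_mul2r leq_subr orbT.
Qed.

Lemma puN (P : P2) : pu (- P) = - pu P.
Proof. by apply: powserP => n; rewrite powserNE !puE coefN tofracN. Qed.

Lemma puB (P Q : P2) : pu (P - Q) = pu P - pu Q.
Proof. by apply: powserP => n; rewrite powserBE !puE coefB tofracB. Qed.

Section System.
Variables (I : finType) (psi : I -> S).
Hypothesis gpsi : forall i, gr (psi i).

Definition indep (J : {set I}) := forall E : I -> P2,
  \sum_(j in J) pu (E j) * psi j = 0 -> forall j, j \in J -> E j = 0.

Lemma basis_ex : exists (J : {set I}) (Den : P2) (T : I -> I -> P2),
  [/\ indep J, Den != 0 & forall i, pu Den * psi i = \sum_(j in J) pu (T i j) * psi j].
Proof.
pose P m := `[< exists2 J, indep J & #|J| = m >].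
have exP : exists m, P m.
  by exists 0%N; apply/asboolP; exists finset.set0; rewrite ?cards0 // => E _ j; rewrite inE.
have bdP m : P m -> (m <= #|I|)%N by move=> /asboolP[J _ <-]; apply: max_card.
have [m /asboolP[J iJ cJ] maxm] := ex_maxnP exP bdP.
have loc i : exists d (s : I -> P2), d != 0 /\ pu d * psi i = \sum_(j in J) pu (s j) * psi j.
  have [iJ'|niJ] := boolP (i \in J).
    exists 1, (fun j => (j == i)%:R); split; first exact: oner_neq0.
    rewrite rmorph1 mul1r (bigD1 i) //= eqxx rmorph1 mul1r big1 ?addr0 // => j /andP[_ ji].
    by rewrite (negPf ji) rmorph0 mul0r.
  have : ~ indep (i |: J).
    move=> iiJ; have : (#|i |: J| <= m)%N by apply: maxm; apply/asboolP; exists (i |: J).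
    by rewrite cardsU1 niJ cJ ltnn.
  move/existsNP => [E]; rewrite not_implyE big_setU1 //= => -[E0 /existsNP[j]].
  rewrite not_implyE => -[jJ Ej].
  have Ei : E i != 0.
    apply/eqP => Ei; apply: Ej; move: jJ; rewrite in_setU1 => /orP[/eqP->//|jJ].
    by apply: iJ jJ; rewrite -[RHS]E0 Ei rmorph0 mul0r add0r.
  exists (E i), (fun j => - E j); split=> //.
  move/eqP: E0; rewrite addr_eq0 => /eqP ->; rewrite -sumrN.
  apply: eq_bigr => j' _; rewrite -mulNr; congr (_ * _).
  by rewrite puN.
have [d dP] := choice loc; have [s sP] := choice dP.
exists J, (\prod_i d i), (fun i j => (\prod_(i' | i' != i) d i') * s i j); split=> //.
  by rewrite prodf_seq_neq0; apply/allP => i _; apply/implyP => _; case: (sP i).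
move=> i; rewrite (bigD1 i) //= rmorphM /= mulrAC; have [_ ->] := sP i.
by rewrite mulrC mulr_sumr; apply: eq_bigr => j _; rewrite rmorphM /= mulrA.
Qed.

Variables (de De : P2) (N N' : I -> I -> P2).
Hypothesis de0 : de != 0.
Hypothesis sys : forall i, pu de * psi i = \sum_j pu (N i j) * fpow q (psi j).
Hypothesis NN' : forall i j, \sum_l N i l * N' l j = De *+ (i == j).
Hypothesis N'N : forall i j, \sum_l N' i l * N l j = De *+ (i == j).
Hypothesis De0 : forall m, spm m De != 0.

Lemma fpowS m f : fpow (q ^ m) (fpow q f) = fpow (q ^ m.+1) f :> S.
Proof. by rewrite fpow_comp ?q_exp_gt0 ?(ltnW (q_gt1 F)) // -expnSr. Qed.

Lemma sys_m m i : fpow (q ^ m) (pu de) * fpow (q ^ m) (psi i) =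
  \sum_j fpow (q ^ m) (pu (N i j)) * fpow (q ^ m.+1) (psi j).
Proof.
have := congr1 (fpow (q ^ m)) (sys i); rewrite rmorphM rmorph_sum /= => ->.
by apply: eq_bigr => j _; rewrite rmorphM /= fpowS.
Qed.

Lemma inv_m m j : fpow (q ^ m) (pu De) * fpow (q ^ m.+1) (psi j) =
  fpow (q ^ m) (pu de) * \sum_i fpow (q ^ m) (pu (N' j i)) * fpow (q ^ m) (psi i).
Proof.
rewrite mulr_sumr.
under [RHS]eq_bigr => i _ do rewrite mulrCA sys_m mulr_sumr.
rewrite exchange_big /=; under [RHS]eq_bigr => l _ do under eq_bigr => i _ do rewrite mulrA.
under [RHS]eq_bigr => l _ do rewrite -mulr_suml.
have E l : \sum_i fpow (q ^ m) (pu (N' j i)) * fpow (q ^ m) (pu (N i l)) = fpow (q ^ m) (pu (De *+ (j == l))).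
  by rewrite -N'N !rmorph_sum; apply: eq_bigr => i _; rewrite !rmorphM.
under [RHS]eq_bigr => l _ do rewrite E.
rewrite (bigD1 j) //= eqxx mulr1n big1 ?addr0 // => l lj.
by rewrite eq_sym (negPf lj) mulr0n !rmorph0 mul0r.
Qed.

Variables (rho : I -> {poly F}) (x0 : I -> K).
Hypothesis x0E : forall i, evr 1 (psi i) (x0 i).
Hypothesis rel0 : \sum_i evt 1 (rho i) * x0 i = 0.

Let h := (\max_i \max_j size (N i j))%N.
Let b := (\max_i \max_j \max_(a < size (N i j)) size ((N i j)`_a)%R)%N.
Let sN i j : (size (N i j) <= h.+1)%N.
Proof. by apply/leqW; apply: leq_trans (leq_bigmax i); apply: leq_bigmax. Qed.
Let bN i j a : (size ((N i j)`_a)%R <= b)%N.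
Proof.
have [lt|ge] := ltnP a (size (N i j)); last by rewrite nth_default // size_poly0.
apply: leq_trans (leq_bigmax i); apply: leq_trans (leq_bigmax j).
exact: (leq_bigmax (Ordinal lt)).
Qed.

(** The given relation pushed through the system to level m. The powers of t inside [sp] clear
    denominators, and sizes stay of order q^m, as [values_independent] demands. *)
Fixpoint rhos (m : nat) : I -> {poly F} :=
  if m is m'.+1 then fun j => \sum_i rhos m' i * sp m' h (N i j) else rho.

Lemma evt_rhos m j : evt 1 (rhos m.+1 j) =
  wK ^- (h * q ^ m) * \sum_i evt 1 (rhos m i) * spm m (N i j).
Proof.
rewrite /= rmorph_sum mulr_sumr; apply: eq_bigr => i _.
by rewrite rmorphM /= evt_sp // mulrCA.
Qed.

Let C1 := (\max_i size (rho i) + b + h)%N.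
Lemma size_rhos m j : (size (rhos m j) <= C1 * q ^ m)%N.
Proof.
elim: m j => [|m IH] j.
  rewrite expn0 muln1 /C1 -addnA; apply: leq_trans (leq_addr _ _).
  exact: (leq_bigmax j).
apply: leq_trans (size_sum _ _ _) _; apply/bigmax_leqP => i _.
apply: leq_trans (size_polyMleq _ _) _; apply: leq_trans (leq_pred _) _.
apply: leq_trans (leq_add (IH i) (size_sp m h (bN i j))) _.
have q1 := q_gt1 F; have qm := q_exp_gt0 F m; rewrite expnS.
have : (b + h * q ^ m <= C1 * q ^ m)%N.
  rewrite /C1 !mulnDl; have : (b <= b * q ^ m)%N by rewrite leq_pmulr.
  by lia.
have : (C1 * q ^ m * 2 <= C1 * q ^ m * q)%N by rewrite leq_mul2l q1 orbT.
rewrite (mulnCA C1) [(q * _)%N]mulnC; lia.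
Qed.

Lemma rhos_rel m (x : I -> K) : (forall i, evr 1 (fpow (q ^ m) (psi i)) (x i)) ->
  \sum_i evt 1 (rhos m i) * x i = 0.
Proof.
elim: m x => [|m IH] x xE.
  rewrite -[RHS]rel0; apply: eq_bigr => i _; congr (_ * _).
  by apply: evr_uniq (x0E i); have := xE i; rewrite expn0 fpow1.
have [y yE] : exists y : I -> K, forall i, evr 1 (fpow (q ^ m) (psi i)) (y i).
  have ex i : exists y, evr 1 (fpow (q ^ m) (psi i)) y.
    apply: evr_gr => //; first exact: q_exp_gt0.
    by have := q_exp_gt0 F m; lia.
  by have [y yE] := choice ex; exists y.
have E i : spm m de * y i = \sum_j spm m (N i j) * x j.
  apply: (@evr_uniq _ 1 (fpow (q ^ m) (pu de) * fpow (q ^ m) (psi i))).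
    by apply: evrM => //; apply: evr_spm.
  by rewrite sys_m; apply: evr_sum => j _; apply: evrM => //; apply: evr_spm.
transitivity (wK ^- (h * q ^ m) * (spm m de * \sum_i evt 1 (rhos m i) * y i)).
  under eq_bigr => j _ do rewrite evt_rhos -mulrA mulr_suml.
  rewrite -mulr_sumr; congr (_ * _); rewrite exchange_big /= mulr_sumr; apply: eq_bigr => i _.
  by rewrite mulrCA E mulr_sumr; apply: eq_bigr => j _; rewrite mulrA.
by rewrite IH // !mulr0.
Qed.

Let claim m := exists (R : I -> P2) (c : K), [/\ c != 0,
  \sum_i pu (R i) * fpow (q ^ m) (psi i) = 0 &
  forall i, spm 0 (R i) = c * evt 1 (rhos m i)].

(** N', which inverts N up to De, undoes one multiplication in [rhos]; the factor [spm m De] joins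
    the constant and is nonzero. *)
Let claim_down m : claim m.+1 -> claim m.
Proof.
move=> [R [c [c0 R0 Rc]]].
exists (fun i => \sum_j R j * (N' j i \Po 'X^(q ^ m))), (c * wK ^- (h * q ^ m) * spm m De); split.
- by rewrite !mulf_neq0 ?invr_eq0 ?expf_neq0 ?wK_neq0.
- have d0 : fpow (q ^ m) (pu de) != 0.
    by apply: contra_neq de0 => /fpow_eq0/pu_eq0.
  apply: (mulfI d0); transitivity (fpow (q ^ m) (pu De) *
      \sum_j pu (R j) * fpow (q ^ m.+1) (psi j)); last by rewrite R0 !mulr0.
  rewrite !mulr_sumr.
  under eq_bigr => i _ do rewrite rmorph_sum mulr_suml mulr_sumr.
  rewrite exchange_big /=; apply: eq_bigr => j _.
  rewrite [RHS]mulrCA inv_m !mulr_sumr; apply: eq_bigr => i _.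
  by rewrite rmorphM /= -fpow_pu ?q_exp_gt0 // [RHS]mulrCA !mulrA.
- move=> i; rewrite rmorph_sum /=.
  under eq_bigr => j _ do rewrite rmorphM /= spm_comp Rc evt_rhos -!mulrA.
  rewrite -mulr_sumr -!mulrA; congr (_ * _); rewrite -mulr_sumr; congr (_ * _).
  under eq_bigr => j _ do rewrite mulr_suml.
  rewrite exchange_big /=; under eq_bigr => l _ do under eq_bigr => j _ do rewrite -mulrA.
  under eq_bigr => l _ do rewrite -mulr_sumr.
  have E l : \sum_j spm m (N l j) * spm m (N' j i) = spm m (De *+ (l == i)).
    by rewrite -NN' rmorph_sum; apply: eq_bigr => j _; rewrite rmorphM.
  under eq_bigr => l _ do rewrite E.
  rewrite (bigD1 i) //= eqxx mulr1n big1 ?addr0 1?mulrC // => l li.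
  by rewrite (negPf li) mulr0n rmorph0 mulr0.
Qed.

(** Rewritten in a maximal independent subset J, the relations [rhos m] cannot be nonzero for all
    large m, by [values_independent]. Where one becomes trivial, the numerical relation is a
    consequence of the functional dependence on J, hence it lifts; [claim_down] carries the lift
    back to level 0. *)
Theorem lift_relation : exists (R : I -> P2) (c : K), [/\ c != 0,
  \sum_i pu (R i) * psi i = 0 & forall i, spm 0 (R i) = c * evt 1 (rho i)].
Proof.
suff [m hm] : exists m, claim m.
  elim: m hm => [|m IH] hm; last by apply/IH/claim_down.
  have [R [c [c0 R0 Rc]]] := hm; exists R, c; split=> //.
  by rewrite -[RHS]R0; apply: eq_bigr => i _; rewrite expn0 fpow1.
have [J [Den [T [iJ Den0 TE]]]] := basis_ex.
have [k0 k0P] := spm_neq0 Den0.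
pose h' := (\max_i \max_j size (T i j))%N.
pose b' := (\max_i \max_j \max_(a < size (T i j)) size ((T i j)`_a)%R)%N.
have sT i j : (size (T i j) <= h'.+1)%N.
  by apply/leqW; apply: leq_trans (leq_bigmax i); apply: leq_bigmax.
have bT i j a : (size ((T i j)`_a)%R <= b')%N.
  have [lt|ge] := ltnP a (size (T i j)); last by rewrite nth_default // size_poly0.
  apply: leq_trans (leq_bigmax i); apply: leq_trans (leq_bigmax j).
  exact: (leq_bigmax (Ordinal lt)).
pose sg m (j : 'I_#|J|) := \sum_i rhos m i * sp m h' (T i (enum_val j)).
have esg m j : evt 1 (sg m j) = wK ^- (h' * q ^ m) * \sum_i evt 1 (rhos m i) * spm m (T i (enum_val j)).
  rewrite /sg rmorph_sum mulr_sumr; apply: eq_bigr => i _.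
  by rewrite rmorphM /= evt_sp // mulrCA.
have [m [km sg0]] : exists m, (k0 <= m)%N /\ forall j, sg m j = 0.
  apply: contrapT => /forallNP nm.
  have [x xE] : exists x : nat -> I -> K, forall m i, evr 1 (fpow (q ^ m) (psi i)) (x m i).
    have ex (mi : nat * I) : exists y, evr 1 (fpow (q ^ mi.1) (psi mi.2)) y.
      apply: evr_gr => //; first exact: q_exp_gt0.
      by have := q_exp_gt0 F mi.1; lia.
    by have [y yE] := choice ex; exists (fun m i => y (m, i)) => m i; apply: (yE (m, i)).
  apply: (@values_independent F #|J| (fun j => psi (enum_val j)) (C1 + b' + h') k0 sg
     (fun m j => x m (enum_val j))) => //.
  - move=> E E0 j; pose E' i := \sum_j (if enum_val j == i then E j else 0).
    have EE j' : E' (enum_val j') = E j'.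
      rewrite /E' (bigD1 j') //= eqxx big1 ?addr0 // => l lj.
      by rewrite (inj_eq enum_val_inj) (negPf lj).
    rewrite -EE; apply: iJ; last exact: enum_valP.
    by rewrite big_enum_val -[RHS]E0; apply: eq_bigr => j' _; rewrite EE.
  - move=> m km; apply: contrapT => /forallNP n0; apply: (nm m); split=> // j.
    by apply/eqP; have /negP := n0 j; rewrite negbK.
  - move=> m j; apply: leq_trans (size_sum _ _ _) _; apply/bigmax_leqP => i _.
    apply: leq_trans (size_polyMleq _ _) _; apply: leq_trans (leq_pred _) _.
    apply: leq_trans (leq_add (size_rhos m i) (size_sp m h' (bT i _))) _.
    rewrite !mulnDl; have : (b' <= b' * q ^ m)%N by rewrite leq_pmulr // q_exp_gt0.
    by lia.
  - move=> m km; have E i : spm m Den * x m i = \sum_(j < #|J|) spm m (T i (enum_val j)) * x m (enum_val j).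
      apply: (@evr_uniq _ 1 (fpow (q ^ m) (pu Den * psi i))).
        by rewrite rmorphM /=; apply: evrM => //; exact: evr_spm.
      rewrite TE big_enum_val rmorph_sum; apply: evr_sum => j _; rewrite rmorphM /=.
      by apply: evrM => //; exact: evr_spm.
    transitivity (wK ^- (h' * q ^ m) * (spm m Den * \sum_i evt 1 (rhos m i) * x m i)).
      under eq_bigr => j _ do rewrite esg -mulrA mulr_suml.
      rewrite -mulr_sumr; congr (_ * _); rewrite exchange_big /= mulr_sumr; apply: eq_bigr => i _.
      by rewrite mulrCA E mulr_sumr; apply: eq_bigr => j _; rewrite mulrA.
    by rewrite rhos_rel // !mulr0.
have sT0 j : j \in J -> \sum_i evt 1 (rhos m i) * spm m (T i j) = 0.
  move=> jJ; have := esg m (enum_rank_in jJ j); rewrite sg0 rmorph0 enum_rankK_in //.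
  move/eqP; rewrite eq_sym mulf_eq0 invr_eq0 expf_eq0 (negPf (wK_neq0 F)) andbF /=.
  by move/eqP.
(* Each function minus its expression in J, weighted by [rhos m]. The sum vanishes identically, and
   the J-part specializes to 0 because [sg m] is zero. *)
pose R i : P2 := Den * (rhos m i)%:P - (if i \in J then \sum_l (rhos m l)%:P * T l i else 0).
exists m, (fun i => R i \Po 'X^(q ^ m)), (spm m Den); split.
- exact: k0P.
- have E0 : \sum_i pu (R i) * psi i = 0.
    rewrite /R; under eq_bigr => i _ do rewrite puB mulrBl.
    rewrite sumrB; apply/eqP; rewrite subr_eq0; apply/eqP.
    transitivity (\sum_i pu (rhos m i)%:P * (pu Den * psi i)).
      by apply: eq_bigr => i _; rewrite rmorphM mulrAC mulrC.
    under eq_bigr => i _ do rewrite TE mulr_sumr.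
    rewrite exchange_big /= [RHS](bigID (mem J)) /= [X in _ + X]big1 ?addr0 => [|i /negPf->]; last first.
      by rewrite rmorph0 mul0r.
    apply: eq_bigr => j ->; rewrite rmorph_sum mulr_suml; apply: eq_bigr => l _.
    by rewrite rmorphM mulrA.
  have := congr1 (fpow (q ^ m)) E0; rewrite rmorph0 rmorph_sum => E; rewrite -[RHS]E.
  by apply: eq_bigr => i _; rewrite rmorphM /= fpow_pu ?q_exp_gt0.
- move=> i; rewrite spm_comp /R rmorphB rmorphM /= spmC.
  case: ifP => iJ'; last by rewrite rmorph0 subr0.
  rewrite rmorph_sum /=; under eq_bigr => l _ do rewrite rmorphM /= spmC.
  by rewrite sT0 // subr0.
Qed.

End System.
End Lift.

(** * From the determinant to a difference equation *)

Lemma strong_rec (A : Type) (a0 : A) (Phi : nat -> (nat -> A) -> A) :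
  (forall m f g, (forall i, (i < m)%N -> f i = g i) -> Phi m f = Phi m g) ->
  exists y, forall m, y m = Phi m y.
Proof.
move=> Pext; pose yt := fix yt n : nat -> A :=
  if n is n'.+1 then fun m => if m == n' then Phi n' (yt n') else yt n' m else fun=> a0.
pose y m := yt m.+1 m.
have ytE n i : (i < n)%N -> yt n i = y i.
  elim: n => // n IH; rewrite ltnS leq_eqVlt => /orP[/eqP->//|lt].
  by rewrite -IH // [LHS]/= ltn_eqF.
by exists y => m; rewrite {1}/y /= eqxx; apply: Pext => i; exact: ytE.
Qed.

(** If the determinant is nonzero, the rows defined over k are independent. A column change over k
    brings them to the form (C, 0); the determinant is then that of the other rows on the kernel, up
    to a factor from k. *)
Lemma kernel_det (k K : fieldType) (f : {rmorphism k -> K}) (T : finType) (s : nat)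
    (Con : T -> T + 'I_s -> k) (lam : 'I_s -> T + 'I_s -> K) :
  let M a b := match a with inl x => f (Con x b) | inr i => lam i b end in
  fdet M != 0 -> exists c (N0 : T + 'I_s -> 'I_s -> k),
  [/\ c != 0, forall x j, \sum_b Con x b * N0 b j = 0
    & fdet M = f c * \det (\matrix_(i, j) \sum_b lam i b * f (N0 b j))].
Proof.
move=> M M0; pose n := #|T|.
pose h (i : 'I_(n + s)) : T + 'I_s :=
  match split i with inl a => inl (enum_val a) | inr b => inr b end.
pose g (b : T + 'I_s) : 'I_(n + s) :=
  match b with inl x => lshift s (enum_rank x) | inr i => rshift n i end.
have hK : cancel h g.
  move=> i; rewrite /h /g -[RHS](splitK i); case: (split i) => a //=.
  by rewrite enum_valK.
have gK : cancel g h.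
  move=> [x|i]; rewrite /h /g; first by rewrite (unsplitK (inl _)) /= enum_rankK.
  by rewrite (unsplitK (inr _)).
have hb : bijective h by exists g.
pose A := \matrix_(i < n, j < n + s) Con (enum_val i) (h j).
pose L := \matrix_(i < s, j < n + s) lam i (h j).
have dE : fdet M = \det (col_mx (map_mx f A) L).
  rewrite (fdet_repr _ hb); congr determinant; apply/matrixP => i j.
  rewrite -(splitK i); case: (split i) => a; rewrite !mxE ?unsplitK.
    by rewrite /h unsplitK /= !mxE.
  by rewrite /h unsplitK /= !mxE.
have uM : col_mx (map_mx f A) L \in unitmx by rewrite unitmxE unitfE -dE.
have fA : row_free A.
  rewrite -(row_free_map f); apply/row_freeP.
  exists (lsubmx (invmx (col_mx (map_mx f A) L))).
  have /(congr1 ulsubmx) := mulmxV uM.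
  rewrite [X in _ = ulsubmx X]scalar_mx_block block_mxKul => E; rewrite -[RHS]E.
  by rewrite mul_col_mx -[in RHS](hsubmxK (invmx _)) !mul_mx_row /ulsubmx col_mxKu row_mxKl.
have rA : \rank A = n by apply/eqP.
pose Rb := row_ebase A; pose Cb := col_ebase A.
have AR : A *m invmx Rb = row_mx Cb 0.
  rewrite -{1}(mulmx_ebase A) mulmxK ?row_ebase_unit // rA pid_mx_row.
  by rewrite mul_mx_row mulmx1 mulmx0.
pose N1 : 'M[k]_(n + s, s) := invmx Rb *m col_mx 0 1%:M.
have AN : A *m N1 = 0 by rewrite /N1 mulmxA AR mul_row_col mulmx0 mul0mx addr0.
have E : col_mx (map_mx f A) L *m map_mx f (invmx Rb) =
    block_mx (map_mx f Cb) 0 (lsubmx (L *m map_mx f (invmx Rb))) (L *m map_mx f N1).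
  rewrite mul_col_mx -map_mxM AR map_row_mx map_mx0 /block_mx; congr col_mx.
  rewrite -[LHS]hsubmxK; congr row_mx; rewrite /N1 map_mxM mulmxA.
  rewrite -{2}(hsubmxK (L *m map_mx f (invmx Rb))) map_col_mx map_mx0 map_mx1.
  by rewrite mul_row_col mulmx0 add0r mulmx1.
have dR : \det Rb != 0 by rewrite -unitfE -unitmxE row_ebase_unit.
have fE : fdet M = f (\det Cb * \det Rb) * \det (L *m map_mx f N1).
  have := congr1 determinant E; rewrite det_mulmx det_lblock -dE !det_map_mx det_inv fmorphV.
  by move=> /(canRL (mulfVK _)); rewrite fmorph_eq0 => -> //; rewrite rmorphM mulrAC.
exists (\det Cb * \det Rb), (fun b j => N1 (g b) j); split.
- by move: M0; rewrite fE mulf_eq0 fmorph_eq0 negb_or => /andP[].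
- move=> x j; rewrite (reindex h) /=; last exact: onW_bij.
  have /matrixP/(_ (enum_rank x) j) := AN; rewrite [RHS]mxE => E0; rewrite -[RHS]E0 mxE.
  by apply: eq_bigr => i _; rewrite [A _ _]mxE enum_rankK hK.
- rewrite fE; congr (_ * \det _); apply/matrixP => i j; rewrite !mxE.
  rewrite [RHS](reindex h) /=; last exact: onW_bij.
  by apply: eq_bigr => l _; rewrite !mxE hK.
Qed.

Section ClDt.
Variables (R : comNzRingType) (Z : R).

Lemma cl_dt s c N (E E' : nat -> nat -> 'I_s -> 'I_s -> R) :
  (forall m i p p', (m < c)%N -> cl Z N (E m i p p') (E' m i p p')) ->
  cl Z N (dt c E) (dt c E').
Proof.
move=> EE; apply: cl_fdet => a b; apply: clB; first exact: cl_refl.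
exact: EE.
Qed.

Lemma cl_dt_stable s h c N (E : nat -> nat -> 'I_s -> 'I_s -> R) :
  (forall m i p p', (h <= i)%N -> (m <= i)%N -> cl Z N (E m i p p') 0) ->
  (h <= c)%N -> cl Z N (dt c E) (dt h E).
Proof.
move=> E0 hc.
pose E1 m i p p' := if (h <= i)%N && (m <= i)%N then 0 else E m i p p'.
have -> : dt h E = dt h E1.
  by apply: eq_fdet => a b; rewrite /E1 leqNgt ltn_ord.
rewrite -(@dt_stable _ _ h c E1) //; last first.
  by move=> m i p p' hi mi; rewrite /E1 hi mi.
apply: cl_dt => m i p p' _; rewrite /E1; case: ifP => [/andP[hi mi]|_]; last exact: cl_refl.
exact: E0.
Qed.

End ClDt.

(** * The determinant of an operator with a simple pole as a determinant of limits *)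

Section Limit.
Variables (F : finFieldType) (s e : nat) (Bs : seq (nat * 'M[{poly {poly F}}]_s)).
Local Notation q := #|F|.
Local Notation W := (powser F).
Local Notation X := (powserX F).
Local Notation K := (Kinf F).
Hypotheses (e0 : (0 < e)%N) (pB : posj Bs).
Hypothesis sB : forall x p p' i, x \in Bs -> (size ((x.2 p p')`_i)%R <= e.+1)%N.

Lemma rv_is_zmod_morphism a n : zmod_morphism (@rv F a n).
Proof.
by move=> p p'; rewrite /rv -sumrB; apply: eq_bigr => i _; rewrite coefB rmorphB mulrBl.
Qed.
HB.instance Definition _ a n := GRing.isZmodMorphism.Build {poly F} W (@rv F a n)
  (rv_is_zmod_morphism a n).

Definition geomN (N : nat) : {poly W} := \sum_(a < N) X ^+ (e * a) *: 'X^a.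
(** (t^e - theta)^(-1) B tau^j with w = 1/t: [geomN] truncates (1 - w^e theta)^(-1), and [rv 1 e] is
    w^e times evaluation at t = 1/w. *)
Definition opnN (N : nat) : seq (nat * 'M[{poly W}]_s) :=
  [seq (x.1, geomN N *: map_mx (map_poly (rv 1 e)) x.2) | x <- Bs].

Local Notation C := (Mop q Bs).
Local Notation h := (hd Bs).

Let Cfar m i p p' : (m.+1 + h <= i.+1.*2)%N -> C m i p p' = 0.
Proof. by move=> far; apply: Mop_far => //; exact: q_gt1. Qed.

Let sC m i p p' : (size (C m i p p') <= e.+1)%N.
Proof.
rewrite /Mop big_seq.
apply: (big_ind (fun p : {poly F} => (size p <= e.+1)%N)) => [|p1 p2 h1 h2|x xB].
- by rewrite size_poly0.
- by apply: leq_trans (size_polyD _ _) _; rewrite geq_max h1.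
rewrite coef_kap ?q_exp_gt0 // coefXnM.
by case: ifP => _; rewrite ?size_poly0 // sB.
Qed.

Let Sm n m i p p' : W := \sum_(a < n) X ^+ (e * a) * rv 1 e (C (m + a) i p p').

Lemma Mop_opnN N m i p p' : Mop q (opnN N) m i p p' = Sm N m i p p'.
Proof.
rewrite /Mop big_map /Sm.
under [RHS]eq_bigr => a _ do rewrite /Mop raddf_sum mulr_sumr.
rewrite exchange_big /=; apply: eq_bigr => x _.
rewrite !mxE /geomN mulr_suml mulr_sumr kap_sum ?q_exp_gt0 // coef_sum.
apply: eq_bigr => a _; rewrite -scalerAl -scalerAr kapZ ?q_exp_gt0 // coefZ; congr (_ * _).
rewrite mulrA -exprD !coef_kap ?q_exp_gt0 // !coefXnM; case: ifP => _; first by rewrite raddf0.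
by rewrite coef_map.
Qed.

Lemma posj_opnN N : posj (opnN N).
Proof. by apply/allP => x /mapP[y yB ->] /=; apply: (allP pB). Qed.

Let clX0 N a (y : W) : (N <= a)%N -> cl X N (X ^+ (e * a) * y) 0.
Proof.
move=> Na; have le : (N <= e * a)%N by apply: leq_trans Na _; rewrite leq_pmull.
by exists (X ^+ (e * a - N) * y); rewrite subr0 mulrA -exprD subnKC.
Qed.

Let Sm_low N n m i p p' : (N + h + 1 <= i)%N -> (m <= i)%N -> cl X N (Sm n m i p p') 0.
Proof.
move=> hi mi; have E0 : \sum_(a < n) 0 = 0 :> W by rewrite big1.
rewrite /Sm -[X in cl _ _ _ X]E0; apply: cl_sum => a _.
have [Na|aN] := leqP N a; first exact: clX0.
by rewrite Cfar ?raddf0 ?mulr0; [exact: cl_refl|lia].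
Qed.

Let Sm_trunc N n m i p p' : (N <= n)%N -> cl X N (Sm n m i p p') (Sm N m i p p').
Proof.
move=> Nn; rewrite /Sm -(big_mkord xpredT (fun a => X ^+ (e * a) * rv 1 e (C (m + a) i p p'))).
rewrite (@big_cat_nat _ _ _ N) //= big_mkord -[X in cl _ _ _ X]addr0.
apply: clD; first exact: cl_refl.
have E0 : \sum_(N <= a < n | (N <= a < n)%N) 0 = 0 :> W by rewrite big1.
rewrite big_nat -[X in cl _ _ _ X]E0; apply: cl_sum => a /andP[Na _].
exact: clX0.
Qed.

(** Row m is cut after c - m terms, so that conjugation by powers of w^e turns every row into a tail
    sum of one and the same sequence ([dt_conj]). Modulo w^N the change is harmless for c large. *)
Let E' c m i p p' : W := Sm (c - m) m i p p'.

Variable l : W.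
Hypothesis lE : forall N, cl X N l (detop q (opnN N)).

Lemma dt_limit N : exists c1, forall c, (c1 <= c)%N -> cl X N l (dt c (E' c)).
Proof.
pose c1 := (N + h + 1)%N; exists (hd (opnN N) + c1 + N)%N => c cc.
apply: cl_trans (lE N) _.
rewrite (@detopE _ _ (q_gt1 F) _ (opnN N) c (posj_opnN N)); last by apply: leq_trans cc; rewrite -addnA leq_addr.
have c1c : (c1 <= c)%N by lia.
have -> : dt c (Mop q (opnN N)) = dt c (Sm N) by apply: eq_dt => *; apply: Mop_opnN.
apply: (@cl_trans _ _ _ (dt c1 (Sm N))).
  by apply: cl_dt_stable => // m i p p'; apply: Sm_low.
apply: (@cl_trans _ _ _ (dt c1 (E' c))).
  by apply: cl_dt => m i p p' mc; apply: cl_sym; apply: Sm_trunc; lia.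
by apply: cl_sym; apply: cl_dt_stable => // m i p p'; apply: Sm_low.
Qed.

Let Cp l i p p' : K := wK ^+ (e * l.+1) * wK ^- (e * i) * evt 1 (C l i p p').

Lemma tofrac_rv (p : {poly F}) : (size p <= e.+1)%N -> tofrac (rv 1 e p) = wK ^+ e * evt 1 p.
Proof.
by move=> sp; rewrite (evt_rv 1 sp) mul1n mulrA divff ?mul1r // expf_neq0 // wK_neq0.
Qed.

Lemma dt_conj c : tofrac (dt c (E' c)) =
  fdet (fun a b : 'I_c * 'I_s => (a == b)%:R - \sum_(a.1 <= l0 < c) Cp l0 b.1 a.2 b.2).
Proof.
rewrite /dt fdet_map.
apply: (@fdet_intertwine _ _ _ _ _
   (fun a b : 'I_c * 'I_s => (a == b)%:R * wK ^- (e * b.1))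
   (fun a b : 'I_c * 'I_s => (a == b)%:R * wK ^+ (e * b.1))).
- move=> a b; under eq_bigr => j _ do rewrite -mulrA.
  rewrite sum_delta; case: eqP => [->|_]; last by rewrite mul0r mulr0.
  by rewrite mul1r mulVf // expf_neq0 // wK_neq0.
- move=> a b; under eq_bigr => j _ do rewrite -mulrA.
  rewrite sum_delta; case: eqP => [->|_]; last by rewrite mul0r mulr0.
  by rewrite mul1r mulfV // expf_neq0 // wK_neq0.
move=> a b; under eq_bigr => j _ do rewrite mulrA.
under [RHS]eq_bigr => j _ do rewrite -mulrA.
rewrite sum_delta -mulr_suml sum_delta_r rmorphB rmorph_nat mulrBl mulrBr; congr (_ - _).
  by case: eqP => [->|_]; rewrite ?mul0r ?mulr0 // mul1r mulr1.
rewrite /E' /Sm rmorph_sum mulr_suml mulr_sumr.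
rewrite -[X in \sum_(X <= _ < _) _]add0n big_addn big_mkord; apply: eq_bigr => j _.
rewrite rmorphM rmorphXn /= tofrac_rv ?sC // -/wK /Cp [(j + _)%N]addnC.
have -> : (e * (a.1 + j).+1 = e * a.1 + (e * j + e))%N by rewrite -addnS mulnDr mulnS [(e + _)%N]addnC.
rewrite !exprD; set A := evt 1 _; set B := wK ^- (e * b.1).
have u : wK ^+ (e * a.1) != 0 :> K by rewrite expf_neq0 // wK_neq0.
rewrite -[LHS](mulVKf u); ring.
Qed.

Local Notation T0 := ('I_h.+1 * 'I_s)%type.

(** The range ends at (m + h) / 2 because the later entries of C vanish; hence for m >= h only
    indices up to m occur and the recursion is explicit. *)
Definition CYf (T : Type) (f : nat -> 'I_s -> T -> {poly F}) (m : nat) p b : {poly F} :=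
  \sum_(i < (m + h)./2) \sum_k C m i p k * f i k b.

(** The values at the indices up to h are free and the recursion is imposed from h on. The initial
    values t^(e m) become 1 after the normalization [y]. *)
Lemma Yb_ex : exists Yb : nat -> 'I_s -> T0 -> {poly F},
  (forall m p b, (m <= h)%N -> Yb m p b = 'X^(e * m) *+ ((b.1 == m :> nat) && (b.2 == p))) /\
  (forall m p b, (h <= m)%N -> Yb m.+1 p b = 'X^e * Yb m p b - CYf Yb m p b).
Proof.
pose Phi m (f : nat -> 'I_s -> T0 -> {poly F}) : 'I_s -> T0 -> {poly F} := fun p b =>
  if (m <= h)%N then 'X^(e * m) *+ ((b.1 == m :> nat) && (b.2 == p))
  else 'X^e * f m.-1 p b - CYf f m.-1 p b.
have [|Yb YbE] := @strong_rec _ (fun _ _ => 0) Phi.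
  move=> m f g fg; apply/funext => p; apply/funext => b; rewrite /Phi.
  case: leqP => // hm; have m1 : (m.-1 < m)%N by rewrite prednK // (leq_ltn_trans _ hm).
  rewrite (fg _ m1); congr (_ - _).
  by apply: eq_bigr => i _; apply: eq_bigr => j _; rewrite fg //; have := ltn_ord i; lia.
by exists Yb; split=> m p b hm; rewrite YbE /Phi ?hm // ltnNge hm.
Qed.

Section WithYb.
Variable Yb : nat -> 'I_s -> T0 -> {poly F}.
Hypothesis Yb0 : forall m p b, (m <= h)%N ->
  Yb m p b = 'X^(e * m) *+ ((b.1 == m :> nat) && (b.2 == p)).
Hypothesis YbS : forall m p b, (h <= m)%N -> Yb m.+1 p b = 'X^e * Yb m p b - CYf Yb m p b.

Lemma size_Yb m p b : (size (Yb m p b) <= (e * m).+1)%N.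
Proof.
elim/ltn_ind: m p b => m IH p b.
have [mh|hm] := leqP m h.
  by rewrite Yb0 //; case: (_ && _); rewrite ?mulr1n ?mulr0n ?size_poly0 ?size_polyXn.
case: m hm IH => // m hm IH; rewrite YbS //; apply: leq_trans (size_polyD _ _) _.
rewrite geq_max size_polyN; apply/andP; split.
  apply: leq_trans (size_polyMleq _ _) _; rewrite size_polyXn /= mulnS.
  by apply: leq_trans (leq_add (leqnn _) (IH m (ltnSn m) p b)) _; rewrite addnS.
apply: leq_trans (size_sum _ _ _) _; apply/bigmax_leqP => i _.
apply: leq_trans (size_sum _ _ _) _; apply/bigmax_leqP => k _.
apply: leq_trans (size_polyMleq _ _) _.
have im : (i < m.+1)%N by have := ltn_ord i; lia.
have := IH i im k b; have := sC m i p k; move: (size _) (size _) => c1 c2 h1 h2.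
have : (e * i <= e * m)%N by rewrite leq_mul2l -ltnS im orbT.
rewrite mulnS; lia.
Qed.

Let y m p b : K := wK ^+ (e * m) * evt 1 (Yb m p b).

Lemma evtXn a n : evt a 'X^n = wK ^- (a * n) :> K.
Proof. by rewrite rmorphXn /= evtX exprVn -exprM. Qed.

Lemma wXe m n : (n <= m)%N -> wK ^+ (e * m) * evt 1 'X^(e * n) = wK ^+ (e * (m - n)) :> K.
Proof.
move=> nm; rewrite evtXn mul1n mulnBr expfB_cond ?(negPf (wK_neq0 F)) //.
by rewrite leq_mul2l nm orbT.
Qed.

Lemma y0 m p b : (m <= h)%N -> y m p b = ((b.1 == m :> nat) && (b.2 == p))%:R.
Proof.
move=> mh; rewrite /y Yb0 // raddfMn /= mulrnAr wXe // subnn muln0 expr0.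
by case: (_ && _).
Qed.

Let D l0 p b : K := wK ^+ (e * l0.+1) * evt 1 (CYf Yb l0 p b).

Lemma DE l0 p b c : (l0 < c)%N -> (h <= c)%N ->
  D l0 p b = \sum_(i < c) \sum_k Cp l0 i p k * y i k b.
Proof.
move=> lc hc; rewrite /D /CYf.
have le : ((l0 + h)./2 <= c)%N by lia.
pose G i := \sum_k Cp l0 i p k * y i k b.
rewrite -(big_mkord xpredT G) (@big_cat_nat _ _ _ (l0 + h)./2) //= big_mkord.
rewrite [X in _ + X]big_nat [X in _ + X]big1 ?addr0 => [|i /andP[ge _]]; last first.
  by rewrite /G big1 // => k _; rewrite /Cp Cfar ?rmorph0 ?mulr0 ?mul0r //; lia.
rewrite rmorph_sum mulr_sumr; apply: eq_bigr => i _.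
rewrite rmorph_sum mulr_sumr; apply: eq_bigr => k _.
rewrite rmorphM /Cp /y; have u : wK ^+ (e * i) != 0 :> K by rewrite expf_neq0 // wK_neq0.
set A := evt 1 _; set B := evt 1 _; move: (wK ^+ (e * i)) u => v u.
rewrite [RHS](_ : _ = wK ^+ (e * l0.+1) * (A * B) * (v^-1 * v)); last by ring.
by rewrite mulVf // mulr1.
Qed.

Lemma yS m p b : (h <= m)%N -> y m.+1 p b = y m p b - D m p b.
Proof.
move=> hm; rewrite /y /D YbS // rmorphB rmorphM mulrBr; congr (_ - _).
rewrite mulrA; congr (_ * _); have := @wXe m.+1 1; rewrite muln1 => -> //.
by rewrite subn1.
Qed.

(** The failure of the recursion below h, summed from m to h: zero if the recursion held there. *)
Let con m p b : K := y m p b - y h p b - \sum_(m <= l0 < h) D l0 p b.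

Lemma sum_D m c p b : (h <= m)%N -> (m <= c)%N ->
  \sum_(m <= l0 < c) D l0 p b = y m p b - y c p b.
Proof.
move=> hm mc; rewrite -[RHS]opprB -(@telescope_sumr _ m c (fun i => y i p b)) // -sumrN big_nat [RHS]big_nat.
apply: eq_bigr => i /andP[mi _]; rewrite yS; last exact: leq_trans hm mi.
by rewrite addrC addKr opprK.
Qed.

(** Multiplying by a unitriangular matrix whose last columns are the solutions [y] makes the tail
    sums telescope: every row from h on becomes y c. Subtracting row h from the others leaves a
    unitriangular block beyond h and the constraints [con] below it. *)
Lemma dt_con d : let c := (h.+1 + d)%N in
  tofrac (dt c (E' c)) = fdet (fun a b : T0 =>
    if a.1 == h :> nat then y c a.2 b else con a.1 a.2 b).
Proof.
move=> c; rewrite dt_conj; pose U : finType := ('I_d * 'I_s + T0)%type.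
pose ix (a : U) : nat := match a with inl a => (h.+1 + a.1)%N | inr a => a.1 end.
pose cp (a : U) : 'I_s := match a with inl a => a.2 | inr a => a.2 end.
pose hU (a : U) : 'I_c * 'I_s :=
  match a with inl a => (rshift h.+1 a.1, a.2) | inr a => (lshift d a.1, a.2) end.
have hix a : (hU a).1 = ix a :> nat by case: a.
have hcp a : (hU a).2 = cp a by case: a.
have hb : bijective hU.
  exists (fun a : 'I_c * 'I_s => match split a.1 with inl i => inr (i, a.2) | inr i => inl (i, a.2) end).
    by move=> [[i p]|[i p]] /=; [rewrite (unsplitK (inr i))|rewrite (unsplitK (inl i))].
  by move=> [i p] /=; rewrite -{2}(splitK i); case: (split i).
rewrite -(fdet_bij _ hb).
pose G (a b : U) : K := (a == b)%:R - \sum_(ix a <= l0 < c) Cp l0 (ix b) (cp a) (cp b).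
rewrite (@eq_fdet _ _ _ G); last first.
  by move=> a b; rewrite /G (inj_eq (bij_inj hb)) !hcp !hix.
pose zr p : U := inr (ord_max, p).
pose Q (a b : U) : K := match b with inr b0 => y (ix a) (cp a) b0 | inl _ => (a == b)%:R end.
pose P (a b : U) : K := (a == b)%:R - ((ix a != h) && (b == zr (cp a)))%:R.
have ixc a : (ix a < c)%N.
  by rewrite /c; case: a => a /=; [rewrite ltn_add2l|apply: leq_trans (ltn_ord _) (leq_addr _ _)].
have Q1 : fdet Q = 1.
  apply: (@fdet_unitri _ _ (fun a : U => if a is inl _ then 1%N else 0%N)).
    case=> a; rewrite /Q ?eqxx //= y0 ?eqxx //; by rewrite -ltnS ltn_ord.
  move=> [a|a] [b|b] ab //= _; rewrite ?(negPf ab) //.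
  rewrite y0; last by rewrite -ltnS ltn_ord.
  case: andP => // -[/eqP E1 /eqP E2]; case/eqP: ab; congr inr.
  by case: a b E1 E2 => [a1 a2] [b1 b2] /= E1 ->; congr pair; apply: val_inj.
have P1 : fdet P = 1.
  apply: (@fdet_unitri _ _ (fun a : U => (ix a != h) : nat)).
    move=> a; rewrite /P eqxx; case: (boolP (_ && _)) => [/andP[h1 /eqP h2]|_]; last by rewrite subr0.
    by move: h1; rewrite h2 /= eqxx.
  move=> a b ab rk; rewrite /P (negPf ab) sub0r.
  case: (boolP (_ && _)) => [/andP[h1 /eqP h2]|_]; last by rewrite oppr0.
  by move: rk; rewrite h1 h2 /= eqxx.
pose N (a b : U) : K := \sum_j G a j * Q j b.
have sumU (f : nat -> 'I_s -> K) : \sum_(j : U) f (ix j) (cp j) = \sum_(i < c) \sum_k f i k.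
  rewrite (pair_bigA _ (fun (i : 'I_c) k => f i k)) /= [RHS](reindex hU) /=; last exact: onW_bij.
  by apply: eq_bigr => j _; rewrite hix hcp.
have hc : (h <= c)%N by rewrite /c; lia.
have NE a b : N a (inr b) = y (ix a) (cp a) b - \sum_(ix a <= l0 < c) D l0 (cp a) b.
  rewrite /N /G /Q; under eq_bigr => j _ do rewrite mulrBl.
  rewrite sumrB sum_delta; congr (_ - _).
  under eq_bigr => j _ do rewrite mulr_suml.
  rewrite exchange_big big_nat [RHS]big_nat; apply: eq_bigr => l0 /andP[_ lc].
  by rewrite (DE _ _ lc hc) -(sumU (fun i k => Cp l0 i (cp a) k * y i k b)).
have NE1 a b : (h <= ix a)%N -> N a (inr b) = y c (cp a) b.
  move=> ha; rewrite NE sum_D // ?(ltnW (ixc a)) //.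
  by rewrite opprB addrC subrK.
have NE2 a b : (ix a < h)%N -> N a (inr b) = con (ix a) (cp a) b + y c (cp a) b.
  move=> ha; rewrite NE (@big_cat_nat _ _ _ h) ?(ltnW ha) //= [X in _ - (_ + X)]sum_D // /con.
  ring.
have NE3 a b : N a (inl b) = G a (inl b) by rewrite /N /Q sum_delta_r.
pose PN (a b : U) : K := \sum_j P a j * N j b.
have PNE a b : PN a b = N a b - (ix a != h)%:R * N (zr (cp a)) b.
  rewrite /PN /P; under eq_bigr => j _ do rewrite mulrBl.
  rewrite sumrB sum_delta; congr (_ - _).
  under eq_bigr => j _ do rewrite -mulnb natrM -mulrA [_ == zr _]eq_sym.
  by rewrite -mulr_sumr sum_delta.
have -> : fdet G = fdet PN.
  by rewrite /PN fdetM P1 mul1r /N fdetM Q1 mulr1.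
rewrite fdet_sum; last first.
  move=> a b; rewrite PNE !NE1 //=; last by rewrite addSn leqW // leq_addr.
  by rewrite gtn_eqF ?mul1r ?subrr // addSn ltnS leq_addr.
have inlE (a b : 'I_d * 'I_s) : (inl a == inl b :> U) = (a == b) by [].
have PNl (a b : 'I_d * 'I_s) : (a.1 <= b.1)%N -> PN (inl a) (inl b) = (a == b)%:R.
  move=> ab; rewrite PNE !NE3.
  have -> : ix (inl a) != h by rewrite gtn_eqF //= addSn ltnS leq_addr.
  have le : (h <= ix (inl a))%N by rewrite /= addSn leqW // leq_addr.
  have E0 : \sum_(h <= l0 < ix (inl a)) Cp l0 (ix (inl b)) a.2 b.2 = 0.
    rewrite big_nat big1 // => l0 /andP[hl lt]; rewrite /Cp Cfar ?rmorph0 ?mulr0 //.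
    by move: lt => /=; lia.
  rewrite mul1r /G inlE [ix (zr _)]/= [cp (zr _)]/= [cp (inl a)]/= [cp (inl b)]/=.
  rewrite [X in _ - (_ - X)](@big_cat_nat _ _ _ (ix (inl a))) ?(ltnW (ixc _)) //= E0 add0r.
  by rewrite opprK ?add0r subrK.
rewrite [X in X * _](@fdet_unitri _ _ (fun a : 'I_d * 'I_s => nat_of_ord a.1)) ?mul1r; first last.
- by move=> a b ab rk; rewrite PNl // (negPf ab).
- by move=> a; rewrite PNl // eqxx.
apply: eq_fdet => a b; rewrite PNE; case: ifP => ah.
  by rewrite NE1 /= ?ah ?mul0r ?subr0 // (eqP ah).
have lt : (a.1 < h)%N by rewrite ltn_neqAle ah -ltnS ltn_ord.
by rewrite NE2 // NE1 //= mul1r addrK.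
Qed.

Lemma vge_y m p b : vge 0 (y m p b).
Proof.
have := vgeM (vge_wn _ (e * m)) (vge_evt 1 (size_Yb m p b)).
by rewrite mul1n subrr.
Qed.

Lemma cvg_y p b : exists x, cvgK (fun m => y m p b) x.
Proof.
apply: cvgK_complete => n; exists (h + 2 * n)%N => m mn.
rewrite yS; last by lia.
rewrite addrC addKr; apply: vgeN; rewrite (@DE _ _ _ m.+1) //; last by lia.
apply: vge_sum => i _; apply: vge_sum => k _.
have [far|near] := leqP (m.+1 + h) i.+1.*2.
  by rewrite /Cp Cfar // rmorph0 mulr0 mul0r; apply: vge00.
rewrite /Cp exprnN; have v1 := vgeM (vge_wn F (e * m.+1)) (vge_w F (- (e * i)%:Z)).
apply: vge_weak (vgeM (vgeM v1 (vge_evt 1 (sC m i p k))) (vge_y i k b)).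
have im : (i + n <= m)%N by move: near mn; lia.
have : (e * i + e * n <= e * m)%N by rewrite -mulnDr leq_mul2l im orbT.
have : (n <= e * n)%N by rewrite leq_pmull.
rewrite mulnS mul1n; lia.
Qed.

Lemma con_poly m p b : (m <= h)%N -> con m p b = wK ^+ (e * h) *
  evt 1 ('X^(e * (h - m)) * Yb m p b - Yb h p b
         - \sum_(m <= l0 < h) 'X^(e * (h - l0.+1)) * CYf Yb l0 p b).
Proof.
move=> mh; rewrite /con !rmorphB rmorphM /= !mulrBr; congr (_ - _ - _).
  by rewrite mulrA wXe ?leq_subr // subKn.
rewrite rmorph_sum mulr_sumr big_nat [RHS]big_nat; apply: eq_bigr => l0 /andP[_ lh].
by rewrite rmorphM /= mulrA wXe ?leq_subr // subKn.
Qed.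

End WithYb.

Hypothesis l0 : l != 0.

Theorem limit_form : exists (Y : nat -> 'M[{poly F}]_s) (a b : {poly F}) (lam : 'M[K]_s) (c : nat),
  [/\ a != 0 /\ b != 0,
      forall m p j, Y m.+1 p j = 'X^e * Y m p j - CYf (fun i k j => Y i k j) m p j,
      forall p j, cvgK (fun m => wK ^+ (e * m) * evt 1 (Y m p j)) (lam p j),
      evt 1 b * tofrac l = evt 1 a * \det lam &
      forall m p j, (size (Y m p j) <= e * m + c)%N].
Proof.
have [Yb [Yb0 YbS]] := Yb_ex.
pose y m p b : K := wK ^+ (e * m) * evt 1 (Yb m p b).
have [la laE] : exists la : 'I_s -> T0 -> K, forall p b, cvgK (fun m => y m p b) (la p b).
  have [la laE] := choice (fun pb : 'I_s * T0 => cvg_y Yb0 YbS pb.1 pb.2).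
  by exists (fun p b => la (p, b)) => p b; apply: (laE (p, b)).
pose ConP m p b : {poly F} := 'X^(e * (h - m)) * Yb m p b - Yb h p b
         - \sum_(m <= l0 < h) 'X^(e * (h - l0.+1)) * CYf Yb l0 p b.
have fin (p : {poly F}) : p != 0 -> evt 1 p != 0 by exact: evt_eq0.
pose kK : {rmorphism {fraction {poly F}} -> K} := flift fin.
have kKE p : kK (tofrac p) = evt 1 p by exact: (flift_tofrac fin).
pose M (a b : T0) : K := if a.1 == h :> nat then la a.2 b else wK ^+ (e * h) * evt 1 (ConP a.1 a.2 b).
have lM : tofrac l = fdet M.
  apply: (@cvgK_uniq _ (fun d => tofrac (dt (h.+1 + d) (E' (h.+1 + d))))).
    move=> N; have [c1 c1P] := dt_limit N; exists c1 => d dc.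
    by apply: cl_vge; apply: cl_sym; apply: c1P; lia.
  pose Md d (a b : T0) : K := if a.1 == h :> nat then y (h.+1 + d)%N a.2 b
     else wK ^+ (e * h) * evt 1 (ConP a.1 a.2 b).
  have -> : (fun d => tofrac (dt (h.+1 + d) (E' (h.+1 + d)))) = (fun d => fdet (Md d)).
    apply/funext => d; rewrite (dt_con Yb0 YbS); apply: eq_fdet => a b; rewrite /Md.
    by case: ifP => // _; rewrite con_poly // -ltnS ltn_ord.
  apply: cvgK_det => i j; rewrite mxE; under eq_fun do rewrite mxE; rewrite /M /Md.
  case: ifP => _; last exact: cvgK_cst.
  have := cvgK_shift h.+1 (laE (enum_val i).2 (enum_val j)).
  by under eq_fun do rewrite addnC.
pose hT (x : 'I_h * 'I_s + 'I_s) : T0 :=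
  match x with inl a => (widen_ord (leqnSn h) a.1, a.2) | inr p => (ord_max, p) end.
have hb : bijective hT.
  apply: inj_surj_bij.
    move=> [[i p]|p] [[i' p']|p'] //= [] E.
    - by move=> <-; congr (inl (_, _)); apply: val_inj.
    - by move: (ltn_ord i); rewrite E ltnn.
    - by move: (ltn_ord i'); rewrite -E ltnn.
    - by rewrite E.
  move=> [i p]; have [lt|ge] := ltnP i h.
    by exists (inl (Ordinal lt, p)); apply/eqP; congr pair; apply: val_inj.
  exists (inr p); apply/eqP; congr pair; apply: val_inj => /=.
  by apply/eqP; rewrite eqn_leq ge -ltnS ltn_ord.
pose Con (x : 'I_h * 'I_s) (z : 'I_h * 'I_s + 'I_s) : {fraction {poly F}} :=
  tofrac (ConP x.1 x.2 (hT z)) / tofrac 'X^(e * h).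
have lM2 : tofrac l = fdet (fun a b => match a with inl x => kK (Con x b) | inr i => la i (hT b) end).
  rewrite lM -(fdet_bij M hb); apply: eq_fdet => -[x|i] z; rewrite /M /=.
    rewrite ltn_eqF // /Con rmorphM fmorphV /= !kKE evtXn mul1n invrK mulrC.
    by [].
  by rewrite eqxx.
have [|c [N0 [c0 CN lE2]]] := @kernel_det _ _ kK _ _ Con (fun i b => la i (hT b)).
  by rewrite -lM2 tofrac_eq0.
have [d d0 /choice[N1 N1E]] := common_den (fun zj : ('I_h * 'I_s + 'I_s) * 'I_s => N0 zj.1 zj.2).
have [[ca cb] /= [cb0 cE]] := frac_ex c.
pose Y m : 'M[{poly F}]_s := \matrix_(p, j) \sum_z Yb m p (hT z) * N1 (z, j).
pose lam : 'M[K]_s := \matrix_(p, j) \sum_z la p (hT z) * evt 1 (N1 (z, j)).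
have CYE m p j : CYf (fun i k j => Y i k j) m p j = \sum_z CYf Yb m p (hT z) * N1 (z, j).
  rewrite /CYf; under [RHS]eq_bigr => z _ do rewrite mulr_suml.
  rewrite [RHS]exchange_big /=; apply: eq_bigr => i _.
  under [RHS]eq_bigr => z _ do rewrite mulr_suml.
  rewrite [RHS]exchange_big /=; apply: eq_bigr => k _.
  by rewrite mxE mulr_sumr; apply: eq_bigr => z _; rewrite mulrA.
have S0 m p j : (m < h)%N -> 'X^(e * (h - m)) * Y m p j - Y h p j
    - \sum_(m <= l0 < h) 'X^(e * (h - l0.+1)) * CYf (fun i k j => Y i k j) l0 p j = 0.
  move=> mh; have E : \sum_z ConP m p (hT z) * N1 (z, j) = 0.
    apply: tofrac_inj; rewrite tofrac0 rmorph_sum /=.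
    transitivity (tofrac d * tofrac 'X^(e * h) * \sum_z Con (Ordinal mh, p) z * N0 z j); last first.
      by rewrite CN mulr0.
    rewrite mulr_sumr; apply: eq_bigr => z _; rewrite tofracM -N1E /= /Con /=.
    have u : tofrac 'X^(e * h) != 0 :> {fraction {poly F}}.
      by rewrite tofrac_eq0 -size_poly_gt0 size_polyXn.
    move: (tofrac 'X^(e * h)) u => v u; rewrite -[LHS]mul1r -(mulfV u); ring.
  rewrite -[RHS]E /ConP; under [RHS]eq_bigr => z _ do rewrite !mulrBl.
  rewrite !sumrB !mxE mulr_sumr; congr (_ - _ - _).
    by apply: eq_bigr => z _; rewrite mulrA.
  under [RHS]eq_bigr => z _ do rewrite mulr_suml.
  rewrite [RHS]exchange_big /=; apply: eq_bigr => l1 _; rewrite CYE mulr_sumr.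
  by apply: eq_bigr => z _; rewrite mulrA.
exists Y, ca, (cb * d ^+ s), lam, (\max_z size (N1 z)).+1; split.
- split; last by rewrite mulf_neq0 // expf_neq0.
  by apply: contraNneq c0 => ca0; rewrite cE ca0 tofrac0 mul0r.
- move=> m p j; have [mh|hm] := ltnP m h; last first.
    rewrite CYE !mxE mulr_sumr -sumrB; apply: eq_bigr => z _.
    by rewrite YbS // mulrBl mulrA.
  have := S0 m p j mh.
  have : 'X^(e * (h - m.+1)) * Y m.+1 p j - Y h p j
    - \sum_(m.+1 <= l0 < h) 'X^(e * (h - l0.+1)) * CYf (fun i k j => Y i k j) l0 p j = 0.
    have [lt|ge] := ltnP m.+1 h; first exact: S0.
    have -> : m.+1 = h by apply/eqP; rewrite eqn_leq mh.
    by rewrite subnn muln0 expr0 mul1r big_geq // subr0 subrr.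
  rewrite (big_ltn mh).
  set A := \sum_(_ <= _ < _) _; set B := CYf _ _ _ _; move: (Y h p j) => yh.
  have -> : (e * (h - m) = e * (h - m.+1) + e)%N by rewrite -mulnSr -subnSK.
  rewrite exprD; set T := 'X^(e * (h - m.+1)) => E1 E2.
  have T0' : T != 0 by rewrite -size_poly_gt0 size_polyXn.
  apply: (mulfI T0'); apply/eqP; rewrite -subr_eq0; apply/eqP.
  transitivity ((T * Y m.+1 p j - yh - A) - (T * 'X^e * Y m p j - yh - (T * B + A))); first by ring.
  by rewrite E1 E2 subrr.
- move=> p j; rewrite mxE.
  have -> : (fun m => wK ^+ (e * m) * evt 1 (Y m p j)) =
     (fun m => \sum_z y m p (hT z) * evt 1 (N1 (z, j))).
    apply/funext => m; rewrite mxE rmorph_sum mulr_sumr; apply: eq_bigr => z _.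
    by rewrite rmorphM mulrA.
  by apply: cvgK_sum => z _; apply: cvgKM; [exact: laE|exact: cvgK_cst].
- rewrite lM2 lE2 cE fmorph_div /= !kKE.
  have -> : lam = evt 1 d *: \matrix_(i, j) \sum_z la i (hT z) * kK (N0 z j).
    apply/matrixP => i j; rewrite !mxE mulr_sumr; apply: eq_bigr => z _.
    rewrite [RHS]mulrCA; congr (_ * _); rewrite -kKE -N1E -kKE.
    exact: (rmorphM kK).
  rewrite detZ rmorphM rmorphXn /=; set dd := \det _.
  have u := fin _ cb0; move: (evt 1 cb) u => v u.
  rewrite -[RHS]mul1r -(mulfV u); ring.
- move=> m p j; rewrite mxE; apply: leq_trans (size_sum _ _ _) _; apply/bigmax_leqP => z _.
  apply: leq_trans (size_polyMleq _ _) _.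
  have h1 := size_Yb Yb0 YbS m p (hT z).
  have h2 : (size (N1 (z, j)) <= \max_z size (N1 z))%N by apply: (leq_bigmax (z, j)).
  apply: leq_trans (leq_pred _) _; apply: leq_trans (leq_add h1 h2) _.
  by rewrite addSnnS.
Qed.

End Limit.

(** * Algebraic values and tensor systems *)

Section Alpha.
Variable F : finFieldType.
Local Notation q := #|F|.
Local Notation W := (powser F).
Local Notation X := (powserX F).
Local Notation k := {fraction {poly F}}.
Local Notation S := (powser k).
Local Notation K := (Kinf F).
Local Notation P2 := {poly {poly F}}.

(** The number f(w) regarded as the function f(u) that is constant in t. *)
Definition al (f : W) : S := PowSer (fun m => tofrac (f m)%:P).

Lemma alE f n : al f n = tofrac (f n)%:P. Proof. by []. Qed.

Lemma al_is_zmod_morphism : zmod_morphism al.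
Proof. by move=> f g; apply: powserP => n; rewrite powserBE !alE powserBE rmorphB tofracB. Qed.
Lemma al_is_monoid_morphism : monoid_morphism al.
Proof.
split; first by apply: powserP => n; rewrite alE !powser1E !rmorph_nat.
move=> f g; apply: powserP => n; rewrite alE !powserME !rmorph_sum /=.
by apply: eq_bigr => i _; rewrite polyCM tofracM.
Qed.
HB.instance Definition _ := GRing.isZmodMorphism.Build W S al al_is_zmod_morphism.
HB.instance Definition _ := GRing.isMonoidMorphism.Build W S al al_is_monoid_morphism.

Lemma fpow_al b f : fpow b (al f) = al (fpow b f).
Proof. by apply: powserP => n; rewrite alE /=; case: ifP; rewrite ?polyC0 ?tofrac0. Qed.

Lemma powser_sumXn M (a : nat -> F) b n : (0 < b)%N ->
  (\sum_(i < M) powserC (a i) * X ^+ (i * b)) n =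
  if (b %| n)%N && (n %/ b < M)%N then a (n %/ b)%N else 0.
Proof.
move=> b0; rewrite powser_sumE; under eq_bigr => i _ do rewrite powserCM_coef powserXnE.
have [/dvdnP[m ->]|nd] := boolP (b %| n)%N; last first.
  rewrite big1 // => i _; rewrite (_ : (_ == _) = false) ?mulr0 //.
  by apply: contraNF nd => /eqP->; rewrite dvdn_mull.
rewrite mulnK //; have [mM|Mm] := ltnP m M.
  rewrite (bigD1 (Ordinal mM)) //= eqxx mulr1 big1 ?addr0 // => j jm.
  rewrite eqn_pmul2r // (_ : (_ == _) = false) ?mulr0 //.
  by apply: contraNF jm => /eqP E; apply/eqP/val_inj.
rewrite big1 // => j _; rewrite eqn_pmul2r // gtn_eqF ?mulr0 //.
exact: leq_trans (ltn_ord j) Mm.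
Qed.

Lemma powser_split (f : W) M : exists r, f = \sum_(i < M) powserC (f i) * X ^+ i + X ^+ M * r.
Proof.
have [|r rE] := (powser_clP M f (\sum_(i < M) powserC (f i) * X ^+ (i * 1))).2 _.
  by move=> i iM; rewrite powser_sumXn // dvd1n divn1 iM.
exists r; rewrite -rE; under eq_bigr do rewrite -{1}[X in _ ^+ X]muln1.
by rewrite addrC subrK.
Qed.

Lemma powser_frob (f : W) : f ^+ q = fpow q f.
Proof.
apply: powserP => n; have [r rE] := powser_split f n.+1.
have q0 : (0 < q)%N := ltnW (q_gt1 F).
have E : f ^+ q = \sum_(i < n.+1) powserC (f i) * X ^+ (i * q) + X ^+ (n.+1 * q) * r ^+ q.
  rewrite {1}rE -(expn1 q) (frobD (@powserC F)) (frob_sum (@powserC F)) expn1 exprMn -exprM.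
  congr (_ + _); apply: eq_bigr => i _; rewrite exprMn -exprM -rmorphXn.
  by rewrite expf_card.
rewrite E powserDE powserXnM [X in _ + X]ifF ?addr0; last first.
  by apply/negbTE; rewrite -ltnNge; apply: leq_trans (ltnSn n) _; rewrite leq_pmulr.
rewrite powser_sumXn // fpowE // ltnS leq_div andbT.
by [].
Qed.

Lemma evr_al a f : evr a (al f) (tofrac f).
Proof.
exists (fun m => (f m)%:P) => // n; exists n => M nM.
have -> : \sum_(m < M) evt a (f m)%:P * wK ^+ m =
    tofrac (\sum_(i < M) powserC (f i) * X ^+ i) :> K.
  by rewrite rmorph_sum; apply: eq_bigr => i _; rewrite evtC rmorphM rmorphXn.
have [r rE] := powser_split f M.
rewrite {2}rE tofracD opprD addrA subrr sub0r tofracM tofracXn; apply: vgeN.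
apply: (@vge_weak _ M); first by rewrite lez_nat.
by rewrite -[M%:Z]addr0; apply: vgeM; [exact: vge_wn|exact: vge_tofrac].
Qed.

Lemma gr_al f : gr (al f).
Proof.
move=> m; exists (f m)%:P => //; have := size_polyC_leq1 (f m).
by case: (size _) => [|[|]].
Qed.

Definition wv (p : {poly F}) : W := PowSer (fun n => p`_n).

Lemma wvE p n : wv p n = p`_n. Proof. by []. Qed.
Lemma wv_is_zmod_morphism : zmod_morphism wv.
Proof. by move=> p p'; apply: powserP => n; rewrite powserBE !wvE coefB. Qed.
Lemma wv_is_monoid_morphism : monoid_morphism wv.
Proof.
split; first by apply: powserP => n; rewrite wvE powser1E coef1.
by move=> p p'; apply: powserP => n; rewrite wvE powserME coefM.
Qed.
HB.instance Definition _ := GRing.isZmodMorphism.Build _ _ wv wv_is_zmod_morphism.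
HB.instance Definition _ := GRing.isMonoidMorphism.Build _ _ wv wv_is_monoid_morphism.

Lemma al_wv p : al (wv p) = pu (map_poly polyC p).
Proof. by apply: powserP => n; rewrite alE puE coef_map wvE. Qed.

Lemma wvX : wv 'X = X.
Proof. by apply: powserP => n; rewrite wvE coefX. Qed.

Lemma wv_rev n (p : {poly F}) : (size p <= n.+1)%N -> exists2 p' : {poly F},
  evt 1 p = wK ^- n * tofrac (wv p') & (p != 0 -> p' != 0).
Proof.
move=> sp; exists (\sum_(i < n.+1) p`_i *: 'X^(n - i)).
  rewrite (evt_rv 1 sp) mul1n; congr (_ * tofrac _); rewrite /rv rmorph_sum.
  apply: eq_bigr => i _; rewrite mul1n -mul_polyC rmorphM rmorphXn /= wvX; congr (_ * _).
  by apply: powserP => m; rewrite wvE coefC /=; case: m.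
apply: contraNneq => E; apply/eqP/polyP => i; rewrite coef0.
have [le|gt] := leqP (size p) i; first by rewrite nth_default.
have lin : (i < n.+1)%N by apply: leq_trans gt sp.
have := congr1 (fun p : {poly F} => p`_(n - i)) E; rewrite coef0 coef_sum.
rewrite (bigD1 (Ordinal lin)) //= coefZ coefXn eqxx mulr1 big1 ?addr0 // => j ji.
rewrite coefZ coefXn (_ : (_ == _) = false) ?mulr0 //; apply: contraNF ji => /eqP E1.
by apply/eqP/val_inj => /=; have := ltn_ord j; move: E1 lin; lia.
Qed.

Lemma wv_evt (p : {poly F}) : exists2 p' : {poly F}, exists n, tofrac (wv p) = wK ^+ n * evt 1 p'
  & (p' = 0 -> p = 0).
Proof.
exists (\sum_(i < (size p).+1) p`_i *: 'X^(size p - i)).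
  exists (size p); rewrite rmorph_sum mulr_sumr.
  rewrite {1}(poly_sum_le (leqnSn (size p))) !rmorph_sum; apply: eq_bigr => i _ /=.
  rewrite -!mul_polyC !rmorphM !rmorphXn /= wvX evtC evtX mulrCA expr1.
  have -> : tofrac (wv (p`_i)%:P) = CK p`_i :> K.
    by congr tofrac; apply: powserP => m; rewrite wvE coefC /=; case: m.
  congr (_ * _); rewrite exprVn -expfB_cond ?(negPf (wK_neq0 F)) ?leq_subr // subKn //.
  by rewrite -ltnS.
move=> E; apply/polyP => i; rewrite coef0.
have [le|gt] := leqP (size p) i; first by rewrite nth_default.
have lin : (i < (size p).+1)%N by apply: ltnW.
have := congr1 (fun p' : {poly F} => p'`_(size p - i)) E; rewrite coef0 coef_sum.
rewrite (bigD1 (Ordinal lin)) //= coefZ coefXn eqxx mulr1 big1 ?addr0 // => j ji.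
rewrite coefZ coefXn (_ : (_ == _) = false) ?mulr0 //; apply: contraNF ji => /eqP E1.
have aux (x1 x2 x3 : nat) : (x1 <= x3)%N -> (x2 <= x3)%N -> (x3 - x2 = x3 - x1)%N -> x1 = x2 by lia.
by apply/eqP/val_inj; apply: (aux _ _ _ (ltn_ord j : (j <= size p)%N) (ltnW gt) E1).
Qed.

Variable f : W.
Local Notation L := (tofrac f : K).

Lemma min_relation (P : P2) : P != 0 -> root (map_poly (evt 1) P) L -> exists d (P1 : P2), [/\ (0 < d)%N, size P1 = d.+1,
  root (map_poly (evt 1) P1) L &
  forall Q : P2, (size Q <= d)%N -> root (map_poly (evt 1) Q) L -> Q = 0].
Proof.
move=> P0 rP; pose R m := `[< exists2 Q : P2, size Q = m.+1 & root (map_poly (evt 1) Q) L >].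
have exR : exists m, R m.
  by exists (size P).-1; apply/asboolP; exists P; rewrite // prednK // size_poly_gt0.
have [d /asboolP[P1 sP1 rP1] mind] := ex_minnP exR.
exists d, P1; split=> //.
  case: d sP1 {mind} => // sP1.
  have P1C : P1 = (P1`_0)%:P by apply: size1_polyC; rewrite sP1.
  have n0 : P1`_0 != 0.
    by have := lead_coef_eq0 P1; rewrite lead_coefE sP1 /= => ->; rewrite -size_poly_eq0 sP1.
  have mE : map_poly (evt 1) P1 = (evt 1 P1`_0)%:P by rewrite {1}P1C map_polyC.
  by move: rP1; rewrite mE rootE hornerC (negPf (evt_eq0 _ n0)).
move=> Q sQ rQ; apply/eqP; apply: contraTT sQ => Q0; rewrite -ltnNge.
have sQ : (0 < size Q)%N by rewrite size_poly_gt0.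
rewrite -(prednK sQ) ltnS; apply: mind; apply/asboolP.
by exists Q => //; rewrite prednK.
Qed.

Section Min.
Variables (d : nat) (P1 : P2).
Hypotheses (d0 : (0 < d)%N) (sP1 : size P1 = d.+1) (rP1 : root (map_poly (evt 1) P1) L).
Hypothesis minP : forall Q : P2, (size Q <= d)%N -> root (map_poly (evt 1) Q) L -> Q = 0.

(* Laurent polynomials in w *)
Definition Lau (x : K) := exists (p : {poly F}) n, x = evt 1 p * wK ^+ n.

Lemma LauD x y : Lau x -> Lau y -> Lau (x + y).
Proof.
move=> [p [n ->]] [p' [n' ->]]; exists (p * 'X^n' + p' * 'X^n), (n + n')%N.
rewrite rmorphD !rmorphM !rmorphXn /= evtX expr1 !exprVn exprD.
have u m : wK ^+ m != 0 :> K by rewrite expf_neq0 // wK_neq0.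
move: (wK ^+ n) (wK ^+ n') (u n) (u n') => a b ua ub.
rewrite mulrDl -[in LHS](mulr1 (evt 1 p)) -(mulVf ub) -[in LHS](mulr1 (evt 1 p')) -(mulVf ua).
by ring.
Qed.

Lemma LauM x y : Lau x -> Lau y -> Lau (x * y).
Proof.
move=> [p [n ->]] [p' [n' ->]]; exists (p * p'), (n + n')%N.
by rewrite rmorphM exprD mulrACA.
Qed.

Lemma Lau_evt p : Lau (evt 1 p).
Proof. by exists p, 0%N; rewrite mulr1. Qed.

Lemma Lau_w n : Lau (wK ^+ n).
Proof. by exists 1, n; rewrite rmorph1 mul1r. Qed.

Lemma Lau0 : Lau 0.
Proof. by exists 0, 0%N; rewrite rmorph0 mul0r. Qed.

Lemma Lau1 : Lau 1.
Proof. by exists 1, 0%N; rewrite rmorph1 mul1r. Qed.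

Lemma Lau_sum (I : Type) (r : seq I) (Pr : pred I) (x : I -> K) :
  (forall i, Pr i -> Lau (x i)) -> Lau (\sum_(i <- r | Pr i) x i).
Proof. by move=> h; apply: (big_ind Lau) => //; [exact: Lau0|exact: LauD]. Qed.

Lemma Lau_prod (I : Type) (r : seq I) (Pr : pred I) (x : I -> K) :
  (forall i, Pr i -> Lau (x i)) -> Lau (\prod_(i <- r | Pr i) x i).
Proof. by move=> h; apply: (big_ind Lau) => //; [exact: Lau1|exact: LauM]. Qed.

Lemma Lau_det n (A : 'M[K]_n) : (forall i j, Lau (A i j)) -> Lau (\det A).
Proof.
move=> h; apply: Lau_sum => s _; apply: LauM; last by apply: Lau_prod => i _.
case: (s : bool); rewrite ?expr0 ?expr1; last exact: Lau1.
by have := Lau_evt (-1); rewrite rmorphN rmorph1.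
Qed.

(** Clearing powers of w produces a polynomial relation of degree below d, excluded by
    minimality. *)
Lemma Lau_indep (x : 'I_d -> K) : (forall c, Lau (x c)) ->
  \sum_c x c * L ^+ c = 0 -> forall c, x c = 0.
Proof.
move=> Lx x0.
have [pn pnE] := choice (fun c : 'I_d => Lx c); have [n nE] := choice pnE.
pose N := (\max_c n c)%N.
pose Q : P2 := \sum_(c < d) ('X^c * (pn c * 'X^(N - n c))%:P).
have xE c : x c = wK ^+ N * evt 1 (pn c * 'X^(N - n c)).
  have nN : (n c <= N)%N by apply: leq_bigmax.
  rewrite nE rmorphM rmorphXn /= evtX expr1 mulrCA; congr (_ * _).
  by rewrite exprVn -expfB_cond ?(negPf (wK_neq0 F)) ?leq_subr // subKn.
have QE : map_poly (evt 1) Q = \sum_(c < d) 'X^c * (evt 1 (pn c * 'X^(N - n c)))%:P.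
  by rewrite rmorph_sum; apply: eq_bigr => c _; rewrite rmorphM /= map_polyXn map_polyC.
have Q0 : Q = 0.
  apply: minP.
    apply: leq_trans (size_sum _ _ _) _; apply/bigmax_leqP => c _.
    apply: leq_trans (size_polyMleq _ _) _; rewrite size_polyXn.
    have := size_polyC_leq1 (pn c * 'X^(N - n c)); have := ltn_ord c.
    by move: (size _) => c1; lia.
  rewrite QE rootE horner_sum; apply/eqP.
  have u : wK ^+ N != 0 :> K by rewrite expf_neq0 // wK_neq0.
  apply: (mulfI u); rewrite mulr0 -[RHS]x0 mulr_sumr; apply: eq_bigr => c _.
  by rewrite hornerM hornerXn hornerC xE -!mulrA; congr (_ * _); rewrite mulrC.
move=> c; rewrite xE; suff -> : pn c * 'X^(N - n c) = 0 by rewrite rmorph0 mulr0.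
have := congr1 (fun R : P2 => R`_c) Q0; rewrite coef0 /Q coef_sum (bigD1 c) //=.
rewrite coefXnM ltnn subnn coefC eqxx big1 ?addr0 // => c' cc'.
rewrite coefXnM; case: ltnP => // le; rewrite coefC subn_eq0 leqNgt ltn_neqAle le andbT.
by move: cc'; rewrite -(inj_eq val_inj) /= => ->.
Qed.

(** For d > 1 the power L^1 belongs to the basis. For d = 1 it must be rewritten by [P1], and nu is
    the leading coefficient. *)
Lemma min_coef : exists nu (nus : 'I_d -> {poly F}), nu != 0 /\
  evt 1 nu * L = \sum_c evt 1 (nus c) * L ^+ c.
Proof.
have [d1|d1] := ltnP 1 d.
  exists 1, (fun c => (c == 1 :> nat)%:R); split; first exact: oner_neq0.
  rewrite (bigD1 (Ordinal d1)) //= big1 ?addr0 ?rmorph1 ?mul1r // => c c1.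
  by rewrite (_ : (_ == _) = false) ?rmorph0 ?mul0r //; apply: contraNF c1 => /eqP E; apply/eqP/val_inj.
have dE : d = 1%N by apply/eqP; rewrite eqn_leq d1.
exists P1`_1, (fun _ => - P1`_0); split.
  by move: sP1; rewrite dE => s2; have := lead_coef_eq0 P1; rewrite lead_coefE s2 /= => ->; rewrite -size_poly_eq0 s2.
have := rP1; rewrite rootE (@horner_coef_wide _ 2); last first.
  by apply: leq_trans (size_poly _ _) _; rewrite sP1 dE.
rewrite big_ord_recr big_ord1 /= !coef_map /= expr0 mulr1 expr1 addrC addr_eq0 => /eqP ->.
have Hs (G : 'I_d -> K) : (forall c, G c = - evt 1 P1`_0) -> \sum_c G c = - evt 1 P1`_0.
  by move: G; rewrite dE => G GE; rewrite big_ord1 GE.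
rewrite [RHS]Hs // => c; rewrite rmorphN (_ : (c : nat) = 0%N) ?expr0 ?mulr1 //.
by move: (ltn_ord c); rewrite {2}dE; case: (c : nat).
Qed.

Lemma wv_indep (v : 'I_d -> {poly F}) : \sum_c wv (v c) * f ^+ c = 0 -> forall c, v c = 0.
Proof.
move=> v0 c; have [p' [n E] E0] := wv_evt (v c).
have Lv c' : Lau (tofrac (wv (v c'))).
  by have [p1 [m ->] _] := wv_evt (v c'); apply: LauM; [exact: Lau_w|exact: Lau_evt].
have := @Lau_indep (fun c' => tofrac (wv (v c'))) Lv.
have -> : \sum_c' tofrac (wv (v c')) * L ^+ c' = 0.
  by rewrite -[RHS]tofrac0 -v0 rmorph_sum; apply: eq_bigr => c' _; rewrite rmorphM rmorphXn.
move=> /(_ erefl c) /eqP; rewrite tofrac_eq0 => /eqP w0.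
by apply/polyP => i; rewrite -wvE w0 coef0.
Qed.

(** The w^i with i < q are independent over q-th powers. Splitting the coefficients into base q
    digits and extracting q-th roots reduces the claim to [wv_indep]. *)
Lemma wv_frob_indep (v : 'I_d -> {poly F}) :
  \sum_c wv (v c) * f ^+ (q * c) = 0 -> forall c, v c = 0.
Proof.
move=> v0; have q0 : (0 < q)%N := ltnW (q_gt1 F).
pose vi i c : {poly F} := \poly_(n < size (v c)) (v c)`_(n * q + i).
have viE i c n : (vi i c)`_n = (v c)`_(n * q + i).
  rewrite coef_poly; case: ltnP => // le; rewrite nth_default //.
  by apply: leq_trans le _; apply: leq_trans (leq_addr _ _); rewrite leq_pmulr.
have vE c : wv (v c) = \sum_(i < q) X ^+ i * fpow q (wv (vi i c)).
  apply: powserP => n; rewrite (coef_digits n (fun i => wv (vi i c))) // !wvE viE.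
  by rewrite -divn_eq.
pose G i := \sum_c wv (vi i c) * f ^+ c.
have E : \sum_(i < q) X ^+ i * fpow q (G i) = 0.
  rewrite -[RHS]v0; under [RHS]eq_bigr => c _ do rewrite vE mulr_suml.
  rewrite [RHS]exchange_big; apply: eq_bigr => i _ /=.
  rewrite /G rmorph_sum mulr_sumr; apply: eq_bigr => c _.
  by rewrite rmorphM rmorphXn /= -(powser_frob f) -exprM mulrA.
have Gi i : (i < q)%N -> G i = 0.
  move=> iq; apply: powserP => n; have := congr1 (fun g : W => g (n * q + i)%N) E.
  by rewrite coef_digits // modnMDl modn_small // divnMDl // divn_small // addn0.
move=> c; apply/polyP => n; rewrite coef0 (divn_eq n q) -viE.
by rewrite (wv_indep (Gi _ (ltn_pmod n q0))) coef0.
Qed.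

Lemma top_relation : exists (bd : {poly F}) (bs : 'I_d -> {poly F}), bd != 0 /\
  wv bd * f ^+ d = \sum_c wv (bs c) * f ^+ c.
Proof.
pose N := (\max_(i < d.+1) size (P1`_i)%R)%N.
have rev i : exists p' : {poly F}, (i < d.+1)%N ->
    evt 1 P1`_i = wK ^- N * tofrac (wv p') /\ (P1`_i != 0 -> p' != 0).
  have [id|_] := ltnP i d.+1; last by exists 0.
  have [|p' E1 E2] := @wv_rev N P1`_i; last by exists p'.
  by apply: leqW; apply: (leq_bigmax (Ordinal id)).
have [p' p'E] := choice rev.
exists (p' d), (fun c => - p' c); split.
  have [_] := p'E d (ltnSn d); apply.
  by have := lead_coef_eq0 P1; rewrite lead_coefE sP1 /= => ->; rewrite -size_poly_eq0 sP1.
apply/eqP; rewrite -subr_eq0 -(tofrac_eq0 (R := W)); apply/eqP.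
have := rP1; rewrite rootE (@horner_coef_wide _ d.+1); last first.
  by apply: leq_trans (size_poly _ _) _; rewrite sP1.
rewrite big_ord_recr /= => /eqP E.
have u : wK ^- N != 0 :> K by rewrite invr_eq0 expf_neq0 // wK_neq0.
have Et : wK ^- N * tofrac (wv (p' d) * f ^+ d) = (map_poly (evt 1) P1)`_d * tofrac f ^+ d.
  by rewrite coef_map /=; have [-> _] := p'E d (ltnSn d); rewrite tofracM tofracXn mulrA.
have Es : wK ^- N * tofrac (\sum_(c < d) wv (- p' c) * f ^+ c) =
    - \sum_(i < d) (map_poly (evt 1) P1)`_i * tofrac f ^+ i.
  rewrite -sumrN rmorph_sum mulr_sumr; apply: eq_bigr => c _ /=.
  have [E1 _] := p'E c (leqW (ltn_ord c)); rewrite coef_map /= E1.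
  by rewrite rmorphN tofracM tofracXn tofracN mulrA mulrN mulNr.
by apply: (mulfI u); rewrite mulr0 tofracB mulrBr Et Es opprK addrC.
Qed.

(** The f^(q c') are expressed in 1, ..., f^(d-1) by repeated use of the top relation, and
    [wv_frob_indep] makes the matrix A of this change nonsingular. Its adjugate expresses f^c
    through f(u^q) = f^q. *)
Lemma alpha_system : exists (De : {poly F}) (N N' : 'I_d -> 'I_d -> {poly F}) (de : {poly F}),
  [/\ de != 0 /\ De != 0, forall c : 'I_d, wv de * f ^+ c = \sum_(c' < d) wv (N c c') * (fpow q f) ^+ c',
      forall c c'', \sum_c' N c c' * N' c' c'' = De *+ (c == c'')
    & forall c c'', \sum_c' N' c c' * N c' c'' = De *+ (c == c'')].
Proof.
have [bd [bs [bd0 bE]]] := top_relation.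
have red j : exists v : 'I_d -> {poly F}, wv (bd ^+ j) * f ^+ j = \sum_c wv (v c) * f ^+ c.
  elim: j => [|j [v vE]].
    exists (fun c => (c == Ordinal d0)%:R); rewrite !expr0 rmorph1 mul1r.
    rewrite (bigD1 (Ordinal d0)) //= ?eqxx rmorph1 mul1r big1 ?addr0 ?expr0 // => c c0.
    by rewrite (negPf c0) rmorph0 mul0r.
  case: d d0 bs bE v vE => // d' _ bs bE v vE.
  exists (fun c => v ord_max * bs c + (if unlift ord0 c is Some c' then bd * v (widen_ord (leqnSn d') c') else 0)).
  rewrite !exprSr rmorphM mulrACA vE mulr_suml big_ord_recr /=.
  have -> : wv (v ord_max) * f ^+ d' * (wv bd * f) = \sum_c wv (v ord_max * bs c) * f ^+ c.
    transitivity (wv (v ord_max) * (wv bd * f ^+ d'.+1)); first by rewrite exprSr; ring.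
    by rewrite bE mulr_sumr; apply: eq_bigr => c _; rewrite rmorphM mulrA.
  under [RHS]eq_bigr => c _ do rewrite rmorphD mulrDl.
  rewrite [RHS]big_split /= addrC; congr (_ + _).
  rewrite [RHS]big_ord_recl unlift_none rmorph0 mul0r add0r; apply: eq_bigr => c _.
  by rewrite liftK rmorphM lift0 exprSr; ring.
have [v vE] := choice (fun c' : 'I_d => red (q * c')%N).
pose A : 'M[{poly F}]_d := \matrix_(c', c) (bd ^+ (q * (d - c')) * v c' c).
pose d1 := bd ^+ (q * d).
have AE (c' : 'I_d) : wv d1 * f ^+ (q * c') = \sum_c wv (A c' c) * f ^+ c.
  have -> : d1 = bd ^+ (q * (d - c')) * bd ^+ (q * c').
    by rewrite /d1 -exprD -mulnDr subnK // ltnW.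
  rewrite rmorphM -mulrA vE mulr_sumr; apply: eq_bigr => c _.
  by rewrite mxE rmorphM mulrA.
have dA : \det A != 0.
  apply/eqP => dA0; have /det0P[v1 v10 v1A] : \det (map_mx (@tofrac {poly F}) A) == 0.
    by rewrite det_map_mx /= dA0 tofrac0.
  have [e e0 /choice[v2 v2E]] := common_den (fun c => v1 0 c).
  have v2A c : \sum_c' v2 c' * A c' c = 0.
    apply: tofrac_inj; rewrite tofrac0 rmorph_sum /=.
    have /matrixP/(_ 0 c) := v1A; rewrite !mxE => E.
    transitivity (tofrac e * \sum_j v1 0 j * map_mx (@tofrac {poly F}) A j c); last by rewrite E mulr0.
    rewrite mulr_sumr; apply: eq_bigr => c' _.
    by rewrite tofracM -v2E [map_mx _ _ _ _]mxE mulrA.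
  have v20 : forall c, v2 c = 0.
    apply: wv_frob_indep; have u : wv d1 != 0.
      apply/eqP => E; have : d1 = 0 by apply/polyP => i; rewrite -wvE E coef0.
      by apply/eqP; rewrite expf_neq0.
    apply: (mulfI u); rewrite mulr0 mulr_sumr.
    under eq_bigr => c _ do rewrite mulrCA AE mulr_sumr.
    rewrite exchange_big /= big1 // => c _.
    transitivity (wv (\sum_c' v2 c' * A c' c) * f ^+ c); last by rewrite v2A rmorph0 mul0r.
    by rewrite rmorph_sum mulr_suml; apply: eq_bigr => c' _; rewrite rmorphM mulrA.
  move/rV0Pn: v10 => [c]; apply/negP/negPn/eqP.
  have := v2E c; rewrite v20 tofrac0 => /eqP; rewrite mulf_eq0 tofrac_eq0 (negPf e0) => /eqP.
  by [].
exists (d1 * \det A), (fun c c' => d1 * (\adj A) c c'), (fun c c' => A c c'), (\det A); split.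
- by split=> //; rewrite mulf_neq0 // expf_neq0.
- move=> c; transitivity (\sum_(c' < d) wv ((\adj A) c c') * (wv d1 * f ^+ (q * c'))).
    under eq_bigr => c' _ do rewrite AE mulr_sumr.
    rewrite exchange_big /=.
    have E c'' : \sum_c' wv ((\adj A) c c') * wv (A c' c'') = wv (\det A *+ (c == c'')).
      have /matrixP/(_ c c'') := mul_adj_mx A; rewrite [RHS]mxE => <-.
      by rewrite mxE rmorph_sum; apply: eq_bigr => c' _; rewrite rmorphM.
    under [RHS]eq_bigr => c'' _ do under eq_bigr => c' _ do rewrite mulrA.
    under [RHS]eq_bigr => c'' _ do rewrite -mulr_suml E.
    rewrite (bigD1 c) //= eqxx mulr1n big1 ?addr0 // => c'' cc.
    by rewrite eq_sym (negPf cc) mulr0n rmorph0 mul0r.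
  apply: eq_bigr => c' _; rewrite rmorphM -powser_frob -exprM; ring.
- move=> c c''; under eq_bigr => c' _ do rewrite -mulrA.
  rewrite -mulr_sumr -mulrnAr; congr (_ * _).
  by have /matrixP/(_ c c'') := mul_adj_mx A; rewrite !mxE.
- move=> c c''; under eq_bigr => c' _ do rewrite mulrCA.
  rewrite -mulr_sumr -mulrnAr; congr (_ * _).
  by have /matrixP/(_ c c'') := mul_mx_adj A; rewrite !mxE.
Qed.

End Min.
End Alpha.

(** * Minors of the solutions of a system *)

Section TensorSystem.
Variables (R : comNzRingType) (s : nat) (T : finType).

Definition rsel (A : T -> 'I_s -> R) (g : {ffun 'I_s -> T}) : 'M[R]_s :=
  \matrix_(i, j) A (g i) j.

(** Multilinear expansion over all row choices, repeated or unordered ones included: the system for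
    minors is then the plain tensor power of M, and [prod_delta] inverts it by the tensor power of
    M'. *)
Lemma det_rsel_expand (de : R) (M : T -> T -> R) (A A' : T -> 'I_s -> R) g :
  (forall x j, de * A x j = \sum_y M x y * A' y j) ->
  de ^+ s * \det (rsel A g) =
  \sum_(g' : {ffun 'I_s -> T}) (\prod_i M (g i) (g' i)) * \det (rsel A' g').
Proof.
move=> AE; rewrite /determinant mulr_sumr.
under [RHS]eq_bigr => g' _ do rewrite mulr_sumr.
rewrite exchange_big /=; apply: eq_bigr => p _.
rewrite mulrCA; under [RHS]eq_bigr => g' _ do rewrite mulrCA.
rewrite -mulr_sumr; congr (_ * _).
transitivity (\prod_i (de * A (g i) (p i))).
  rewrite big_split /= prodr_const card_ord; congr (_ * _).
  by apply: eq_bigr => i _; rewrite mxE.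
under eq_bigr => i _ do rewrite AE.
rewrite bigA_distr_bigA /=; apply: eq_bigr => g' _.
by rewrite big_split /=; congr (_ * _); apply: eq_bigr => i _; rewrite mxE.
Qed.

Lemma prod_delta (M M' : T -> T -> R) De (g g'' : {ffun 'I_s -> T}) :
  (forall x y, \sum_z M x z * M' z y = De *+ (x == y)) ->
  \sum_(g' : {ffun 'I_s -> T}) (\prod_i M (g i) (g' i)) * (\prod_i M' (g' i) (g'' i)) =
  De ^+ s *+ (g == g'').
Proof.
move=> MM; under eq_bigr => g' _ do rewrite -big_split /=.
rewrite -(bigA_distr_bigA (fun i z => M (g i) z * M' z (g'' i))).
under eq_bigr => i _ do rewrite MM.
case: eqP => [->|ne].
  by under eq_bigr => i _ do rewrite eqxx; rewrite prodr_const card_ord.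
have [i gi] : exists i, g i != g'' i.
  apply: contrapT => /forallNP h; apply: ne; apply/ffunP => i.
  by apply/eqP; have /negP := h i; rewrite negbK.
by rewrite (bigD1 i) //= (negPf gi) mulr0n mul0r.
Qed.

End TensorSystem.

(** * From an algebraic L to relations between minors of residues *)

Section Core.
Variables (F : finFieldType) (r s : nat) (f : powser F) (P : {poly {poly F}}).
Hypothesis s_gt0 : (0 < s)%N.
Local Notation q := #|F|.
Local Notation k := {fraction {poly F}}.
Local Notation S := (powser k).
Local Notation K := (Kinf F).
Local Notation P2 := {poly {poly F}}.
Local Notation L := (tofrac f : K).
Local Notation Tr := ('I_r + 'I_s)%type.
Hypotheses (P0 : P != 0) (rP : root (map_poly (evt 1) P) L).
Variables (Th : Tr -> 'I_s -> S) (h0 : nat) (de De : P2) (M M' : Tr -> Tr -> P2).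
Hypothesis grTh : forall x j, gr (Th x j).
Hypothesis Thr : forall i j, Th (inr i) j = powserX k ^+ h0 *+ (i == j).
Hypothesis de0 : de != 0.
Hypothesis De0 : forall m, spm m De != 0.
Hypothesis sys : forall x j, pu de * Th x j = \sum_y pu (M x y) * fpow q (Th y j).
Hypothesis MM' : forall x y, \sum_z M x z * M' z y = De *+ (x == y).
Hypothesis M'M : forall x y, \sum_z M' x z * M z y = De *+ (x == y).
Variables (p0 : 'I_s -> 'I_r) (xP : 'M[K]_s) (a b : {poly F}).
Hypothesis xPE : forall i j, evr 1 (Th (inl (p0 i)) j) (xP i j).
Hypotheses (a0 : a != 0).
Hypothesis relL : evt 1 b * L * wK ^+ (h0 * s) = evt 1 a * \det xP.

(** Specialization at t = theta^(q^m), where the m-th twist of the solution has its pole. *)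
Definition evK (m : nat) (R : P2) : K := (map_poly (evt (q ^ m)) R).[wK].

Variables (K0 : nat) (AK : nat -> 'I_r -> 'I_s -> K).
Hypothesis resid : forall m, (K0 <= m)%N -> exists (Y : 'M[S]_s) (B : 'M[K]_s),
  [/\ \det B != 0, forall i j, Lau (AK m i j),
      forall i j, evr (q ^ m) (\sum_l Th (inl i) l * Y l j) (\sum_l AK m i l * B l j)
    & forall i j, evr (q ^ m) (\sum_l Th (inr i) l * Y l j) 0].

Lemma Lau_evK m R : Lau (evK m R).
Proof.
rewrite /evK horner_coef; apply: Lau_sum => i _; apply: LauM; last exact: Lau_w.
by rewrite coef_map /= -evt_comp; apply: Lau_evt.
Qed.

(** [lift_relation] is applied to all products of a power of L with a minor of [Th]. At t =
    theta^(q^m) the matrix Y extracts the polar part: rows of the constant block become 0, so the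
    minors that meet them disappear, and the remaining ones are minors of [AK m] times det B.
    [Lau_indep] then isolates the exponent 0 of L. *)
Theorem core_relation : exists Rg : {ffun 'I_s -> 'I_r} -> P2,
  [/\ spm 0 (Rg [ffun i => p0 i]) != 0,
      forall g, g != [ffun i => p0 i] -> spm 0 (Rg g) = 0
    & forall m, (K0 <= m)%N ->
      \sum_g evK m (Rg g) * \det (\matrix_(i, j) AK m (g i) j) = 0].
Proof.
have [d [P1 [d0 sP1 rP1 minP]]] := min_relation P0 rP.
have [Da [Na [Na' [da [[da0 Da0] sa NNa NNa']]]]] := alpha_system d0 sP1 rP1 minP.
have [nu [nus [nu0 nuE]]] := min_coef d0 sP1 rP1.
pose cu (p : {poly F}) : P2 := map_poly polyC p.
have cuM p p' : cu (p * p') = cu p * cu p' by rewrite /cu rmorphM.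
pose I := ('I_d * {ffun 'I_s -> Tr})%type.
pose psi (x : I) : S := al f ^+ x.1 * \det (rsel Th x.2).
pose de1 := cu da * de ^+ s; pose De1 := cu Da * De ^+ s.
pose N (x y : I) := cu (Na x.1 y.1) * \prod_i M (x.2 i) (y.2 i).
pose N' (x y : I) := cu (Na' x.1 y.1) * \prod_i M' (x.2 i) (y.2 i).
have sumI (V : nmodType) (G : 'I_d -> {ffun 'I_s -> Tr} -> V) :
    \sum_(x : I) G x.1 x.2 = \sum_c \sum_g G c g.
  by rewrite pair_bigA.
have cuNN (A A' : 'I_d -> 'I_d -> {poly F}) (B B' : Tr -> Tr -> P2) Dx Dy (x y : I) :
    (forall c c'', \sum_c' A c c' * A' c' c'' = Dx *+ (c == c'')) ->
    (forall x y, \sum_z B x z * B' z y = Dy *+ (x == y)) ->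
    \sum_(z : I) (cu (A x.1 z.1) * \prod_i B (x.2 i) (z.2 i)) *
       (cu (A' z.1 y.1) * \prod_i B' (z.2 i) (y.2 i)) = (cu Dx * Dy ^+ s) *+ (x == y).
  move=> AA BB; rewrite (sumI _ (fun c g => (cu (A x.1 c) * \prod_i B (x.2 i) (g i)) *
       (cu (A' c y.1) * \prod_i B' (g i) (y.2 i)))).
  transitivity ((\sum_c cu (A x.1 c) * cu (A' c y.1)) *
     (\sum_(g : {ffun 'I_s -> Tr}) (\prod_i B (x.2 i) (g i)) * (\prod_i B' (g i) (y.2 i)))).
    rewrite big_distrlr /=; apply: eq_bigr => c _; apply: eq_bigr => g _.
    by rewrite mulrACA.
  rewrite (prod_delta _ _ BB).
  have -> : \sum_c cu (A x.1 c) * cu (A' c y.1) = cu Dx *+ (x.1 == y.1).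
    transitivity (cu (\sum_c A x.1 c * A' c y.1)).
      by rewrite /cu rmorph_sum; apply: eq_bigr => c _; rewrite rmorphM.
    by rewrite AA /cu raddfMn.
  case: x y => [c g] [c' g'] /=; rewrite -pair_eqE /pair_eq /=.
  by case: (c == c'); case: (g == g'); rewrite ?mulr1n ?mulr0n ?mulr0 ?mul0r.
have gpsi x : gr (psi x).
  apply: grM; last by apply: gr_det => i j; rewrite mxE.
  rewrite -[al f ^+ _]rmorphXn; exact: gr_al.
have dE1 : de1 != 0.
  rewrite mulf_neq0 ?expf_neq0 // /cu map_poly_eq0_id0 // polyC_eq0.
  by rewrite lead_coef_eq0.
have spcu m p : spm m (cu p) = tofrac (fpow (q ^ m) (wv p)).
  by apply: evr_uniq (evr_spm m (cu p)) _; rewrite -al_wv fpow_al; apply: evr_al.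
have wv0 (p : {poly F}) : wv p = 0 -> p = 0 by move=> E; apply/polyP => i; rewrite -wvE E coef0.
have De10 m : spm m De1 != 0.
  rewrite /De1 rmorphM rmorphXn /= mulf_neq0 ?expf_neq0 // spcu tofrac_eq0.
  by apply: contra_neq Da0 => /fpow_eq0/wv0.
have sys1 x : pu de1 * psi x = \sum_y pu (N x y) * fpow q (psi y).
  case: x => c g; rewrite /psi /= rmorphM rmorphXn /= mulrACA.
  have -> : pu (cu da) * al f ^+ c = \sum_(c' < d) pu (cu (Na c c')) * (al (fpow q f)) ^+ c'.
    rewrite -al_wv -rmorphXn -rmorphM sa rmorph_sum; apply: eq_bigr => c' _.
    by rewrite rmorphM rmorphXn /= al_wv.
  rewrite (@det_rsel_expand _ _ _ _ (fun x y => pu (M x y)) _ (fun y j => fpow q (Th y j))) //.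
  rewrite (sumI _ (fun c' g' => pu (N (c, g) (c', g')) * fpow q (al f ^+ c' * \det (rsel Th g')))).
  rewrite big_distrlr /=; apply: eq_bigr => c' _; apply: eq_bigr => g' _.
  rewrite !rmorphM rmorphXn /= fpow_al mulrACA; congr (_ * _ * (_ * _)).
    by rewrite rmorph_prod.
  by rewrite -det_map_mx; congr determinant; apply/matrixP => i j; rewrite !mxE.
have [th thE] : exists th : Tr -> 'I_s -> K, forall x j, evr 1 (Th x j) (th x j).
  have ex (xj : Tr * 'I_s) : exists y, evr 1 (Th xj.1 xj.2) y.
    by rewrite -[Th _ _]fpow1; apply: evr_gr.
  by have [y yE] := choice ex; exists (fun x j => y (x, j)) => x j; apply: (yE (x, j)).
pose gI : {ffun 'I_s -> Tr} := [ffun i => inr i].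
pose gP : {ffun 'I_s -> Tr} := [ffun i => inl (p0 i)].
(* This is nu times (b L w^(h0 s) - a det xP), with nu L expanded by [min_coef], so that only powers
   of L below d occur. The choice gI takes the constant block, and gP the rows [p0]. *)
pose rho (x : I) : {poly F} := if x.2 == gI then b * nus x.1
  else if (x.2 == gP) && (x.1 == Ordinal d0) then - (a * nu) else 0.
pose x0 (x : I) : K := L ^+ x.1 * \det (rsel th x.2).
have x0E x : evr 1 (psi x) (x0 x).
  apply: evrM; last by apply: evr_det => i j; rewrite !mxE.
  by rewrite -rmorphXn -[L ^+ _]rmorphXn; apply: evr_al.
have dI : \det (rsel th gI) = wK ^+ (h0 * s).
  have -> : rsel th gI = (wK ^+ h0)%:M.
    apply/matrixP => i j; rewrite !mxE ffunE; apply: evr_uniq (thE _ _) _.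
    rewrite Thr; case: (i == j); last by rewrite !mulr0n; apply: evr0.
    by rewrite !mulr1n; apply: evr_Xn.
  by rewrite det_scalar -exprM.
have dP : \det (rsel th gP) = \det xP.
  congr determinant; apply/matrixP => i j; rewrite !mxE ffunE.
  exact: evr_uniq (thE _ _) (xPE _ _).
have IP : gP != gI.
  by apply/eqP => /ffunP/(_ (Ordinal s_gt0)); rewrite !ffunE.
have rel0 : \sum_x evt 1 (rho x) * x0 x = 0.
  rewrite (sumI _ (fun c g => evt 1 (rho (c, g)) * x0 (c, g))).
  rewrite (eq_bigr (fun c => evt 1 (b * nus c) * (L ^+ c * wK ^+ (h0 * s)) -
     (evt 1 (a * nu) * \det xP) *+ (c == Ordinal d0))) => [|c _]; last first.
    rewrite (bigD1 gI) //= /rho /x0 /= eqxx dI; congr (_ + _).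
    rewrite (bigD1 gP) //= (negPf IP) eqxx /= big1 ?addr0 => [|g /andP[gnI gnP]]; last first.
      by rewrite (negPf gnI) (negPf gnP) rmorph0 mul0r.
    rewrite dP; case: eqP => [->|_]; last by rewrite rmorph0 mul0r mulr0n oppr0.
    by rewrite mulr1n rmorphN mulNr expr0 mul1r.
  rewrite sumrB [X in _ - X](bigD1 (Ordinal d0)) //= ?eqxx mulr1n [X in _ - (_ + X)]big1 ?addr0 => [|c /negPf->]; last first.
    by rewrite mulr0n.
  transitivity (evt 1 nu * (evt 1 b * L * wK ^+ (h0 * s)) - evt 1 nu * (evt 1 a * \det xP)); last first.
    by rewrite relL subrr.
  congr (_ - _); last by rewrite rmorphM; ring.
  transitivity (evt 1 b * wK ^+ (h0 * s) * (evt 1 nu * L)); last by ring.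
  rewrite nuE mulr_sumr; apply: eq_bigr => c _; rewrite rmorphM; ring.
have [R [c1 [c10 R0 Rc]]] := @lift_relation F I psi gpsi de1 De1 N N' dE1 sys1
  (fun x y => cuNN _ _ _ _ _ _ x y NNa MM') (fun x y => cuNN _ _ _ _ _ _ x y NNa' M'M)
  De10 rho x0 x0E rel0.
pose il (g : {ffun 'I_s -> 'I_r}) : {ffun 'I_s -> Tr} := [ffun i => inl (g i)].
have ilI g : il g != gI.
  by apply/eqP => /ffunP/(_ (Ordinal s_gt0)); rewrite !ffunE.
have ilP g : (il g == gP) = (g == [ffun i => p0 i]).
  apply/eqP/eqP => [/ffunP E|->]; last by apply/ffunP => i; rewrite !ffunE.
  by apply/ffunP => i; have := E i; rewrite !ffunE => -[].
exists (fun g => R (Ordinal d0, il g)); split.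
- rewrite Rc /rho /= (negPf (ilI _)) ilP !eqxx /= mulf_neq0 //.
  by apply: evt_eq0 => //; rewrite oppr_eq0 mulf_neq0.
- by move=> g gp; rewrite Rc /rho /= (negPf (ilI _)) ilP (negPf gp) rmorph0 mulr0.
move=> m mK; have [Y [B [B0 LA top bot]]] := resid mK.
pose vv (x : Tr) (j : 'I_s) : K := if x is inl i then \sum_l AK m i l * B l j else 0.
pose ThY (x : Tr) (j : 'I_s) : S := \sum_l Th x l * Y l j.
have vvE x j : evr (q ^ m) (ThY x j) (vv x j) by case: x => i; [exact: top|exact: bot].
have E0 : \sum_x evK m (R x) * (L ^+ x.1 * \det (rsel vv x.2)) = 0.
  apply: (@evr_uniq _ (q ^ m) ((\sum_x pu (R x) * psi x) * \det Y)); last first.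
    by rewrite R0 mul0r; apply: evr0.
  rewrite mulr_suml; apply: evr_sum => x _; rewrite -mulrA; apply: evrM; first exact: evr_pu.
  rewrite /psi -mulrA; apply: evrM.
    by rewrite -rmorphXn -[L ^+ _]rmorphXn; apply: evr_al.
  rewrite -det_mulmx; apply: evr_det => i j; rewrite !mxE.
  have -> : \sum_l rsel Th x.2 i l * Y l j = ThY (x.2 i) j by apply: eq_bigr => l _; rewrite mxE.
  exact: vvE.
have dvv (g : {ffun 'I_s -> Tr}) i j : g i = inr j -> \det (rsel vv g) = 0.
  move=> gi; rewrite /determinant big1 // => p _.
  by rewrite (bigD1 i) //= mxE gi mul0r mulr0.
have dil g : \det (rsel vv (il g)) = \det (rsel (AK m) g) * \det B.
  rewrite -det_mulmx; congr determinant; apply/matrixP => i j; rewrite !mxE ffunE /=.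
  by apply: eq_bigr => l _; rewrite mxE.
have sum_il (G : {ffun 'I_s -> Tr} -> K) : (forall (g : {ffun 'I_s -> Tr}) i j, g i = inr j -> G g = 0) ->
    \sum_g G g = \sum_g' G (il g').
  move=> G0; rewrite (bigID (fun g : {ffun 'I_s -> Tr} => [forall i, if g i is inl _ then true else false])) /=.
  rewrite [X in _ + X]big1 ?addr0 => [|g]; last first.
    rewrite negb_forall => /existsP[i]; case E: (g i) => [//|j] _; exact: G0 E.
  rewrite (reindex_onto il (fun g => [ffun i => if g i is inl x then x else p0 i])) /=; last first.
    move=> g /forallP gl; apply/ffunP => i; rewrite !ffunE; have := gl i.
    by case: (g i).
  apply: eq_bigl => g; apply/andP; split.
    by apply/forallP => i; rewrite ffunE.
  by apply/eqP/ffunP => i; rewrite !ffunE.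
have E1 : \sum_c (\sum_g evK m (R (c, il g)) * \det (rsel (AK m) g)) * L ^+ c = 0.
  apply: (mulIf B0); rewrite mul0r -[RHS]E0.
  have -> : \sum_x evK m (R x) * (L ^+ x.1 * \det (rsel vv x.2)) =
      \sum_(c < d) \sum_g evK m (R (c, g)) * (L ^+ c * \det (rsel vv g)).
    by rewrite pair_bigA; apply: eq_bigr => -[].
  rewrite mulr_suml.
  apply: eq_bigr => c _; rewrite sum_il => [|g i j gi]; last by rewrite (dvv _ _ _ gi) !mulr0.
  rewrite !mulr_suml; apply: eq_bigr => g _; rewrite dil; ring.
pose xc (c : 'I_d) : K := \sum_g evK m (R (c, il g)) * \det (rsel (AK m) g).
have LX c : Lau (xc c).
  apply: Lau_sum => g _; apply: LauM; first exact: Lau_evK.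
  by apply: Lau_det => i j; rewrite mxE.
have E2 : xc (Ordinal d0) = 0 by apply: (Lau_indep d0 sP1 rP1 minP LX).
by rewrite -[RHS]E2; apply: eq_bigr => g _; congr (_ * \det _).
Qed.

End Core.

(** * Independence of the coefficients of an exponential *)

Section ExpCoefs.
Variables (F : finFieldType) (K : fieldType) (f : {rmorphism F -> K}) (theta : K).
Local Notation q := #|F|.
Hypothesis theta_inj : forall m n, theta ^+ (q ^ m) = theta ^+ (q ^ n) -> m = n.

Lemma inj_roots (x : nat -> K) (P : {poly K}) : injective x -> P != 0 ->
  exists M, forall m, (M <= m)%N -> P.[x m] != 0.
Proof.
move=> xI; have [n] := ubnP (size P); elim: n P => // n IH P; rewrite ltnS => sP P0.
have [[m0 r0]|nr] := pselect (exists m0, root P (x m0)); last first.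
  by exists 0%N => m _; apply/negP => h; apply: nr; exists m.
have /factor_theorem[Q PE] := r0.
have Q0 : Q != 0 by apply: contraNneq P0 => Q0; rewrite PE Q0 mul0r.
have [|M hM] := IH Q _ Q0.
  apply: leq_trans sP; rewrite PE size_mul ?polyXsubC_eq0 // size_XsubC addn2 //.
exists (M + m0.+1)%N => m le; rewrite PE hornerM hornerXsubC mulf_neq0 //.
  by apply: hM; apply: leq_trans le; rewrite leq_addr.
rewrite subr_eq0; apply/eqP => /xI E; move: le; rewrite E; lia.
Qed.

Variables (r : nat) (a : nat -> K).
Hypotheses (r0 : (0 < r)%N) (ar : a r != 0).

Section Seq.
Variable e : nat -> K.
Hypothesis e0 : e 0%N = 1.

(** With e the series of the e_n tau^n, this is the coefficient of tau^m in tau^i e. The hypothesis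
    [eS] below reads e theta = phi_theta e, so e is the exponential of phi. *)
Definition Ei (i m : nat) : K := if (i <= m)%N then e (m - i) ^+ (q ^ i) else 0.

Hypothesis eS : forall n, (theta ^+ (q ^ n) - theta) * e n = \sum_(j < r) a j.+1 * Ei j.+1 n.

Lemma EiS i m : Ei i.+1 m.+1 = Ei i m ^+ q.
Proof.
rewrite /Ei ltnS subSS; case: ifP => _; first by rewrite -exprM expnSr.
by rewrite expr0n gtn_eqF // (ltnW (q_gt1 F)).
Qed.

Lemma theta_neq m i : m != i -> theta ^+ (q ^ m) - theta ^+ (q ^ i) != 0.
Proof. by apply: contra_neq => /eqP; rewrite subr_eq0 => /eqP/theta_inj. Qed.

(** If N were the last index with e_N nonzero, the recursion at N + r would reduce to a_r e_N^(q^r)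
    = 0. *)
Lemma e_nonzero M : exists2 m, (M <= m)%N & e m != 0.
Proof.
apply: contrapT => nex.
have eM m : (M <= m)%N -> e m = 0.
  by move=> Mm; apply/eqP; apply: contraT => em; case: nex; exists m.
have ex : exists N, `[< forall m, (N <= m)%N -> e m = 0 >] by exists M; apply/asboolP.
have [N /asboolP eN minN] := ex_minnP ex.
case: N eN minN => [|N] eN minN; first by have /eqP := eN 0%N isT; rewrite e0 oner_eq0.
have eN0 : e N != 0.
  apply/eqP => eN0; have : (N.+1 <= N)%N.
    apply: minN; apply/asboolP => m; rewrite leq_eqVlt => /orP[/eqP<-//|]; exact: eN.
  by rewrite ltnn.
have := eS (N + r); rewrite eN ?mulr0; last by rewrite -addn1 leq_add2l.
case: r r0 ar => // r' _ ar'; rewrite big_ord_recr /= big1 ?add0r => [|j _]; last first.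
  rewrite /Ei; case: ifP => _; last by rewrite mulr0.
  rewrite eN ?expr0n ?gtn_eqF ?q_exp_gt0 ?mulr0 //.
  by have := ltn_ord j; lia.
rewrite /Ei leq_addl addnK => /esym/eqP.
by rewrite mulf_eq0 (negPf ar') expf_eq0 (negPf eN0) andbF.
Qed.

(** The coefficient of tau^m in w e, with the twisted polynomial w encoded as an ordinary
    polynomial. *)
Definition act (w : {poly K}) (m : nat) : K := \sum_(i < size w) w`_i * Ei i m.

Lemma act_wide (w : {poly K}) n m : (size w <= n)%N -> act w m = \sum_(i < n) w`_i * Ei i m.
Proof.
move=> le; rewrite /act (big_ord_widen n (fun i => w`_i * Ei i m)) // big_mkcond /=.
by apply: eq_bigr => i _; case: ltnP => // ge; rewrite nth_default // mul0r.
Qed.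


Lemma actD c w w' m : act (c *: w + w') m = c * act w m + act w' m.
Proof.
pose n := (size (c *: w + w')%R + size w + size w')%N.
rewrite !(@act_wide _ n); try by rewrite /n; move: (size _) (size _) (size _) => x1 x2 x3; lia.
rewrite mulr_sumr -big_split; apply: eq_bigr => i _ /=.
by rewrite coefD coefZ mulrDl mulrA.
Qed.

Lemma act0 m : act 0 m = 0.
Proof. by rewrite /act size_poly0 big_ord0. Qed.

Lemma act_sum n (c : 'I_n -> K) (w : 'I_n -> {poly K}) m :
  act (\sum_i c i *: w i) m = \sum_i c i * act (w i) m.
Proof.
elim: n c w => [|n IH] c w; first by rewrite !big_ord0 act0.
by rewrite !big_ord_recl actD IH.
Qed.

Lemma actXn i m : act 'X^i m = Ei i m.
Proof.
rewrite /act size_polyXn big_ord_recr /= coefXn eqxx mul1r big1 ?add0r // => j _.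
by rewrite coefXn ltn_eqF ?mul0r.
Qed.

(** Right multiplication by phi_theta. As w phi_theta e = w e theta, it multiplies coefficient m of
    w e by theta^(q^m). *)
Definition mulT (w : {poly K}) : {poly K} := \sum_(i < size w) w`_i *:
  (theta ^+ (q ^ i) *: 'X^i + \sum_(j < r) a j.+1 ^+ (q ^ i) *: 'X^(i + j.+1)).

Lemma act_mulT (w : {poly K}) m : act (mulT w) m = theta ^+ (q ^ m) * act w m.
Proof.
rewrite /mulT act_sum /act mulr_sumr; apply: eq_bigr => i _.
rewrite -/(act _ m) mulrCA; congr (_ * _); rewrite actD actXn act_sum.
under eq_bigr => j _ do rewrite actXn.
suff -> : \sum_(j < r) a j.+1 ^+ (q ^ i) * Ei (i + j.+1) m =
    (theta ^+ (q ^ m) - theta ^+ (q ^ i)) * Ei i m by ring.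
have [im|mi] := leqP i m; last first.
  rewrite [in RHS]/Ei leqNgt mi mulr0 big1 // => j _.
  by rewrite /Ei leqNgt (leq_trans mi) ?mulr0 // leq_addr.
have := congr1 (fun y => y ^+ (q ^ i)) (eS (m - i)).
rewrite exprMn (frobD f) (frobN f) -exprM -expnD subnK // => E.
rewrite [in RHS]/Ei im E (frob_sum f); apply: eq_bigr => j _.
rewrite exprMn; congr (_ * _); rewrite /Ei leq_subRL //; case: ifP => _; last first.
  by rewrite expr0n gtn_eqF ?q_exp_gt0.
by rewrite -exprM -expnD subnDA addnC.
Qed.

Lemma size_mulT_le (w : {poly K}) : (size (mulT w) <= size w + r)%N.
Proof.
apply: leq_trans (size_sum _ _ _) _; apply/bigmax_leqP => i _.
apply: leq_trans (size_scale_leq _ _) _; apply: leq_trans (size_polyD _ _) _.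
rewrite geq_max; apply/andP; split.
  apply: leq_trans (size_scale_leq _ _) _; rewrite size_polyXn.
  by apply: leq_trans (ltn_ord i) (leq_addr _ _).
apply: leq_trans (size_sum _ _ _) _; apply/bigmax_leqP => j _.
apply: leq_trans (size_scale_leq _ _) _; rewrite size_polyXn.
by rewrite -addnS; have := ltn_ord i; have := ltn_ord j; lia.
Qed.

Lemma coef_mulT (w : {poly K}) d : size w = d.+1 -> (mulT w)`_(d + r) != 0.
Proof.
move=> sw; rewrite /mulT sw big_ord_recr coefD coef_sum big1 ?add0r => [|i _].
  rewrite coefZ coefD coefZ coefXn gtn_eqF ?mulr0 ?add0r; last by rewrite -addn1 leq_add2l.
  rewrite coef_sum; case: r r0 ar => // r' _ ar'; rewrite big_ord_recr /= coefZ coefXn eqxx mulr1.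
  rewrite big1 ?add0r => [|j _]; last first.
    by rewrite coefZ coefXn eqn_add2l gtn_eqF ?mulr0 // ltnS.
  rewrite mulf_neq0 ?expf_neq0 //.
  by have := lead_coef_eq0 w; rewrite lead_coefE sw /= => ->; rewrite -size_poly_eq0 sw.
rewrite coefZ coefD coefZ coefXn gtn_eqF ?mulr0 ?add0r; last first.
  by apply: leq_trans (ltn_ord i) (leq_addr _ _).
rewrite coef_sum big1 ?mulr0 // => j _; rewrite coefZ coefXn gtn_eqF ?mulr0 //.
by have := ltn_ord i; have := ltn_ord j; rewrite /=; lia.
Qed.

(** Left multiplication by tau. *)
Definition phT (w : {poly K}) : {poly K} := \poly_(i < (size w).+1) (if i is i'.+1 then w`_i' ^+ q else 0).

Lemma act_phT (w : {poly K}) m : act (phT w) m.+1 = act w m ^+ q.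
Proof.
rewrite (@act_wide _ (size w).+1) ?size_poly // big_ord_recl coef_poly mul0r add0r.
rewrite /act -[X in _ = _ ^+ X](expn1 q) (frob_sum f) expn1; apply: eq_bigr => i _.
by rewrite coef_poly lift0 ltnS ltn_ord EiS exprMn.
Qed.

Lemma size_phT (w : {poly K}) d : size w = d.+1 -> size (phT w) = d.+2.
Proof.
move=> sw; rewrite /phT size_poly_eq sw //= expf_neq0 //.
by have := lead_coef_eq0 w; rewrite lead_coefE sw /= => ->; rewrite -size_poly_eq0 sw.
Qed.

Definition null (w : {poly K}) := exists M, forall m, (M <= m)%N -> act w m = 0.

Lemma null_lin c w w' : null w -> null w' -> null (c *: w + w').
Proof.
move=> [M h] [M' h']; exists (M + M')%N => m le.
by rewrite actD h ?h' ?mulr0 ?addr0 //; lia.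
Qed.

(** Suppose w e is a polynomial for some nonzero w, and take one of least degree d. The tau^l w
    reach every degree from d on, so modulo such elements all twisted polynomials have degree below
    d. Hence 1, phi_theta, ..., phi_theta^d are dependent, which yields a nonzero P with
    P(theta^(q^m)) e_m = 0 for large m, against [e_nonzero]. *)
Lemma act_indep (w : {poly K}) : null w -> w = 0.
Proof.
move=> nw1; apply/eqP; apply: contraT => w0.
pose Pd d := `[< exists2 w : {poly K}, size w = d.+1 & null w >].
have exd : exists d, Pd d.
  by exists (size w).-1; apply/asboolP; exists w; rewrite // prednK // size_poly_gt0.
have [d /asboolP[w1 sw nw] mind] := ex_minnP exd.
have nl l : exists2 v : {poly K}, size v = (d + l).+1 & null v.
  elim: l => [|l [v sv [M h]]]; first by exists w1; rewrite // addn0.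
  exists (phT v); first by rewrite (size_phT sv) addnS.
  exists M.+1 => -[//|m] le; rewrite act_phT h // expr0n gtn_eqF //.
  exact: ltnW (q_gt1 F).
have red (v : {poly K}) : exists2 v' : {poly K}, (size v' <= d)%N & null (v - v').
  have [n] := ubnP (size v); elim: n v => // n IH v; rewrite ltnS => sv.
  have [le|gt] := leqP (size v) d.
    by exists v => //; rewrite subrr; exists 0%N => m _; apply: act0.
  have [u su nu] := nl ((size v).-1 - d)%N.
  have {}su : size u = size v by rewrite su; move: gt; case: (size v) => // c; lia.
  have u0 : lead_coef u != 0 by rewrite lead_coef_eq0 -size_poly_eq0 su -lt0n; lia.
  pose v1 := v - (lead_coef v / lead_coef u) *: u.
  have sv1 : (size v1 < size v)%N.
    have v0 : v != 0 by rewrite -size_poly_gt0; lia.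
    rewrite -(prednK (_ : 0 < size v)%N) ?size_poly_gt0 // ltnS; apply/leq_sizeP => j jv.
    rewrite coefB coefZ; move: jv; rewrite leq_eqVlt => /orP[/eqP<-|lt].
      have -> : u`_(size v).-1 = lead_coef u by rewrite lead_coefE su.
      by rewrite -lead_coefE divfK // subrr.
    rewrite !nth_default ?mulr0 ?subr0 ?su //; move: lt; case: (size v) => //.
  have [|v' sv' nv'] := IH v1; first exact: leq_trans sv1 sv.
  exists v' => //; have -> : v - v' = (lead_coef v / lead_coef u) *: u + (v1 - v').
    by rewrite /v1 addrA [_ *: u + _]addrC subrK.
  exact: null_lin.
pose tj j := iter j mulT 1.
have act_tj j m : act (tj j) m = theta ^+ (q ^ m) ^+ j * e m.
  elim: j => [|j IH]; first by rewrite mul1r -[tj 0%N]/('X^0) actXn /Ei leq0n subn0 expr1.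
  by rewrite /tj iterS act_mulT IH mulrA exprS.
have [v vP] := choice (fun j => (let: ex_intro2 v h1 h2 := red (tj j) in ex_intro _ v (conj h1 h2)) : exists v : {poly K}, (size v <= d)%N /\ null (tj j - v)).
have [|c [j0 cj0] cE] := @ker_ex K 'I_d.+1 'I_d (fun j i => (v j)`_i).
  by rewrite !card_ord.
pose P : {poly K} := \poly_(j < d.+1) c (inord j).
have P0 : P != 0.
  apply: contraNneq cj0 => P0; have := congr1 (fun p : {poly K} => p`_j0) P0.
  by rewrite coef_poly ltn_ord inord_val coef0 => ->.
have xI : injective (fun m => theta ^+ (q ^ m)) by move=> m n /theta_inj.
have [M1 hM1] := inj_roots xI P0.
have sum0 : \sum_(j < d.+1) c j *: v j = 0.
  apply/polyP => i; rewrite coef0 coef_sum; under eq_bigr => j _ do rewrite coefZ.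
  have [lt|ge] := ltnP i d; first exact: (cE (Ordinal lt)).
  rewrite big1 // => j _; rewrite nth_default ?mulr0 //; apply: leq_trans ge.
  by case: (vP j).
have nul : null (\sum_(j < d.+1) c j *: (tj j - v j)).
  apply: (big_ind null); first by exists 0%N => m _; apply: act0.
    by move=> x y nx ny; rewrite -[x]scale1r; apply: null_lin.
  move=> j _; rewrite -[_ *: _]addr0; apply: null_lin; first by case: (vP j).
  by exists 0%N => m _; apply: act0.
have [M2 hM2] := nul.
have [m mM em] := e_nonzero (M1 + M2).
have := hM2 m; rewrite (leq_trans (leq_addl _ _) mM) => /(_ isT).
under eq_bigr => j _ do rewrite scalerBr.
rewrite sumrB sum0 subr0 act_sum => E.
have : P.[theta ^+ (q ^ m)] * e m = 0.
  rewrite (@horner_coef_wide _ d.+1) ?size_poly // mulr_suml -[RHS]E; apply: eq_bigr => j _.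
  by rewrite coef_poly ltn_ord inord_val act_tj mulrA.
move/eqP; rewrite mulf_eq0 (negPf em) orbF (negPf (hM1 m _)) //.
exact: leq_trans (leq_addr _ _) mM.
Qed.

Lemma iter_mulT j i : (size (iter j mulT 'X^i) <= (i + r * j).+1)%N /\
  (iter j mulT 'X^i)`_(i + r * j) != 0.
Proof.
elim: j => [|j [IH1 IH2]].
  by rewrite muln0 addn0 /= size_polyXn coefXn eqxx oner_eq0.
have sE : size (iter j mulT 'X^i) = (i + r * j).+1.
  apply/eqP; rewrite eqn_leq IH1 ltnNge; apply: contra IH2 => le.
  by rewrite nth_default.
rewrite iterS mulnS [(r + _)%N]addnC addnA; split; last exact: coef_mulT.
by apply: leq_trans (size_mulT_le _) _; rewrite sE addSn.
Qed.

(** The relation says that the combination of the tau^i phi_theta^j with coefficients of the R i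
    kills e in large degrees. The degrees i + r j with i < r are distinct, so [act_indep] leaves no
    coefficient. *)
Lemma Ei_indep (R : nat -> {poly K}) K0 :
  (forall m, (K0 <= m)%N -> \sum_(i < r) (R i).[theta ^+ (q ^ m)] * Ei i m = 0) ->
  forall i, (i < r)%N -> R i = 0.
Proof.
move=> rel i0 i0r; apply/eqP; apply: contraT => Ri0.
pose n := (\max_(i < r) size (R i))%N.
pose w : {poly K} := \sum_(ij : 'I_r * 'I_n) (R ij.1)`_ij.2 *: iter ij.2 mulT 'X^(ij.1).
have w0 : w = 0.
  apply: act_indep; exists K0 => m mK.
  rewrite -[RHS](rel m mK) /w.
  have lin (T : finType) (c : T -> K) (u : T -> {poly K}) : act (\sum_x c x *: u x) m = \sum_x c x * act (u x) m.
    rewrite (sum_enum_val (R := {poly K}) (fun x => c x *: u x)) act_sum.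
    by rewrite [RHS]sum_enum_val.
  rewrite lin -(pair_bigA _ (fun (i : 'I_r) (j : 'I_n) => (R i)`_j * act (iter j mulT 'X^i) m)) /=.
  apply: eq_bigr => i _; rewrite (@horner_coef_wide _ n); last by apply: (leq_bigmax i).
  rewrite mulr_suml; apply: eq_bigr => j _; rewrite -mulrA; congr (_ * _).
  elim: (nat_of_ord j) => [|j' IH]; first by rewrite mul1r actXn.
  by rewrite iterS act_mulT IH mulrA exprS.
have exd : exists d, [exists ij : 'I_r * 'I_n, ((R ij.1)`_ij.2 != 0) && (ij.1 + r * ij.2 == d)%N].
  have sn : ((size (R i0)).-1 < n)%N.
    by rewrite prednK ?size_poly_gt0 // (leq_bigmax (Ordinal i0r)).
  exists (i0 + r * (size (R i0)).-1)%N; apply/existsP; exists (Ordinal i0r, Ordinal sn).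
  by rewrite /= eqxx andbT -lead_coefE lead_coef_eq0.
have bd d : [exists ij : 'I_r * 'I_n, ((R ij.1)`_ij.2 != 0) && (ij.1 + r * ij.2 == d)%N] -> (d <= r + r * n)%N.
  move=> /existsP[[i j] /= /andP[_ /eqP<-]]; apply: leq_add; first exact: ltnW.
  by rewrite leq_mul2l (ltnW (ltn_ord j)) orbT.
have [d /existsP[[i1 j1] /= /andP[R1 /eqP dE]] maxd] := ex_maxnP exd bd.
have := congr1 (fun p : {poly K} => p`_d) w0; rewrite coef0 /w coef_sum.
rewrite (bigD1 (i1, j1)) //= coefZ big1 ?addr0 => [|[i j] /= ij].
  by move/eqP; rewrite mulf_eq0 (negPf R1) -dE (negPf (iter_mulT j1 i1).2).
rewrite coefZ; have [->|Rij] := eqVneq (R i)`_j 0; first by rewrite mul0r.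
have le : (i + r * j <= d)%N.
  by apply: maxd; apply/existsP; exists (i, j); rewrite /= Rij eqxx.
suff -> : (iter j mulT 'X^i)`_d = 0 by rewrite mulr0.
apply: nth_default; apply: leq_trans (iter_mulT j i).1 _.
rewrite ltn_neqAle le andbT -dE; apply: contraNneq ij => E.
have jE : (j : nat) = j1.
  have := congr1 (fun x => x %/ r)%N E; rewrite ![(_ + r * _)%N]addnC ![(r * _)%N]mulnC.
  by rewrite !divnMDl // !divn_small // !addn0.
move: E; rewrite jE => /addIn iE.
by apply/eqP; congr pair; apply: val_inj.
Qed.

End Seq.

Section Vec.
Variables (X : nat -> nat -> K) (c : nat -> K).
Hypothesis c0 : forall m, c m != 0.
Let z m p := if p == 0%N then X m p else (theta ^+ (q ^ m) - theta) * X m p.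
Hypothesis X0 : X 0%N 0%N = 1.
Hypothesis X0p : forall p, (0 < p < r)%N -> X 0%N p = 0.
Hypothesis XS0 : forall m, X m.+1 0%N = c m * \sum_(j < r) a j.+1 * z m j ^+ q.
Hypothesis XSp : forall m p, (p.+1 < r)%N -> X m.+1 p.+1 = c m * z m p ^+ q.

(** Up to the scalars g, X m 0 is the coefficient e_m of an exponential and z m p is [Ei e p m]. The
    factor theta^(q^m) - theta that separates X from z moves into R 0. *)
Theorem vec_indep (R : nat -> {poly K}) K0 :
  (forall m, (K0 <= m)%N -> \sum_(p < r) (R p).[theta ^+ (q ^ m)] * X m p = 0) ->
  forall p, (p < r)%N -> R p = 0.
Proof.
move=> rel.
pose g := fix g m := if m is m'.+1 then (theta ^+ (q ^ m'.+1) - theta) * c m' * g m' ^+ q else 1.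
have gS m : g m.+1 = (theta ^+ (q ^ m.+1) - theta) * c m * g m ^+ q by [].
have th0 m : theta ^+ (q ^ m.+1) - theta != 0.
  by have := @theta_neq m.+1 0 isT; rewrite expn0 expr1.
have g0 m : g m != 0.
  elim: m => [|m IH]; first exact: oner_neq0.
  by rewrite gS !mulf_neq0 ?expf_neq0.
pose e m := X m 0%N / g m.
have zE m p : (p < r)%N -> z m p = g m * Ei e p m.
  elim: m p => [|m IH] [|p] pr.
  - by rewrite /z eqxx X0 /Ei leqnn subnn expn0 expr1 /e X0 mulrC divfK.
  - by rewrite /z /= X0p // mulr0 /Ei ltn0 mulr0.
  - by rewrite /z eqxx /Ei leq0n subn0 expn0 expr1 /e mulrC divfK.
  rewrite /z [_ == _]/= XSp // EiS IH ?(ltnW pr) // exprMn gS; ring.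
have e0 : e 0%N = 1 by rewrite /e X0 divr1.
have eS n : (theta ^+ (q ^ n) - theta) * e n = \sum_(j < r) a j.+1 * Ei e j.+1 n.
  case: n => [|n].
    by rewrite expn0 expr1 subrr mul0r big1 // => j _; rewrite /Ei ltn0 mulr0.
  apply: (mulfI (_ : c n * g n ^+ q != 0)); first by rewrite mulf_neq0 ?expf_neq0.
  transitivity (g n.+1 * e n.+1); first by rewrite gS; ring.
  rewrite /e mulrC divfK // XS0 -mulrA; congr (_ * _); rewrite mulr_sumr.
  by apply: eq_bigr => j _; rewrite zE // exprMn EiS mulrCA.
pose R' p := if p == 0%N then ('X - theta%:P) * R p else R p.
have R'0 : forall p, (p < r)%N -> R' p = 0.
  apply: (Ei_indep e0 eS (K0 := K0.+1)) => -[//|m] mK.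
  apply: (mulfI (g0 m.+1)); rewrite mulr0.
  transitivity ((theta ^+ (q ^ m.+1) - theta) * \sum_(p < r) (R p).[theta ^+ (q ^ m.+1)] * X m.+1 p).
    rewrite !mulr_sumr; apply: eq_bigr => p _; rewrite mulrCA -zE // /z /R'.
    case: eqP => [->|_]; last by ring.
    by rewrite hornerM hornerXsubC mulrA.
  by rewrite rel ?mulr0 // ltnW.
move=> p pr; have := R'0 p pr; rewrite /R'; case: eqP => // _ /eqP.
by rewrite mulf_eq0 polyXsubC_eq0 => /eqP.
Qed.

End Vec.
End ExpCoefs.

(** * The residue of the functional equation *)

Section EvalAt.
Variable F : finFieldType.
Local Notation q := #|F|.
Local Notation k := {fraction {poly F}}.
Local Notation S := (powser k).
Local Notation K := (Kinf F).
Local Notation P2 := {poly {poly F}}.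
Local Notation wF := (@wK F).

Lemma wKX_inj a b : wF ^+ a = wF ^+ b -> a = b.
Proof.
rewrite -!rmorphXn => /tofrac_inj E; have := congr1 (fun s : powser F => s b) E.
rewrite !powserXnE eqxx; case: eqP => [->//|_] /eqP.
by rewrite eq_sym oner_eq0.
Qed.

Lemma wK_ratio_eq0 a b : (wF ^- a * wF ^+ b - 1 == 0) = (a == b).
Proof.
have wn n : wF ^+ n != 0 by rewrite expf_neq0 ?wK_neq0.
apply/eqP/eqP => [/eqP|->]; last by rewrite mulVf ?subrr.
rewrite subr_eq0 => /eqP E; apply: wKX_inj; apply: (mulfI (_ : wF ^- a != 0)).
  by rewrite invr_eq0.
by rewrite mulVf.
Qed.

Lemma evK_is_zmod_morphism m : zmod_morphism (@evK F m).
Proof. by move=> x y; rewrite /evK rmorphB hornerD hornerN. Qed.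
Lemma evK_is_monoid_morphism m : monoid_morphism (@evK F m).
Proof. by split=> [|x y]; rewrite /evK ?rmorph1 ?hornerC // rmorphM hornerM. Qed.
HB.instance Definition _ m := GRing.isZmodMorphism.Build P2 K (@evK F m) (evK_is_zmod_morphism m).
HB.instance Definition _ m := GRing.isMonoidMorphism.Build P2 K (@evK F m) (evK_is_monoid_morphism m).

Lemma evr_evK m (P : P2) : evr (q ^ m) (pu P) (evK m P).
Proof. exact: evr_pu. Qed.

Lemma evK_Xn m n : evK m 'X^n = wF ^+ n.
Proof. by rewrite /evK map_polyXn hornerXn. Qed.

Lemma evK_comp m j (P : P2) : evK (m + j) (P \Po 'X^(q ^ j)) = evK m P ^+ (q ^ j).
Proof.
apply: evr_uniq (evr_evK _ _) _; rewrite expnD -fpow_pu ?q_exp_gt0 //.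
exact/evr_frob/evr_evK.
Qed.

Definition cu (p : {poly F}) : P2 := map_poly polyC p.

Lemma cu_is_zmod_morphism : zmod_morphism cu.
Proof. by move=> x y; rewrite /cu rmorphB. Qed.
Lemma cu_is_monoid_morphism : monoid_morphism cu.
Proof. by split=> [|x y]; rewrite /cu ?rmorph1 // rmorphM. Qed.
HB.instance Definition _ := GRing.isZmodMorphism.Build {poly F} P2 cu cu_is_zmod_morphism.
HB.instance Definition _ := GRing.isMonoidMorphism.Build {poly F} P2 cu cu_is_monoid_morphism.

Lemma cu_comp n (p : {poly F}) : cu p \Po 'X^n = cu (p \Po 'X^n).
Proof. by rewrite /cu map_comp_poly map_polyXn. Qed.

Lemma evK_cu m p : evK m (cu p) = tofrac (wv p).
Proof. by apply: evr_uniq (evr_evK _ _) _; rewrite -al_wv; apply: evr_al. Qed.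

Lemma wv_eq0 (p : {poly F}) : (wv p == 0) = (p == 0).
Proof.
apply/eqP/eqP => [E|->]; last by apply: powserP => n; rewrite wvE coef0.
by apply/polyP => i; rewrite -wvE E coef0.
Qed.

Lemma spm_cu m p : spm m (cu p) = tofrac (fpow (q ^ m) (wv p)).
Proof. by apply: evr_uniq (evr_spm m (cu p)) _; rewrite -al_wv fpow_al; apply: evr_al. Qed.

Lemma spm_cu_neq0 m p : p != 0 -> spm m (cu p) != 0.
Proof.
move=> p0; rewrite spm_cu tofrac_eq0; apply: contra_neq p0 => /fpow_eq0 E.
by apply/eqP; rewrite -wv_eq0 E.
Qed.

Lemma spm_Xn m n : spm m 'X^n = wF ^+ (n * q ^ m).
Proof. by rewrite /spm map_polyXn hornerXn -exprM mulnC. Qed.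

(** t^a u^b - 1, which vanishes where theta^b = t^a. *)
Definition tiP (a b : nat) : P2 := ('X^a)%:P * 'X^b - 1.

Lemma tiP_comp a b c : tiP a b \Po 'X^c = tiP a (b * c).
Proof. by rewrite /tiP comp_polyB comp_polyM !comp_polyC comp_Xn_poly -exprM mulnC. Qed.

Lemma evK_tiP m a b : evK m (tiP a b) = wF ^- (q ^ m * a) * wF ^+ b - 1.
Proof.
by rewrite /tiP rmorphB rmorphM rmorph1 /= evK_Xn /evK map_polyC hornerC /= evtXn.
Qed.

Lemma spm_tiP m a b : spm m (tiP a b) = wF ^- a * wF ^+ (b * q ^ m) - 1.
Proof.
have [M1 MM] := @spm_is_monoid_morphism F m.
by rewrite /tiP (@spm_is_zmod_morphism F m) MM M1 spm_Xn spmC evtXn mul1n.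
Qed.

Lemma tiP_frob j b : tiP 1 b ^+ (q ^ j) = tiP (q ^ j) (b * q ^ j).
Proof.
rewrite /tiP (frobD (polyC \o polyC)) (frobN (polyC \o polyC)) expr1n exprMn -exprM.
by rewrite -rmorphXn /= expr1.
Qed.

Lemma tiP_neq0 a b : (0 < b)%N -> tiP a b != 0.
Proof.
move=> b0; apply/eqP => /(congr1 (fun p : P2 => p`_0)).
rewrite /tiP coefB coefCM coefXn coef1 coef0 eq_sym (gtn_eqF b0) mulr0 sub0r.
by move/eqP; rewrite oppr_eq0 oner_eq0.
Qed.

(** A polynomial over K whose value at theta^(q^m) is [evK m R]; infinitely many vanishing
    specializations therefore force R = 0. *)
Definition Rt (R : P2) : {poly K} :=
  \sum_(i < size R) map_poly (@CK F) R`_i * (wF ^+ i)%:P.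

Lemma RtE m R : (Rt R).[(wF)^-1 ^+ (q ^ m)] = evK m R.
Proof.
rewrite /Rt horner_sum /evK horner_coef size_map_inj_poly ?rmorph0 //; last first.
  move=> x y /eqP; rewrite -subr_eq0 -rmorphB => E; apply/eqP; rewrite -subr_eq0.
  by apply: contraTT E => E; apply: evt_eq0; rewrite ?q_exp_gt0.
by apply: eq_bigr => i _; rewrite hornerM hornerC coef_map /evt exprVn.
Qed.

Lemma Rt_eq0 R : Rt R = 0 -> R = 0.
Proof.
move=> R0; apply/polyP => i; apply/polyP => l; rewrite !coef0.
pose p := \poly_(j < size R) R`_j`_l.
have p0 : p = 0.
  apply/eqP; rewrite -wv_eq0 -tofrac_eq0 -(evK_cu 0) /evK horner_coef.
  have := congr1 (fun P : {poly K} => P`_l) R0; rewrite coef0 /Rt coef_sum => E.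
  rewrite -[X in _ == X]E.
  have sz : (size (map_poly (evt (q ^ 0)) (cu p)) <= size R)%N.
    by do 2! apply: leq_trans (size_poly _ _) _; exact: size_poly.
  rewrite -horner_coef (horner_coef_wide _ sz); apply/eqP/eq_bigr => j _.
  by rewrite coefMC !coef_map /= evtC coef_poly ltn_ord.
have := congr1 (fun P : {poly F} => P`_i) p0; rewrite coef_poly coef0.
by case: ltnP => // le _; rewrite (nth_default 0 le) coef0.
Qed.

Lemma theta_inj m n : (wF)^-1 ^+ (q ^ m) = (wF)^-1 ^+ (q ^ n) -> m = n.
Proof.
rewrite !exprVn => E; have E' := invr_inj E; apply/eqP.
by rewrite -(eqn_exp2l m n (q_gt1 F)) (wKX_inj E').
Qed.

Lemma evK_zero (R : P2) K0 : (forall m, (K0 <= m)%N -> evK m R = 0) -> R = 0.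
Proof.
move=> h; apply: Rt_eq0; apply/eqP/negPn/negP => R0.
have [M hM] := inj_roots theta_inj R0.
by have := hM _ (leq_addr K0 M); rewrite RtE h ?eqxx // leq_addl.
Qed.

Definition evrm m n a (f : 'M[S]_(m, n)) (x : 'M[K]_(m, n)) := forall i j, evr a (f i j) (x i j).

Lemma evrm_mul m n p a (f : 'M[S]_(m, n)) (g : 'M[S]_(n, p)) x y :
  evrm a f x -> evrm a g y -> evrm a (f *m g) (x *m y).
Proof. by move=> fx gy i j; rewrite !mxE; apply: evr_sum => l _; apply: evrM; [exact: fx|exact: gy]. Qed.

Lemma evrmZ m n a f0 x0 (f : 'M[S]_(m, n)) x : evr a f0 x0 -> evrm a f x -> evrm a (f0 *: f) (x0 *: x).
Proof. by move=> f0x fx i j; rewrite !mxE; apply: evrM => //; exact: fx. Qed.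

Lemma evrmD m n a (f g : 'M[S]_(m, n)) x y : evrm a f x -> evrm a g y -> evrm a (f + g) (x + y).
Proof. by move=> fx gy i j; rewrite !mxE; apply: evrD; [exact: fx|exact: gy]. Qed.

Lemma evrm_pu m n l (A : 'M[P2]_(m, n)) : evrm (q ^ l) (map_mx (@pu F) A) (map_mx (evK l) A).
Proof. by move=> i j; rewrite !mxE; apply: evr_evK. Qed.

Lemma evrm_adj n a (f : 'M[S]_n) x : evrm a f x -> evrm a (\adj f) (\adj x).
Proof.
move=> fx i j; rewrite !mxE /cofactor; apply: evrM.
  have sg l : evr a ((-1) ^+ l : S) ((-1) ^+ l).
    by elim: l => [|l IH]; rewrite ?expr0 ?exprS; [exact: evr1|apply: evrM => //; exact/evrN/evr1].
  exact: sg.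
by apply: evr_det => i2 j2; rewrite !mxE; exact: fx.
Qed.

Lemma evrm_frob m n l (f : 'M[S]_(m, n)) x : evrm 1 f x ->
  evrm (q ^ l) (map_mx (fpow (q ^ l)) f) (map_mx (fun y => y ^+ (q ^ l)) x).
Proof. by move=> fx i j; rewrite !mxE -[X in evr X]mul1n; apply: evr_frob; exact: fx. Qed.

Lemma det_map_frob n l (x : 'M[K]_n) : \det (map_mx (fun y => y ^+ (q ^ l)) x) = \det x ^+ (q ^ l).
Proof.
rewrite /determinant (frob_sum (@CK F)); apply: eq_bigr => s _; rewrite exprMn; congr (_ * _).
  case: (s : bool); rewrite ?expr0 ?expr1n // expr1 (frobN (@CK F)) expr1n //.
by rewrite -prodrXl; apply: eq_bigr => i _; rewrite mxE.
Qed.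

End EvalAt.


Section MatrixSteps.
Variables (R : comNzRingType) (r s : nat).

Lemma step_mx (x ti d : R) (Psi p Phi1 Psi1 a Phi2 : 'M[R]_(r, s)) (B D N : 'M[R]_r) :
  x *: Psi = p + B *m Phi1 -> ti *: Phi1 = D *m Psi1 -> d *: Psi1 = a + N *m Phi2 ->
  (x * ti * d) *: Psi = ((ti * d) *: p + B *m D *m a) + B *m D *m N *m Phi2.
Proof.
move=> E1 E2 E3.
have -> : (x * ti * d) *: Psi = (ti * d) *: (x *: Psi) by rewrite scalerA; congr (_ *: _); ring.
rewrite E1 scalerDr -addrA; congr (_ + _).
rewrite [ti * d]mulrC -scalerA scalemxAr E2 scalemxAr scalemxAr E3.
by rewrite !mulmxDr !mulmxA.
Qed.

Lemma sys_mx (x ti : R) (Psi p Phi1 Psi1 : 'M[R]_(r, s)) (B D : 'M[R]_r) :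
  x *: Psi = p + B *m Phi1 -> ti *: Phi1 = D *m Psi1 ->
  (ti * x) *: Psi = ti *: p + B *m D *m Psi1.
Proof. by move=> E1 E2; rewrite -scalerA E1 scalerDr scalemxAr E2 mulmxA. Qed.

Lemma resid_mx (x ti d : R) (Psi Phi Psi1 a : 'M[R]_(r, s)) (D N : 'M[R]_r) (A : 'M[R]_s) :
  d *: Psi = a + N *m Phi -> ti *: Phi = D *m Psi1 ->
  Psi *m ((x * d * ti) *: A) = (x * ti) *: (a *m A) + N *m D *m (x *: Psi1) *m A.
Proof.
move=> E1 E2.
have -> : Psi *m ((x * d * ti) *: A) = (x * ti) *: ((d *: Psi) *m A).
  by rewrite -scalemxAr -scalemxAl scalerA; congr (_ *: _); ring.
rewrite E1 mulmxDl scalerDr; congr (_ + _).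
transitivity (N *m (x *: (D *m Psi1)) *m A); last by rewrite -!scalemxAr !mulmxA.
by rewrite -E2 scalerA -scalemxAr -scalemxAl.
Qed.

(** An inhomogeneous system made homogeneous: the constant rows carry the inhomogeneous term P. *)
Definition blk (A : 'M[R]_r) (P : 'M[R]_(r, s)) (x : R) (i j : 'I_r + 'I_s) : R :=
  match i, j with
  | inl i, inl j => A i j | inl i, inr j => P i j
  | inr i, inl j => 0 | inr i, inr j => x *+ (i == j) end.

Lemma blk_mul (A A' : 'M[R]_r) (P P' : 'M[R]_(r, s)) (x x' d : R) :
  A *m A' = d%:M -> A *m P' + x' *: P = 0 -> x * x' = d ->
  forall i j, \sum_z blk A P x i z * blk A' P' x' z j = d *+ (i == j).
Proof.
move=> AA AP xx i j; rewrite big_sumType /=; case: i j => i [j|j] /=.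
- rewrite [X in _ + X]big1 ?addr0 => [|l _]; last by rewrite mulr0.
  by have := congr1 (fun C : 'M[R]_r => C i j) AA; rewrite !mxE.
- rewrite [X in _ + X](bigD1 j) //= eqxx mulr1n [X in _ + (_ + X)]big1 ?addr0 => [|l /negPf lj]; last first.
    by rewrite lj mulr0.
  have := congr1 (fun C : 'M[R]_(r, s) => C i j) AP; rewrite !mxE => E.
  by rewrite mulr0n -[RHS]E; congr (_ + _); rewrite mulrC.
- by rewrite !big1 ?addr0 // => l _; rewrite ?mulr0 ?mul0r.
rewrite big1 ?add0r => [|l _]; last by rewrite mul0r.
rewrite (bigD1 i) //= eqxx mulr1n big1 ?addr0 => [|l /negPf li]; last first.
  by rewrite eq_sym li mul0r.
by rewrite mulrnAr xx.
Qed.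

Lemma blk_inv (A A' : 'M[R]_r) (P : 'M[R]_(r, s)) (c x : R) : A *m A' = c%:M -> A' *m A = c%:M ->
  (forall i j, \sum_z blk A P x i z * blk (x *: A') (- (A' *m P)) c z j = (x * c) *+ (i == j)) /\
  (forall i j, \sum_z blk (x *: A') (- (A' *m P)) c i z * blk A P x z j = (x * c) *+ (i == j)).
Proof.
move=> E1 E2; split; apply: blk_mul => //.
- by rewrite -scalemxAr E1 scale_scalar_mx.
- by rewrite mulmxN mulmxA E1 mul_scalar_mx addNr.
- by rewrite -scalemxAl E2 scale_scalar_mx.
- by rewrite -scalemxAl scalerN subrr.
- by rewrite mulrC.
Qed.

End MatrixSteps.

(** * Iterating the difference equation and taking residues *)

Section Uniform.
Variable F : finFieldType.
Local Notation q := #|F|.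
Local Notation k := {fraction {poly F}}.
Local Notation S := (powser k).
Local Notation X := (powserX k).
Local Notation K := (Kinf F).
Local Notation P2 := {poly {poly F}}.
Local Notation wF := (@wK F).
Local Notation PU := (map_mx (@pu F)).
Local Notation FR b := (map_mx (@fpow k b)).
Local Notation CX b := (map_mx (comp_poly ('X^b : P2))).
Variables (r s kk dd : nat) (pt : pred 'I_r) (p0 : 'I_s -> 'I_r).
Hypotheses (s_gt0 : (0 < s)%N) (p0I : injective p0) (p0P : forall i, pt (p0 i)).
Hypothesis Pp0 : forall i, pt i -> exists l, i = p0 l.
Local Notation e := (q ^ kk)%N.
Variables (m_ : 'I_r -> nat) (EE : 'M[{poly F}]_r).
Hypotheses (mkk : forall i, m_ i = 0%N \/ (0 < kk)%N) (dEE : \det EE != 0).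
Definition Dm : 'M[P2]_r := diag_mx (\row_i tiP F 1 e ^+ m_ i).
Definition Bh : 'M[P2]_r := Dm *m map_mx (@cu F) EE.
(** In the rows of [pt], Phi is Psi divided by t^e - theta^e; in the others they are equal. [db n]
    is the transition after n twists with denominators cleared, as [tiPhi] states. *)
Definition db (n : nat) : 'M[P2]_r :=
  diag_mx (\row_i if pt i then 'X^(e * q ^ n) else tiP F e (e * q ^ n)).
Variables (Psi Phi : 'M[S]_(r, s)) (pp : 'M[P2]_(r, s)).
Hypothesis H1 : forall i j, X ^+ e * Psi i j = (if pt i then pu (tiP F e e) else X ^+ e) * Phi i j.
Hypothesis H2 : X ^+ dd *: Psi = PU pp + PU Bh *m FR q Phi.

(** The matrix in front of Phi(u^(q^(n+1))) after n further uses of the equation, with [db 1]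
    turning each twisted Phi back into Psi. *)
Fixpoint NK (n : nat) : 'M[P2]_r :=
  if n is n'.+1 then Bh *m db 1 *m CX q (NK n') else Bh.

Lemma puXn n : pu 'X^n = X ^+ n :> S.
Proof. by rewrite -puX; exact: (rmorphXn (@pu F)). Qed.

Lemma puM P Q : pu (P * Q) = pu P * pu Q :> S.
Proof. exact: (rmorphM (@pu F)). Qed.

Lemma fpowM b (g h : S) : fpow b (g * h) = fpow b g * fpow b h.
Proof. exact: (rmorphM (@fpow k b)). Qed.

Lemma PU_comp m n b (A : 'M[P2]_(m, n)) : (0 < b)%N -> FR b (PU A) = PU (CX b A).
Proof. by move=> b0; apply/matrixP => i j; rewrite !mxE fpow_pu. Qed.

Lemma FR_X b n : (0 < b)%N -> fpow b (X ^+ n) = X ^+ (n * b) :> S.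
Proof. by move=> b0; rewrite fpowXn prednK. Qed.

Lemma FRZ m n b (c : S) (A : 'M[S]_(m, n)) : FR b (c *: A) = fpow b c *: FR b A.
Proof. by apply/matrixP => i j; rewrite !mxE rmorphM. Qed.

Lemma FR_comp m n a b (A : 'M[S]_(m, n)) : (0 < a)%N -> (0 < b)%N -> FR a (FR b A) = FR (a * b) A.
Proof. by move=> a0 b0; apply/matrixP => i j; rewrite !mxE fpow_comp. Qed.

Lemma PU_diagE m n (d : 'rV[P2]_m) (A : 'M[S]_(m, n)) i j :
  (PU (diag_mx d) *m A) i j = pu (d 0 i) * A i j.
Proof. by rewrite map_diag_mx mul_diag_mx mxE [in X in X * _]mxE. Qed.

Lemma q_gt0 : (0 < q)%N. Proof. by have := q_exp_gt0 F 1; rewrite expn1. Qed.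

Lemma tiPhi n : pu (tiP F e (e * q ^ n)) *: FR (q ^ n) Phi = PU (db n) *m FR (q ^ n) Psi.
Proof.
have b0 := q_exp_gt0 F n.
apply/matrixP => i j; rewrite PU_diagE mxE [in LHS]mxE [FR _ Psi _ _]mxE.
have := congr1 (fpow (q ^ n)) (H1 i j); rewrite !rmorphM /= FR_X //.
rewrite mxE; case: (pt i) => [|E].
  by rewrite fpow_pu // tiP_comp puXn => ->.
congr (_ * _); apply: (mulfI (expf_neq0 (e * q ^ n) (powserX_neq0 k))).
by rewrite E FR_X.
Qed.

Lemma FR_rel m n de (a : 'M[P2]_(m, n)) (N : 'M[P2]_m) (B C : 'M[S]_(m, n)) :
  pu de *: B = PU a + PU N *m C ->
  pu (de \Po 'X^q) *: FR q B = PU (CX q a) + PU (CX q N) *m FR q C.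
Proof.
move=> E; have := congr1 (FR q) E.
by rewrite FRZ fpow_pu ?q_gt0 // map_mxD map_mxM !PU_comp ?q_gt0.
Qed.

Lemma map_mxZpu m n (c : P2) (A : 'M[P2]_(m, n)) : PU (c *: A) = pu c *: PU A.
Proof. by apply/matrixP => i j; rewrite !mxE rmorphM. Qed.

Lemma PU_mul m n p (A : 'M[P2]_(m, n)) (B : 'M[P2]_(n, p)) : PU (A *m B) = PU A *m PU B.
Proof. exact: map_mxM. Qed.

Lemma PU_mul3 m n p l (A : 'M[P2]_(m, n)) (B : 'M[P2]_(n, p)) (C : 'M[P2]_(p, l)) :
  PU (A *m B *m C) = PU A *m PU B *m PU C.
Proof. by rewrite (PU_mul (A *m B)) PU_mul. Qed.

Lemma PU_comb m n c (p a : 'M[P2]_(m, n)) (B D : 'M[P2]_m) :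
  PU (c *: p + B *m D *m a) = pu c *: PU p + PU B *m PU D *m PU a.
Proof. by rewrite map_mxD map_mxZpu PU_mul3. Qed.

Lemma iterNK n : exists (de : P2) a, pu de *: Psi = PU a + PU (NK n) *m FR (q ^ n.+1) Phi.
Proof.
elim: n => [|n [de [a IH]]].
  by exists 'X^dd, pp; rewrite puXn expn1.
exists ('X^dd * tiP F e (e * q) * (de \Po 'X^q)),
  ((tiP F e (e * q) * (de \Po 'X^q)) *: pp + Bh *m db 1 *m CX q a).
have H1' := tiPhi 1; rewrite expn1 in H1'.
have FE : FR q (FR (q ^ n.+1) Phi) = FR (q ^ n.+2) Phi.
  by rewrite [in RHS]expnS; apply: FR_comp; rewrite ?q_gt0 ?q_exp_gt0.
have E := FR_rel IH; rewrite FE in E.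
have EN : PU (NK n.+1) = PU Bh *m PU (db 1) *m PU (CX q (NK n)) := PU_mul3 _ _ _.
rewrite EN (PU_comb _ pp (CX q a) Bh (db 1)) !puM puXn.
exact: step_mx H2 H1' E.
Qed.

Section Residue.
Variables (h0 : nat) (xT : 'M[K]_(r, s)).
Hypothesis xTE : evrm 1 (X ^+ h0 *: Psi) xT.
Let xP : 'M[K]_s := \matrix_(i, j) xT (p0 i) j.
Hypothesis xP0 : \det xP != 0.

Lemma evK_ti0 m : evK m (tiP F e (e * q ^ m)) = 0.
Proof. by apply/eqP; rewrite evK_tiP wK_ratio_eq0 mulnC. Qed.

(** At t = theta^(q^m) the factor ti in Y vanishes and cancels the pole of the twisted Phi. What is
    left of Psi Y is [NK n] applied to the polar rows, and the adjugate of their values reduces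
    these to a scalar matrix: the columns [p0] of [NK n] remain. *)
Lemma residA n : let m := n.+1 in exists (Y : 'M[S]_s) (B : 'M[K]_s),
  [/\ \det B != 0,
      evrm (q ^ m) (X ^+ h0 *: (Psi *m Y)) ((\matrix_(i, j) evK m (NK n i (p0 j))) *m B)
    & evrm (q ^ m) Y 0].
Proof.
move=> m; have [de [a E]] := iterNK n; rewrite -/m in E.
pose Th : 'M[S]_s := \matrix_(i, j) (X ^+ h0 *: Psi) (p0 i) j.
pose fx l l' (x : 'M[K]_(l, l')) := map_mx (fun y => y ^+ (q ^ m)) x.
have ThE : evrm (q ^ m) (FR (q ^ m) Th) (fx _ _ xP).
  by apply: evrm_frob => i j; rewrite !mxE; have := xTE (p0 i) j; rewrite !mxE.
have adE := evrm_adj ThE.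
pose ti := tiP F e (e * q ^ m).
have ti0 : evr (q ^ m) (pu ti) 0 by rewrite -(evK_ti0 m); apply: evr_evK.
pose Y : 'M[S]_s := (X ^+ (h0 * q ^ m) * pu de * pu ti) *: \adj (FR (q ^ m) Th).
pose B : 'M[K]_s := (wF ^+ h0 * wF ^+ (e * q ^ m) * \det xP ^+ (q ^ m))%:M.
have de1 : evr (q ^ m) (pu de) (evK m de) by exact: evr_evK.
exists Y, B; split.
- by rewrite det_scalar expf_neq0 // !mulf_neq0 ?expf_neq0 ?wK_neq0.
- have -> : X ^+ h0 *: (Psi *m Y) =
      X ^+ h0 *: ((X ^+ (h0 * q ^ m) * pu ti) *: (PU a *m \adj (FR (q ^ m) Th)) +
      PU (NK n) *m PU (db m) *m FR (q ^ m) (X ^+ h0 *: Psi) *m \adj (FR (q ^ m) Th)).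
    by congr (_ *: _); rewrite FRZ FR_X ?q_exp_gt0 // /Y (resid_mx _ _ E (tiPhi m)).
  have -> : (\matrix_(i, j) evK m (NK n i (p0 j))) *m B =
      wF ^+ h0 *: ((wF ^+ (h0 * q ^ m) * 0) *: (map_mx (evK m) a *m \adj (fx _ _ xP)) +
      map_mx (evK m) (NK n) *m map_mx (evK m) (db m) *m fx _ _ xT *m \adj (fx _ _ xP)).
    rewrite mulr0 scale0r add0r /B -!mulrA mul_mx_scalar -scalerA; congr (_ *: _).
    rewrite -mulmxA; apply/matrixP => i j; rewrite !mxE.
    (* Outside [pt] the entry of [db m] is ti itself, which is zero at this point. *)
    have dbE l : (map_mx (evK m) (NK n) *m map_mx (evK m) (db m)) i l =
        if pt l then evK m (NK n i l) * wF ^+ (e * q ^ m) else 0.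
      rewrite map_diag_mx mul_mx_diag !mxE; case: (pt l).
        by congr (_ * _); exact: evK_Xn.
      transitivity (evK m (NK n i l) * 0); last exact: mulr0.
      by congr (_ * _); exact: evK_ti0.
    under eq_bigr => l _ do rewrite dbE.
    rewrite (bigID pt) /= [X in _ + X]big1 ?addr0 => [|l /negPf->]; last by rewrite mul0r.
    have adP l : (fx _ _ xT *m \adj (fx _ _ xP)) (p0 l) j = \det xP ^+ (q ^ m) *+ (l == j).
      have := congr1 (fun A : 'M[K]_s => A l j) (mul_mx_adj (fx _ _ xP)).
      rewrite !mxE det_map_frob => <-; apply: eq_bigr => u _; by rewrite !mxE.
    rewrite (bigD1 (p0 j)) //= big1 ?addr0 => [|l /andP[pl lj]]; last first.
      have [l' lE] := Pp0 pl; rewrite lE adP.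
      have /negPf-> : l' != j by apply: contraNneq lj => <-; rewrite lE.
      by rewrite mulr0n mulr0.
    rewrite p0P adP eqxx mulr1n; ring.
  apply: evrmZ; first exact: evr_Xn.
  apply: evrmD.
    apply: evrmZ; first by apply: evrM => //; exact: evr_Xn.
    by apply: evrm_mul => //; exact: evrm_pu.
  apply: evrm_mul => //; apply: evrm_mul; last exact: evrm_frob.
  by apply: evrm_mul; exact: evrm_pu.
have -> : 0 = (wF ^+ (h0 * q ^ m) * evK m de * 0) *: \adj (fx _ _ xP) by rewrite mulr0 scale0r.
apply: evrmZ => //; apply: evrM => //; apply: evrM => //; exact: evr_Xn.
Qed.
End Residue.

Section Relation.
Variables (f : powser F) (P : P2) (h0 : nat) (xT : 'M[K]_(r, s)) (a b : {poly F}).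
Local Notation L := (tofrac f : K).
Hypotheses (P0 : P != 0) (rP : root (map_poly (evt 1) P) L).
Hypothesis grP : forall i j, gr (X ^+ h0 * Psi i j).
Hypothesis xTE : evrm 1 (X ^+ h0 *: Psi) xT.
Hypothesis a0 : a != 0.
Hypothesis relL : evt 1 b * L * wF ^+ (h0 * s) = evt 1 a * \det (\matrix_(i, j) xT (p0 i) j).
Variables (K0 : nat) (AK : nat -> 'M[K]_(r, s)).
Hypothesis resid : forall m, (K0 <= m)%N -> exists (Y : 'M[S]_s) (B : 'M[K]_s),
  [/\ \det B != 0, forall i j, Lau (AK m i j),
      evrm (q ^ m) (X ^+ h0 *: (Psi *m Y)) (AK m *m B) & evrm (q ^ m) Y 0].

(** At t = 1/w and u = w^(q^m), the factor t u^e - 1 is zero only for e q^m = 1, and [mkk] excludes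
    the case e = 1 unless the factor has exponent 0. *)
Lemma spm_Bh m : spm m (\det Bh) != 0.
Proof.
rewrite /Bh det_mulmx det_diag rmorphM rmorph_prod mulf_neq0 //.
  apply/prodf_neq0 => i _; rewrite mxE rmorphXn; have [->|kk0] := mkk i; first by rewrite expr0 oner_neq0.
  apply: expf_neq0; rewrite [X in X != 0]spm_tiP wK_ratio_eq0 -expnD eq_sym.
  by rewrite -(expn0 q) eqn_exp2l ?q_gt1 // addn_eq0 negb_and -lt0n kk0.
by rewrite det_map_mx; apply: spm_cu_neq0.
Qed.

(** u^h0 Psi is stacked over u^h0 times the identity: the lower block absorbs the polynomial part of
    the equation, so the system becomes homogeneous, and the shift by h0 brings Psi under the degree
    bound [gr]. *)
Theorem uniform_relation : exists Rg : {ffun 'I_s -> 'I_r} -> P2,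
  [/\ spm 0 (Rg [ffun i => p0 i]) != 0,
      forall g, g != [ffun i => p0 i] -> spm 0 (Rg g) = 0
    & forall m, (K0 <= m)%N ->
      \sum_g evK m (Rg g) * \det (\matrix_(i, j) AK m (g i) j) = 0].
Proof.
pose ti1 := tiP F e (e * q).
pose x := ti1 * 'X^dd.
pose db' : 'M[P2]_r := diag_mx (\row_i if pt i then ti1 else 'X^(e * q)).
pose A := Bh *m db 1; pose A' := db' *m \adj Bh.
pose c := \det Bh * ('X^(e * q) * ti1).
have dd1 : db 1 *m db' = ('X^(e * q) * ti1)%:M.
  rewrite /db /db' mulmx_diag -diag_const_mx; congr diag_mx; apply/rowP => i; rewrite !mxE expn1.
  by case: (pt i) => //; rewrite mulrC.
have dd2 : db' *m db 1 = ('X^(e * q) * ti1)%:M.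
  by rewrite diag_mxC dd1.
have E1 : A *m A' = c%:M.
  rewrite /A /A' mulmxA -(mulmxA Bh) dd1 mul_mx_scalar -scalemxAl mul_mx_adj scale_scalar_mx.
  by congr _%:M; rewrite mulrC.
have E2 : A' *m A = c%:M.
  rewrite /A /A' mulmxA -(mulmxA db') mul_adj_mx mul_mx_scalar -scalemxAl dd2 scale_scalar_mx.
  by [].
have [MM M'M] := blk_inv (ti1 *: pp) x E1 E2.
pose Th (y : 'I_r + 'I_s) (j : 'I_s) : S :=
  match y with inl i => X ^+ h0 * Psi i j | inr i => X ^+ h0 *+ (i == j) end.
(* The exponents e and e q^(m+1) never agree, so this factor of the determinant does not vanish on
   any twist. *)
have tin m : spm m ti1 != 0.
  rewrite /ti1 spm_tiP wK_ratio_eq0 -mulnA -expnS -expnD eqn_exp2l ?q_gt1 //; lia.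
have De0 m : spm m (x * c) != 0.
  by rewrite /x /c !rmorphM !mulf_neq0 ?spm_Bh ?tin // ?[X in X != 0]spm_Xn ?expf_neq0 ?wK_neq0.
pose de := x * 'X^(h0 * q.-1).
have de0 : de != 0.
  by rewrite /de /x !mulf_neq0 ?expf_neq0 ?polyX_eq0 // tiP_neq0 // muln_gt0 q_exp_gt0 q_gt0.
have H1' := tiPhi 1; rewrite expn1 in H1'.
have H12 : (pu ti1 * X ^+ dd) *: Psi = pu ti1 *: PU pp + PU A *m FR q Psi.
  by rewrite (PU_mul Bh (db 1)); exact: sys_mx H2 H1'.
have qE : (h0 + h0 * q.-1 = h0 * q)%N by rewrite -mulnS prednK // q_gt0.
have sys y j : pu de * Th y j = \sum_z pu (blk A (ti1 *: pp) x y z) * fpow q (Th z j).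
  rewrite big_sumType /de /x !puM !puXn; case: y => i; rewrite /Th /blk.
    transitivity (X ^+ (h0 * q) * ((pu ti1 * X ^+ dd) *: Psi) i j).
      by rewrite mxE -qE exprD; ring.
    rewrite H12 mxE mulrDr addrC; congr (_ + _).
      rewrite [in LHS]mxE mulr_sumr; apply: eq_bigr => l _.
      by rewrite fpowM FR_X ?q_gt0 // [PU _ _ _]mxE [FR _ _ _ _]mxE mulrCA.
    rewrite (bigD1 j) //= eqxx mulr1n big1 ?addr0 => [|l /negPf lj]; last first.
      by rewrite lj mulr0n rmorph0 mulr0.
    by rewrite FR_X ?q_gt0 // !mxE puM mulrC.
  rewrite big1 ?add0r => [|l _]; last by rewrite rmorph0 mul0r.
  rewrite (bigD1 i) //= eqxx mulr1n big1 ?addr0 => [|l /negPf li]; last first.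
    by rewrite eq_sym li mulr0n rmorph0 mul0r.
  rewrite add0r puM puXn; case: (i == j); last by rewrite !mulr0n rmorph0 !mulr0.
  by rewrite !mulr1n FR_X ?q_gt0 // -qE exprD; ring.
apply: (@core_relation F r s f P s_gt0 P0 rP Th h0 de (x * c) _ _ _ _ de0 De0 sys MM M'M
   p0 (\matrix_(i, j) xT (p0 i) j) a b _ a0 relL K0 (fun m i j => AK m i j)) => //.
- move=> [i|i] j /=; first exact: grP.
  by case: (i == j); rewrite ?mulr1n ?mulr0n; [exact: gr_Xn|exact: gr0].
- by move=> i j /=; have := xTE (p0 i) j; rewrite !mxE.
move=> m /resid[Y [B [B0 LA top bot]]]; exists Y, B; split=> // i j.
  by have := top i j; rewrite !mxE mulr_sumr => E; under eq_bigr => l _ do rewrite -mulrA.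
have -> : \sum_l Th (inr i) l * Y l j = X ^+ h0 * Y i j.
  rewrite (bigD1 i) //= eqxx mulr1n big1 ?addr0 // => l /negPf li.
  by rewrite eq_sym li mulr0n mul0r.
by rewrite -(mulr0 (wF ^+ h0)); apply: evrM; [exact: evr_Xn|have := bot i j; rewrite mxE].
Qed.
End Relation.

End Uniform.

Section ScalarPole.
Variable F : finFieldType.
Local Notation q := #|F|.
Local Notation k := {fraction {poly F}}.
Local Notation S := (powser k).
Local Notation X := (powserX k).
Local Notation K := (Kinf F).
Local Notation P2 := {poly {poly F}}.
Local Notation wF := (@wK F).
Local Notation PU := (map_mx (@pu F)).
Local Notation FR b := (map_mx (@fpow k b)).
Local Notation CX b := (map_mx (comp_poly ('X^b : P2))).
Variables (r : nat) (pt : pred 'I_r) (EE : 'M[{poly F}]_r).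
Hypothesis dEE : \det EE != 0.

Definition NN (n : nat) : 'M[P2]_r := NK 0 pt (fun=> 0%N) EE n.
Definition Ew : 'M[K]_r := map_mx (fun p => tofrac (wv p)) EE.
Definition evN (n : nat) : 'M[K]_r := map_mx (evK n.+1) (NN n).

Lemma Bh0 : Bh 0 (fun=> 0%N) EE = map_mx (@cu F) EE.
Proof.
rewrite /Bh /Dm -[RHS]mul1mx; congr (_ *m _); apply/matrixP => i j.
by rewrite !mxE expr0.
Qed.

Lemma evN0 : evN 0 = Ew.
Proof. by apply/matrixP => i j; rewrite /evN /NN /= Bh0 !mxE evK_cu. Qed.

Lemma evNS n : evN n.+1 = Ew *m diag_mx (\row_i if pt i then wF ^+ q else wF ^- (q ^ n.+2) * wF ^+ q - 1)
  *m map_mx (fun x => x ^+ q) (evN n).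
Proof.
rewrite /evN /NN -/(NN n); set A := map_mx _ _.
have -> : A = map_mx (evK n.+2) (Bh 0 (fun=> 0%N) EE *m db F 0 pt 1 *m CX q (NN n)) by [].
have EM (B D C : 'M[P2]_r) : map_mx (evK n.+2) (B *m D *m C) =
    map_mx (evK n.+2) B *m map_mx (evK n.+2) D *m map_mx (evK n.+2) C by rewrite !map_mxM.
rewrite EM Bh0; congr (_ *m _ *m _).
- by apply/matrixP => i j; rewrite !mxE; exact: evK_cu.
- apply/matrixP => i j; rewrite !mxE; case: (i == j); last exact: rmorph0.
  rewrite !mulr1n; case: (pt i).
    by apply: etrans (evK_Xn _ _ _) _; rewrite expn0 mul1n expn1.
  by apply: etrans (evK_tiP _ _ _ _) _; rewrite expn0 mul1n expn1 muln1.
apply/matrixP => i j; rewrite !mxE.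
by have := evK_comp n.+1 1 (NN n i j); rewrite addn1 expn1.
Qed.

End ScalarPole.

(** * Positive twist: residues of full rank *)

Section FullRank.
Variable F : finFieldType.
Local Notation q := #|F|.
Local Notation k := {fraction {poly F}}.
Local Notation S := (powser k).
Local Notation X := (powserX k).
Local Notation K := (Kinf F).
Local Notation P2 := {poly {poly F}}.
Local Notation wF := (@wK F).
Local Notation PU := (map_mx (@pu F)).
Local Notation FR b := (map_mx (@fpow k b)).
Local Notation CX b := (map_mx (comp_poly ('X^b : P2))).
Variables (r kk dd : nat) (m_ : 'I_r -> nat) (EE : 'M[{poly F}]_r).
Local Notation e := (q ^ kk)%N.
Hypotheses (r_gt0 : (0 < r)%N) (kk0 : (0 < kk)%N) (dEE : \det EE != 0).
Hypothesis m_lt : forall i, (m_ i < e)%N.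
Local Notation Bh := (Bh kk m_ EE).
Local Notation NK := (NK kk xpredT m_ EE).

Fixpoint Mt (n : nat) : 'M[P2]_r := if n is n'.+1 then Bh *m CX q (Mt n') else 1%:M.

Lemma CX_mul a m n p (A : 'M[P2]_(m, n)) (B : 'M[P2]_(n, p)) : CX a (A *m B) = CX a A *m CX a B.
Proof. exact: map_mxM. Qed.

Lemma CX_comp a b m n (A : 'M[P2]_(m, n)) : CX a (CX b A) = CX (a * b) A.
Proof.
apply/matrixP => i j; rewrite !mxE -comp_polyA; congr (_ \Po _).
by rewrite comp_Xn_poly -exprM.
Qed.

Lemma CX1 m n (A : 'M[P2]_(m, n)) : CX 1 A = A.
Proof. by apply/matrixP => i j; rewrite mxE expr1 comp_polyXr. Qed.

Lemma MtD j l : Mt (j + l) = Mt j *m CX (q ^ j) (Mt l).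
Proof.
elim: j => [|j IH]; first by rewrite mul1mx expn0 CX1.
rewrite addSn [Mt _.+1]/= IH (CX_mul q (Mt j)) CX_comp mulmxA -expnS.
by [].
Qed.

Lemma NK_Mt n : exists x, NK n = 'X^x *: Mt n.+1.
Proof.
have db1 : db F kk (xpredT : pred 'I_r) 1 = ('X^(e * q))%:M.
  by apply/matrixP => i j; rewrite !mxE expn1.
elim: n => [|n [x IH]].
  exists 0%N; rewrite expr0 scale1r /= ; suff -> : CX q 1%:M = 1%:M :> 'M[P2]_r by rewrite mulmx1.
  exact: map_mx1.
exists (e * q + x * q)%N.
have -> : NK n.+1 = Bh *m db F kk (xpredT : pred 'I_r) 1 *m CX q (NK n) by [].
rewrite db1 IH.
have -> : CX q ('X^x *: Mt n.+1) = 'X^(x * q) *: CX q (Mt n.+1).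
  by apply/matrixP => i j; rewrite !mxE comp_polyM comp_Xn_poly -exprM mulnC.
by rewrite mul_mx_scalar -scalemxAl -scalemxAr scalerA -exprD.
Qed.

(** The twist by q^i of the factor t u^e - 1 vanishes at t = theta^(q^m) exactly for kk + i = m; all
    other twists stay invertible. *)
Lemma det_Mt m j l : (forall i, (i < l)%N -> kk + j + i != m)%N ->
  evK m (\det (CX (q ^ j) (Mt l))) != 0.
Proof.
elim: l j => [|l IH] j h.
  by rewrite /= map_mx1 det1 rmorph1 oner_neq0.
rewrite [Mt _]/= CX_mul CX_comp -expnSr det_mulmx rmorphM mulf_neq0 //; last first.
  by apply: IH => i il; have := h i.+1 il; rewrite addnS -addSn addnS.
rewrite /Bh CX_mul det_mulmx rmorphM mulf_neq0 //.
  rewrite map_diag_mx det_diag rmorph_prod; apply/prodf_neq0 => i _; rewrite !mxE.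
  suff: evK m (comp_poly 'X^(q ^ j) (tiP F 1 e ^+ m_ i)) != 0 by [].
  have -> : comp_poly 'X^(q ^ j) (tiP F 1 e ^+ m_ i) = tiP F 1 (e * q ^ j) ^+ m_ i.
    by rewrite rmorphXn; congr (_ ^+ _); exact: tiP_comp.
  rewrite rmorphXn; apply: expf_neq0.
  rewrite [X in X != 0]evK_tiP wK_ratio_eq0 muln1 -expnD eqn_exp2l ?q_gt1 // eq_sym.
  by have := h 0%N isT; rewrite addn0.
have -> : CX (q ^ j) (map_mx (@cu F) EE) = map_mx (@cu F) (map_mx (comp_poly 'X^(q ^ j)) EE).
  by apply/matrixP => i l'; rewrite !mxE; exact: cu_comp.
rewrite !det_map_mx [X in X != 0]evK_cu tofrac_eq0 wv_eq0.
rewrite comp_poly_eq0 // size_polyXn; exact: q_exp_gt0.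
Qed.

Lemma PU_diagX (p : P2) (n_ : 'I_r -> nat) :
  PU (diag_mx (\row_i p ^+ n_ i)) = diag_mx (\row_i pu p ^+ n_ i).
Proof.
apply/matrixP => i j; rewrite !mxE; case: (i == j); last exact: rmorph0.
by rewrite !mulr1n; exact: (rmorphXn (@pu F)).
Qed.

(** The pole ti = p^e' is shared: p^(m_i) is already in the system and Y supplies p^(n_i). Once it
    is cancelled, everything to the right of M collapses to a scalar through the adjugate. *)
Lemma full_mx (R : idomainType) (x y d ti p : R) (Psi Phi Psi1 a M Q : 'M[R]_r) (n_ : 'I_r -> nat) e' :
  (forall i, m_ i + n_ i = e')%N -> p ^+ e' = ti -> ti != 0 ->
  d *: Psi = a + M *m diag_mx (\row_i p ^+ m_ i) *m Q *m Phi -> ti *: Phi = y *: Psi1 ->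
  Psi *m ((x * d) *: (\adj (Q *m (x *: Psi1)) *m diag_mx (\row_i p ^+ n_ i))) =
  (x *: (a *m \adj (Q *m (x *: Psi1)) *m diag_mx (\row_i p ^+ n_ i))) +
  (y * \det (Q *m (x *: Psi1))) *: M.
Proof.
move=> mn pe ti0 E1 E2; set A := \adj _; set Dn := diag_mx _; set D := diag_mx _ in E1.
have DD : D *m Dn = ti%:M.
  rewrite mulmx_diag -diag_const_mx; congr diag_mx; apply/rowP => i.
  by rewrite !mxE -exprD mn pe.
have inj (U V : 'M[R]_r) : ti *: U = ti *: V -> U = V.
  move=> E; apply/matrixP => i j; apply: (mulfI ti0).
  by have := congr1 (fun C : 'M[R]_r => C i j) E; rewrite !mxE.
apply: inj.
have -> : ti *: (Psi *m ((x * d) *: (A *m Dn))) = (x * ti) *: ((d *: Psi) *m A *m Dn).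
  by rewrite -scalemxAr -!scalemxAl !scalerA mulmxA; congr (_ *: _); ring.
rewrite E1 !mulmxDl !scalerDr; congr (_ + _).
  by rewrite scalerA mulrC.
have -> : (x * ti) *: (M *m D *m Q *m Phi *m A *m Dn) = y *: (M *m D *m (Q *m (x *: Psi1) *m A) *m Dn).
  transitivity (x *: (M *m D *m Q *m (ti *: Phi) *m A *m Dn)).
    by rewrite -!scalemxAr -!scalemxAl scalerA.
  rewrite E2 -!scalemxAr -!scalemxAl -!scalemxAr -!scalemxAl !scalerA !mulmxA.
  by congr (_ *: _); rewrite mulrC.
rewrite mul_mx_adj mul_mx_scalar -!scalemxAl -mulmxA DD mul_mx_scalar !scalerA.
by congr (_ *: _); ring.
Qed.

Variables (Psi Phi : 'M[S]_r) (pp : 'M[P2]_r).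
Hypothesis H1 : forall i j, X ^+ e * Psi i j = pu (tiP F e e) * Phi i j.
Hypothesis H2 : X ^+ dd *: Psi = PU pp + PU Bh *m FR q Phi.
Variables (f : powser F) (P : P2) (h0 : nat) (xT : 'M[K]_r) (a b : {poly F}).
Local Notation L := (tofrac f : K).
Hypotheses (P0 : P != 0) (rP : root (map_poly (evt 1) P) L).
Hypothesis grP : forall i j, gr (X ^+ h0 * Psi i j).
Hypothesis xTE : evrm 1 (X ^+ h0 *: Psi) xT.
Hypotheses (a0 : a != 0) (xT0 : \det xT != 0).
Hypothesis relL : evt 1 b * L * wF ^+ (h0 * r) = evt 1 a * \det xT.

Let H1' i j : X ^+ e * Psi i j = (if xpredT i then pu (tiP F e e) else X ^+ e) * Phi i j.
Proof. exact: H1. Qed.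

(** The twist with index m - kk is singular at t = theta^(q^m), to order m_i < e in row i, while the
    pole has order e. So Y can still vanish there, and the residue is the product of the twists to
    the left of this one, which is invertible. *)
Lemma residB m : (kk <= m)%N -> exists (Y : 'M[S]_r) (B : 'M[K]_r),
  [/\ \det B != 0, forall i j, Lau (map_mx (evK m) (Mt (m - kk)) i j),
      evrm (q ^ m) (X ^+ h0 *: (Psi *m Y)) (map_mx (evK m) (Mt (m - kk)) *m B)
    & evrm (q ^ m) Y 0].
Proof.
move=> mkk; set j := (m - kk)%N.
have m0 : (0 < m)%N by exact: leq_trans kk0 mkk.
have [de [A E]] := iterNK (pt := xpredT) H1' H2 m.-1; rewrite prednK // in E.
have [x NE] := NK_Mt m.-1; rewrite prednK // in NE.
have mE : m = (j + (1 + kk.-1))%N by rewrite add1n prednK // subnK.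
pose p := tiP F 1 (e * q ^ j).
pose Q : 'M[P2]_r := 'X^x *: (CX (q ^ j) (map_mx (@cu F) EE) *m CX (q ^ j.+1) (Mt kk.-1)).
have DmE : CX (q ^ j) (Dm F kk m_) = diag_mx (\row_i p ^+ m_ i).
  apply/matrixP => i l; rewrite !mxE; case: (i == l); last by rewrite !mulr0n rmorph0.
  by rewrite !mulr1n rmorphXn; congr (_ ^+ _); exact: tiP_comp.
have NQ : NK m.-1 = Mt j *m diag_mx (\row_i p ^+ m_ i) *m Q.
  rewrite NE /Q -scalemxAr; congr (_ *: _); rewrite {1}mE MtD -mulmxA; congr (_ *m _).
  rewrite MtD CX_mul CX_comp expn1 -expnSr mulmxA; congr (_ *m _).
  have -> : Mt 1 = Bh by rewrite /= map_mx1 mulmx1.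
  by rewrite CX_mul DmE.
have PE : PU (NK m.-1) = PU (Mt j) *m diag_mx (\row_i pu p ^+ m_ i) *m PU Q.
  by rewrite NQ (PU_mul3 (Mt j) _ Q) PU_diagX.
rewrite PE in E.
pose n_ i := (e - m_ i)%N.
have mn i : (m_ i + n_ i = e)%N by rewrite subnKC // ltnW.
pose ti := tiP F e (e * q ^ m).
have pti : pu p ^+ e = pu ti.
  rewrite -rmorphXn; congr pu; rewrite tiP_frob /ti -mulnA -expnD.
  by rewrite subnK.
have tin0 : pu ti != 0.
  by apply/eqP => /pu_eq0/eqP; apply/negP; rewrite tiP_neq0 // muln_gt0 !q_exp_gt0.
have tiE : pu ti *: FR (q ^ m) Phi = X ^+ (e * q ^ m) *: FR (q ^ m) Psi.
  rewrite (tiPhi (pt := xpredT) H1' m); apply/matrixP => i l; rewrite PU_diagE [in RHS]mxE; congr (_ * _).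
  by rewrite mxE; exact: puXn.
pose x0 : S := X ^+ (h0 * q ^ m).
have full := full_mx x0 mn pti tin0 E tiE.
set Y := (x0 * pu de) *: _ in full.
pose fx := map_mx (fun y => y ^+ (q ^ m)) xT.
have ThE : evrm (q ^ m) (x0 *: FR (q ^ m) Psi) fx.
  by have := evrm_frob m xTE; rewrite FRZ FR_X ?q_exp_gt0.
pose Qe := map_mx (evK m) Q.
have QE : evrm (q ^ m) (PU Q *m (x0 *: FR (q ^ m) Psi)) (Qe *m fx).
  by apply: evrm_mul => //; exact: evrm_pu.
have dE : evrm (q ^ m) (diag_mx (\row_i pu p ^+ n_ i)) (0 : 'M[K]_r).
  move=> i l; rewrite !mxE; case: (i == l); last by rewrite mulr0n; exact: evr0.
  rewrite mulr1n -rmorphXn.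
  have := evr_evK m (p ^+ n_ i).
  have -> // : evK m (p ^+ n_ i) = 0.
  have n0 : (0 < n_ i)%N by rewrite subn_gt0.
  have p0 : evK m p = 0.
    by apply/eqP; rewrite evK_tiP wK_ratio_eq0 muln1 -expnD addnC subnK.
  by rewrite -(prednK n0) exprS rmorphM (_ : evK m p * _ = 0) // p0 mul0r.
pose B : 'M[K]_r := (wF ^+ h0 * (wF ^+ (e * q ^ m) * (\det Qe * \det xT ^+ (q ^ m))))%:M.
have Qe0 : \det Qe != 0.
  rewrite /Qe det_map_mx /Q -mul_scalar_mx !det_mulmx !rmorphM det_scalar rmorphXn /=.
  rewrite !mulf_neq0 ?expf_neq0 // ?[X in X != 0]evK_Xn ?expf_neq0 ?wK_neq0 //.
    have -> : CX (q ^ j) (map_mx (@cu F) EE) = map_mx (@cu F) (map_mx (comp_poly 'X^(q ^ j)) EE).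
      by apply/matrixP => i l'; rewrite !mxE; exact: cu_comp.
    rewrite !det_map_mx [X in X != 0]evK_cu tofrac_eq0 wv_eq0.
    rewrite comp_poly_eq0 // size_polyXn; exact: q_exp_gt0.
  by apply: det_Mt => i il; rewrite mE; lia.
exists Y, B; split.
- by rewrite det_scalar expf_neq0 // !mulf_neq0 ?expf_neq0 ?wK_neq0.
- by move=> i l; rewrite mxE; apply: Lau_evK.
- rewrite full.
  have -> : map_mx (evK m) (Mt j) *m B = wF ^+ h0 *: (wF ^+ (h0 * q ^ m) *:
      (map_mx (evK m) A *m \adj (Qe *m fx) *m 0) +
      (wF ^+ (e * q ^ m) * \det (Qe *m fx)) *: map_mx (evK m) (Mt j)).
    by rewrite mulmx0 scaler0 add0r mul_mx_scalar scalerA det_mulmx det_map_frob.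
  apply: evrmZ; first exact: evr_Xn.
  apply: evrmD.
    apply: evrmZ; first exact: evr_Xn.
    apply: evrm_mul dE; apply: evrm_mul; [exact: evrm_pu|exact: evrm_adj].
  apply: evrmZ; last exact: evrm_pu.
  by apply: evrM; [exact: evr_Xn|exact: evr_det].
have E0 : (wF ^+ (h0 * q ^ m) * evK m de) *: (\adj (Qe *m fx) *m (0 : 'M[K]_r)) = 0.
  by rewrite [X in _ *: X]mulmx0 scaler0.
rewrite -[X in evrm _ _ X]E0.
apply: evrmZ; first by apply: evrM; [exact: evr_Xn|exact: evr_evK].
by apply: evrm_mul dE; exact: evrm_adj.
Qed.

(** The minor with rows g of [Mt] is det (sel g) times det [Mt]. After division by det [Mt] the
    relation has coefficients fixed in m, so [evK_zero] gives T = 0; at theta = t only the identity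
    choice survives in T, with a nonzero coefficient. *)
Theorem full_rank_contra : False.
Proof.
have xTP : \det xT = \det (\matrix_(i, j) xT (id i) j).
  by congr determinant; apply/matrixP => i j; rewrite mxE.
have relL' := relL; rewrite xTP in relL'.
have [Rg [R1 R0 rel]] := @uniform_relation F r r kk dd xpredT id r_gt0 m_ EE
  (fun i => or_intror kk0) dEE Psi Phi pp H1' H2 f P h0 xT a b P0 rP grP xTE a0 relL' kk _ residB.
pose sel (g : {ffun 'I_r -> 'I_r}) : 'M[P2]_r := \matrix_(i, j) (g i == j)%:R.
pose T := \sum_g Rg g * \det (sel g).
have T0 : T = 0.
  apply: (@evK_zero _ _ kk) => m mk; rewrite /T rmorph_sum.
  apply: (mulIf (_ : \det (map_mx (evK m) (Mt (m - kk))) != 0)).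
    rewrite det_map_mx; have := @det_Mt m 0 (m - kk); rewrite expn0 CX1; apply => i; lia.
  rewrite mul0r -[RHS](rel m mk) mulr_suml; apply: eq_bigr => g _.
  rewrite rmorphM -mulrA; congr (_ * _); rewrite -det_map_mx -det_mulmx; congr determinant.
  apply/matrixP => i j; rewrite !mxE (bigD1 (g i)) //= big1 ?addr0 => [|l lg].
    by rewrite !mxE eqxx rmorph1 mul1r.
  by rewrite !mxE eq_sym (negPf lg) rmorph0 mul0r.
have := congr1 (spm 0) T0; rewrite rmorph0 /T rmorph_sum (bigD1 [ffun i => id i]) //= big1 ?addr0 => [|g gi].
  rewrite rmorphM.
  have -> : \det (sel [ffun i => i]) = 1.
    rewrite -(@det1 _ r); congr determinant; apply/matrixP => i j; rewrite !mxE ffunE.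
    by case: (i == j).
  by rewrite rmorph1 mulr1 => /eqP; rewrite (negPf R1).
by rewrite rmorphM; apply: etrans (congr1 (fun y => y * _) (R0 g gi)) _; exact: mul0r.
Qed.

End FullRank.

(** * The generating series of the recursion *)

(** theta^(-d) B(theta) as a polynomial in u = 1/theta, for B of degree at most d. *)
Definition hom (R : nzRingType) (d : nat) (B : {poly R}) : {poly R} :=
  \poly_(i < d.+1) B`_(d - i).

Section Generating.
Variable F : finFieldType.
Local Notation q := #|F|.
Local Notation k := {fraction {poly F}}.
Local Notation S := (powser k).
Local Notation X := (powserX k).
Local Notation K := (Kinf F).
Local Notation P2 := {poly {poly F}}.
Local Notation wF := (@wK F).

Definition sr (c : nat -> {poly F}) : S := PowSer (fun n => tofrac (c n)).

Lemma srE c n : sr c n = tofrac (c n). Proof. by []. Qed.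

Lemma sr_poly (f : S) (c : nat -> {poly F}) N : (forall n, f n = tofrac (c n)) ->
  (forall n, (N <= n)%N -> f n = 0) -> f = pu (\poly_(n < N) c n).
Proof.
move=> fE f0; apply: powserP => n; rewrite puE coef_poly; case: ltnP => [_|/f0->].
  exact: fE.
by rewrite tofrac0.
Qed.

Lemma fpow_sum b (I : Type) (r : seq I) (f : I -> S) :
  fpow b (\sum_(i <- r) f i) = \sum_(i <- r) fpow b (f i).
Proof. exact: (raddf_sum (@fpow k b)). Qed.

Lemma evr_fpow a b (c : nat -> {poly F}) x : (0 < b)%N ->
  serK (fun n => evt a (c n) * wF ^+ (b * n)) x -> evr a (fpow b (sr c)) x.
Proof.
move=> b0 px.
exists (fun n => if (b %| n)%N then c (n %/ b)%N else 0) => [m|].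
  by rewrite fpowE // srE; case: ifP; rewrite ?tofrac0.
pose cc M := ((M + b.-1) %/ b)%N.
have ccP A : exists B, forall m, (B <= m)%N -> (A <= cc m)%N.
  exists (A * b)%N => m le; rewrite /cc leq_divRL //.
  by apply: leq_trans le (leq_addr _ _).
apply: cvgK_close (cvgK_comp px ccP) _ => n; exists 0%N => m _.
suff -> : \sum_(m0 < m) evt a (if (b %| m0)%N then c (m0 %/ b)%N else 0) * wF ^+ m0 =
   \sum_(m0 < cc m) evt a (c m0) * wF ^+ (b * m0) by rewrite subrr; apply: vge00.
rewrite -(sum_dvd (fun m0 => evt a (c m0) * wF ^+ (b * m0))) //.
apply: eq_bigr => i _; case: ifP => [d|_]; last by rewrite rmorph0 mul0r.
by rewrite [(b * _)%N]mulnC divnK.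
Qed.

Lemma gr_shift (f : S) (c : nat -> {poly F}) C h0 : (forall n, f n = tofrac (c n)) ->
  (forall n, ((size (c n)).*2 <= n + C)%N) -> (C <= h0)%N -> gr (X ^+ h0 * f).
Proof.
move=> fE sc Ch n; rewrite powserXnM; case: leqP => [le|_]; last first.
  by exists 0; rewrite ?tofrac0 ?size_poly0.
exists (c (n - h0)%N) => //; apply: leq_trans (sc _) _.
by move: Ch le; move: (n) (h0) (C) => x1 x2 x3; lia.
Qed.

Variables (s e : nat) (Bs : seq (nat * 'M[P2]_s)).
Hypotheses (e0 : (0 < e)%N) (pB : posj Bs).
Hypothesis sB : forall x p p' i, x \in Bs -> (size ((x.2 p p')`_i)%R <= e.+1)%N.
Variables (Y : nat -> 'M[{poly F}]_s) (lam : 'M[K]_s) (c : nat).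
Local Notation CY m p j := (CYf Bs (fun i k j => Y i k j) m p j).
Hypothesis YS : forall m p j, Y m.+1 p j = 'X^e * Y m p j - CY m p j.
Hypothesis Ylim : forall p j, cvgK (fun m => wF ^+ (e * m) * evt 1 (Y m p j)) (lam p j).
Hypothesis sY : forall m p j, (size (Y m p j) <= e * m + c)%N.
Local Notation h := (hd Bs).

(** The series of the Y_m theta^(-m-1), hence the shift by one; [hc] is t^e - theta times it, where
    the product with theta leaves the constant term - Y_0. *)
Definition gc p j (n : nat) : {poly F} := if n is m.+1 then Y m p j else 0.
Definition hc p j (n : nat) : {poly F} := if n is m.+1 then CY m p j else - Y 0%N p j.
(** The substitution u -> u^e moves the pole theta = t^e to theta^e = t^e, which is theta = t when e
    is a power of q. *)
Definition gser : 'M[S]_s := \matrix_(p, j) fpow e (sr (gc p j)).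
Definition hser : 'M[S]_s := \matrix_(p, j) fpow e (sr (hc p j)).

Lemma hcE p j n : hc p j n = 'X^e * gc p j n - gc p j n.+1.
Proof.
case: n => [|m] /=; first by rewrite mulr0 sub0r.
by rewrite YS opprB addrC subrK.
Qed.

Lemma hser_gser p j : X ^+ e * hser p j = pu (tiP F e e) * gser p j.
Proof.
have -> : hser p j = fpow e (sr (hc p j)) by rewrite /hser mxE.
have -> : gser p j = fpow e (sr (gc p j)) by rewrite /gser mxE.
have E : X * sr (hc p j) = pu (tiP F e 1) * sr (gc p j).
  apply: powserP => n; rewrite powserXM /tiP puB puM rmorph1 mulrBl mul1r powserBE.
  have -> : pu ('X^e)%:P * pu 'X^1 * sr (gc p j) = X * (pu ('X^e)%:P * sr (gc p j)).
    by rewrite puXn expr1 mulrA [X * _]mulrC.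
  rewrite powserXM; case: n => [|n]; first by rewrite srE /= tofrac0 subr0.
  rewrite pu_C powserCM_coef !srE -tofracM -tofracB; congr tofrac; exact: hcE.
have := congr1 (fpow e) E; rewrite !fpowM fpow_pu // tiP_comp mul1n => <-.
by congr (_ * _); rewrite -[X in fpow _ X]expr1 FR_X // mul1n.
Qed.

(** The partial sums at theta = t telescope to - w^(e M) Y_M, whence the sign of the limit. *)
Lemma evr_hser : evrm 1 hser (- lam).
Proof.
move=> p j; rewrite !mxE; apply: evr_fpow => //.
suff E M : \sum_(n < M.+1) evt 1 (hc p j n) * wF ^+ (e * n) =
    - (wF ^+ (e * M) * evt 1 (Y M p j)).
  move=> n; have [M hM] := Ylim p j n; exists M.+1 => -[//|m] le.
  by rewrite E -opprD; apply/vgeN/hM.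
elim: M => [|M IH]; first by rewrite big_ord1 /= muln0 expr0 mulr1 mul1r rmorphN.
rewrite big_ord_recr IH hcE /= rmorphB rmorphM /= evtXn mul1n mulrBl.
rewrite addrA -mulrA mulrCA mulnS exprD [_ ^- e * _]mulrA mulVf ?expf_neq0 ?wK_neq0 //; ring.
Qed.

Lemma size_CY m p j : (size (CY m p j) <= e.+1 + (e * (m + h)./2 + c))%N.
Proof.
have sC m' i p1 p2 : (size (Mop q Bs m' i p1 p2) <= e.+1)%N.
  rewrite /Mop big_seq.
  apply: (big_ind (fun p : {poly F} => (size p <= e.+1)%N)) => [|u v h1 h2|x xB].
  - by rewrite size_poly0.
  - by apply: leq_trans (size_polyD _ _) _; rewrite geq_max h1.
  rewrite coef_kap ?q_exp_gt0 // coefXnM.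
  by case: ifP => _; rewrite ?size_poly0 // sB.
rewrite /CYf; apply: (big_ind (fun p : {poly F} => (size p <= _)%N)) => [|u v h1 h2|i _].
- by rewrite size_poly0.
- by apply: leq_trans (size_polyD _ _) _; rewrite geq_max h1.
apply: (big_ind (fun p : {poly F} => (size p <= _)%N)) => [|u v h1 h2|l _].
- by rewrite size_poly0.
- by apply: leq_trans (size_polyD _ _) _; rewrite geq_max h1.
apply: leq_trans (size_polyMleq _ _) _; apply: leq_trans (leq_pred _) _.
apply: leq_add; first exact: sC.
apply: leq_trans (sY _ _ _) _; rewrite leq_add2r leq_mul2l ltnW ?orbT //.
Qed.

Let C0 := (e.+1.*2 + e * h + c.*2)%N.

(** The coefficient [CY] of index m only involves Y_i with i < (m + h) / 2; this halves its degree
    in t relative to the exponent of u. *)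
Lemma gr_hser h0 p j : (C0 <= h0)%N -> gr (X ^+ h0 * hser p j).
Proof.
move=> le; apply: (gr_shift (c := fun n => if (e %| n)%N then hc p j (n %/ e)%N else 0)) le.
  by move=> n; rewrite mxE fpowE //; case: ifP; rewrite ?tofrac0.
move=> n; case: ifP => [/dvdnP[m ->]|_]; last by rewrite size_poly0.
rewrite mulnK //; case: m => [|m] /=.
  rewrite size_polyN; have := sY 0 p j; rewrite muln0 /C0.
  by move: (size _) => x; move: (e * h)%N => y; lia.
have := size_CY m p j; rewrite /C0; move: (size _) => x.
have : ((m + h)./2.*2 <= m + h)%N by rewrite -[X in (_ <= X)%N]odd_double_half leq_addl.
move: ((m + h)./2)%N => z; move: (h) => h'; nia.
Qed.

(** [gser] itself grows with slope 1; a twist by at least q >= 2 brings it down to slope 1/2. *)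
Lemma gr_gser h0 i p j : (C0 <= h0)%N -> gr (X ^+ h0 * fpow (q ^ i.+1) (gser p j)).
Proof.
move=> le; have Q2 : (2 <= q ^ i.+1)%N.
  by apply: leq_trans (q_gt1 F) _; rewrite -{1}(expn1 q) leq_pexp2l ?q_gt0.
move: (q ^ i.+1)%N Q2 => Q Q2; have Qe0 : (0 < Q * e)%N by rewrite muln_gt0 e0 andbT ltnW.
apply: (gr_shift (c := fun n => if (Q * e %| n)%N then gc p j (n %/ (Q * e))%N else 0)) le.
  by move=> n; rewrite mxE fpow_comp ?(ltnW Q2) // fpowE //; case: ifP; rewrite ?tofrac0.
move=> n; case: ifP => [/dvdnP[m ->]|_]; last by rewrite size_poly0.
rewrite mulnK //; case: m => [|m] /=; first by rewrite size_poly0.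
have := sY m p j; rewrite /C0; move: (size _) => x; move: (e * h)%N => y; nia.
Qed.

(** [kap] picks coefficients in a progression, so the recursion term is one coefficient of the
    reversed polynomial times the twisted generating series. *)
Lemma CY_coef m p j d : (h <= d)%N -> tofrac (CY m p j) =
  \sum_(x <- Bs) \sum_l (pu (hom d (x.2 p l)) * fpow (q ^ x.1) (sr (gc l j))) (d + m.+1)%N.
Proof.
move=> hd; rewrite /CYf.
have E1 (x : nat * 'M[P2]_s) l : x \in Bs ->
    (pu (hom d (x.2 p l)) * fpow (q ^ x.1) (sr (gc l j))) (d + m.+1)%N =
    tofrac (\sum_(i < (m + h)./2) (kap (q ^ x.1) ('X^m * x.2 p l))`_i * Y i l j).
  move=> xB; have Q0 := q_exp_gt0 F x.1.
  have Q2 : (2 <= q ^ x.1)%N.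
    have := allP pB _ xB; case: (x.1) => // i _.
    by apply: leq_trans (q_gt1 F) _; rewrite -{1}(expn1 q) leq_pexp2l ?q_gt0.
  have sz : (size (x.2 p l) <= d)%N by apply: leq_trans hd; exact: size_hd.
  move: sz (size_hd p l xB) Q0 Q2; set B := x.2 p l; move: (q ^ x.1)%N => Q sz szh Q0 Q2.
  set n := (d + m.+1)%N.
  pose T := \sum_(i < n) (tofrac (Y i l j))%:P * 'X^(Q * i.+1) : {poly k}.
  rewrite (@powserM_poly _ _ _ n (map_poly (@tofrac _) (hom d B)) T); first last.
  - move=> i iN; rewrite fpowE // /T coef_sum.
    under eq_bigr => i1 _ do rewrite coefCM coefXn.
    case: ifP => [/dvdnP[y yE]|nd]; last first.
      rewrite big1 // => i1 _; case: eqP => [E|_]; last by rewrite mulr0.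
      by rewrite E dvdn_mulr in nd.
    rewrite yE mulnK // srE; case: y yE => [|y] yE.
      rewrite /= tofrac0 big1 // => i1 _; case: eqP => [E|_]; last by rewrite mulr0.
      by move/eqP: E; rewrite mul0n eq_sym muln_eq0 (gtn_eqF Q0).
    have yn : (y < n)%N by move: iN; rewrite yE; nia.
    rewrite (bigD1 (Ordinal yn)) //= mulnC eqxx mulr1 big1 ?addr0 // => i1 ne.
    case: eqP => [E|_]; last by rewrite mulr0.
    case/eqP: ne; apply: val_inj => /=; move/eqP: E; rewrite eqn_pmul2l // => /eqP[]. by [].
  - by move=> i _; rewrite puE coef_map.
  rewrite /T mulr_sumr coef_sum rmorph_sum.
  have term i : (map_poly (@tofrac _) (hom d B) * ((tofrac (Y i l j))%:P * 'X^(Q * i.+1)))`_n =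
      tofrac ((kap Q ('X^m * B))`_i * Y i l j).
    rewrite mulrA coefMXn coefMC coef_map /= coef_kap // coefXnM.
    rewrite tofracM; case: ltnP => [lt|le].
      case: ifP => [_|_]; first by rewrite tofrac0 mul0r.
      rewrite nth_default ?tofrac0 ?mul0r //; apply: leq_trans sz _.
      by move: lt; rewrite /n; move: (Q * i.+1)%N => z; lia.
    congr (_ * _); congr tofrac; rewrite coef_poly.
    move: le; rewrite /n; have : (0 < Q * i.+1)%N by rewrite muln_gt0 Q0.
    move: (Q * i.+1)%N => z z0 le; case: ltnP => le1; case: ltnP => le2 //.
    + by exfalso; lia.
    + by congr (_`_ _); lia.
    by exfalso; lia.
  under eq_bigr => i _ do rewrite term.
  transitivity (\sum_(i < (m + h)./2) (tofrac ((kap Q ('X^m * B))`_i * Y i l j) : k)); last by [].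
  rewrite [RHS](big_ord_widen n (fun i => tofrac ((kap Q ('X^m * B))`_i * Y i l j))); last first.
    rewrite /n; have : ((m + h)./2.*2 <= m + h)%N by rewrite -[X in (_ <= X)%N]odd_double_half leq_addl.
    move: ((m + h)./2)%N => z; lia.
  rewrite [RHS]big_mkcond; apply: eq_bigr => i _; case: ltnP => // le.
  rewrite coef_kap // coefXnM; case: ifP => _; first by rewrite mul0r tofrac0.
  rewrite nth_default ?mul0r ?tofrac0 //; apply: leq_trans szh _.
  have : (m + h < ((m + h)./2.+1).*2)%N.
    rewrite -[X in (X < _)%N]odd_double_half doubleS; case: (odd _); lia.
  move: ((m + h)./2)%N le => z le; nia.
transitivity (\sum_(x <- Bs) \sum_l (tofrac (\sum_(i < (m + h)./2)
   (kap (q ^ x.1) ('X^m * x.2 p l))`_i * Y i l j) : k)); last first.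
  by rewrite !big_seq; apply: eq_bigr => x xB; apply: eq_bigr => l _; rewrite E1.
rewrite rmorph_sum.
under eq_bigr => i _ do rewrite rmorph_sum.
under eq_bigr => i _ do under eq_bigr => l _ do rewrite /Mop mulr_suml rmorph_sum.
under [RHS]eq_bigr => x _ do under eq_bigr => l _ do rewrite rmorph_sum.
rewrite [RHS]exchange_big /= [LHS]exchange_big /=; apply: eq_bigr => l _.
by rewrite exchange_big.
Qed.

(** Beyond index d both sides agree coefficientwise by [CY_coef]; the remaining difference is a
    polynomial. *)
Lemma hser_eq d p j : (h <= d)%N -> exists pp : P2,
  X ^+ (e * d) * hser p j = pu pp +
   \sum_(x <- Bs) \sum_l pu (hom d (x.2 p l) \Po 'X^e) * fpow (q ^ x.1) (gser l j).
Proof.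
move=> hd.
pose R := X ^+ d * sr (hc p j) -
   \sum_(x <- Bs) \sum_l pu (hom d (x.2 p l)) * fpow (q ^ x.1) (sr (gc l j)).
have [rc rE] : exists rc : nat -> {poly F}, forall n, R n = tofrac (rc n).
  pose isp (f : S) := exists rc : nat -> {poly F}, forall n, f n = tofrac (rc n).
  have ispM f g : isp f -> isp g -> isp (f * g).
    move=> [r1 E1] [r2 E2]; exists (fun n => \sum_(i < n.+1) r1 i * r2 (n - i)%N) => n.
    by rewrite powserME rmorph_sum; apply: eq_bigr => i _; rewrite E1 E2; exact: (esym (tofracM _ _)).
  have ispB f g : isp f -> isp g -> isp (f - g).
    move=> [r1 E1] [r2 E2]; exists (fun n => r1 n - r2 n) => n.
    by rewrite powserBE E1 E2 tofracB.
  have isp0 : isp 0 by exists (fun=> 0) => n; rewrite tofrac0.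
  have ispD f g : isp f -> isp g -> isp (f + g).
    move=> [r1 E1] [r2 E2]; exists (fun n => r1 n + r2 n) => n.
    by rewrite powserDE E1 E2 tofracD.
  have ispP (P : P2) : isp (pu P) by exists (fun n => P`_n).
  apply: ispB; first by apply: ispM; [rewrite -puXn; exact: ispP|exists (hc p j)].
  apply: (big_ind isp) => // x _; apply: (big_ind isp) => // l _; apply: ispM => //.
  exists (fun n => if (q ^ x.1 %| n)%N then gc l j (n %/ q ^ x.1)%N else 0) => n.
  by rewrite fpowE ?q_exp_gt0 //; case: ifP; rewrite ?tofrac0.
have R0 n : (d.+1 <= n)%N -> R n = 0.
  move=> dn; rewrite /R powserBE powserXnM (ltnW dn).
  have -> : n = (d + (n - d.+1).+1)%N by lia.
  set m := (n - d.+1)%N; rewrite addKn srE [hc _ _ _]/= (CY_coef m p j hd).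
  rewrite powser_sumE; apply/eqP; rewrite subr_eq0; apply/eqP; apply: eq_bigr => x _.
  by rewrite powser_sumE.
have RE := sr_poly rE R0.
exists ((\poly_(n < d.+1) rc n) \Po 'X^e).
rewrite -fpow_pu // -RE /R mxE.
have -> : X ^+ (e * d) = fpow e (X ^+ d) :> S by rewrite FR_X // mulnC.
rewrite -fpowM -[LHS](subrK (fpow e (\sum_(x <- Bs) \sum_l pu (hom d (x.2 p l)) * fpow (q ^ x.1) (sr (gc l j))))).
rewrite -rmorphB; congr (_ + _); rewrite fpow_sum; apply: eq_bigr => x _.
rewrite fpow_sum; apply: eq_bigr => l _; rewrite fpowM fpow_pu // mxE.
by rewrite !fpow_comp ?q_exp_gt0 // mulnC.
Qed.

End Generating.

Section Homogenization.
Variable R : comNzRingType.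
Implicit Types P Q : {poly R}.

Lemma homE d P : hom d P = \sum_(i < d.+1) P`_i *: 'X^(d - i).
Proof.
apply/polyP => n; rewrite coef_poly coef_sum.
under eq_bigr => i _ do rewrite coefZ coefXn.
case: ltnP => [nd|dn].
  have lt : (d - n < d.+1)%N by rewrite ltnS leq_subr.
  rewrite (bigD1 (Ordinal lt)) //= subKn // eqxx mulr1 big1 ?addr0 // => i /eqP ne.
  case: eqP => [E|_]; last by rewrite mulr0.
  case: ne; apply: val_inj; rewrite /= E subKn //.
  by have := ltn_ord i; rewrite ltnS.
rewrite big1 // => i _; case: eqP => [E|_]; last by rewrite mulr0.
by move: dn; rewrite E => /leq_trans/(_ (leq_subr _ _)); rewrite ltnn.
Qed.

Lemma homM d1 d2 P Q : (size P <= d1.+1)%N -> (size Q <= d2.+1)%N ->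
  hom (d1 + d2) (P * Q) = hom d1 P * hom d2 Q.
Proof.
move=> sP sQ.
have wide (d : nat) (T : {poly R}) : (size T <= d.+1)%N -> T = \sum_(i < d.+1) T`_i *: 'X^i.
  by move=> sT; rewrite -poly_def; apply/polyP => i; rewrite coef_poly; case: ltnP => // le;
     rewrite nth_default // (leq_trans sT).
have homD d (A B : {poly R}) : hom d (A + B) = hom d A + hom d B.
  by rewrite !homE -big_split /=; apply: eq_bigr => i _; rewrite coefD scalerDl.
have hom0 d : hom d 0 = 0 :> {poly R}.
  by rewrite homE big1 // => i _; rewrite coef0 scale0r.
have hom_sum d (I : Type) (r : seq I) (f : I -> {poly R}) : hom d (\sum_(i <- r) f i) = \sum_(i <- r) hom d (f i).
  exact: (big_morph (hom d) (homD d) (hom0 d)).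
have homZX d (c : R) n : (n <= d)%N -> hom d (c *: 'X^n) = c *: 'X^(d - n).
  move=> nd; rewrite homE (bigD1 (Ordinal (nd : n < d.+1)%N)) //= coefZ coefXn eqxx mulr1 big1 ?addr0 //.
  move=> i ni; rewrite coefZ coefXn; case: eqP => [E|_]; last by rewrite mulr0 scale0r.
  by case/eqP: ni; apply: val_inj.
rewrite {1}(wide _ _ sP) {1}(wide _ _ sQ) big_distrlr /= hom_sum !homE big_distrlr /=.
apply: eq_bigr => i _; rewrite hom_sum; apply: eq_bigr => j _.
rewrite -!scalerAl -!scalerAr !scalerA -!exprD homZX; last first.
  by rewrite leq_add // -ltnS ltn_ord.
congr (_ *: _); congr ('X^ _).
have := ltn_ord i; have := ltn_ord j; rewrite !ltnS; move: (nat_of_ord i) (nat_of_ord j) => x y; lia.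
Qed.

Lemma homX d m P : (size P <= d.+1)%N -> hom (d * m) (P ^+ m) = hom d P ^+ m.
Proof.
move=> sP; have sX n : (size (P ^+ n) <= (d * n).+1)%N.
  elim: n => [|n IH]; first by rewrite expr0 muln0 size_poly1.
  rewrite exprS; apply: leq_trans (size_polyMleq _ _) _; rewrite mulnS.
  have aux (x y z u : nat) : (x <= z.+1)%N -> (y <= u.+1)%N -> ((x + y).-1 <= (z + u).+1)%N by lia.
  exact: aux.
elim: m => [|m IH]; first by rewrite muln0 !expr0 homE big_ord1 subn0 coef1 scale1r.
by rewrite mulnS !exprS homM // IH.
Qed.

End Homogenization.

(** * The contradiction for matrices with invertible residues *)

Section Assembly.
Variable F : finFieldType.
Local Notation q := #|F|.
Local Notation k := {fraction {poly F}}.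
Local Notation S := (powser k).
Local Notation X := (powserX k).
Local Notation K := (Kinf F).
Local Notation P2 := {poly {poly F}}.
Local Notation wF := (@wK F).
Local Notation PU := (map_mx (@pu F)).
Local Notation FR b := (map_mx (@fpow k b)).

Lemma hom_cu d p : hom d (cu p) = cu (hom d p) :> P2.
Proof.
apply/polyP => i; rewrite coef_map !coef_poly; case: ltnP => // _.
by case: ltnP => // le; rewrite nth_default //; apply: esym; exact: raddf0.
Qed.

Lemma wv_hom d (p : {poly F}) : (size p <= d.+1)%N -> tofrac (wv (hom d p)) = wF ^+ d * evt 1 p.
Proof.
move=> sp; rewrite (evt_rv 1 sp) mul1n mulrA mulfV ?expf_neq0 ?wK_neq0 // mul1r.
congr tofrac; apply: powserP => n; rewrite wvE coef_poly /rv powser_sumE.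
have E i : (powserC p`_i * powserX F ^+ (1 * (d - i))) n = p`_i *+ (n == d - i)%N.
  by rewrite powserCM_coef powserXnE mul1n mulr_natr.
under eq_bigr => i _ do rewrite E.
case: ltnP => [nd|dn].
  have lt : (d - n < d.+1)%N by rewrite ltnS leq_subr.
  rewrite (bigD1 (Ordinal lt)) //= subKn // eqxx mulr1n big1 ?addr0 // => i /eqP ne.
  case: eqP => [E'|_]; last by rewrite mulr0n.
  case: ne; apply: val_inj; rewrite /= E' subKn //.
  by have := ltn_ord i; rewrite ltnS.
rewrite big1 // => i _; case: eqP => [E'|_]; last by rewrite mulr0n.
by move: dn; rewrite E' => /leq_trans/(_ (leq_subr _ _)); rewrite ltnn.
Qed.

Section Matrix.
Variables (r kk d : nat) (m_ : 'I_r -> nat) (EE0 : 'M[{poly F}]_r).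
Local Notation e := (q ^ kk)%N.
Hypotheses (dEE0 : \det EE0 != 0) (m_d : forall i, (m_ i <= d)%N).
Hypothesis sEE : forall i j, (size (EE0 i j) <= (d - m_ i).+1)%N.
(** Over the common denominator (t - theta)^e, row i of this matrix stands for a pole of order e -
    m_i. *)
Definition Bt : 'M[P2]_r := \matrix_(i, j) (('X%:P - 'X) ^+ m_ i * cu (EE0 i j)).
Definition EEh : 'M[{poly F}]_r := \matrix_(i, j) (hom (d - m_ i) (EE0 i j) \Po 'X^e).

Lemma BhE i j : Bh kk m_ EEh i j = hom d (Bt i j) \Po 'X^e.
Proof.
rewrite /Bh /Dm mul_diag_mx !mxE -(subnKC (m_d i)).
have s1 : (size ('X%:P - 'X : P2)%R <= 2)%N.
  apply: leq_trans (size_polyD _ _) _; rewrite size_polyN size_polyX geq_max leqnn andbT.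
  by apply: leq_trans (size_polyC_leq1 _) _.
have s2 : (size (cu (EE0 i j)) <= (d - m_ i).+1)%N by apply: leq_trans (size_poly _ _) (sEE i j).
have s3 : (size (('X%:P - 'X : P2) ^+ m_ i)%R <= (m_ i).+1)%N.
  elim: (m_ i) => [|n IH]; first by rewrite expr0 size_poly1.
  rewrite exprS; apply: leq_trans (size_polyMleq _ _) _.
  have aux (x y z : nat) : (x <= 2)%N -> (y <= z.+1)%N -> ((x + y).-1 <= z.+2)%N by lia.
  exact: aux.
rewrite homM // comp_polyM subnKC // hom_cu cu_comp; congr (_ * _).
rewrite -{2}(mul1n (m_ i)) homX // rmorphXn /=; congr (_ ^+ _).
rewrite homE big_ord_recl big_ord1 /= !coefB !coefC !coefX /= subr0 sub0r subn0.
rewrite /tiP comp_polyD comp_polyZ comp_Xn_poly expr1 scaleN1r expr0.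
by rewrite expr1 -mul_polyC; congr (_ + _); apply: esym; exact: rmorphN1.
Qed.

Lemma det_EEh : \det EEh != 0.
Proof.
have -> : EEh = map_mx (comp_poly 'X^e) (\matrix_(i, j) hom (d - m_ i) (EE0 i j)).
  by apply/matrixP => i j; rewrite !mxE.
rewrite det_map_mx comp_poly_eq0 ?size_polyXn ?q_exp_gt0 //; last by rewrite ltnS q_exp_gt0.
set A := \matrix_(i, j) _.
have D : \det (map_mx (fun p => tofrac (wv p)) A) = tofrac (wv (\det A)) :> K.
  exact: (det_map_mx (@tofrac (powser F) \o @wv F) A).
rewrite -wv_eq0 -tofrac_eq0 -D.
have -> : map_mx (fun p => tofrac (wv p)) A =
    diag_mx (\row_i wF ^+ (d - m_ i)) *m map_mx (evt 1) EE0.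
  by apply/matrixP => i j; rewrite mul_diag_mx !mxE wv_hom.
have D1 : \det (map_mx (evt 1) EE0) = evt 1 (\det EE0) := det_map_mx (evt 1) EE0.
rewrite det_mulmx det_diag D1 mulf_neq0 ?evt_eq0 //.
by apply/prodf_neq0 => i _; rewrite mxE expf_neq0 ?wK_neq0.
Qed.

End Matrix.

(** [limit_form] and its generating series supply the data of [full_rank_contra]: m_i < e keeps the
    degree in t within the bound for a simple pole, and l != 0 makes the matrix of limits
    invertible. *)
Lemma full_case (r kk : nat) (m_ : 'I_r -> nat) (EE0 : 'M[{poly F}]_r) (l : powser F) (P : P2) :
  (0 < r)%N -> (0 < kk)%N -> \det EE0 != 0 -> (forall i, m_ i < q ^ kk)%N ->
  l != 0 -> (forall N, cl (powserX F) N l (detop q (opnN (q ^ kk) [:: (1%N, Bt m_ EE0)] N))) ->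
  P != 0 -> root (map_poly (evt 1) P) (tofrac l) -> False.
Proof.
move=> r0 kk0 dE m_lt l0 ldet P0 rP; set Bs := [:: _] in ldet; set e := (q ^ kk)%N in ldet.
have e0 : (0 < e)%N by exact: q_exp_gt0.
have pB : posj Bs by [].
have sB x p p' i : x \in Bs -> (size ((x.2 p p')`_i)%R <= e.+1)%N.
  rewrite inE => /eqP->; rewrite mxE coefM.
  apply: (big_ind (fun p : {poly F} => (size p <= e.+1)%N)) => [|u v h1 h2|j _].
  - by rewrite size_poly0.
  - by apply: leq_trans (size_polyD _ _) _; rewrite geq_max h1.
  have sz n j' : (size ((('X%:P - 'X : P2) ^+ n)`_j')%R <= n.+1)%N.
    elim: n j' => [|n IH] j'; first by rewrite expr0 coef1; case: eqP; rewrite ?size_poly1 ?size_poly0.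
    rewrite exprS mulrBl coefB coefCM coefXM.
    apply: leq_trans (size_polyD _ _) _; rewrite geq_max; apply/andP; split.
      apply: leq_trans (size_polyMleq _ _) _; rewrite size_polyX /=; exact: IH.
    rewrite size_polyN; case: eqP => _; first by rewrite size_poly0.
    exact: leq_trans (IH _) _.
  rewrite coef_map; apply: leq_trans (size_polyMleq _ _) _.
  have := sz (m_ p) j; have := size_polyC_leq1 (EE0 p p')`_(i - j); have := m_lt p; rewrite -/e.
  by move: (size _) (size _) => x1 x2; lia.
have [Y [a [b [lam [c [[a0 b0] YS Ylim relL sY]]]]]] := limit_form e0 pB sB ldet l0.
(* d has to exceed [hd Bs] for [hser_eq], and all degrees of entries for the reversal [hom]. *)
pose d := (hd Bs + e + \max_i \max_j size (EE0 i j))%N.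
have hd_d : (hd Bs <= d)%N by rewrite /d -addnA leq_addr.
have m_d i : (m_ i <= d)%N by apply: leq_trans (ltnW (m_lt i)) _; rewrite /d addnAC leq_addl.
have sEE i j : (size (EE0 i j) <= (d - m_ i).+1)%N.
  have : (size (EE0 i j) <= \max_i \max_j size (EE0 i j))%N.
    by apply: leq_trans (leq_bigmax i); apply: leq_trans (leq_bigmax j).
  have := m_lt i; rewrite /d -/e; move: (\max_i _)%N (size _) => x y; lia.
pose Psi := hser e Bs Y; pose Phi := gser e Y.
have [pp ppE] : exists pp : 'I_r * 'I_r -> P2, forall ij, X ^+ (e * d) * Psi ij.1 ij.2 = pu (pp ij) +
    \sum_(x <- Bs) \sum_l pu (hom d (x.2 ij.1 l) \Po 'X^e) * fpow (q ^ x.1) (Phi l ij.2).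
  have ex (ij : 'I_r * 'I_r) := hser_eq e0 pB Y c ij.1 ij.2 hd_d.
  by have [pp ppE] := choice ex; exists pp.
pose h0 := (e.+1.*2 + e * hd Bs + c.*2)%N.
have H2 : X ^+ (e * d) *: Psi = PU (\matrix_(i, j) pp (i, j)) + PU (Bh kk m_ (EEh kk d m_ EE0)) *m FR q Phi.
  apply/matrixP => i j; apply: etrans (_ : X ^+ (e * d) * Psi i j = _); first by rewrite mxE.
  rewrite (ppE (i, j)) /= big_seq1 [RHS]mxE; congr (_ + _); first by rewrite !mxE.
  rewrite [RHS]mxE; apply: eq_bigr => x _; rewrite [PU _ _ _]mxE [FR _ _ _ _]mxE BhE // expn1.
apply: (@full_rank_contra F r kk (e * d) m_ (EEh kk d m_ EE0) r0 kk0 _ m_lt Psi Phi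
   (\matrix_(i, j) pp (i, j)) _ H2 l P h0 (wF ^+ h0 *: (- lam)) ((-1) ^+ r * a) b P0 rP).
- exact: det_EEh.
- exact: hser_gser.
- by move=> i j; apply: (gr_hser e0 pB sB sY).
- by apply: evrmZ; [exact: evr_Xn|exact: (evr_hser e0 YS Ylim)].
- by rewrite mulf_neq0 // expf_neq0 // oppr_eq0 oner_neq0.
- have E := relL; apply/negP => /eqP D0.
  move: D0; rewrite detZ -scaleN1r detZ => /eqP.
  rewrite !mulf_eq0 !expf_eq0 oppr_eq0 oner_eq0 (negPf (wK_neq0 F)) !andbF /= => /eqP D0.
  move: E; rewrite D0 mulr0 => /eqP; rewrite mulf_eq0 tofrac_eq0 (negPf l0) orbF.
  by apply/negP; exact: evt_eq0.
have DL : \det (wF ^+ h0 *: - lam) = wF ^+ (h0 * r) * ((-1) ^+ r * \det lam).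
  by rewrite detZ -exprM -scaleN1r detZ.
rewrite relL DL rmorphM rmorphXn rmorphN1.
have s1 : (-1) ^+ r * (-1) ^+ r = 1 :> K by rewrite -exprD addnn -mul2n exprM sqrrN !expr1n.
have alg (x y z u : K) : u * u = 1 -> x * y * z = u * x * (z * (u * y)).
  by move=> h; rewrite -[LHS]mul1r -h; ring.
exact: alg s1.
Qed.

End Assembly.

(** * The untwisted modules *)

Section ScalarCase.
Variable F : finFieldType.
Local Notation q := #|F|.
Local Notation k := {fraction {poly F}}.
Local Notation S := (powser k).
Local Notation X := (powserX k).
Local Notation K := (Kinf F).
Local Notation P2 := {poly {poly F}}.
Local Notation wF := (@wK F).
Local Notation PU := (map_mx (@pu F)).
Local Notation FR b := (map_mx (@fpow k b)).
Variables (r s d : nat) (pt : pred 'I_r) (p0 : 'I_s -> 'I_r) (EE0 : 'M[{poly F}]_r).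
Hypotheses (s_gt0 : (0 < s)%N) (p0P : forall i, pt (p0 i)).
Hypothesis Pp0 : forall i, pt i -> exists l, i = p0 l.
Hypothesis dE : \det EE0 != 0.
Hypothesis sEE : forall i j, (size (EE0 i j) <= d.+1)%N.

Definition E0 : 'M[K]_r := wF ^+ d *: map_mx (evt 1) EE0.
Definition D0 (n : nat) : 'M[K]_r :=
  diag_mx (\row_i if pt i then wF ^+ q else wF ^- (q ^ n.+2) * wF ^+ q - 1).
(** The values of the iterated matrices at t = theta^(q^(n+1)): each step twists the previous value
    by Frobenius and multiplies from the left. *)
Fixpoint Z0 (n : nat) : 'M[K]_r :=
  if n is n'.+1 then E0 *m D0 n' *m map_mx (fun x => x ^+ q) (Z0 n') else E0.

Lemma Z0E n : Z0 n = evN pt (EEh 0 d (fun=> 0%N) EE0) n.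
Proof.
have E : Ew (EEh 0 d (fun=> 0%N) EE0) = E0.
  apply/matrixP => i j; rewrite [LHS]mxE [in LHS]mxE [RHS]mxE [X in _ * X]mxE expn0 expr1 comp_polyXr.
  by rewrite subn0 wv_hom.
elim: n => [|n IH]; first by rewrite evN0 E.
by rewrite evNS -IH E.
Qed.

Variables (Psi Phi : 'M[S]_(r, s)) (f : powser F) (P : P2) (h0 : nat) (xP : 'M[K]_s) (a b : {poly F}).
Hypothesis S1 : forall i j, X * Psi i j = (if pt i then pu (tiP F 1 1) else X) * Phi i j.
Hypothesis S2 : forall i j, exists pp : P2, X ^+ d * Psi i j = pu pp +
  \sum_l pu (cu (hom d (EE0 i l))) * fpow q (Phi l j).
Hypotheses (P0 : P != 0) (rP : root (map_poly (evt 1) P) (tofrac f)).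
Hypothesis grP : forall i j, gr (X ^+ h0 * Psi i j).
Hypothesis xPE : forall i j, evr 1 (Psi (p0 i) j) (xP i j).
Hypotheses (a0 : a != 0) (b0 : b != 0) (f0 : f != 0).
Hypothesis relL : evt 1 b * tofrac f = evt 1 a * \det xP.

Theorem scalar_relation : exists Rg : {ffun 'I_s -> 'I_r} -> P2,
  [/\ spm 0 (Rg [ffun i => p0 i]) != 0,
      forall g, g != [ffun i => p0 i] -> spm 0 (Rg g) = 0
    & forall n, \sum_g evK n.+1 (Rg g) * \det (\matrix_(i, j) Z0 n (g i) (p0 j)) = 0].
Proof.
have [pp ppE] : exists pp : 'I_r * 'I_s -> P2, forall ij, X ^+ d * Psi ij.1 ij.2 = pu (pp ij) +
    \sum_l pu (cu (hom d (EE0 ij.1 l))) * fpow q (Phi l ij.2).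
  by have [pp ppE] := choice (fun ij : 'I_r * 'I_s => S2 ij.1 ij.2); exists pp.
pose EE := EEh 0 d (fun=> 0%N) EE0.
have H1 i j : X ^+ (q ^ 0) * Psi i j = (if pt i then pu (tiP F (q ^ 0) (q ^ 0)) else X ^+ (q ^ 0)) * Phi i j.
  by rewrite expn0 expr1 S1.
have H2 : X ^+ d *: Psi = PU (\matrix_(i, j) pp (i, j)) + PU (Bh 0 (fun=> 0%N) EE) *m FR q Phi.
  apply/matrixP => i j; apply: etrans (_ : X ^+ d * Psi i j = _); first by rewrite mxE.
  rewrite (ppE (i, j)) [RHS]mxE; congr (_ + _); first by rewrite !mxE.
  rewrite [RHS]mxE; apply: eq_bigr => l _; rewrite [PU _ _ _]mxE [FR _ _ _ _]mxE Bh0 [map_mx _ _ _ _]mxE.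
  by rewrite [EE _ _]mxE expn0 expr1 comp_polyXr subn0.
have [xT xTE] : exists xT : 'M[K]_(r, s), evrm 1 (X ^+ h0 *: Psi) xT.
  have ex (ij : 'I_r * 'I_s) : exists y, evr 1 (X ^+ h0 * Psi ij.1 ij.2) y.
    by rewrite -[X in evr _ X]fpow1; apply: evr_gr.
  have [y yE] := choice ex; exists (\matrix_(i, j) y (i, j)) => i j.
  by rewrite !mxE; exact: (yE (i, j)).
have xTP : \matrix_(i, j) xT (p0 i) j = wF ^+ h0 *: xP.
  apply/matrixP => i j; rewrite mxE [RHS]mxE; have := xTE (p0 i) j; rewrite mxE => E.
  by apply: evr_uniq E _; apply: evrM; [exact: evr_Xn|exact: xPE].
have xP0 : \det xP != 0.
  apply/eqP => D; move: relL; rewrite D mulr0 => /eqP; rewrite mulf_eq0 tofrac_eq0 (negPf f0) orbF.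
  by apply/negP; exact: evt_eq0.
have xT0 : \det (\matrix_(i, j) xT (p0 i) j) != 0.
  by rewrite xTP detZ mulf_neq0 ?expf_neq0 ?wK_neq0.
have relL' : evt 1 b * (tofrac f : K) * wF ^+ (h0 * s) = evt 1 a * \det (\matrix_(i, j) xT (p0 i) j).
  by rewrite xTP detZ relL -exprM; ring.
have dEE : \det EE != 0 by apply: det_EEh => // i j; rewrite subn0.
pose AK m : 'M[K]_(r, s) := \matrix_(i, j) evK m (NN pt EE m.-1 i (p0 j)).
have resid m : (1 <= m)%N -> exists (Y : 'M[S]_s) (B : 'M[K]_s),
    [/\ \det B != 0, forall i j, Lau (AK m i j),
      evrm (q ^ m) (X ^+ h0 *: (Psi *m Y)) (AK m *m B) & evrm (q ^ m) Y 0].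
  case: m => // n _; have [Y [B [B0 top bot]]] := residA p0P Pp0 H1 H2 xTE xT0 n.
  exists Y, B; split=> // i j; rewrite mxE; exact: Lau_evK.
have [Rg [R1 R0 rel]] := uniform_relation s_gt0 (fun=> or_introl erefl) dEE H1 H2 P0 rP grP xTE a0 relL' resid.
exists Rg; split=> // n; rewrite -[RHS](rel n.+1 isT); apply: eq_bigr => g _; congr (_ * \det _).
by apply/matrixP => i j; rewrite !mxE Z0E mxE.
Qed.

End ScalarCase.

Section DetTests.
Variables (R : idomainType) (r : nat).

Lemma det_neq0 (A : 'M[R]_r) : (forall v : 'rV[R]_r, v *m A = 0 -> v = 0) -> \det A != 0.
Proof.
move=> h; apply/negP => /eqP D.
have [v v0 vA] : exists2 v : 'rV[{fraction R}]_r, v != 0 & v *m map_mx (@tofrac R) A = 0.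
  by apply/det0P; rewrite det_map_mx /= D tofrac0.
have [d d0 dv] := common_den (fun j : 'I_r => v 0 j).
have [u uE] := choice dv.
have uA : \row_j u j *m A = 0.
  apply/rowP => j; rewrite !mxE; apply: tofrac_inj; rewrite tofrac0 rmorph_sum.
  have := congr1 (fun w : 'rV[{fraction R}]_r => tofrac d * w 0 j) vA; rewrite !mxE mulr0 => E.
  rewrite -[RHS]E mulr_sumr; apply: eq_bigr => l _.
  by rewrite !mxE rmorphM mulrA uE.
case/eqP: v0; apply/rowP => j; rewrite mxE; apply: (mulfI (_ : tofrac d != 0)); first by rewrite tofrac_eq0.
rewrite uE mulr0 -tofrac0; congr tofrac.
by have := congr1 (fun w : 'rV[R]_r => w 0 j) (h _ uA); rewrite !mxE.
Qed.

End DetTests.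

Section PhiZero.
Variable F : finFieldType.
Local Notation q := #|F|.
Local Notation k := {fraction {poly F}}.
Local Notation S := (powser k).
Local Notation X := (powserX k).
Local Notation K := (Kinf F).
Local Notation P2 := {poly {poly F}}.
Local Notation wF := (@wK F).
Variables (r : nat) (a : nat -> {poly F}).
Hypotheses (r0 : (0 < r)%N) (ar : a r != 0).

(** Companion form of a scalar equation of order r; the state consists of a series and its twists by
    q, ..., q^(r-1). *)
Definition Ephi : 'M[{poly F}]_r :=
  \matrix_(i, j) if i == 0%N :> nat then a j.+1 else (i == j.+1 :> nat)%:R.

Lemma det_Ephi : \det Ephi != 0.
Proof.
apply: det_neq0 => v vE.
have col (j : 'I_r) : v 0 (Ordinal r0) * a j.+1 + \sum_(i | i != Ordinal r0) v 0 i * (i == j.+1 :> nat)%:R = 0.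
  have := congr1 (fun w : 'rV[{poly F}]_r => w 0 j) vE; rewrite mxE [RHS]mxE => E.
  rewrite -[RHS]E [RHS](bigD1 (Ordinal r0)) //= [Ephi _ _]mxE /=; congr (_ + _).
  apply: eq_bigr => i ni; rewrite [Ephi _ _]mxE; case: ifP => // /eqP i0; case/eqP: ni; exact: val_inj.
have lt : (r.-1 < r)%N by rewrite prednK.
have v0 : v 0 (Ordinal r0) = 0.
  have := col (Ordinal lt); rewrite /= prednK // big1 ?addr0 => [/eqP|i _].
    by rewrite mulf_eq0 (negPf ar) orbF => /eqP.
  by rewrite (ltn_eqF (ltn_ord i)) mulr0.
apply/rowP => i; rewrite mxE; case: (posnP i) => [i0|ip].
  by rewrite -[RHS]v0; congr (v 0 _); apply: val_inj.
have lt1 : (i.-1 < r)%N by apply: leq_ltn_trans (leq_pred _) (ltn_ord i).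
have := col (Ordinal lt1); rewrite v0 mul0r add0r (bigD1 i) /=; last first.
  by apply/eqP => E; move: ip; rewrite E.
rewrite prednK // eqxx mulr1 big1 ?addr0 // => l /andP[_ li].
by rewrite (_ : (l == i :> nat) = false) ?mulr0 //; apply: negbTE.
Qed.

(** The minors are the single entries of the first column of Z0. With theta = 1/w this column
    satisfies the recursion of [vec_indep], so it consists of exponential coefficients up to
    scalars. *)
Lemma phi_independent d (Rg : {ffun 'I_1 -> 'I_r} -> P2) :
  (forall n, \sum_g evK n.+1 (Rg g) * \det (\matrix_(i, j)
     Z0 d (fun i : 'I_r => i == 0%N :> nat) Ephi n (g i) (Ordinal r0)) = 0 :> K) ->
  forall g, Rg g = 0.
Proof.
set Z := Z0 d _ Ephi => rel.
have frobE (x y : K) : (x - y) ^+ q = x ^+ q - y ^+ q.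
  by have := frobD (@CK F) 1 x (- y); rewrite (frobN (@CK F)) expn1.
(* The first matrix has no diagonal factor, so step 0, from the unit vector to the first column,
   lacks the power w^q. *)
pose c (m : nat) : K := if m is 0%N then wF ^+ d else wF ^+ (d + q).
pose XX (m p : nat) : K := if m is m'.+1 then
   (if insub p is Some i then Z m' i (Ordinal r0) else 0) else (p == 0%N)%:R.
pose th : K := wF^-1.
have XE m (i : 'I_r) : XX m.+1 i = Z m i (Ordinal r0).
  by rewrite /XX insubT //= => ?; congr (Z m _ _); apply: val_inj.
have c0 m : c m != 0 by case: m => [|m]; rewrite expf_neq0 ?wK_neq0.
have Erow0 (y : 'I_r -> K) : \sum_j E0 d Ephi (Ordinal r0) j * y j = wF ^+ d * \sum_(j < r) evt 1 (a j.+1) * y j.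
  by rewrite mulr_sumr; apply: eq_bigr => j _; rewrite !mxE /= mulrA.
have ErowS p (lt : (p.+1 < r)%N) (y : 'I_r -> K) :
    \sum_j E0 d Ephi (Ordinal lt) j * y j = wF ^+ d * y (Ordinal (ltnW lt)).
  rewrite (bigD1 (Ordinal (ltnW lt))) //= !mxE /= eqxx rmorph1 mulr1 big1 ?addr0 // => j nj.
  rewrite !mxE /= eqSS eq_sym (_ : (j == p :> nat) = false) ?rmorph0 ?mulr0 ?mul0r //.
  by apply: negbTE; rewrite -val_eqE in nj.
pose zz m p := if p == 0%N then XX m p else (th ^+ (q ^ m) - th) * XX m p.
have zq m (j : 'I_r) : zz m.+1 j ^+ q = (if j == 0%N :> nat then 1 else th ^+ (q ^ m.+2) - th ^+ q) * Z m j (Ordinal r0) ^+ q.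
  rewrite /zz XE; case: eqP => _; first by rewrite mul1r.
  by rewrite exprMn frobE -exprM -expnSr.
have zq0 (j : 'I_r) : zz 0%N j ^+ q = (j == Ordinal r0)%:R.
  have -> : (j == Ordinal r0) = (j == 0%N :> nat) by [].
  rewrite /zz /XX expn0 expr1 subrr mul0r; case: (nat_of_ord j == 0%N) => /=; first by rewrite expr1n.
  by rewrite expr0n gtn_eqF // q_gt0.
have ZS m i : Z m.+1 i (Ordinal r0) = wF ^+ q * \sum_j E0 d Ephi i j * zz m.+1 j ^+ q.
  rewrite /Z /= -/Z -mulmxA mxE mulr_sumr; apply: eq_bigr => j _.
  rewrite mul_diag_mx mxE [in X in _ * (X * _)]mxE [map_mx _ _ _ _]mxE zq.
  have -> : (if j == 0%N :> nat then wF ^+ q else wF ^- (q ^ m.+2) * wF ^+ q - 1) =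
      wF ^+ q * (if j == 0%N :> nat then 1 else th ^+ (q ^ m.+2) - th ^+ q).
    case: eqP => _; first by rewrite mulr1.
    by rewrite /th !exprVn mulrBr mulrC mulfV ?expf_neq0 ?wK_neq0.
  by rewrite -mulrA mulrCA.
have XS0 m : XX m.+1 0%N = c m * \sum_(j < r) evt 1 (a j.+1) * zz m j ^+ q.
  have := XE m (Ordinal r0) => /= ->; case: m => [|m] /=.
    rewrite (eq_bigr (fun j : 'I_r => evt 1 (a j.+1) * (j == Ordinal r0)%:R)) => [|j _]; last by rewrite zq0.
    rewrite (bigD1 (Ordinal r0)) // eqxx mulr1 big1 ?addr0 => [|j /negPf->]; last by rewrite mulr0.
    by rewrite [X in _ * X]addr0 /Z /= !mxE.
  by rewrite ZS Erow0 mulrA -exprD addnC.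
have XSp m p : (p.+1 < r)%N -> XX m.+1 p.+1 = c m * zz m p ^+ q.
  move=> lt; have := XE m (Ordinal lt) => /= ->; case: m => [|m] /=.
    have := zq0 (Ordinal (ltnW lt)) => /= ->; rewrite /Z /= !mxE /= eqSS -val_eqE /=.
    by rewrite rmorph_nat.
  by rewrite ZS ErowS mulrA -exprD addnC.
pose Rp (p : nat) : {poly K} := if insub p is Some i then Rt (Rg [ffun=> i]) else 0.
have RpE (i : 'I_r) : Rp i = Rt (Rg [ffun=> i]).
  by rewrite /Rp insubT //= => ?; congr (Rt (Rg _)); apply/ffunP => j; rewrite !ffunE; apply: val_inj.
have rel' m : (1 <= m)%N -> \sum_(p < r) (Rp p).[th ^+ (q ^ m)] * XX m p = 0.
  case: m => // m _; rewrite -[RHS](rel m).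
  rewrite [RHS](reindex (fun i : 'I_r => [ffun=> i])); last first.
    exists (fun g : {ffun 'I_1 -> 'I_r} => g 0) => [i _|g _]; first by rewrite ffunE.
    by apply/ffunP => j; rewrite ffunE ord1.
  apply: eq_bigr => i _; rewrite RpE RtE XE det_mx11 mxE ffunE.
  by [].
have Rp0 := @vec_indep F K (@CK F) th (@theta_inj F) r (fun j => evt 1 (a j)) r0 (evt_eq0 (ltn0Sn 0) ar)
  XX c c0 erefl _ XS0 XSp Rp 1 rel'.
move=> g; apply: Rt_eq0; have -> : g = [ffun=> g 0] by apply/ffunP => j; rewrite ffunE ord1.
rewrite -RpE; apply: Rp0 => // p /andP[p0 _].
by rewrite /XX gtn_eqF.
Qed.

End PhiZero.

Section FieldIdentities.
Variable K : fieldType.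
Implicit Types A B c k m f : K.

Lemma cdiv1 A m k f : A != 0 -> m != 0 -> A * m * (k / (A * m) * f) = k * f.
Proof. by move=> A0 m0; field; rewrite A0 m0. Qed.

Lemma cdiv2 A m k f : A != 0 -> m != 0 -> A * (k / (A * m) * (m * f)) = k * f.
Proof. by move=> A0 m0; field; rewrite A0 m0. Qed.

Lemma cdiv3 A B c m k f : A != 0 -> B != 0 -> c != 0 -> m != 0 ->
  k / (A * B * c * m) * (B * (m * f)) = k * f / (A * c).
Proof. by move=> A0 B0 c0 m0; field; rewrite A0 B0 c0 m0. Qed.

Lemma cdiv4 A c k f : A != 0 -> c != 0 -> k = f + A * (k - f) * c / (A * c).
Proof. by move=> A0 c0; field; rewrite A0 c0. Qed.

End FieldIdentities.

(** * Minors of codimension one and the adjugate *)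

Section Minors.
Variables (R : comNzRingType) (s : nat).

Definition stk (g : 'I_s -> 'I_s.+1) (u : 'I_s.+1 -> R) : 'M[R]_s.+1 :=
  \matrix_(i, j) if unlift ord_max i is Some i' then (g i' == j)%:R else u j.
(** The signed maximal minors of the selection matrix of g: constants 0, 1 or -1, equal to the usual
    cofactor signs when g is injective and increasing. *)
Definition eps (g : 'I_s -> 'I_s.+1) (j : 'I_s.+1) : R := cofactor (stk g (fun=> 0)) ord_max j.

Lemma stk_det g u : \det (stk g u) = \sum_j u j * eps g j.
Proof.
rewrite (expand_det_row _ ord_max); apply: eq_bigr => j _; rewrite mxE unlift_none; congr (_ * _).
by rewrite /eps /cofactor; congr (_ * \det _); apply/matrixP => i l; rewrite !mxE liftK.
Qed.

Lemma eps_id : eps (lift ord_max) ord_max = 1.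
Proof.
rewrite /eps /cofactor addnn -mul2n exprM sqrrN !expr1n mul1r -[RHS](@det1 _ s).
congr determinant; apply/matrixP => i j; rewrite !mxE liftK.
by rewrite (inj_eq (@lift_inj _ ord_max)).
Qed.

End Minors.

Section MapEps.
Variables (R R' : comNzRingType) (f : R -> R') (fD : zmod_morphism f) (fM : monoid_morphism f).

Lemma map_eps s (g : 'I_s -> 'I_s.+1) j : f (eps R g j) = eps R' g j.
Proof.
pose phi : {rmorphism R -> R'} := HB.pack f (GRing.isZmodMorphism.Build R R' f fD)
  (GRing.isMonoidMorphism.Build R R' f fM).
have : phi (eps R g j) = eps R' g j; last by [].
rewrite /eps -cofactor_map_mx; congr (cofactor _ _ _); apply/matrixP => i l; rewrite !mxE.
by case: unlift => [?|]; rewrite ?rmorph_nat ?rmorph0.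
Qed.

End MapEps.

Section EvalEps.
Variables (F : finFieldType) (s : nat).
Implicit Type g : 'I_s -> 'I_s.+1.

Lemma evK_eps m g j : @evK F m (eps {poly {poly F}} g j) = eps (Kinf F) g j.
Proof.
exact (@map_eps {poly {poly F}} (Kinf F) (@evK F m) (@evK_is_zmod_morphism F m) (@evK_is_monoid_morphism F m) s g j).
Qed.

Lemma spm_eps m g j : @spm F m (eps {poly {poly F}} g j) = eps (Kinf F) g j.
Proof.
exact (@map_eps {poly {poly F}} (Kinf F) (@spm F m) (@spm_is_zmod_morphism F m) (@spm_is_monoid_morphism F m) s g j).
Qed.

End EvalEps.

(** The selected unit rows are stacked over the last row of adj M; multiplied by M, that last row
    becomes det M times a unit vector, and expanding along it leaves the minor. *)
Lemma stk_minor (R : idomainType) s (M : 'M[R]_s.+1) (g : 'I_s -> 'I_s.+1) : \det M != 0 ->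
  \det (\matrix_(i, j) M (g i) (lift ord_max j)) = \sum_j (\adj M) ord_max j * eps R g j.
Proof.
move=> M0; apply: (mulIf M0); rewrite -stk_det -det_mulmx.
set T := stk g _ *m M.
have Tm j : T ord_max j = \det M *+ (ord_max == j).
  have := congr1 (fun A : 'M[R]_s.+1 => A ord_max j) (mul_adj_mx M); rewrite [X in _ = X]mxE => <-.
  by rewrite !mxE; apply: eq_bigr => l _; rewrite mxE unlift_none.
rewrite [RHS](expand_det_row _ ord_max) (bigD1 ord_max) //= Tm eqxx mulr1n big1 ?addr0 => [|j nj]; last first.
  by rewrite Tm eq_sym (negPf nj) mul0r.
rewrite mulrC; congr (_ * _); rewrite /cofactor addnn -mul2n exprM sqrrN !expr1n mul1r.
congr determinant; apply/matrixP => i j; rewrite !mxE (bigD1 (g i)) //= !mxE liftK eqxx mul1r big1 ?addr0 // => l ng.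
by rewrite mxE liftK eq_sym (negPf ng) mul0r.
Qed.

(** * Independence for the untwisted exterior power *)

Section WedgeZero.
Variable F : finFieldType.
Local Notation q := #|F|.
Local Notation k := {fraction {poly F}}.
Local Notation S := (powser k).
Local Notation X := (powserX k).
Local Notation K := (Kinf F).
Local Notation P2 := {poly {poly F}}.
Local Notation wF := (@wK F).
Variables (s : nat) (a : nat -> {poly F}).
Hypotheses (s0 : (0 < s)%N) (ar : a s.+1 != 0).

(** The companion matrix of wedge^(r-1) with r = s + 1. The extra last coordinate is, up to sign,
    the twist of the first one, which absorbs the tau^2 term. *)
Definition wrow (R : pzRingType) (b : nat -> R) (i j : nat) : R :=
  (-1) ^+ s * (if i == s then (j == 0%N)%:R else (- b (s - i)%N) *+ (j == 0%N) + b s.+1 *+ (j == i.+1)).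
Definition Ewed : 'M[{poly F}]_s.+1 := \matrix_(i, j) wrow a i j.

Lemma wrow_col (R : comNzRingType) (b : nat -> R) (y : 'rV[R]_s.+1) (A : 'M[R]_s.+1) :
  (forall i j, A i j = wrow b i j) ->
  (y *m A) 0 ord0 = (-1) ^+ s * (y 0 ord_max - \sum_(i < s) b (s - i)%N * y 0 (widen_ord (leqnSn s) i)) /\
  (forall i : 'I_s, (y *m A) 0 (lift ord0 i) = (-1) ^+ s * (b s.+1 * y 0 (widen_ord (leqnSn s) i))).
Proof.
move=> AE; split=> [|i].
  rewrite mxE big_ord_recr /= AE /wrow eqxx mulr1 addrC mulrBr; congr (_ + _); first by rewrite mulrC.
  rewrite mulr_sumr -sumrN; apply: eq_bigr => i _.
  rewrite AE /wrow (ltn_eqF (ltn_ord i)) eqxx mulr1n mulr0n addr0 mulrC; ring.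
rewrite mxE big_ord_recr /= AE /wrow eqxx /= mulr0 mulr0 addr0.
rewrite (bigD1 i) //= AE /wrow (ltn_eqF (ltn_ord i)) /= mulr0n add0r /bump /= add1n eqxx mulr1n.
rewrite big1 ?addr0 => [|l li]; first by rewrite mulrC -mulrA.
rewrite AE /wrow (ltn_eqF (ltn_ord l)) /= mulr0n add0r eqSS (_ : (i == l :> nat) = false) ?mulr0n ?mulr0 //.
by apply: negbTE; rewrite eq_sym.
Qed.

Lemma det_Ewed : \det Ewed != 0.
Proof.
apply: det_neq0 => v vE.
have [c0 cS] := @wrow_col {poly F} a v Ewed (fun i j => mxE _ _ _ _).
have sg0 : (-1 : {poly F}) ^+ s != 0 by rewrite expf_neq0 // oppr_eq0 oner_neq0.
have v0 (i : 'I_s) : v 0 (widen_ord (leqnSn s) i) = 0.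
  have := cS i; rewrite vE mxE => /esym/eqP; rewrite !mulf_eq0 (negPf sg0) (negPf ar) /=.
  by move/eqP.
apply/rowP => i; rewrite mxE; case: (unliftP ord_max i) => [j|] ->.
  by rewrite -[RHS](v0 j); congr (v 0 _); apply: val_inj; rewrite /= /bump leqNgt ltn_ord.
move: c0; rewrite vE mxE big1 ?subr0 => [|j _]; last by rewrite v0 mulr0.
by move/esym/eqP; rewrite mulf_eq0 (negPf sg0) => /eqP.
Qed.

(** By [stk_minor] the minors are combinations of the last row v of adj Z. As v Z is det Z times the
    last unit vector, the recursion of Z induces the dual recursion on v, which is that of the
    exponential of phi, so [vec_indep] applies. What it controls is the coefficient of each
    coordinate of v, whence the sums with [eps]. *)
Lemma wedge_independent d (Rg : {ffun 'I_s -> 'I_s.+1} -> P2) :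
  (forall n, \sum_g evK n.+1 (Rg g) * \det (\matrix_(i, j)
     Z0 d (fun i : 'I_s.+1 => i != ord_max) Ewed n (g i) (lift ord_max j)) = 0 :> K) ->
  forall j, \sum_g Rg g * eps P2 g j = 0.
Proof.
set Z := Z0 d _ Ewed => rel.
have frobE (x y : K) : (x - y) ^+ q = x ^+ q - y ^+ q.
  by have := frobD (@CK F) 1 x (- y); rewrite (frobN (@CK F)) expn1.
have wn n : wF ^+ n != 0 by rewrite expf_neq0 ?wK_neq0.
pose b j := evt 1 (a j).
have b0 : b s.+1 != 0 by exact: evt_eq0.
pose sg : K := (-1) ^+ s.
have sg0 : sg != 0 by rewrite expf_neq0 // oppr_eq0 oner_neq0.
pose EK := map_mx (evt 1) Ewed.
have EKE i j : EK i j = wrow b i j.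
  rewrite !mxE /wrow rmorphM rmorphXn rmorphN1; congr (_ * _).
  by case: eqP => _; rewrite ?rmorph_nat // rmorphD !rmorphMn rmorphN.
have dEK : \det EK != 0.
  have -> : \det EK = evt 1 (\det Ewed) := det_map_mx (evt 1) Ewed.
  by apply: evt_eq0 => //; exact: det_Ewed.
have E0E : E0 d Ewed = wF ^+ d *: EK by [].
have dE0 : \det (E0 d Ewed) != 0.
  by rewrite E0E detZ; apply: mulf_neq0; [exact: expf_neq0 (wn d)|exact: dEK].
pose th : K := wF^-1.
have mu0 n : th ^+ (q ^ n.+2) - th ^+ q != 0.
  by rewrite subr_eq0 -(expn1 q); apply/eqP => /theta_inj.
have DE n : D0 F (fun i : 'I_s.+1 => i != ord_max) n =
    diag_mx (\row_i (wF ^+ q * (if i == ord_max then th ^+ (q ^ n.+2) - th ^+ q else 1))).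
  congr diag_mx; apply/rowP => i; rewrite !mxE; case: eqP => _ /=; last by rewrite mulr1.
  by rewrite /th !exprVn mulrBr mulrC mulfV.
have dD n : \det (D0 F (fun i : 'I_s.+1 => i != ord_max) n) != 0.
  rewrite DE det_diag; apply/prodf_neq0 => i _; rewrite mxE; apply: mulf_neq0; first exact: wn.
  by case: (i == ord_max); [exact: mu0|exact: oner_neq0].
have ZS n : Z n.+1 = E0 d Ewed *m D0 F (fun i : 'I_s.+1 => i != ord_max) n *m map_mx (fun x => x ^+ q) (Z n) by [].
have dZ n : \det (Z n) != 0.
  elim: n => [|n IH]; first exact: dE0.
  rewrite ZS det_mulmx (det_mulmx (E0 d Ewed)); apply: mulf_neq0; first by apply: mulf_neq0; [exact: dE0|exact: dD].
  have := @det_map_frob F s.+1 1 (Z n); rewrite expn1 => ->; exact: expf_neq0.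
(* At m = 0 the row is the last unit vector, the initial condition of [vec_indep] after reversal. *)
pose v (m : nat) : 'rV[K]_s.+1 := if m is m'.+1 then row ord_max (\adj (Z m')) else delta_mx 0 ord_max.
have vZ m : v m.+1 *m Z m = \det (Z m) *: delta_mx 0 ord_max.
  rewrite /v -row_mul mul_adj_mx; apply/rowP => j; rewrite !mxE eqxx /= eq_sym.
  by rewrite mulr_natr.
pose fv m := map_mx (fun x : K => x ^+ q) (v m).
have [ka [ka0 step]] : exists ka : nat -> K, (forall m, ka m != 0) /\ forall m,
    v m.+1 *m EK *m (if m is m'.+1 then D0 F (fun i : 'I_s.+1 => i != ord_max) m' else 1%:M) = ka m *: fv m.
  exists (fun m => wF ^- d * (if m is m'.+1 then \det (Z m'.+1) / \det (Z m') ^+ q else \det (Z 0%N))).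
  split=> [m|m].
    apply: mulf_neq0; first by rewrite invr_eq0; exact: wn.
    case: m => [|m]; first exact: dZ.
    apply: mulf_neq0; first exact: dZ.
    by rewrite invr_eq0; exact: expf_neq0 (dZ m).
  have fin0 (u u' : 'rV[K]_s.+1) : wF ^+ d *: u = u' -> u = wF ^- d *: u'.
    by move=> <-; rewrite scalerA mulVf // scale1r.
  rewrite -scalerA; apply: fin0; case: m => [|m].
    rewrite mulmx1 scalemxAr -E0E.
    have -> : fv 0%N = delta_mx 0 ord_max.
      apply/rowP => j; rewrite !mxE eqxx /=; case: (j == ord_max); rewrite ?expr1n // expr0n.
      by rewrite gtn_eqF // q_gt0.
    exact: vZ.
  set Dm := D0 _ _ _; pose N := map_mx (fun x : K => x ^+ q) (Z m).
  have dN : \det N = \det (Z m) ^+ q by have := @det_map_frob F s.+1 1 (Z m); rewrite expn1.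
  have uN : N \in unitmx by rewrite unitmxE unitfE dN expf_neq0.
  have frN : fv m.+1 *m N = \det (Z m) ^+ q *: delta_mx 0 ord_max.
    apply/rowP => j; have := congr1 (fun w : 'rV[K]_s.+1 => w 0 j ^+ q) (vZ m).
    rewrite !mxE exprMn => E.
    have -> : \det (Z m) ^+ q * ((0 == 0 :> 'I_1) && (j == ord_max))%:R = \det (Z m) ^+ q * ((0 == 0 :> 'I_1) && (j == ord_max))%:R ^+ q.
      by case: (_ && _); rewrite ?expr1n // expr0n gtn_eqF // q_gt0.
    rewrite -E; have := @frob_sum F K (@CK F) 1 _ (index_enum 'I_s.+1) xpredT (fun l => v m.+1 0 l * Z m l j).
    rewrite expn1 => ->; apply: eq_bigr => l _; rewrite exprMn mxE; congr (_ * _).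
    by rewrite mxE.
  have E2 : (v m.+2 *m E0 d Ewed *m Dm) *m N = \det (Z m.+1) *: delta_mx 0 ord_max.
    by rewrite -vZ ZS !mulmxA.
  rewrite scalemxAl scalemxAr -E0E -[LHS](mulmxK uN) E2.
  rewrite -[RHS](mulmxK uN); congr (_ *m _).
  rewrite -scalemxAl frN scalerA; congr (_ *: _); apply: esym.
  exact: divfK (expf_neq0 q (dZ m)) _.
have scE (x : K) (u : 'rV[K]_s.+1) j : (x *: u) 0 j = x * u 0 j by rewrite mxE.
pose XX (m p : nat) : K := if (p <= s)%N then v m 0 (inord (s - p)) else 0.
pose zz m p := if p == 0%N then XX m p else (th ^+ (q ^ m) - th) * XX m p.
pose mu m : K := if m is m'.+1 then th ^+ (q ^ m'.+2) - th ^+ q else 1.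
have mun m : mu m != 0 by case: m => [|m]; [exact: oner_neq0|exact: mu0].
pose wq m : K := if m is m'.+1 then wF ^+ q else 1.
have wqn m : wq m != 0 by case: m => [|m]; [exact: oner_neq0|exact: wn].
have colE m (y : 'rV[K]_s.+1) j : (y *m (if m is m'.+1 then D0 F (fun i : 'I_s.+1 => i != ord_max) m' else 1%:M)) 0 j
    = y 0 j * (wq m * (if j == ord_max then mu m else 1)).
  case: m => [|m]; first by rewrite mulmx1 /wq /mu; case: eqP; rewrite !mulr1.
  by rewrite DE mul_mx_diag !mxE.
pose c m := ka m / (sg * b s.+1 * wq m * mu m).
have c0 m : c m != 0.
  apply: mulf_neq0; first exact: ka0.
  by rewrite invr_eq0; exact: mulf_neq0 (mulf_neq0 (mulf_neq0 sg0 b0) (wqn m)) (mun m).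
have zq m p : (p <= s)%N -> zz m p ^+ q = (if p == 0%N then 1 else mu m) * fv m 0 (inord (s - p)).
  move=> ps; rewrite /zz /XX ps mxE; case: eqP => [_|p0]; first by rewrite mul1r.
  rewrite exprMn frobE -exprM -expnSr; case: m => [|m] //.
  rewrite /mu mul1r mxE eqxx /= (_ : inord (s - p) == ord_max = false) ?mulr0n ?expr0n ?gtn_eqF ?q_gt0 ?mulr0 //.
  by apply/eqP => /(congr1 val); rewrite /= inordK ?ltnS ?leq_subr // => E; move/eqP: p0; lia.
have XSp m p : (p.+1 < s.+1)%N -> XX m.+1 p.+1 = c m * zz m p ^+ q.
  rewrite ltnS => ps; have lt : (s - p.+1 < s)%N by lia.
  have [_ /(_ (Ordinal lt)) E] := wrow_col (v m.+1) EKE.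
  have := congr1 (fun w : 'rV[K]_s.+1 => w 0 (lift ord0 (Ordinal lt))) (step m); rewrite colE E scE.
  have -> : widen_ord (leqnSn s) (Ordinal lt) = inord (s - p.+1).
    by apply: val_inj; rewrite /= inordK // ltnS leq_subr.
  have -> : lift ord0 (Ordinal lt) = inord (s - p).
    by apply: val_inj; rewrite /= inordK ?ltnS ?leq_subr // /bump /=; lia.
  rewrite zq ?(ltnW ps) // {1}/XX ps => E1.
  move: E1; have -> : (inord (s - p) == ord_max :> 'I_s.+1) = (p == 0%N).
    by rewrite -val_eqE /= inordK ?ltnS ?leq_subr //; lia.
  rewrite -/sg => E1; rewrite /c; have An := mulf_neq0 (mulf_neq0 sg0 b0) (wqn m).
  case: (p == 0%N) E1 => E1.
    apply: (mulfI (mulf_neq0 An (mun m))); rewrite mul1r (cdiv1 _ _ An (mun m)) -E1; ring.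
  apply: (mulfI An); rewrite (cdiv2 _ _ An (mun m)) -E1; ring.
have XS0 m : XX m.+1 0%N = c m * \sum_(j < s.+1) b j.+1 * zz m j ^+ q.
  have [E _] := wrow_col (v m.+1) EKE.
  have := congr1 (fun w : 'rV[K]_s.+1 => w 0 ord0) (step m); rewrite colE E scE.
  have -> : (ord0 == ord_max :> 'I_s.+1) = false by rewrite -val_eqE /= ltn_eqF.
  rewrite -/sg mulr1 => E1.
  have zs : zz m s ^+ q = mu m * fv m 0 ord0.
    rewrite zq // subnn gtn_eqF //; congr (_ * fv m 0 _); apply: val_inj; by rewrite /= inordK.
  have sumE : \sum_(i < s) b (s - i)%N * v m.+1 0 (widen_ord (leqnSn s) i) =
      c m * \sum_(j < s) b j.+1 * zz m j ^+ q.
    rewrite (reindex_inj rev_ord_inj) /= mulr_sumr; apply: eq_bigr => i _.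
    rewrite mulrCA -XSp ?ltnS ?ltn_ord // /XX ltn_ord subKn ?ltn_ord //; congr (_ * v m.+1 0 _).
    by apply: val_inj; rewrite /= inordK // ltnS leq_subr.
  rewrite big_ord_recr /= zs mulrDr -sumE.
  have -> : XX m.+1 0%N = v m.+1 0 ord_max.
    by rewrite /XX /= subn0; congr (v m.+1 0 _); apply: val_inj; rewrite /= inordK.
  set T := \sum_(i < s) _ in E1 *.
  have -> : c m * (b s.+1 * (mu m * fv m 0 ord0)) = ka m * fv m 0 ord0 / (sg * wq m).
    exact: cdiv3 sg0 b0 (wqn m) (mun m).
  by rewrite -E1; exact: cdiv4 sg0 (wqn m).
pose T j : P2 := \sum_g Rg g * eps P2 g j.
pose Rp (p : nat) : {poly K} := if (p <= s)%N then Rt (T (inord (s - p))) else 0.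
have rel' m : (1 <= m)%N -> \sum_(p < s.+1) (Rp p).[th ^+ (q ^ m)] * XX m p = 0.
  case: m => // m _; rewrite -[RHS](rel m).
  transitivity (\sum_j evK m.+1 (T j) * v m.+1 0 j).
    rewrite [RHS](reindex_inj rev_ord_inj) /=; apply: eq_bigr => p _.
    rewrite /Rp /XX -ltnS ltn_ord RtE.
    have -> : inord (s - p) = rev_ord p by apply: val_inj; rewrite /= inordK ?subSS // ltnS leq_subr.
    by [].
  transitivity (\sum_g evK m.+1 (Rg g) * \sum_j (\adj (Z m)) ord_max j * eps K g j); last first.
    by apply: eq_bigr => g _; rewrite stk_minor.
  under [RHS]eq_bigr => g _ do rewrite mulr_sumr.
  rewrite [RHS]exchange_big; apply: eq_bigr => j _; rewrite /T rmorph_sum mulr_suml.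
  apply: eq_bigr => g _.
  have me : evK m.+1 (eps P2 g j) = eps K g j := @evK_eps F s m.+1 _ j.
  have vE : v m.+1 0 j = (\adj (Z m)) ord_max j by rewrite mxE.
  apply: (@etrans _ _ (evK m.+1 (Rg g) * evK m.+1 (eps P2 g j) * v m.+1 0 j)); first by rewrite rmorphM.
  by rewrite me vE -mulrA; congr (_ * _); rewrite mulrC.
have Rp0 := @vec_indep F K (@CK F) th (@theta_inj F) s.+1 b (ltn0Sn s) b0 XX c c0 _ _ XS0 XSp Rp 1 rel'.
have R0 p : (p <= s)%N -> Rp p = 0.
  move=> ps; apply: Rp0; rewrite ?ltnS //.
    rewrite /XX /= subn0 /v mxE eqxx /= (_ : inord s = ord_max) ?eqxx //.
    by apply: val_inj; rewrite /= inordK.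
  move=> p' /andP[p0 ps']; rewrite ltnS in ps'; rewrite /XX ps' /v mxE eqxx /=.
  rewrite (_ : inord (s - p') == ord_max = false) //.
  by apply/eqP => /(congr1 val); rewrite /= inordK ?ltnS ?leq_subr //; lia.
move=> j; apply: Rt_eq0; have := R0 (s - j)%N (leq_subr _ _); rewrite /Rp leq_subr.
by rewrite subKn ?inord_val // -ltnS.
Qed.

End WedgeZero.

(** * Reduction of the operators *)

Section Reduction.
Variable F : finFieldType.
Local Notation q := #|F|.
Local Notation W := (powser F).
Local Notation X := (powserX F).
Local Notation P2 := {poly {poly F}}.
Local Notation iW := (map_poly (@powserC F)).

Lemma rv_polyC n c : rv 1 n c%:P = X ^+ n * powserC c.
Proof.
rewrite /rv big_ord_recl big1 ?addr0 => [|i _]; last by rewrite coefC /= rmorph0 mul0r.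
by rewrite coefC eqxx subn0 mul1n mulrC.
Qed.

Lemma rv_cu n p : map_poly (rv 1 n) (cu p) = (X ^+ n) *: iW p.
Proof.
apply/polyP => i; rewrite coefZ !coef_map_id0 ?raddf0 ?rmorph0 //.
exact: rv_polyC.
Qed.

(** A_0 = theta is scalar, so (t - A_0)^(-1) has a simple pole from the start and e = 1. *)
Lemma LopN_scalar s (cs : seq 'M[{poly F}]_s) nl N :
  LopN (@TModule F s ('X%:M :: cs) nl) N =
  opnN 1 [seq (j, map_mx (@cu F) ('X%:M :: cs)`_j) | j <- iota 1 (size cs)] N.
Proof.
rewrite /LopN /opnN -map_comp; apply: eq_map => j /=; congr (_, _).
have -> : map_mx iW ('X%:M : 'M[{poly F}]_s) = 'X%:M by rewrite map_scalar_mx /= map_polyX.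
have pw i : ('X%:M : 'M[{poly W}]_s) ^+ i = ('X^i)%:M.
  elim: i => [|i IH]; first by rewrite !expr0.
  by rewrite !exprS IH [LHS](_ : _ = 'X%:M *m ('X^i)%:M) // mul_scalar_mx scale_scalar_mx.
apply/matrixP => p p'; rewrite summxE !mxE rv_cu expr1 /geomN mulr_suml.
apply: eq_bigr => i _; rewrite pw mul_scalar_mx !mxE exprS polyCM -!mul_polyC mul1n; ring.
Qed.

Lemma tofrac_rv1 d (p : {poly F}) : (size p <= d.+1)%N -> tofrac (rv 1 d p) = @wK F ^+ d * evt 1 p.
Proof. by move=> sp; rewrite (evt_rv 1 sp) mul1n mulrA mulfV ?mul1r // expf_neq0 ?wK_neq0. Qed.

Lemma rv_mulX d (c : {poly F}) : (size c <= d)%N -> X * rv 1 d ('X * c) = rv 1 d c.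
Proof.
move=> sc; apply: tofrac_inj.
have s1 : (size ('X * c)%R <= d.+1)%N.
  by apply: leq_trans (size_polyMleq _ _) _; rewrite size_polyX /=.
have E : tofrac (X * rv 1 d ('X * c)) = @wK F * (@wK F ^+ d * evt 1 ('X * c)).
  by rewrite -(tofrac_rv1 s1); exact: tofracM.
rewrite E (tofrac_rv1 (leqW sc)) rmorphM /= evtX mulrCA; congr (_ * _).
by rewrite mulrA mulfV ?mul1r // wK_neq0.
Qed.

Definition Pt_ m (c : {poly F}) : P2 := ('X%:P - 'X) ^+ m * cu c.

Lemma Pt_S m c i : (Pt_ m.+1 c)`_i = 'X * (Pt_ m c)`_i - (if i is i'.+1 then (Pt_ m c)`_i' else 0).
Proof.
rewrite /Pt_ exprS -mulrA mulrBl coefB coefCM coefXM; congr (_ - _).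
by case: i.
Qed.

Lemma size_Pt m c i : (size ((Pt_ m c)`_i)%R <= m.+1)%N.
Proof.
elim: m i => [|m IH] i.
  by rewrite /Pt_ expr0 mul1r coef_map; exact: size_polyC_leq1.
rewrite Pt_S; apply: leq_trans (size_polyD _ _) _; rewrite geq_max size_polyN; apply/andP; split.
  apply: leq_trans (size_polyMleq _ _) _; rewrite size_polyX /=; exact: IH.
by case: i => [|i]; [rewrite size_poly0|apply: leq_trans (IH _) _].
Qed.

Lemma rv_pow d m c : (m <= d)%N -> map_poly (rv 1 d) (Pt_ m c) =
  (X ^+ (d - m))%:P * ((1 - X%:P * 'X) ^+ m * iW c).
Proof.
elim: m => [|m IH] md.
  by rewrite /Pt_ !expr0 !mul1r subn0 rv_cu -mul_polyC.
have X0 : X%:P != 0 :> {poly W} by rewrite polyC_eq0 powserX_neq0.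
apply: (mulfI X0); transitivity ((1 - X%:P * 'X) * map_poly (rv 1 d) (Pt_ m c)); last first.
  rewrite IH ?(ltnW md) // exprS -[(d - m)%N in LHS]prednK ?subn_gt0 // -subnS.
  rewrite exprS polyCM; ring.
apply/polyP => i; rewrite coefCM mulrBl mul1r coefB -mulrA coefCM coefXM.
rewrite !coef_map_id0 ?raddf0 // Pt_S raddfB /= mulrBr rv_mulX; last first.
  exact: leq_trans (size_Pt _ _ _) md.
congr (_ - _ * _); case: i => [|i] /=; first by rewrite raddf0.
by [].
Qed.

Section Tensor.
Variables (s r n kk : nat) (E : 'M[{poly F}]_s) (EE0 : 'M[{poly F}]_r) (n_ : 'I_r -> nat).
Local Notation e := (q ^ kk)%N.
Hypotheses (r0 : (0 < r)%N) (rs : (r <= s)%N).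
Hypotheses (n0 : forall p, (0 < n_ p)%N) (nn : forall p, (n_ p <= n.+1)%N) (ne : (n.+1 <= e)%N).
Hypothesis sn : (s <= r * n.+1)%N.
Hypothesis E0 : forall i j : 'I_s, (r <= j)%N -> E i j = 0.
Hypothesis Elow : forall (i j : 'I_s) (p k : 'I_r) l, i = (p + r * l)%N :> nat -> j = k :> nat ->
  E i j = if l.+1 == n_ p then EE0 p k else 0.
Hypothesis ns : forall p : 'I_r, (p + r * (n_ p).-1 < s)%N.
Local Notation m_ := (fun p : 'I_r => (e - n_ p)%N).
Local Notation Nsh := (mx1 s (fun i j => (j == i + r)%N%:R) : 'M[{poly F}]_s).

Let y : {poly W} := X%:P * 'X.
Let A0 : 'M[{poly W}]_s := map_mx iW ('X%:M + Nsh).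
Let NW : 'M[{poly W}]_s := map_mx iW Nsh.
Let gN N : {poly W} := \sum_(a < N) y ^+ (e * a).
(** Here y = w theta. By Frobenius (1 - y)^e = 1 - y^e, so [gN] approximates (1 - y)^(-e) and
    [hn N l] approximates (1 - y)^(-l) by polynomials satisfying the exact recursion [hnS]. *)
Let hn N (l : nat) : {poly W} := (1 - y) ^+ (e - l) * gN N.

Lemma A0E : A0 = 'X%:M + NW.
Proof. by rewrite /A0 map_mxD map_scalar_mx /= map_polyX. Qed.

Lemma NWE (i j : 'I_s) : NW i j = (j == (i + r)%N :> nat)%:R.
Proof. by rewrite !mxE addSn eqSS rmorph_nat. Qed.

Lemma NWX l (i j : 'I_s) : (NW ^+ l) i j = (j == (i + r * l)%N :> nat)%:R.
Proof.
elim: l i j => [|l IH] i j; first by rewrite expr0 muln0 addn0 mxE eq_sym.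
rewrite exprS [NW * _]/(NW *m _) mxE.
under eq_bigr => u _ do rewrite NWE IH.
have [lt|ge] := ltnP (i + r) s.
  rewrite (bigD1 (Ordinal lt)) //= eqxx mul1r mulnS addnA big1 ?addr0 // => u nu.
  by rewrite (_ : (u == (i + r)%N :> nat) = false) ?mul0r //; apply: negbTE; rewrite -val_eqE in nu.
rewrite big1 => [|u _]; last by rewrite ltn_eqF ?mul0r // (leq_trans (ltn_ord u)).
by rewrite ltn_eqF // (leq_trans (ltn_ord j)) // mulnS addnA (leq_trans ge) // leq_addr.
Qed.

Lemma NW_nil : NW ^+ n.+1 = 0.
Proof.
apply/matrixP => i j; rewrite NWX mxE ltn_eqF //.
by apply: leq_trans (ltn_ord j) _; apply: leq_trans sn _; rewrite leq_addl.
Qed.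

Definition cong N (A B : 'M[{poly W}]_s) := exists C, A = B + (X ^+ N)%:P *: C.

Lemma gN_tel N : (1 - y ^+ e) * gN N = 1 - y ^+ (e * N).
Proof.
rewrite /gN; elim: N => [|N IH]; first by rewrite big_ord0 mulr0 muln0 expr0 subrr.
rewrite big_ord_recr /= mulrDr IH mulnS exprD mulrBl mul1r; ring.
Qed.

Lemma hnS N l : (l < e)%N -> hn N l.+1 * (1 - y) = hn N l.
Proof. by move=> le; rewrite /hn mulrAC -exprSr -subSn. Qed.

Lemma hn0 N : hn N 0 = 1 - y ^+ (e * N).
Proof.
rewrite /hn subn0 -gN_tel; congr (_ * _).
by rewrite (frobD (polyC \o @powserC F)) (frobN (polyC \o @powserC F)) expr1n.
Qed.

Let Sg N : 'M[{poly W}]_s := \sum_(i < N) (X ^+ i.+1)%:P *: A0 ^+ i.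
Let Vg N : 'M[{poly W}]_s := \sum_(i < N) (X ^+ i)%:P *: A0 ^+ i.
Let Wg N : 'M[{poly W}]_s := \sum_(l < n.+1) ((X ^+ l.+1)%:P * hn N l.+1) *: NW ^+ l.
Let Q : 'M[{poly W}]_s := 1%:M - X%:P *: A0.

Lemma SgV N : Sg N = X%:P *: Vg N.
Proof. by rewrite /Sg /Vg scaler_sumr; apply: eq_bigr => i _; rewrite scalerA exprS polyCM. Qed.

Lemma QV N : Q *m Vg N = 1%:M - (X ^+ N)%:P *: A0 ^+ N.
Proof.
rewrite /Q mulmxBl mul1mx -scalemxAl mulmx_sumr.
have -> : X%:P *: (\sum_(i < N) A0 *m ((X ^+ i)%:P *: A0 ^+ i)) = \sum_(i < N) (X ^+ i.+1)%:P *: A0 ^+ i.+1.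
  rewrite scaler_sumr; apply: eq_bigr => i _; rewrite -scalemxAr scalerA exprS polyCM.
  by rewrite [in RHS]exprS.
rewrite /Vg -sumrB; elim: N => [|N IH]; first by rewrite big_ord0 expr0 expr0 scale1r subrr.
by rewrite big_ord_recr /= IH addrA subrK.
Qed.

(** In the product with (1 - y) - w N, with N the nilpotent shift, 1 - y lowers l and w N raises it,
    so the terms telescope; nilpotency closes the sum. *)
Lemma WQ N : Wg N *m Q = (X%:P * hn N 0) *: 1%:M.
Proof.
pose t l : 'M[{poly W}]_s := ((X ^+ l.+1)%:P * hn N l) *: NW ^+ l.
have QE : Q = (1 - y)%:M - X%:P *: NW.
  by rewrite /Q A0E scalerDr scale_scalar_mx /y opprD addrA -raddfB.
have te (l : 'I_n.+1) : ((X ^+ l.+1)%:P * hn N l.+1) *: NW ^+ l *m Q = t l - t l.+1.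
  rewrite QE mulmxBr mul_mx_scalar scalerA mulrC -mulrA hnS; last first.
    by apply: leq_trans ne.
  congr (_ - _); rewrite -scalemxAl -scalemxAr scalerA /t.
  have -> : NW ^+ l.+1 = NW ^+ l *m NW by rewrite exprSr.
  by congr (_ *: _); rewrite mulrAC -polyCM -exprSr.
rewrite /Wg mulmx_suml (eq_bigr (fun l : 'I_n.+1 => t l - t l.+1)) //.
rewrite sumrB big_ord_recl [X in _ - X]big_ord_recr /= addrC.
have -> : t n.+1 = 0 by rewrite /t NW_nil scaler0.
have -> : \sum_(i < n) t (bump 0 i) = \sum_(i < n) t i.+1 by apply: eq_bigr.
by rewrite add0r addrK /t expr1 expr0.
Qed.

(** Both sides are inverses of t - A_0 modulo w^N: one as a geometric series in A_0, the other as
    the finite expansion in the nilpotent part with poles along theta = t. *)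
Lemma Wg_cong N : cong N (Wg N) (Sg N).
Proof.
have yN : exists z, y ^+ (e * N) = (X ^+ N)%:P * z.
  have le : (N <= e * N)%N by rewrite leq_pmull // q_exp_gt0.
  exists (y ^+ (e * N - N) * 'X ^+ N).
  by rewrite -{1}(subnKC le) exprD {1}/y exprMn polyC_exp; ring.
have [z zE] := yN.
have E1 : Wg N *m (Q *m Vg N) = (1 - (X ^+ N)%:P * z) *: Sg N.
  rewrite mulmxA WQ -scalemxAl mul1mx hn0 zE SgV scalerA; congr (_ *: _); ring.
rewrite QV mulmxBr mulmx1 -scalemxAr in E1.
exists (Wg N *m A0 ^+ N - z *: Sg N).
have E2 : Wg N = (1 - (X ^+ N)%:P * z) *: Sg N + (X ^+ N)%:P *: (Wg N *m A0 ^+ N).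
  by rewrite -E1 subrK.
rewrite scalerBr scalerA {1}E2 scalerBl scale1r -addrA; congr (_ + _).
by rewrite addrC.
Qed.

Let EW := map_mx iW E.
Let E1 : 'M[{poly W}]_(s, r) := \matrix_(i, j) EW i (widen_ord rs j).
Let pi : 'M[W]_(r, s) := \matrix_(i, j) (i == j :> nat)%:R.

Lemma EW_rect : EW = E1 *m map_mx polyC pi.
Proof.
apply/matrixP => i j; rewrite [RHS]mxE.
have [lt|ge] := ltnP j r.
  rewrite (bigD1 (Ordinal lt)) //= !mxE eqxx mulr1 big1 ?addr0 => [|l nl].
    by congr (iW (E i _)); apply: val_inj.
  by rewrite !mxE (_ : (l == j :> nat) = false) ?mulr0 //; apply: negbTE; rewrite -val_eqE in nl.
rewrite mxE E0 // rmorph0 big1 // => l _.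
by rewrite !mxE ltn_eqF ?mulr0 // (leq_trans (ltn_ord l)).
Qed.

Lemma pi_mul (A : 'M[{poly W}]_(s, r)) p k : (map_mx polyC pi *m A) p k = A (widen_ord rs p) k.
Proof.
rewrite mxE (bigD1 (widen_ord rs p)) //= !mxE eqxx mul1r big1 ?addr0 // => l nl.
by rewrite !mxE eq_sym (_ : (l == p :> nat) = false) ?mul0r //; apply: negbTE; rewrite -val_eqE in nl.
Qed.

Lemma NW_E1 l p k : (map_mx polyC pi *m (NW ^+ l *m E1)) p k = if l.+1 == n_ p then iW (EE0 p k) else 0.
Proof.
rewrite pi_mul mxE.
under eq_bigr => u _ do rewrite NWX.
have [lt|ge] := ltnP (p + r * l) s.
  rewrite (bigD1 (Ordinal lt)) //= eqxx mul1r big1 ?addr0 => [|u nu]; last first.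
    by rewrite (_ : (u == (p + r * l)%N :> nat) = false) ?mul0r //; apply: negbTE; rewrite -val_eqE in nu.
  by rewrite !mxE (@Elow _ _ p k l) //; case: eqP; rewrite ?rmorph0.
rewrite big1 => [|u _]; last by rewrite ltn_eqF ?mul0r // (leq_trans (ltn_ord u)).
case: eqP => // lE; have := ns p; rewrite -lE /= ltnNge ge. by [].
Qed.

Lemma rv_Bt N p k : (X ^+ (n_ p))%:P * hn N (n_ p) * iW (EE0 p k) =
  (geomN F e N \Po 'X^e) * map_poly (rv 1 e) (Bt m_ EE0 p k).
Proof.
have gE : geomN F e N \Po 'X^e = gN N.
  rewrite /geomN /gN rmorph_sum /=; apply: eq_bigr => a _.
  by rewrite linearZ /= comp_Xn_poly -exprM /y exprMn -mul_polyC polyC_exp.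
have rvX m : (m <= e)%N -> map_poly (rv 1 e) (('X%:P - 'X : P2) ^+ m * cu (EE0 p k)) =
    (X ^+ (e - m))%:P * ((1 - y) ^+ m * iW (EE0 p k)).
  exact: rv_pow.
rewrite gE mxE rvX ?leq_subr // subKn; last by apply: leq_trans (nn p) ne.
rewrite /hn; ring.
Qed.

(** E has only r nonzero columns, so [detop_rect] reduces the size to r. In row p only the power n_p
    - 1 of the nilpotent shift meets E, which gives a pole of order n_p along theta = t, written as
    (t - theta)^(e - n_p) over t^e - theta^e. *)
Lemma tensor_cl nl N : cl X N
  (detop q (LopN (@TModule F s [:: 'X%:M + Nsh; E] nl) N))
  (detop q (opnN e [:: (1%N, Bt m_ EE0)] N)).
Proof.
have q1 := q_gt1 F.
pose M1 : 'M[{poly W}]_(s, r) := Sg N *m E1.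
have -> : LopN (@TModule F s [:: 'X%:M + Nsh; E] nl) N = [seq (x.1, x.2 *m map_mx polyC pi) | x <- [:: (1%N, M1)]].
  rewrite /LopN /=; congr [:: (_, _)].
  rewrite /M1 -mulmxA -EW_rect /Sg mulmx_suml; apply: eq_bigr => i _.
  by rewrite -scalemxAl.
rewrite (detop_rect q1) //=.
have -> : detop q (opnN e [:: (1%N, Bt m_ EE0)] N) =
    detop q [:: (1%N, (geomN F e N \Po 'X^e) *: map_mx (map_poly (rv 1 e)) (Bt m_ EE0))].
  rewrite /opnN /=; move: (geomN F e N) (map_mx _ _) => g M.
  (* Every operator here is a multiple of tau^1, so [detop_comm] replaces theta^q by theta in the
     scalar factor. Doing this kk times turns t^e - theta^e into t^e - theta. *)
  elim: kk => [|j IH]; first by rewrite expn0 expr1 comp_polyXr.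
  rewrite IH expnSr.
  have := @detop_comm W q q1 r (g \Po 'X^(q ^ j)) [:: (1%N, M)] isT; rewrite /= expn1 => <-.
  by rewrite -comp_polyA comp_Xn_poly -exprM mulnC.
apply: (cl_detop q1) => // m i p k; rewrite /Mop !big_seq1 /=.
have [C CE] := Wg_cong N.
have EqE : (map_mx polyC pi *m M1) p k + (X ^+ N)%:P * (map_mx polyC pi *m (C *m E1)) p k =
    ((geomN F e N \Po 'X^e) *: map_mx (map_poly (rv 1 e)) (Bt m_ EE0)) p k.
  transitivity ((map_mx polyC pi *m (Wg N *m E1)) p k).
    rewrite CE mulmxDl -scalemxAl mulmxDr -scalemxAr.
    by rewrite [RHS]mxE; congr (_ + _); rewrite [RHS]mxE.
  rewrite /Wg mulmx_suml mulmx_sumr summxE.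
  have lt : ((n_ p).-1 < n.+1)%N by rewrite prednK.
  rewrite (bigD1 (Ordinal lt)) //= big1 ?addr0 => [|l nl']; last first.
    rewrite -scalemxAl -scalemxAr mxE NW_E1 (_ : (l.+1 == n_ p) = false) ?mulr0 //.
    by apply: contraNF nl' => /eqP E'; rewrite -val_eqE /= -E'.
  rewrite -scalemxAl -scalemxAr mxE NW_E1 prednK // eqxx rv_Bt.
  by rewrite [RHS]mxE; congr (_ * _); rewrite [RHS]mxE.
rewrite -EqE mulrDr kapD ?q_exp_gt0 // coefD mul_polyC -scalerAr kapZ ?q_exp_gt0 // coefZ.
by eexists; rewrite opprD addNKr -mulrN.
Qed.

End Tensor.
End Reduction.

Lemma sign_alg (R : comNzRingType) (x y u : R) : u * u = 1 -> x * y = u * x * (u * y).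
Proof. by move=> h; rewrite mulrACA h mul1r. Qed.

(** * Contradiction in the untwisted cases *)

Section ZeroTwist.
Variable F : finFieldType.
Local Notation q := #|F|.
Local Notation k := {fraction {poly F}}.
Local Notation S := (powser k).
Local Notation X := (powserX k).
Local Notation K := (Kinf F).
Local Notation P2 := {poly {poly F}}.
Local Notation wF := (@wK F).

Lemma neg_rel s (lam : 'M[K]_s) (a b : {poly F}) (f : powser F) :
  evt 1 b * tofrac f = evt 1 a * \det lam ->
  evt 1 b * tofrac f = evt 1 ((-1) ^+ s * a) * \det (- lam).
Proof.
have DL : \det (- lam) = (-1) ^+ s * \det lam by rewrite -scaleN1r detZ.
move=> ->; rewrite DL rmorphM rmorphXn rmorphN1.
have s1 : (-1) ^+ s * (-1) ^+ s = 1 :> K by rewrite -exprD addnn -mul2n exprM sqrrN !expr1n.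
exact: sign_alg s1.
Qed.

Lemma sign_neq0 s (a : {poly F}) : a != 0 -> (-1) ^+ s * a != 0.
Proof. by move=> a0; rewrite mulf_neq0 // expf_neq0 // oppr_eq0 oner_neq0. Qed.

Lemma size_cu_coef s (A : 'M[{poly F}]_s) p p' i : (size ((map_mx (@cu F) A p p')`_i)%R <= 2)%N.
Proof. by rewrite mxE coef_map; apply: leq_trans (size_polyC_leq1 _) _. Qed.

Lemma sum_iota1 (V : nmodType) r (G : nat -> V) : \sum_(j <- iota 1 r) G j = \sum_(j < r) G j.+1.
Proof.
rewrite (iotaDl 1 0) big_map -[X in iota 0 X]subn0 -/(index_iota 0 r) big_mkord.
by apply: eq_bigr => i _; rewrite add1n.
Qed.

Lemma hom1 d (c : {poly F}) : (size c <= 1)%N -> hom d c = c * 'X^d.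
Proof.
move=> /size1_polyC cE; rewrite cE homE big_ord_recl big1 ?addr0 => [|i _].
  by rewrite coefC eqxx subn0 mul_polyC.
by rewrite coefC /= scale0r.
Qed.

Lemma pu_sign n (p : P2) : pu ((-1) ^+ n * p) = (-1) ^+ n * pu p :> S.
Proof.
elim: n => [|n IH]; first by rewrite !expr0 !mul1r.
by rewrite !exprS -!mulrA !mulN1r puN IH.
Qed.

Lemma cu_sign n (p : {poly F}) : cu ((-1) ^+ n * p) = (-1) ^+ n * cu p.
Proof.
elim: n => [|n IH]; first by rewrite !expr0 !mul1r.
by rewrite !exprS -!mulrA !mulN1r -IH; exact: (raddfN (@cu F)).
Qed.

Lemma fpow_sign b n (f : S) : fpow b ((-1) ^+ n * f) = (-1) ^+ n * fpow b f.
Proof.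
elim: n => [|n IH]; first by rewrite !expr0 !mul1r.
by rewrite !exprS -!mulrA !mulN1r -IH; exact: (raddfN (@fpow k b)).
Qed.

Lemma gr_sign n (f : S) : gr f -> gr ((-1) ^+ n * f).
Proof.
move=> gf; elim: n => [|n IH]; first by rewrite expr0 mul1r.
by rewrite exprS -mulrA mulN1r; exact: grN.
Qed.

Lemma cuXn d : cu 'X^d = 'X^d :> P2.
Proof. by rewrite /cu map_polyXn. Qed.

Section Phi.
Variables (r : nat) (a : nat -> {poly F}) (l : powser F) (P : P2).
Hypotheses (r0 : (0 < r)%N) (ar : a r != 0) (l0 : l != 0).
Local Notation Bs := [seq (j, map_mx (@cu F) (a j)%:M : 'M[P2]_1) | j <- iota 1 r].
Hypothesis ldet : forall N, cl (powserX F) N l (detop q (opnN 1 Bs N)).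
Hypotheses (P0 : P != 0) (rP : root (map_poly (evt 1) P) (tofrac l)).

Lemma posj_phi : posj Bs.
Proof. by apply/allP => x /mapP[j]; rewrite mem_iota => /andP[j0 _] ->. Qed.

Lemma size_phi x p p' i : x \in Bs -> (size ((x.2 p p')`_i)%R <= 2)%N.
Proof. by move=> /mapP[j _ ->]; exact: size_cu_coef. Qed.

(** Row 0 of the state is the generating series, [hser] in Psi and [gser] in Phi, and row i > 0 is
    the twist of [gser] by q^i in both; so only row 0 has a pole. Independence kills every
    coefficient, including the one known to be nonzero at theta = t. *)
Lemma phi_zero : False.
Proof.
have [Y [c1 [c2 [lam [c [[c10 c20] YS Ylim relL sY]]]]]] := limit_form (ltn0Sn 0) posj_phi size_phi ldet l0.
pose d := (hd Bs + \max_(i < r) size (a i.+1))%N.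
have hd_d : (hd Bs <= d)%N by rewrite leq_addr.
have sEE i j : (size (Ephi r a i j) <= d.+1)%N.
  rewrite mxE; case: ifP => _; last first.
    by apply: leq_trans (_ : 1 <= _)%N => //; case: (_ == _); rewrite ?size_poly1 ?size_poly0.
  by apply: leqW; apply: leq_trans (leq_addl _ _); exact: (leq_bigmax j).
pose hs := hser 1 Bs Y; pose gs := gser 1 Y.
pose Phi : 'M[S]_(r, 1) := \matrix_(i, j) fpow (q ^ i) (gs 0 j).
pose Psi : 'M[S]_(r, 1) := \matrix_(i, j) if i == 0%N :> nat then hs 0 j else fpow (q ^ i) (gs 0 j).
(* The constant of [gr_hser] for e = 1, where 2 (e + 1) = 4. *)
pose h0 := (4 + 1 * hd Bs + c.*2)%N.
have S1 i j : X * Psi i j = (if i == 0%N :> nat then pu (tiP F 1 1) else X) * Phi i j.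
  rewrite [Psi _ _]mxE [Phi _ _]mxE; case: eqP => [->|//]; rewrite expn0 fpow1.
  exact: (hser_gser (ltn0Sn 0) YS).
have S2 i j : exists pp : P2, X ^+ d * Psi i j = pu pp +
    \sum_l pu (cu (hom d (Ephi r a i l))) * fpow q (Phi l j).
  rewrite mxE; case: eqP => [i0|/eqP i0].
    have [pp ppE] := hser_eq (ltn0Sn 0) posj_phi Y c 0 j hd_d; exists pp.
    rewrite mul1n in ppE; rewrite ppE; congr (_ + _); rewrite big_map sum_iota1.
    apply: eq_bigr => u _; rewrite big_ord1 expr1 comp_polyXr [map_mx _ _ _ _]mxE [_%:M _ _]mxE eqxx mulr1n.
    rewrite hom_cu [Ephi _ _ _ _]mxE i0 /= [Phi _ _]mxE; congr (_ * _).
    by rewrite fpow_comp ?q_gt0 ?q_exp_gt0 // expnS.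
  exists 0; rewrite rmorph0 add0r; rewrite -lt0n in i0.
  have lt : (i.-1 < r)%N by apply: leq_ltn_trans (leq_pred _) (ltn_ord i).
  rewrite (bigD1 (Ordinal lt)) //= big1 ?addr0 => [|u nu]; last first.
    rewrite [Ephi _ _ _ _]mxE gtn_eqF // (_ : (i == u.+1 :> nat) = false); last first.
      apply: contraNF nu => /eqP E; apply/eqP/val_inj; by rewrite /= E.
    by rewrite hom1 ?size_poly0 // mul0r rmorph0 rmorph0 mul0r.
  rewrite [Ephi _ _ _ _]mxE gtn_eqF //= prednK // eqxx hom1 ?size_poly1 // mul1r cuXn puXn; congr (_ * _).
  by rewrite [Phi _ _]mxE /= fpow_comp ?q_gt0 ?q_exp_gt0 // -expnS prednK.
have grP i j : gr (X ^+ h0 * Psi i j).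
  rewrite mxE; case: eqP => [_|/eqP i0]; first exact: (gr_hser (ltn0Sn 0) posj_phi size_phi sY).
  by rewrite -lt0n in i0; rewrite -(prednK i0); exact: (gr_gser (ltn0Sn 0) posj_phi sY).
have xPE (i j : 'I_1) : evr 1 (Psi (Ordinal r0) j) ((- lam) i j).
  by rewrite [Psi _ _]mxE /= (ord1 i); exact: (evr_hser (ltn0Sn 0) YS Ylim).
have [|i ip|Rg [R1 _ rel]] := @scalar_relation F r 1 d (fun i : 'I_r => i == 0%N :> nat) (fun=> Ordinal r0)
   (Ephi r a) (ltn0Sn 0) _ _ (det_Ephi r0 ar) sEE Psi Phi l P h0 (- lam) ((-1) ^+ 1 * c1) c2
   S1 S2 P0 rP grP xPE (sign_neq0 1 c10) c20 l0 (neg_rel relL).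
- by [].
- by exists 0; apply: val_inj; apply/eqP.
have R0 := @phi_independent F r a r0 ar d Rg rel.
by move: R1; rewrite R0 rmorph0 eqxx.
Qed.

End Phi.

Section Wedge.
Variables (s : nat) (a : nat -> {poly F}) (l : powser F) (P : P2) (E1 E2 : 'M[{poly F}]_s).
Hypotheses (s0 : (0 < s)%N) (ar : a s.+1 != 0) (l0 : l != 0).
Hypothesis E1E : forall i j, E1 i j = if j == 0%N :> nat then (-1) ^+ s.+1 * a (s - i)%N
  else if j == i.+1 :> nat then (-1) ^+ s * a s.+1 else 0.
Hypothesis E2E : forall i j, E2 i j = if (i.+1 == s) && (j == 0%N :> nat) then a s.+1 else 0.
Local Notation Bs := [:: (1%N, map_mx (@cu F) E1); (2%N, map_mx (@cu F) E2)].
Hypothesis ldet : forall N, cl (powserX F) N l (detop q (opnN 1 Bs N)).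
Hypotheses (P0 : P != 0) (rP : root (map_poly (evt 1) P) (tofrac l)).

Lemma size_wedge x p p' i : x \in Bs -> (size ((x.2 p p')`_i)%R <= 2)%N.
Proof. by rewrite !inE => /orP[] /eqP->; exact: size_cu_coef. Qed.

Lemma lift_maxE (x : 'I_s) : lift ord_max x = x :> nat.
Proof. by rewrite /= /bump leqNgt ltn_ord. Qed.

Lemma widen_lift (i : 'I_s) : widen_ord (leqnSn s) i = lift ord_max i.
Proof. by apply: val_inj; rewrite /= /bump leqNgt ltn_ord. Qed.

Lemma wrow_E1 (i j : 'I_s) : wrow s a i j = E1 i j.
Proof.
rewrite /wrow E1E (ltn_eqF (ltn_ord i)); case: eqP => [->|_].
  by rewrite mulr1n mulr0n addr0 exprS; ring.
by rewrite mulr0n add0r; case: eqP => _; rewrite ?mulr1n ?mulr0n ?mulr0.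
Qed.

Lemma wrow_E2 (i : 'I_s) : wrow s a i s = (-1) ^+ s * E2 i (Ordinal s0).
Proof.
rewrite /wrow E2E (ltn_eqF (ltn_ord i)) /= eqxx andbT (gtn_eqF s0) mulr0n add0r eq_sym.
by case: eqP.
Qed.

(** tau^2 occurs only in the first column, so adjoining the twisted first coordinate [tl] makes the
    equation first order. The adjoined row has no pole; the s polar rows are those of
    [lift ord_max]. *)
Lemma wedge_zero : False.
Proof.
have pB : posj Bs by [].
have [Y [c1 [c2 [lam [c [[c10 c20] YS Ylim relL sY]]]]]] := limit_form (ltn0Sn 0) pB size_wedge ldet l0.
pose d := (hd Bs + \max_i \max_j size (Ewed s a i j))%N.
have hd_d : (hd Bs <= d)%N by rewrite leq_addr.
have sEE i j : (size (Ewed s a i j) <= d.+1)%N.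
  apply: leqW; apply: leq_trans (leq_addl _ _).
  by apply: leq_trans (leq_bigmax i); exact: (leq_bigmax j).
pose hs := hser 1 Bs Y; pose gs := gser 1 Y.
pose tl j : S := (-1) ^+ s * fpow q (gs (Ordinal s0) j).
pose Phi : 'M[S]_(s.+1, s) := \matrix_(i, j) if unlift ord_max i is Some i' then gs i' j else tl j.
pose Psi : 'M[S]_(s.+1, s) := \matrix_(i, j) if unlift ord_max i is Some i' then hs i' j else tl j.
pose h0 := (4 + 1 * hd Bs + c.*2)%N.
have PhiL i j : Phi (lift ord_max i) j = gs i j by rewrite mxE liftK.
have PhiM j : Phi ord_max j = tl j by rewrite mxE unlift_none.
have PsiL i j : Psi (lift ord_max i) j = hs i j by rewrite mxE liftK.
have PsiM j : Psi ord_max j = tl j by rewrite mxE unlift_none.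
have sgS : (-1) ^+ s * (-1) ^+ s = 1 :> S by rewrite -exprD addnn -mul2n exprM sqrrN !expr1n.
have puS (p : P2) := pu_sign s p.
have cuS (p : {poly F}) := cu_sign s p.
have homS (p : {poly F}) : hom d ((-1) ^+ s * p) = (-1) ^+ s * hom d p.
  have -> : (-1) ^+ s = ((-1) ^+ s)%:P :> {poly F} by rewrite polyC_exp polyCN.
  by rewrite !homE [RHS]mul_polyC scaler_sumr; apply: eq_bigr => i _; rewrite coefCM scalerA.
have fqtl j : fpow q (tl j) = (-1) ^+ s * fpow (q ^ 2) (gs (Ordinal s0) j).
  by rewrite /tl fpow_sign fpow_comp ?q_gt0 // mulnn.
have S1 i j : X * Psi i j = (if i != ord_max then pu (tiP F 1 1) else X) * Phi i j.
  case: (unliftP ord_max i) => [i'|] ->; last by rewrite eqxx PsiM PhiM.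
  by rewrite eq_sym neq_lift PsiL PhiL; exact: (hser_gser (ltn0Sn 0) YS).
have S2 i j : exists pp : P2, X ^+ d * Psi i j = pu pp +
    \sum_l pu (cu (hom d (Ewed s a i l))) * fpow q (Phi l j).
  case: (unliftP ord_max i) => [i'|] ->; last first.
    exists 0; rewrite rmorph0 add0r (bigD1 ord0) //= big1 ?addr0 => [|u nu]; last first.
      rewrite [Ewed _ _ _ _]mxE /wrow /= eqxx (_ : (u == 0%N :> nat) = false); last first.
        by apply: negbTE; rewrite -val_eqE in nu.
      by rewrite homS hom1 ?size_poly0 // mul0r mulr0 rmorph0 rmorph0 mul0r.
    rewrite [Ewed _ _ _ _]mxE /wrow /= eqxx homS hom1 ?size_poly1 // mul1r cuS cuXn puS puXn PsiM.
    have -> : ord0 = lift ord_max (Ordinal s0) :> 'I_s.+1.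
      by apply: val_inj; rewrite /= /bump leqNgt s0.
    by rewrite PhiL /tl mulrA [X ^+ d * _]mulrC.
  have W1 (u : 'I_s) : wrow s a (lift ord_max i') (lift ord_max u) = E1 i' u.
    by rewrite !lift_maxE; exact: wrow_E1.
  have W2 : wrow s a (lift ord_max i') (ord_max : 'I_s.+1) = (-1) ^+ s * E2 i' (Ordinal s0).
    by rewrite lift_maxE; exact: wrow_E2.
  have [pp ppE] := hser_eq (ltn0Sn 0) pB Y c i' j hd_d; exists pp.
  rewrite mul1n in ppE; rewrite PsiL ppE; congr (_ + _).
  rewrite big_cons big_seq1 [RHS]big_ord_recr /=; congr (_ + _).
    apply: eq_bigr => u _; rewrite widen_lift PhiL expr1 comp_polyXr [map_mx _ _ _ _]mxE hom_cu expn1.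
    by rewrite [Ewed _ _ _ _]mxE W1.
  have fE : fpow q (Phi ord_max j) = (-1) ^+ s * fpow (q ^ 2) (gs (Ordinal s0) j) by rewrite PhiM.
  rewrite fE [Ewed _ _ _ _]mxE W2 homS cuS puS.
  rewrite (bigD1 (Ordinal s0)) //= big1 ?addr0 => [|u nu]; last first.
    rewrite expr1 comp_polyXr [map_mx _ _ _ _]mxE E2E (_ : (u == 0%N :> nat) = false) ?andbF; last first.
      by apply: negbTE; rewrite -val_eqE in nu.
    by rewrite hom_cu hom1 ?size_poly0 // mul0r rmorph0 rmorph0 mul0r.
  rewrite expr1 comp_polyXr [map_mx _ _ _ _]mxE hom_cu.
  exact: sign_alg sgS.
have grtl j : gr (X ^+ h0 * tl j).
  have g1 : gr (X ^+ h0 * fpow q (gs (Ordinal s0) j)).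
    by rewrite -(expn1 q); exact: (gr_gser (ltn0Sn 0) pB sY).
  by rewrite /tl mulrCA; exact: gr_sign.
have grP i j : gr (X ^+ h0 * Psi i j).
  case: (unliftP ord_max i) => [i'|] ->; last by rewrite PsiM.
  by rewrite PsiL; exact: (gr_hser (ltn0Sn 0) pB size_wedge sY).
have xPE (i j : 'I_s) : evr 1 (Psi (lift ord_max i) j) ((- lam) i j).
  by rewrite PsiL; exact: (evr_hser (ltn0Sn 0) YS Ylim).
have [i|i ip|Rg [R1 R0 rel]] := @scalar_relation F s.+1 s d (fun i : 'I_s.+1 => i != ord_max) (lift ord_max)
   (Ewed s a) s0 _ _ (det_Ewed ar) sEE Psi Phi l P h0 (- lam) ((-1) ^+ s * c1) c2
   S1 S2 P0 rP grP xPE (sign_neq0 s c10) c20 l0 (neg_rel relL).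
- by rewrite eq_sym neq_lift.
- by case: (unliftP ord_max i) ip => [i'|] ->; [exists i'|rewrite eqxx].
(* At theta = t only the coefficient of the selection [gp] survives, and its sign constant at
   [ord_max] is 1. *)
have T0 := @wedge_independent F s a s0 ar d Rg rel ord_max.
pose gp : {ffun 'I_s -> 'I_s.+1} := [ffun i => lift ord_max i].
have spmM (x y : P2) : spm 0 (x * y) = spm 0 x * spm 0 y := (@spm_is_monoid_morphism F 0).2 x y.
have e1 : eps K gp ord_max = 1.
  rewrite -[RHS](@eps_id K s); congr (cofactor _ _ _); apply/matrixP => i j; rewrite !mxE.
  by case: unlift => [u|] //; rewrite ffunE.
have := congr1 (spm 0) T0; rewrite rmorph0 rmorph_sum (bigD1 gp) //= big1 ?addr0 => [E'|g gi]; last first.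
  by apply: etrans (spmM _ _) _; rewrite (R0 g gi) mul0r.
have E2' := etrans (esym (spmM (Rg gp) (eps P2 gp ord_max))) E'.
by move: R1; rewrite spm_eps e1 mulr1 in E2'; rewrite -/gp E2' eqxx.
Qed.

End Wedge.
End ZeroTwist.

(** * The pole orders of the given t-modules *)

Section Cases.
Variable F : finFieldType.
Local Notation q := #|F|.
Local Notation P2 := {poly {poly F}}.

(** Counting from 0, the last row is p = 0 at l = n + 1, and the rows with entries 1 above it are p
    > 0 at l = n; this gives pole orders n + 2 and n + 1 for the twist n + 1. *)
Lemma phi_E_block r (phi : Drinfeld_module F r) n (i j : 'I_(r * n.+1 + 1)) (p k : 'I_r) l :
  i = (p + r * l)%N :> nat -> j = k :> nat ->
  phi_E phi n.+1 i j = if l.+1 == (if p == 0%N :> nat then n.+2 else n.+1) then Ephi r phi p k else 0.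
Proof.
move=> iE jE; rewrite !mxE iE jE; have kr := ltn_ord k; have pr := ltn_ord p.
move: (nat_of_ord p) (nat_of_ord k) pr kr => {iE jE}p' k' pr kr; rewrite mulnS.
have hle a b : (a < b)%N -> (r * a + r <= r * b)%N by move=> ab; rewrite addnC -mulnS leq_mul2l ab orbT.
case: (eqVneq p' 0%N) => [->|p0].
  rewrite add0n eqSS; case: (ltngtP l n.+1) => h.
  - have := hle _ _ h; rewrite mulnS => h1.
    rewrite (_ : (_ == _) = false); last by apply/eqP; lia.
    rewrite (_ : _ && _ = false) //; apply/negP => /andP[h2 /eqP h3].
    case: (ltngtP l n) => h4; first by have := hle _ _ h4; lia.
      by lia.
    by move: h3; rewrite h4; lia.
  - have := hle _ _ h; rewrite mulnS => h1.
    rewrite (_ : (_ == _) = false); last by apply/eqP; lia.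
    by rewrite (_ : _ && _ = false) //; apply/negP => /andP[h2 /eqP h3]; lia.
  by rewrite h mulnS addn1 eqxx kr.
rewrite eqSS (_ : ((p' + r * l).+1 == _) = false); last first.
  apply/eqP => h1; case: (ltngtP l n) => h; first by have := hle _ _ h; lia.
    by have := hle _ _ h; lia.
  by move: h1; rewrite h; lia.
case: (ltngtP l n) => h.
- have := hle _ _ h => h1; rewrite (_ : _ && _ = false) //.
  by apply/negP => /andP[h2 /eqP h3]; lia.
- have := hle _ _ h => h1; rewrite (_ : _ && _ = false) //.
  by apply/negP => /andP[h2 /eqP h3]; lia.
have E : ((k' < r - 1)%N && ((p' + r * l).+1 == (r + r * n + 1 - r + k'.+1)%N)) = (p' == k'.+1).
  rewrite h; apply/andP/eqP => [[h2 /eqP h3]|h2]; first by lia.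
  by split; [lia|apply/eqP; lia].
by rewrite E.
Qed.

Lemma expq_gt n : (n.+1 <= q ^ n.+1)%N.
Proof. by apply: ltnW; apply: ltn_expl; exact: q_gt1. Qed.

Lemma phi_case r (phi : Drinfeld_module F r) n (l : powser F) (P : P2) : l != 0 ->
  (forall N, cl (powserX F) N l (detop q (LopN (phi_tensor phi n) N))) ->
  P != 0 -> root (map_poly (evt 1) P) (tofrac l) -> False.
Proof.
move=> l0; have r0 := Defs.rank_gt0 phi; have ar := dcoef_lead phi; case: n => [|n] ldet P0 rP.
  apply: (@phi_zero F r phi l P r0 ar l0 _ P0 rP) => N.
  have H : cl (powserX F) N l (detop q (LopN (@TModule F 1
    ('X%:M :: [seq (phi k)%:M | k <- iota 1 r]) (scalar_tmodule _)) N)) := ldet N.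
  rewrite LopN_scalar size_map size_iota in H.
  suff E : [seq (j, map_mx (@cu F) ('X%:M :: [seq (phi k)%:M | k <- iota 1 r])`_j) | j <- iota 1 r] =
      [seq (j, map_mx (@cu F) (phi j)%:M : 'M[P2]_1) | j <- iota 1 r] by rewrite -E.
  apply/eq_in_map => -[|j]; rewrite mem_iota // add1n ltnS => /andP[_ jr] /=.
  by rewrite (nth_map 0%N) ?size_iota // nth_iota // add1n.
pose n' (p : 'I_r) := if p == 0%N :> nat then n.+2 else n.+1.
have n'0 p : (0 < n' p)%N by rewrite /n'; case: ifP.
have n'n p : (n' p <= n.+2)%N by rewrite /n'; case: ifP.
(* A power of q that is at least the largest pole order n + 2. *)
pose e := (q ^ n.+2)%N.
have ee : (n.+2 <= e)%N by exact: expq_gt.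
apply: (@full_case F r n.+2 (fun p => (e - n' p)%N) (Ephi r phi) l P r0 isT (det_Ephi r0 ar) _ l0 _ P0 rP).
  by move=> p; rewrite ltn_subrL n'0 q_exp_gt0.
move=> N; apply: cl_trans (ldet N) _.
suff: cl (powserX F) N (detop q (LopN (@TModule F (r * n.+1 + 1)
    [:: 'X%:M + mx1 _ (fun i j => (j == i + r)%N%:R); phi_E phi n.+1] (shift_tmodule _ (Defs.rank_gt0 phi))) N))
  (detop q (opnN (q ^ n.+2) [:: (1%N, Bt (fun p => (q ^ n.+2 - n' p)%N) (Ephi r phi))] N)) by [].
apply: (tensor_cl _ n'0 n'n ee).
- by rewrite mulnS -addnA leq_addr.
- by rewrite [in X in (_ <= X)%N]mulnS addnC leq_add2r.
- move=> i j rj; rewrite mxE; case: ifP => _.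
    by rewrite leqNgt ltnS rj.
  by rewrite (_ : (j.+1 <= r - 1)%N = false) //; apply/negbTE; rewrite -ltnNge; move: (nat_of_ord j) rj => x; lia.
- by move=> i j p k l' iE jE; apply: phi_E_block.
move=> p; have := ltn_ord p; rewrite /n'; case: eqP => [->|_] _ /=; first by rewrite add0n addn1.
by rewrite mulnS; move: (nat_of_ord p) (ltn_ord p) (r * n)%N => x y; lia.
Qed.

(** Counting from 0, the row with the single entry 1 is p = s at l = n, and the rows after it are p
    < s at l = n + 1; so the pole orders are n + 1 in the last row and n + 2 elsewhere. *)
Lemma wedge_F_block s (phi : Drinfeld_module F s.+1) n (i j : 'I_(s.+1 * n.+1 + s.+1 - 1)) (p k : 'I_s.+1) l :
  i = (p + s.+1 * l)%N :> nat -> j = k :> nat ->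
  ((-1) ^+ (s.+1 - 1) *: wedge_F phi n.+1) i j =
  if l.+1 == (if p == s :> nat then n.+1 else n.+2) then Ewed s phi p k else 0.
Proof.
move=> iE jE; have iS := ltn_ord i; rewrite mxE [in X in _ * X]mxE [Ewed _ _ _ _]mxE /wrow subn1 /=.
rewrite iE jE; rewrite iE in iS.
have kr := ltn_ord k; have pr := ltn_ord p.
move: (nat_of_ord p) (nat_of_ord k) pr kr iS => {iE jE}p' k' pr kr iS; rewrite mulnS in iS *.
have hle a b : (a < b)%N -> (s.+1 * a + s.+1 <= s.+1 * b)%N.
  by move=> ab; rewrite addnC -mulnS leq_mul2l ab orbT.
case: (ltngtP l n) => h.
- have h1 := hle _ _ h; rewrite (_ : (_ < _)%N = true); last by lia.
  by rewrite mulr0 (_ : (_ == _) = false) //; apply/eqP; case: ifP => _; lia.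
- have [h2|h2] := ltnP n.+1 l.
    by have := hle _ _ h2; rewrite mulnS; lia.
  have lE : l = n.+1 by lia.
  rewrite lE mulnS in iS *; have ps : (p' < s)%N by lia.
  rewrite (ltn_eqF ps) eqxx (_ : (_ < _)%N = false); last by apply/negbTE; rewrite -leqNgt; lia.
  rewrite (_ : (_ == (s.+1 + s.+1 * n)%N) = false); last by apply/eqP; lia.
  have -> : ((p' + (s.+1 + s.+1 * n)).+1 - (s.+1 + s.+1 * n) = p'.+1)%N by lia.
  congr (_ * _); rewrite eqSS subSS; case: (k' =P 0%N) => [->|k0].
    by rewrite mulr1n mulr0n addr0.
  by rewrite mulr0n add0r eqSS; case: (k' == p'.+1); rewrite ?mulr1n ?mulr0n.
rewrite h in iS *; case: (p' =P s) => [->|ps].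
  rewrite eqxx (_ : (_ < _)%N = false); last by apply/negbTE; rewrite -leqNgt; lia.
  rewrite (_ : (_ == (s.+1 + s.+1 * n)%N) = true); last by apply/eqP; lia.
  by rewrite eqSS.
rewrite (_ : (_ < _)%N = true); last by lia.
by rewrite mulr0 (_ : (n.+1 == n.+2) = false) //; apply/eqP; lia.
Qed.

Lemma wedge_case r (phi : Drinfeld_module F r) n (l : powser F) (P : P2) : (2 <= r)%N -> l != 0 ->
  (forall N, cl (powserX F) N l (detop q (LopN (wedge_tensor phi n) N))) ->
  P != 0 -> root (map_poly (evt 1) P) (tofrac l) -> False.
Proof.
case: r phi => [//|s] phi r2 l0; have ar := dcoef_lead phi.
case: n => [|n] ldet P0 rP.
  have sE : (s.+1 - 1 = s)%N by rewrite subn1.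
  have s0 : (0 < s.+1 - 1)%N by rewrite sE.
  apply: (@wedge_zero F (s.+1 - 1) phi l P (wedge_E1 phi) (wedge_E2 phi) s0 _ l0 _ _ _ P0 rP).
  - by rewrite sE.
  - move=> i j; have e1 : (s.+1 - i.+1 = s.+1 - 1 - i)%N by move: (nat_of_ord i) => x; lia.
    rewrite mxE !eqSS -e1; case: eqP => _; first by congr (_ ^+ _ * _); rewrite sE.
    by case: eqP => // _; congr (_ * phi _); rewrite sE.
  - by move=> i j; rewrite mxE eqSS; case: ifP => // _; congr (phi _); rewrite sE.
  move=> N; have H : cl (powserX F) N l (detop q (LopN (@TModule F (s.+1 - 1)
    ('X%:M :: [:: wedge_E1 phi; wedge_E2 phi]) (scalar_tmodule _)) N)) := ldet N.
  by rewrite LopN_scalar in H.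
have s0 : (0 < s)%N by [].
pose n' (p : 'I_s.+1) := if p == s :> nat then n.+1 else n.+2.
have n'0 p : (0 < n' p)%N by rewrite /n'; case: ifP.
have n'n p : (n' p <= n.+2)%N by rewrite /n'; case: ifP.
pose e := (q ^ n.+2)%N.
have ee : (n.+2 <= e)%N by exact: expq_gt.
apply: (@full_case F s.+1 n.+2 (fun p => (e - n' p)%N) (Ewed s phi) l P isT isT (det_Ewed ar) _ l0 _ P0 rP).
  by move=> p; rewrite ltn_subrL n'0 q_exp_gt0.
move=> N; apply: cl_trans (ldet N) _.
suff: cl (powserX F) N (detop q (LopN (@TModule F (s.+1 * n.+1 + s.+1 - 1)
    [:: 'X%:M + mx1 _ (fun i j => (j == i + s.+1)%N%:R); (-1) ^+ (s.+1 - 1) *: wedge_F phi n.+1]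
    (shift_tmodule _ (Defs.rank_gt0 phi))) N))
  (detop q (opnN (q ^ n.+2) [:: (1%N, Bt (fun p => (q ^ n.+2 - n' p)%N) (Ewed s phi))] N)) by [].
apply: (tensor_cl _ n'0 n'n ee).
- by rewrite mulnS; move: (s.+1 * n)%N => x; lia.
- by rewrite [in X in (_ <= X)%N]mulnS; move: (s.+1 * n.+1)%N => x; lia.
- move=> i j rj; have := ltn_ord i; rewrite mxE [in X in _ * X]mxE.
  move: (s.+1 * n.+1)%N (nat_of_ord i) (nat_of_ord j) rj => x i' j' rj ix.
  case: ifP => _; first by rewrite mulr0.
  case: ifP => [_|_]; first by rewrite (_ : (j'.+1 == 1%N) = false) ?mulr0 //; apply/eqP; lia.
  rewrite (_ : (j'.+1 == 1%N) = false); last by apply/eqP; lia.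
  by rewrite (_ : (j'.+1 == _) = false) ?mulr0 //; apply/eqP; lia.
- by move=> i j p k l' iE jE; apply: wedge_F_block.
move=> p; have := ltn_ord p; rewrite /n'; case: eqP => [->|ps] pr /=; first by rewrite mulnS; move: (s.+1 * n)%N => x; lia.
by rewrite mulnS; move: (nat_of_ord p) ps pr (s.+1 * n)%N => x y z u; lia.
Qed.

Lemma powser_neq0 (l : powser F) : l 0%N = 1 -> l != 0.
Proof. by move=> l1; apply/eqP => l0; move/eqP: l1; rewrite l0 powser0E eq_sym oner_eq0. Qed.

End Cases.

Theorem theorem1p3 (F : finFieldType) (R : realType) (C : Cinfty F R)
    (r : nat) (phi : Drinfeld_module F r) (n : nat) :
  transcendental_over (Kbar C) (Kinf_to_Cinf C (Lvalue (phi_tensor phi n))) /\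
  ((2 <= r)%N ->
   transcendental_over (Kbar C)
     (Kinf_to_Cinf C (Lvalue (wedge_tensor phi n)))).
Proof.
split=> [|r2] /algebraic_Kinf[P [P0 rP]].
  have [l [LE /powser_neq0 l0 ldet]] := Lvalue_detop (phi_tensor phi n).
  by rewrite LE in rP; exact: phi_case l0 ldet P0 rP.
have [l [LE /powser_neq0 l0 ldet]] := Lvalue_detop (wedge_tensor phi n).
by rewrite LE in rP; exact: wedge_case r2 l0 ldet P0 rP.
Qed.
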